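(* Let $G$ be a finite group acting faithfully on a complete non-singular toric variety $X$ over $\mathbb{C}$. Then $X$ is $G$-versal if and only if, for any prime $p$, $X$ is $G_p$-versal for a Sylow $p$-subgroup $G_p$ of $G$.
   Context: All varieties are irreducible and, together with group actions and maps, are defined over $\mathbb{C}$. The $G$-action on the toric variety $X$ is by arbitrary variety automorphisms; it need not preserve the torus. For a finite group $H$, a faithful $H$-variety is a variety with a faithful $H$-action. An irreducible $H$-variety $X$ is $H$-versal if it is faithful and, for any faithful $H$-variety $Y$ and any non-empty $H$-invariant open subset $U\subset X$, there exists an $H$-equivariant rational map $Y\dashrightarrow U$. Subgroups of $G$ act on $X$ by restriction. *)

(* Defs.v *)
From HB Require Import structures.
From mathcomp Require Import all_boot all_order all_algebra all_fingroup.
From mathcomp Require Import mpoly.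
From mathcomp Require Import boolp classical_sets topology.

Set Implicit Arguments.
Unset Strict Implicit.
Unset Printing Implicit Defensive.

Import GRing.Theory.
Local Open Scope classical_set_scope.
Local Open Scope ring_scope.

(* Varieties over an algebraically closed field K are treated in the classical
   language of Serre: a variety is its set of K-points with the Zariski
   topology and the sheaf of regular K-valued functions.  Elements of O(U) are
   represented by total functions X -> K whose values outside U are irrelevant
   (regular_ext). *)

Record fspace (K : closedFieldType) := FSpace {
  carrier :> topologicalType;
  regular : set carrier -> (carrier -> K) -> Prop;
  regular_open : forall U f, regular U f -> open U;
  regular_ext : forall U f g, {in U, f =1 g} -> regular U f -> regular U g;
  regular_restrict : forall U V f,
    open V -> V `<=` U -> regular U f -> regular V f;
  regular_glue : forall U f,
    (forall x, U x -> exists V, [/\ V x, V `<=` U & regular V f]) ->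
    regular U f;
  regular_cst : forall U (c : K), open U -> regular U (fun=> c);
  regular_add : forall U f g,
    regular U f -> regular U g -> regular U (fun x => f x + g x);
  regular_mul : forall U f g,
    regular U f -> regular U g -> regular U (fun x => f x * g x);
  regular_inv : forall U f,
    regular U f -> regular (U `&` [set x | f x != 0]) (fun x => (f x)^-1)
}.

(* The pairs (V, f) with  lfun V f  are basic open sets with basic functions on
   them.  They generate a topology with base the sets V, and a sheaf whose
   sections are the functions locally equal to some f. *)
Record local_functions (K : closedFieldType) (T : Type) := LocalFunctions {
  lfun :> set T -> (T -> K) -> Prop;
  lfun_cst : forall c : K, lfun setT (fun=> c);
  lfun_add : forall V W f g, lfun V f -> lfun W g ->
    lfun (V `&` W) (fun x => f x + g x);
  lfun_mul : forall V W f g, lfun V f -> lfun W g ->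
    lfun (V `&` W) (fun x => f x * g x);
  lfun_inv : forall V f, lfun V f ->
    lfun (V `&` [set x | f x != 0]) (fun x => (f x)^-1)
}.

Definition generated_type (K : closedFieldType) (T : Type)
  (B : local_functions K T) : Type := T.

Section GeneratedSpace.
Context {K : closedFieldType} {T : Type} (B : local_functions K T).

Definition generated_open (W : set T) : Prop :=
  forall x, W x -> exists V f, [/\ B V f, V x & V `<=` W].

Definition generated_regular (U : set T) (f : T -> K) : Prop :=
  forall x, U x ->
    exists V g, [/\ B V g, V x, V `<=` U & forall y, V y -> f y = g y].

Lemma lfun_restrict V W f g : B V f -> B W g -> B (V `&` W) f.
Proof.
move=> Bf Bg; have := lfun_add Bf (lfun_mul (lfun_cst B 0) Bg).
rewrite setTI; congr (lfun _ _ _).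
by apply/funext => x; rewrite mul0r addr0.
Qed.

Lemma generated_openT : generated_open setT.
Proof. by move=> x _; exists setT, (fun=> 0); split => //; exact: lfun_cst. Qed.

Lemma generated_openI : setI_closed generated_open.
Proof.
move=> U V oU oV x [/oU [U' [f [Bf Ux sU]]] /oV [V' [g [Bg Vx sV]]]].
exists (U' `&` V'), f; split => //; first exact: lfun_restrict Bf Bg.
by move=> y [/sU ? /sV].
Qed.

Lemma generated_open_bigU (I : Type) (F : I -> set T) :
  (forall i, generated_open (F i)) -> generated_open (\bigcup_i F i).
Proof.
move=> oF x [i _ /oF [V [f [Bf Vx sV]]]].
by exists V, f; split => // y /sV Fy; exists i.
Qed.

HB.instance Definition _ := gen_eqMixin (generated_type B).
HB.instance Definition _ := gen_choiceMixin (generated_type B).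
HB.instance Definition _ := isOpenTopological.Build (generated_type B)
  generated_openT generated_openI generated_open_bigU.

Lemma openE_generated (U : set (generated_type B)) :
  open U = generated_open U.
Proof. by []. Qed.

Lemma generated_regular_open (U : set T) f :
  generated_regular U f -> generated_open U.
Proof. by move=> rf x /rf [V [g [Bg Vx sV _]]]; exists V, g. Qed.

Lemma generated_regular_ext (U : set T) (f g : T -> K) :
  {in U, f =1 g} -> generated_regular U f -> generated_regular U g.
Proof.
move=> fg rf x /rf [V [h [Bh Vx sV fh]]]; exists V, h; split => // y Vy.
by rewrite -fh // fg //; apply/mem_set/sV.
Qed.

Lemma generated_regular_restrict (U V : set T) (f : T -> K) :
  generated_open V -> V `<=` U -> generated_regular U f ->
  generated_regular V f.
Proof.
move=> oV sVU rf x Vx.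
have [W [g [Bg Wx sW fg]]] := rf x (sVU _ Vx).
have [W' [h [Bh W'x sW']]] := oV x Vx.
exists (W `&` W'), g; split => //; first exact: lfun_restrict Bg Bh.
  by move=> y [_ /sW'].
by move=> y [Wy _]; exact: fg.
Qed.

Lemma generated_regular_glue (U : set T) (f : T -> K) :
  (forall x, U x -> exists V, [/\ V x, V `<=` U & generated_regular V f]) ->
  generated_regular U f.
Proof.
move=> H x /H [V [Vx sV rf]]; have [W [g [Bg Wx sW fg]]] := rf x Vx.
by exists W, g; split => // y /sW /sV.
Qed.

Lemma generated_regular_cst (U : set T) (c : K) :
  generated_open U -> generated_regular U (fun=> c).
Proof.
move=> oU x /oU [V [f [Bf Vx sV]]]; exists V, (fun=> c); split => //.
by have := lfun_restrict (lfun_cst B c) Bf; rewrite setTI.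
Qed.

Lemma generated_regular_add (U : set T) (f g : T -> K) :
  generated_regular U f -> generated_regular U g ->
  generated_regular U (fun x => f x + g x).
Proof.
move=> rf rg x Ux; have [V [f' [Bf Vx sV ff]]] := rf x Ux.
have [W [g' [Bg Wx sW gg]]] := rg x Ux.
exists (V `&` W), (fun x => f' x + g' x); split => //.
- exact: lfun_add.
- by move=> y [/sV].
- by move=> y [Vy Wy]; rewrite ff // gg.
Qed.

Lemma generated_regular_mul (U : set T) (f g : T -> K) :
  generated_regular U f -> generated_regular U g ->
  generated_regular U (fun x => f x * g x).
Proof.
move=> rf rg x Ux; have [V [f' [Bf Vx sV ff]]] := rf x Ux.
have [W [g' [Bg Wx sW gg]]] := rg x Ux.
exists (V `&` W), (fun x => f' x * g' x); split => //.
- exact: lfun_mul.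
- by move=> y [/sV].
- by move=> y [Vy Wy]; rewrite ff // gg.
Qed.

Lemma generated_regular_inv (U : set T) (f : T -> K) :
  generated_regular U f ->
  generated_regular (U `&` [set x | f x != 0]) (fun x => (f x)^-1).
Proof.
move=> rf x [Ux fx]; have [V [g [Bg Vx sV fg]]] := rf x Ux.
exists (V `&` [set x | g x != 0]), (fun x => (g x)^-1); split.
- exact: lfun_inv.
- by split => //=; rewrite -fg.
- by move=> y [Vy /= gy]; split; [exact: sV | rewrite /= fg].
- by move=> y [Vy _]; rewrite fg.
Qed.

Definition generated_space : fspace K :=
  @FSpace K (generated_type B) generated_regular
    generated_regular_open generated_regular_ext generated_regular_restrict
    generated_regular_glue generated_regular_cst generated_regular_add
    generated_regular_mul generated_regular_inv.

End GeneratedSpace.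

(* Affine n-space: the basic open sets are the loci q != 0, with functions
   p / q, for polynomials p and q. *)
Section AffineSpace.
Variables (K : closedFieldType) (n : nat).

Definition affine_lfun (V : set ('I_n -> K)) (f : ('I_n -> K) -> K) : Prop :=
  exists p q : {mpoly K[n]}, V = [set x | q.@[x] != 0] /\
    forall x, V x -> f x = p.@[x] / q.@[x].

Lemma affine_lfun_cst c : affine_lfun setT (fun=> c).
Proof.
exists c%:MP, 1; split; last by move=> x _; rewrite mevalC meval1 divr1.
by apply/seteqP; split => x // _; rewrite /= meval1 oner_neq0.
Qed.

Lemma affine_lfun_add V W f g : affine_lfun V f -> affine_lfun W g ->
  affine_lfun (V `&` W) (fun x => f x + g x).
Proof.
move=> [p [q [-> fE]]] [p' [q' [-> gE]]].
exists (p * q' + p' * q), (q * q'); split.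
  by apply/seteqP; split => x /=; rewrite mevalM mulf_eq0 negb_or => /andP.
move=> x [/= q0 q'0]; rewrite fE // gE // addf_div //.
by rewrite mevalD !mevalM.
Qed.

Lemma affine_lfun_mul V W f g : affine_lfun V f -> affine_lfun W g ->
  affine_lfun (V `&` W) (fun x => f x * g x).
Proof.
move=> [p [q [-> fE]]] [p' [q' [-> gE]]].
exists (p * p'), (q * q'); split.
  by apply/seteqP; split => x /=; rewrite mevalM mulf_eq0 negb_or => /andP.
by move=> x [/= q0 q'0]; rewrite fE // gE // mulf_div !mevalM.
Qed.

Lemma affine_lfun_inv V f : affine_lfun V f ->
  affine_lfun (V `&` [set x | f x != 0]) (fun x => (f x)^-1).
Proof.
move=> [p [q [-> fE]]]; exists (q * q), (p * q); split.
  apply/seteqP; split => x /=; rewrite mevalM mulf_eq0 negb_or.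
    by move=> [q0]; rewrite fE // mulf_eq0 negb_or invr_eq0.
  by move=> /andP[p0 q0]; split => //; rewrite fE // mulf_neq0 ?invr_eq0.
by move=> x [/= q0 _]; rewrite fE // invf_div !mevalM -mulf_div divff // mulr1.
Qed.

Definition affine_local : local_functions K ('I_n -> K) :=
  LocalFunctions affine_lfun_cst affine_lfun_add affine_lfun_mul
    affine_lfun_inv.

Definition affine_space : fspace K := generated_space affine_local.

End AffineSpace.

(* An arbitrary subset S with the induced topology and the sheaf of functions
   that extend locally to regular functions of X.  Only locally closed S are
   used below. *)
Section InducedSpace.
Variables (K : closedFieldType) (X : fspace K) (S : set X).

Definition sub_lfun (V : set {x : X | S x}) (f : {x : X | S x} -> K) : Prop :=
  exists U g, [/\ regular U g, V = sval @^-1` U &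
    forall x, V x -> f x = g (sval x)].

Lemma sub_lfun_cst c : sub_lfun setT (fun=> c).
Proof.
exists setT, (fun=> c); split => //.
by apply: regular_cst; exact: openT.
Qed.

Lemma sub_lfun_add V W f g : sub_lfun V f -> sub_lfun W g ->
  sub_lfun (V `&` W) (fun x => f x + g x).
Proof.
move=> [U [f' [rf -> fE]]] [U' [g' [rg -> gE]]].
have oI : open (U `&` U') by apply: openI; apply: regular_open; eassumption.
exists (U `&` U'), (fun x => f' x + g' x); split => //.
  by apply: regular_add; [apply: regular_restrict rf | apply: regular_restrict rg].
by move=> x [Ux U'x]; rewrite fE // gE.
Qed.

Lemma sub_lfun_mul V W f g : sub_lfun V f -> sub_lfun W g ->
  sub_lfun (V `&` W) (fun x => f x * g x).
Proof.
move=> [U [f' [rf -> fE]]] [U' [g' [rg -> gE]]].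
have oI : open (U `&` U') by apply: openI; apply: regular_open; eassumption.
exists (U `&` U'), (fun x => f' x * g' x); split => //.
  by apply: regular_mul; [apply: regular_restrict rf | apply: regular_restrict rg].
by move=> x [Ux U'x]; rewrite fE // gE.
Qed.

Lemma sub_lfun_inv V f : sub_lfun V f ->
  sub_lfun (V `&` [set x | f x != 0]) (fun x => (f x)^-1).
Proof.
move=> [U [f' [rf -> fE]]].
exists (U `&` [set x | f' x != 0]), (fun x => (f' x)^-1); split.
- exact: regular_inv.
- by apply/seteqP; split => x [Ux /= fx]; split => //; move: fx; rewrite /= fE.
- by move=> x [Ux _]; rewrite fE.
Qed.

Definition sub_local : local_functions K {x : X | S x} :=
  LocalFunctions sub_lfun_cst sub_lfun_add sub_lfun_mul sub_lfun_inv.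

Definition induced_space : fspace K := generated_space sub_local.

Definition incl (x : induced_space) : X := sval (x : {x : X | S x}).

End InducedSpace.

(* The product in the category of spaces with functions; the topology is not
   the product topology.  The basic open sets are the loci b != 0 in U x V,
   with functions a / b, where a and b are in the algebra of functions on
   U x V generated by O(U) and O(V). *)
Section Product.
Variables (K : closedFieldType) (X Y : fspace K).

Inductive tensor (U : set X) (V : set Y) : (X * Y -> K) -> Prop :=
| tensor_fst f : regular U f -> tensor U V (fun z => f z.1)
| tensor_snd g : regular V g -> tensor U V (fun z => g z.2)
| tensor_add a b : tensor U V a -> tensor U V b ->
    tensor U V (fun z => a z + b z)
| tensor_mul a b : tensor U V a -> tensor U V b ->
    tensor U V (fun z => a z * b z).

Lemma tensor_restrict U V U' V' a : open U' -> U' `<=` U -> open V' ->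
  V' `<=` V -> tensor U V a -> tensor U' V' a.
Proof.
move=> oU sU oV sV; elim=> {a}.
- by move=> f rf; apply: tensor_fst; exact: regular_restrict rf.
- by move=> g rg; apply: tensor_snd; exact: regular_restrict rg.
- by move=> a b _ ta _ tb; exact: tensor_add.
- by move=> a b _ ta _ tb; exact: tensor_mul.
Qed.

Definition prod_lfun (W : set (X * Y)) (f : X * Y -> K) : Prop :=
  exists U V a b, [/\ [/\ open U, open V, tensor U V a & tensor U V b],
    W = [set z | [/\ U z.1, V z.2 & b z != 0]] &
    forall z, W z -> f z = a z / b z].

Lemma prod_lfun_cst c : prod_lfun setT (fun=> c).
Proof.
have oX : open [set: X] by exact: openT.
have oY : open [set: Y] by exact: openT.
exists setT, setT, (fun=> c), (fun=> 1); split.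
- split => //.
    by apply: (@tensor_fst _ _ (fun=> c)); exact: regular_cst.
  by apply: (@tensor_fst _ _ (fun=> 1)); exact: regular_cst.
- by apply/seteqP; split => z //= _; split => //; exact: oner_neq0.
- by move=> z _; rewrite divr1.
Qed.

Lemma prod_lfun_add W W' f g : prod_lfun W f -> prod_lfun W' g ->
  prod_lfun (W `&` W') (fun x => f x + g x).
Proof.
move=> [U [V [a [b [[oU oV ta tb] -> fE]]]]].
move=> [U' [V' [a' [b' [[oU' oV' ta' tb'] -> gE]]]]].
have oUU := openI oU oU'; have oVV := openI oV oV'.
have res1 c : tensor U V c -> tensor (U `&` U') (V `&` V') c.
  by apply: tensor_restrict => // x [].
have res2 c : tensor U' V' c -> tensor (U `&` U') (V `&` V') c.
  by apply: tensor_restrict => // x [].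
exists (U `&` U'), (V `&` V'), (fun z => a z * b' z + a' z * b z),
  (fun z => b z * b' z); split.
- split => //; last by apply: tensor_mul; [exact: res1 | exact: res2].
  by apply: tensor_add; apply: tensor_mul; (exact: res1 || exact: res2).
- apply/seteqP; split => z /=; rewrite mulf_eq0 negb_or.
    by move=> [[Uz Vz ->] [U'z V'z ->]].
  by move=> [[Uz U'z] [Vz V'z] /andP[]].
- move=> z [/= [Uz Vz bz] [U'z V'z b'z]].
  by rewrite fE // gE // addf_div.
Qed.

Lemma prod_lfun_mul W W' f g : prod_lfun W f -> prod_lfun W' g ->
  prod_lfun (W `&` W') (fun x => f x * g x).
Proof.
move=> [U [V [a [b [[oU oV ta tb] -> fE]]]]].
move=> [U' [V' [a' [b' [[oU' oV' ta' tb'] -> gE]]]]].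
have oUU := openI oU oU'; have oVV := openI oV oV'.
have res1 c : tensor U V c -> tensor (U `&` U') (V `&` V') c.
  by apply: tensor_restrict => // x [].
have res2 c : tensor U' V' c -> tensor (U `&` U') (V `&` V') c.
  by apply: tensor_restrict => // x [].
exists (U `&` U'), (V `&` V'), (fun z => a z * a' z),
  (fun z => b z * b' z); split.
- by split => //; apply: tensor_mul; (exact: res1 || exact: res2).
- apply/seteqP; split => z /=; rewrite mulf_eq0 negb_or.
    by move=> [[Uz Vz ->] [U'z V'z ->]].
  by move=> [[Uz U'z] [Vz V'z] /andP[]].
- move=> z [/= [Uz Vz bz] [U'z V'z b'z]].
  by rewrite fE // gE // mulf_div.
Qed.

Lemma prod_lfun_inv W f : prod_lfun W f ->
  prod_lfun (W `&` [set z | f z != 0]) (fun z => (f z)^-1).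
Proof.
move=> [U [V [a [b [[oU oV ta tb] -> fE]]]]].
exists U, V, (fun z => b z * b z), (fun z => a z * b z); split.
- by split => //; exact: tensor_mul.
- apply/seteqP; split => z /=; rewrite mulf_eq0 negb_or.
    by move=> [[Uz Vz bz]]; rewrite fE // mulf_eq0 negb_or invr_eq0.
  move=> [Uz Vz /andP[az bz]]; split => //.
  by rewrite fE // mulf_neq0 ?invr_eq0.
- move=> z [/= [Uz Vz bz] _].
  by rewrite fE // invf_div -mulf_div divff // mulr1.
Qed.

Definition prod_local : local_functions K (X * Y) :=
  LocalFunctions prod_lfun_cst prod_lfun_add prod_lfun_mul prod_lfun_inv.

Definition prod_space : fspace K := generated_space prod_local.

End Product.

Definition regular_map (K : closedFieldType) (X Y : fspace K) (f : X -> Y) :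
    Prop :=
  continuous f /\
  forall U g, regular U g -> regular (f @^-1` U) (g \o f).

Definition isomorphism (K : closedFieldType) (X Y : fspace K) (f : X -> Y) :
    Prop :=
  regular_map f /\
  exists g : Y -> X, [/\ cancel f g, cancel g f & regular_map g].

Definition zero_locus (K : closedFieldType) (n : nat)
    (I : set {mpoly K[n]}) : set (affine_space K n) :=
  [set x | forall p, I p -> p.@[x] = 0].

(* Isomorphic to a closed algebraic subset of some affine space. *)
Definition affine (K : closedFieldType) (X : fspace K) : Prop :=
  exists n (I : set {mpoly K[n]}) (f : X -> induced_space (zero_locus I)),
    isomorphism f.

Definition irreducible (T : topologicalType) (Z : set T) : Prop :=
  Z !=set0 /\
  forall A B : set T, closed A -> closed B ->
    Z `<=` A `|` B -> Z `<=` A \/ Z `<=` B.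

Definition diagonal (K : closedFieldType) (X : fspace K) :
    set (prod_space X X) :=
  [set z : X * X | z.1 = z.2].

Record variety (K : closedFieldType) := Variety {
  space :> fspace K;
  variety_irreducible : irreducible [set: space];
  variety_affine_cover : exists (m : nat) (U : 'I_m -> set space),
    [/\ forall i, open (U i), forall i, affine (induced_space (U i)) &
        \bigcup_i U i = setT];
  variety_separated : closed (@diagonal K space)
}.

Definition complete (K : closedFieldType) (X : variety K) : Prop :=
  forall (Y : variety K) (Z : set (prod_space X Y)),
    closed Z -> closed ((fun z : X * Y => z.2) @` Z : set Y).

(* A chain of irreducible closed subsets through x, that is, a chain of prime
   ideals of the local ring O_{X,x}. *)
Definition irreducible_chain (T : topologicalType) (x : T) (d : nat)
    (Z : nat -> set T) : Prop :=
  (forall i, (i <= d)%N -> [/\ closed (Z i), irreducible (Z i) & Z i x]) /\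
  (forall i, (i < d)%N -> Z i `<` Z i.+1).

(* The Krull dimension of O_{X,x} is d. *)
Definition local_dimension (T : topologicalType) (x : T) (d : nat) : Prop :=
  (exists Z, irreducible_chain x d Z) /\
  (forall e Z, irreducible_chain x e Z -> (e <= d)%N).

Definition regular_at (K : closedFieldType) (X : fspace K) (x : X)
    (f : X -> K) : Prop :=
  exists2 U, U x & regular U f.

(* O_{X,x} is a regular local ring: its maximal ideal, the germs vanishing at
   x, is generated by dim O_{X,x} elements. *)
Definition nonsingular_at (K : closedFieldType) (X : fspace K) (x : X) : Prop :=
  exists2 d, local_dimension x d &
  exists t : 'I_d -> X -> K,
    (forall i, regular_at x (t i) /\ t i x = 0) /\
    forall f, regular_at x f -> f x = 0 ->
    exists a : 'I_d -> X -> K, (forall i, regular_at x (a i)) /\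
      \forall y \near x, f y = \sum_(i < d) a i y * t i y.

Definition nonsingular (K : closedFieldType) (X : variety K) : Prop :=
  forall x : X, nonsingular_at x.

Definition torus (K : closedFieldType) (n : nat) : fspace K :=
  induced_space ([set x | forall i, x i != 0] : set (affine_space K n)).

Definition torus_coord (K : closedFieldType) (n : nat) (t : torus K n) :
  'I_n -> K := incl t.

Definition torus_elt (K : closedFieldType) (n : nat) (x : 'I_n -> K)
  (x_neq0 : forall i, x i != 0) : torus K n := exist _ x x_neq0.

Definition torus_one (K : closedFieldType) (n : nat) : torus K n :=
  torus_elt (fun i : 'I_n => oner_neq0 K).

Lemma torus_mul_neq0 (K : closedFieldType) (n : nat) (s t : torus K n) i :
  torus_coord s i * torus_coord t i != 0.
Proof. by rewrite mulf_neq0 //; [exact: (svalP s) | exact: (svalP t)]. Qed.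

Definition torus_mul (K : closedFieldType) (n : nat) (s t : torus K n) :
  torus K n := torus_elt (torus_mul_neq0 s t).

(* X contains a torus as an open (hence dense) subset U, and the translation
   action of the torus on itself extends to an action sigma on X.  Normality is
   not required separately: it follows from non-singularity. *)
Definition toric (K : closedFieldType) (X : variety K) : Prop :=
  exists (n : nat) (U : set X) (j : torus K n -> induced_space U)
    (sigma : prod_space (torus K n) X -> X),
  [/\ open U, isomorphism j, regular_map sigma,
      (forall x, sigma (torus_one K n, x) = x) /\
      (forall s t x, sigma (torus_mul s t, x) = sigma (s, sigma (t, x))) &
      forall s t, sigma (s, incl (j t)) = incl (j (torus_mul s t))].

(* Actions are the library's right actions  to x a ; replacing a by its inverse
   turns them into left actions and changes none of the notions below. *)
Section Versality.
Variables (K : closedFieldType) (gT : finGroupType) (H : {set gT}).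

Definition acts_regularly (X : variety K) (to : action H X) : Prop :=
  forall a, a \in H -> regular_map (fun x : X => to x a).

Definition acts_faithfully (X : variety K) (to : action H X) : Prop :=
  forall a, a \in H -> (forall x : X, to x a = x) -> a = 1%g.

Definition faithful_variety (X : variety K) (to : action H X) : Prop :=
  acts_regularly to /\ acts_faithfully to.

Definition invariant_set (X : variety K) (to : action H X) (U : set X) : Prop :=
  forall a x, a \in H -> U x -> U (to x a).

(* An H-equivariant rational map from Y to the open subset U of X, represented
   by a morphism f defined on a non-empty open subset V of Y; V itself need not
   be H-invariant, and equivariance is required wherever both sides make
   sense. *)
Definition equivariant_rational_map (Y X : variety K) (toY : action H Y)
    (toX : action H X) (U : set X) : Prop :=
  exists (V : set Y) (f : induced_space V -> induced_space U),
    [/\ open V, V !=set0, regular_map f &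
        forall a (v w : induced_space V), a \in H -> incl w = toY (incl v) a ->
          incl (f w) = toX (incl (f v)) a].

Definition versal (X : variety K) (to : action H X) : Prop :=
  faithful_variety to /\
  forall (Y : variety K) (toY : action H Y), faithful_variety toY ->
  forall U : set X, open U -> U !=set0 -> invariant_set to U ->
    equivariant_rational_map toY to U.

End Versality.

(* Main.v *)
Require Import Defs.
From HB Require Import structures.
From mathcomp Require Import all_boot all_order all_algebra all_fingroup.
From mathcomp Require Import all_solvable.
From mathcomp Require Import mpoly complex.
From mathcomp Require Import boolp classical_sets reals topology.
From mathcomp Require Import fraction ring zify.

(* In homogeneous (Cox) coordinates X is birationally the quotient of affine N-space by
   the kernel of a homomorphism of tori, and each automorphism of X lifts to a polynomial
   self-map of affine N-space because it permutes the prime divisors of X and a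
   homogeneous element with trivial divisor is constant.  The lifts of the elements of G
   compose only up to a 2-cocycle ga with values in the kernel.

   Let Y be a faithful G-variety.  An H-equivariant rational map Y --> X has |G : H|
   translates, permuted by G; comparing their lifts and multiplying over the cosets of H
   shows that ga^|G : H| is a coboundary over Y.  The indices of the Sylow subgroups have
   gcd 1, so ga itself is a coboundary over Y and the lifts can be corrected to an action
   of G on rational maps from Y to affine N-space.  The lifts are homogeneous for a
   positive grading, hence affine in the variables of each weight modulo those of lower
   weight; averaging against a function whose sum over orbits is 1 and which vanishes at
   all points but one of a free orbit gives a fixed map with a prescribed value, that is
   an equivariant rational map Y --> X meeting a prescribed open set.

   The lifts are found through the local rings of X inside its function field, a rational
   function field.  By completeness every monomial place has a centre; the centre of a
   lexicographic place is fixed by the torus, and non-singularity makes its local ring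
   that of the origin of affine n-space in suitable monomial coordinates. *)

Set Implicit Arguments.
Unset Strict Implicit.
Unset Printing Implicit Defensive.

Import Order.TTheory GRing.Theory Num.Theory.
Local Open Scope ring_scope.

(** * Unique factorization *)

Section Divisibility.
Variable R : idomainType.
Implicit Types a b c p q : R.

(** Nothing makes the class of [ga] vanish a priori: its values lie in the kernel of a homomorphism
    of tori, on which the lifts act, and over the point alone it may be nontrivial. It does not
    depend on [Y], whereas the cochains that trivialize its powers are functions on [Y]; this is
    where versality enters. The weights of the grading are positive because the rays of a complete
    fan have a relation with positive coefficients. Divisors are never introduced as geometric
    objects. Points, places and charts are all relations [V f c], meaning that [f] is defined with
    value [c], on one function field, and they are compared by inclusion; prime divisors are the
    valuations of prime polynomials in the charts, available because polynomial rings are factorial.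
    Passing from the group to a subgroup is not formal either: a variety with an action of the
    subgroup need not carry one of the group. It is first mapped to the regular representation of
    the whole group, whose linear structure allows such maps to be built by averaging. *)

Definition divides a b := exists c, b = c * a.

Definition prime_elt p :=
  [/\ p != 0, ~ divides p 1 & forall a b, divides p (a * b) -> divides p a \/ divides p b].

Inductive prime_product : R -> Prop :=
| prime_product_unit u : divides u 1 -> prime_product u
| prime_product_mul p a : prime_elt p -> prime_product a -> prime_product (p * a).

(** The factors are prime rather than irreducible, so that the existence of a factorization already
    implies its uniqueness. *)
Definition factorial_ring := forall a, a != 0 -> prime_product a.

Lemma dvdxx a : divides a a. Proof. by exists 1; rewrite mul1r. Qed.
Lemma dvd_trans a b c : divides a b -> divides b c -> divides a c.
Proof. by move=> [x ->] [y ->]; exists (y * x); rewrite mulrA. Qed.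
Lemma dvd_mull a b c : divides a c -> divides a (b * c).
Proof. by move=> [x ->]; exists (b * x); rewrite mulrA. Qed.
Lemma dvd_mulr a b c : divides a b -> divides a (b * c).
Proof. by move=> h; rewrite mulrC; apply: dvd_mull. Qed.
Lemma dvd_add a b c : divides a b -> divides a c -> divides a (b + c).
Proof. by move=> [x ->] [y ->]; exists (x + y); rewrite mulrDl. Qed.
Lemma dvd_opp a b : divides a b -> divides a (- b).
Proof. by move=> [x ->]; exists (- x); rewrite mulNr. Qed.
Lemma dvd_sum a (I : Type) (r : seq I) (P : pred I) (F : I -> R) :
  (forall i, P i -> divides a (F i)) -> divides a (\sum_(i <- r | P i) F i).
Proof.
move=> h; apply: (big_ind (divides a)) => //; last exact: dvd_add.
by exists 0; rewrite mul0r.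
Qed.
Lemma dvd0 a : divides a 0. Proof. by exists 0; rewrite mul0r. Qed.

Lemma dvd1_neq0 u : divides u 1 -> u != 0.
Proof.
by move=> [v e]; apply/eqP => u0; move: e; rewrite u0 mulr0 => /eqP; rewrite oner_eq0.
Qed.

Lemma dvd1_mul a b : divides a 1 -> divides b 1 -> divides (a * b) 1.
Proof. by move=> [c h] [d h']; exists (c * d); rewrite mulrACA -h -h' mulr1. Qed.

Lemma prime_prodM a b : prime_product a -> prime_product b -> prime_product (a * b).
Proof.
move=> pa pb; elim: pa => [u du|p c pp _ IH]; last first.
  by rewrite -mulrA; apply: prime_product_mul.
elim: pb => [v dv|p c pp _ IH]; first by apply: prime_product_unit; apply: dvd1_mul.
by rewrite mulrCA; apply: prime_product_mul.
Qed.

Lemma prime_prod_neq0 a : prime_product a -> a != 0.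
Proof.
elim=> [u|p {}a [p0 _ _] _ a0]; first exact: dvd1_neq0.
by rewrite mulf_neq0.
Qed.

End Divisibility.

Section PolyFactorial.
Variable R : idomainType.
Implicit Types (p : R) (f g h : {poly R}).

Lemma dvdC_coef p f : divides p%:P f <-> forall i, divides p f`_i.
Proof.
split=> [[g ->] i|H]; first by rewrite coefMC; exists g`_i.
have /choice [c cE] : forall i, exists c, f`_i = c * p by exact: H.
exists (\poly_(i < size f) c i); apply/polyP => i.
rewrite coefMC coef_poly; case: ltnP => hi; first by rewrite cE.
by rewrite nth_default // mul0r.
Qed.

Lemma dvdC_min p f : ~ divides p%:P f ->
  exists2 i, ~ divides p f`_i & forall j, (j < i)%N -> divides p f`_j.
Proof.
move=> h; have : exists i, `[< ~ divides p f`_i >].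
  apply: contrapT => /forallNP H; apply: h; apply/dvdC_coef => i.
  by apply: contrapT => hi; apply: (H i); apply/asboolP.
case/ex_minnP => i /asboolP hi hm; exists i => // j ji; apply: contrapT => hj.
by have := hm j (asboolT hj); rewrite leqNgt ji.
Qed.

(** With [i] and [j] the lowest indices of coefficients not divisible by [p], the coefficient of
    index i + j of the product is f_i g_j plus multiples of [p]. *)
Lemma primeC p : prime_elt p -> prime_elt p%:P.
Proof.
case=> p0 pn pP; split.
- by rewrite polyC_eq0.
- by move=> /dvdC_coef /(_ 0%N); rewrite coef1.
move=> f g pfg; apply: contrapT => /not_orP [/dvdC_min [i fi hi] /dvdC_min [j gj hj]].
have /dvdC_coef /(_ (i + j)%N) := pfg; rewrite coefM.
have li : (i < (i + j).+1)%N by rewrite ltnS leq_addr.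
rewrite (bigD1 (Ordinal li)) //= addKn => H.
have: divides p (f`_i * g`_j).
  rewrite -[X in divides _ X](addrK (\sum_(k < (i + j).+1 | k != Ordinal li)
      f`_k * g`_(i + j - k))).
  apply: dvd_add => //; apply/dvd_opp/dvd_sum => k ki.
  case: (ltngtP k i) => hk.
  - by apply/dvd_mulr/hi.
  - apply/dvd_mull/hj; rewrite ltn_subLR; last by rewrite -ltnS.
    by rewrite ltn_add2r.
  - by move: ki; rewrite -val_eqE /= hk eqxx.
by case/pP.
Qed.

Definition primitive f := forall p, prime_elt p -> ~ divides p%:P f.

Hypothesis facR : factorial_ring R.

Lemma dvd1C (u : R) : divides u 1 -> divides u%:P (1 : {poly R}).
Proof. by move=> [v e]; exists v%:P; rewrite -polyCM -e. Qed.

Lemma prime_productC (a : R) : prime_product a -> prime_product a%:P.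
Proof.
elim=> [u du|p {}a pp _ IH]; first by apply/prime_product_unit/dvd1C.
by rewrite polyCM; apply: prime_product_mul => //; apply: primeC.
Qed.

Lemma primitive_part f : f != 0 ->
  exists (c : R) g, [/\ f = c%:P * g, prime_product c & primitive g].
Proof.
move=> f0; have pl : prime_product (lead_coef f) by apply: facR; rewrite lead_coef_eq0.
(* The prime factors of the leading coefficient are tested one by one: [l] holds those still to be
   tested, [c] those found not to divide [g]. *)
suff H l : prime_product l -> forall g (c : R), lead_coef g = c * l ->
    (forall q, prime_elt q -> divides q c -> ~ divides q%:P g) ->
    exists (d : R) h, [/\ g = d%:P * h, prime_product d & primitive h].
  apply: (H _ pl _ 1); first by rewrite mul1r.
  by move=> q [_ h _] /h.
elim=> {pl} [u du|p a pp pa IH] g c lE hc.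
  exists 1, g; split; first by rewrite mul1r.
    by apply: prime_product_unit; apply: dvdxx.
  move=> q pq qg; apply: (hc q) => //.
  have: divides q (c * u).
    by rewrite -lE; move/dvdC_coef: qg; apply.
  case: pq => _ qn qP /qP[//|h]; case: qn.
  by apply: dvd_trans h du.
have [p0 pn pP] := pp.
have [[g1 gE]|pg] := EM (divides p%:P g); last first.
  apply: (IH _ (c * p)); first by rewrite lE mulrA.
  move=> q pq; have [q0 qn qP] := pq; case/qP; first exact: hc.
  move=> [d pE] qg; apply: pg.
  have: divides p (d * q) by rewrite -pE; apply: dvdxx.
  case/pP.
    move=> [e dE]; case: qn; exists e; apply: (mulIf p0).
    by rewrite mul1r mulrAC -dE -pE.
  by move=> [e qE]; apply: dvd_trans qg; exists e%:P; rewrite qE polyCM.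
have [] := IH g1 c.
- apply: (mulIf p0); rewrite -mulrA (mulrC a) -lE gE lead_coefM lead_coefC.
  by [].
- by move=> q pq qc qg; apply: (hc q) => //; rewrite gE; apply: dvd_mulr.
move=> d [h [g1E pd ph]]; exists (p * d), h; split => //.
  by rewrite gE g1E polyCM [p%:P * _]mulrC [RHS]mulrAC.
by apply: prime_product_mul.
Qed.

(** [%|] is divisibility up to a nonzero scalar [c], that is, over the field of fractions. Each
    prime factor of [c] divides the cofactor, since it does not divide the primitive [f], and can be
    cancelled. *)
Lemma gauss_dvd f g : primitive f -> f %| g -> divides f g.
Proof.
move=> pf /Pdiv.Idomain.dvdpP [[c q] /= c0]; rewrite -mul_polyC => e.
have pc := facR c0.
elim: pc q e c0 => [u [v uv]|p a pp pa IH] q e c0.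
  exists (v%:P * q); apply: (@mulfI _ u%:P); first by rewrite polyC_eq0.
  by rewrite e !mulrA -polyCM [u * v]mulrC -uv mul1r.
have: divides p%:P (q * f).
  by rewrite -e polyCM -mulrA; apply/dvd_mulr/dvdxx.
have [p0 _ _] := pp.
case: (primeC pp) => _ _ h /h [[q1 qE]|/(pf _ pp)//].
apply: (IH q1); last by move: c0; rewrite mulf_eq0 negb_or => /andP[].
apply: (@mulfI _ p%:P); first by rewrite polyC_eq0.
by rewrite mulrA -polyCM e qE mulrA (mulrC q1).
Qed.

Lemma primitive_dvd f g : primitive f -> divides g f -> primitive g.
Proof. by move=> pf gf p pp pg; apply: (pf p pp); apply: dvd_trans pg gf. Qed.

(** Induction on the degree of the primitive part. A primitive [g] without proper factors is prime:
    if it does not divide [a], a nonconstant gcd of the two would have a primitive part properly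
    dividing [g]; so they are coprime and [g] divides the other factor. *)
Lemma factorial_poly : factorial_ring {poly R}.
Proof.
move=> f f0; have [c [g [fE pc pg]]] := primitive_part f0.
have c0 := prime_prod_neq0 pc.
have g0 : g != 0 by apply: contra_neq f0 => g0; rewrite fE g0 mulr0.
rewrite fE; apply: prime_prodM; first exact: prime_productC.
have [n sn] := ubnP (size g); elim: n => // n IH in g pg g0 sn {fE} *.
have [s1|s1] := leqP (size g) 1.
  move: pg g0; rewrite (size1_polyC s1) polyC_eq0 => pg g0.
  apply: prime_product_unit; apply: dvd1C.
  case: (facR g0) => [//|p a pp _] in pg *.
  by case: (pg _ pp); rewrite polyCM; apply/dvd_mulr/dvdxx.
have [[a [b [gE sa sb]]]|irr] := EM (exists a b,
    [/\ g = a * b, (size a < size g)%N & (size b < size g)%N]).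
  have a0 : a != 0 by apply: contra_neq g0 => a0; rewrite gE a0 mul0r.
  have b0 : b != 0 by apply: contra_neq g0 => b0; rewrite gE b0 mulr0.
  rewrite gE; apply: prime_prodM; apply: IH => //.
  - by apply: primitive_dvd pg _; rewrite gE; apply/dvd_mulr/dvdxx.
  - exact: leq_trans sa sn.
  - by apply: primitive_dvd pg _; rewrite gE; apply/dvd_mull/dvdxx.
  - exact: leq_trans sb sn.
rewrite -[g]mulr1; apply: prime_product_mul; last first.
  by apply: prime_product_unit; apply: dvdxx.
split=> //.
  move=> [v e]; have v0 : v != 0.
    by apply: contra_eq_neq e => ->; rewrite mul0r oner_neq0.
  have := congr1 (size : {poly R} -> nat) e; rewrite size_mul // size_poly1.
  by move: v0 s1; rewrite -size_poly_gt0; lia.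
move=> a b gab; have [ga|ga] := boolP (g %| a).
  by left; apply: gauss_dvd.
right; apply: gauss_dvd => //.
suff cop : coprimep g a by rewrite -(Gauss_dvdpr _ cop); case: gab => q ->; rewrite dvdp_mull.
rewrite /coprimep; set d := gcdp g a.
have dg : d %| g by apply: dvdp_gcdl.
have d0 : d != 0 by rewrite gcdp_eq0 negb_and g0.
rewrite eqn_leq size_poly_gt0 d0 andbT leqNgt; apply/negP => sd.
have sdg : (size d < size g)%N.
  rewrite ltn_neqAle (dvdp_leq g0 dg) andbT (dvdp_size_eqp dg).
  by apply: contra ga => /eqp_dvdl <-; apply: dvdp_gcdr.
have [e [d1 [dE pe pd1]]] := primitive_part d0.
have e0 := prime_prod_neq0 pe.
have sd1 : size d1 = size d.
  by rewrite dE mul_polyC size_scale.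
have [] : divides d1 g.
  apply: gauss_dvd => //; apply: dvdp_trans dg; rewrite dE mul_polyC.
  by rewrite dvdpZr.
move=> q gE; apply: irr; exists q, d1; split => //; last by rewrite sd1.
have q0 : q != 0 by apply: contra_neq g0 => q0; rewrite gE q0 mul0r.
have d10 : d1 != 0 by rewrite -size_poly_gt0 sd1 size_poly_gt0.
rewrite [X in (_ < size (polyseq X))%N]gE size_mul // sd1.
by move: sd; case: (size d) => [|[|k]] // _; rewrite !addnS /= ltnS leq_addr.
Qed.

(** Prepares the induction on the number of variables in [prime_zero]. A constant prime is compared
    with the coefficients of [B]; a prime of positive degree is coprime to [B] over the field of
    fractions, whence a Bezout relation with denominators cleared. *)
Lemma prime_poly_cases Q B : prime_elt Q -> ~ divides Q B ->
  (exists a, [/\ Q = a%:P, prime_elt a & exists i, ~ divides a B`_i]) \/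
  ((1 < size Q)%N /\ exists u v, exists2 r : R, r != 0 & u * Q + v * B = r%:P).
Proof.
move=> pQ QB; have [Q0 Q1 QP] := pQ.
have [s1|s1] := leqP (size Q) 1; [left|right; split=> //].
  have QE := size1_polyC s1; move: (Q`_0) QE => a QE.
  have pa : prime_elt a.
    split; first by move: Q0; rewrite QE polyC_eq0.
      by move=> /dvd1C; rewrite -QE.
    move=> c d h; have : divides Q (c%:P * d%:P).
      by rewrite QE -polyCM; case: h => t ->; exists t%:P; rewrite polyCM.
    by case/QP; rewrite QE => /dvdC_coef /(_ 0%N); rewrite coefC /=; [left|right].
  exists a; split=> //; have [|i aB _] := @dvdC_min a B; first by rewrite -QE.
  by exists i.
have prQ : primitive Q.
  move=> p pp [c QE]; have := dvdxx Q; rewrite {2}QE => /QP [[d cE]|[d pE]].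
    case: (primeC pp) => p0 p1 _; apply: p1; exists d; apply: (mulIf Q0).
    by rewrite mul1r {1}QE cE mulrAC.
  have d0 : d != 0.
    by apply: contra_eq_neq pE => ->; rewrite mul0r; case: (primeC pp).
  have := congr1 (size : {poly _} -> nat) pE; rewrite size_polyC size_mul //.
  by move: s1 d0; rewrite -size_poly_gt0; case: (p != 0); lia.
have nQB : ~~ (Q %| B) by apply/negP => /(gauss_dvd prQ).
have cop : coprimep Q B.
  rewrite /coprimep; set d := gcdp Q B.
  have dQ : d %| Q by apply: dvdp_gcdl.
  have d0 : d != 0 by rewrite gcdp_eq0 negb_and Q0.
  rewrite eqn_leq size_poly_gt0 d0 andbT leqNgt; apply/negP => sd.
  have sdQ : (size d < size Q)%N.
    rewrite ltn_neqAle (dvdp_leq Q0 dQ) andbT (dvdp_size_eqp dQ).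
    by apply: contra nQB => /eqp_dvdl <-; apply: dvdp_gcdr.
  have /Pdiv.Idomain.dvdpP [[c r] /= c0 e] := dQ.
  have r0 : r != 0.
    apply: contra_eq_neq e => ->; rewrite mul0r -size_poly_eq0 size_scale //.
    by rewrite size_poly_eq0.
  have sr : (size Q = (size r + size d).-1)%N.
    by rewrite -(size_scale _ c0) e size_mul.
  have : divides Q (r * d) by rewrite -e -mul_polyC; apply/dvd_mull/dvdxx.
  case/QP => - [t tE].
    have := congr1 (size : {poly _} -> nat) tE; rewrite size_mul //; last first.
      by apply: contra_neq r0 => t0; rewrite tE t0 mul0r.
    have : t != 0 by apply: contra_neq r0 => t0; rewrite tE t0 mul0r.
    by rewrite -size_poly_gt0; lia.
  have := congr1 (size : {poly _} -> nat) tE.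
  have t0 : t != 0 by apply: contra_neq d0 => t0; rewrite tE t0 mul0r.
  by rewrite size_mul //; move: t0; rewrite -size_poly_gt0; lia.
have /Bezout_coprimepP [[u v] /= uv] := cop; exists u, v.
move: uv => /eqp_size; rewrite size_poly1 => /eqP/size_poly1P [r r0 E].
by exists r.
Qed.

End PolyFactorial.

Section Transfer.
Variables (R S : idomainType) (f : {rmorphism R -> S}) (g : {rmorphism S -> R}).
Hypotheses (fK : cancel f g) (gK : cancel g f).

Lemma dvd_transfer a b : divides a b <-> divides (f a) (f b).
Proof.
split=> [[c ->]|[c e]]; first by exists (f c); rewrite rmorphM.
by exists (g c); rewrite -[b]fK e rmorphM fK.
Qed.

Lemma prime_transfer p : prime_elt p -> prime_elt (f p).
Proof.
case=> p0 pn pP; split.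
- by apply: contra_neq p0 => fp; rewrite -[p]fK fp rmorph0.
- by rewrite -(rmorph1 f) => /dvd_transfer.
move=> a b; rewrite -[a]gK -[b]gK -rmorphM => /dvd_transfer /pP [h|h]; [left|right];
  exact/dvd_transfer.
Qed.

Lemma factorial_transfer : factorial_ring R -> factorial_ring S.
Proof.
move=> fR a a0; rewrite -[a]gK; have : g a != 0.
  by apply: contra_neq a0 => ga; rewrite -[a]gK ga rmorph0.
move/fR; elim=> [u du|p b pp _ IH].
  by apply: prime_product_unit; rewrite -(rmorph1 f); apply/dvd_transfer.
by rewrite rmorphM; apply: prime_product_mul => //; apply: prime_transfer.
Qed.
End Transfer.

Section MpolyUni.
Variables (K : comNzRingType) (n : nat).

Definition munimulti (p : {poly {mpoly K[n]}}) : {mpoly K[n.+1]} :=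
  (map_poly (@mwiden n K) p).['X_ord_max].

Fact munimulti_zmod : zmod_morphism munimulti.
Proof. by move=> p q; rewrite /munimulti rmorphB /= hornerD hornerN. Qed.
Fact munimulti_monoid : monoid_morphism munimulti.
Proof.
by split=> [|p q]; rewrite /munimulti ?rmorph1 ?hornerC // rmorphM /= hornerM.
Qed.
HB.instance Definition _ := GRing.isZmodMorphism.Build _ _ munimulti munimulti_zmod.
HB.instance Definition _ := GRing.isMonoidMorphism.Build _ _ munimulti munimulti_monoid.

End MpolyUni.

Section MpolyUniIso.

Lemma mpoly_rmorph_ext (K : comNzRingType) n (S : comNzRingType)
    (f g : {rmorphism {mpoly K[n]} -> S}) :
  (forall c, f c%:MP = g c%:MP) -> (forall i, f 'X_i = g 'X_i) -> f =1 g.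
Proof.
move=> hC hX p; rewrite [p]mpolyE !rmorph_sum; apply: eq_bigr => m _.
rewrite -mul_mpolyC !rmorphM /= hC; congr (_ * _).
rewrite mpolyXE_id !rmorph_prod; apply: eq_bigr => i _.
by rewrite !rmorphXn /= hX.
Qed.

Variables (K : comNzRingType) (n : nat).

Lemma muniX_max : muni ('X_ord_max : {mpoly K[n.+1]}) = 'X.
Proof.
rewrite muniE msuppX big_seq1 mcoeffX eqxx scale1r mnmE eqxx expr1.
rewrite (_ : [multinom _ | i < n] = 0%MM) ?mpolyX0 ?scale1r //.
by apply/mnmP => i; rewrite !mnmE -val_eqE /= gtn_eqF.
Qed.

Lemma muniX_widen i :
  muni ('X_(widen_ord (leqnSn n) i) : {mpoly K[n.+1]}) = ('X_i)%:P.
Proof.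
rewrite muniE msuppX big_seq1 mcoeffX eqxx scale1r mnmE.
rewrite -val_eqE /= ltn_eqF // expr0 alg_polyC; congr (_%:P).
congr ('X_[_]); apply/mnmP => j; rewrite !mnmE -!val_eqE //=.
Qed.

Lemma munimultiK : cancel (@munimulti K n) (@muni n K).
Proof.
have H : (@muni n K) \o (@munimulti K n) \o polyC =1 polyC.
  move=> c /=; rewrite /munimulti map_polyC hornerC.
  apply: (mpoly_rmorph_ext (f := (@muni n K) \o (@mwiden n K)) (g := polyC)).
    by move=> a /=; rewrite mwidenC muniC.
  by move=> i /=; rewrite mwidenX mnmwiden1 muniX_widen.
elim/poly_ind => [|p c IH]; first by rewrite rmorph0 muni0.
rewrite rmorphD rmorphM muniD muniM IH; congr (_ * _ + _); last exact: H.
by rewrite /= /munimulti map_polyX hornerX muniX_max.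
Qed.

Lemma muniK : cancel (@muni n K) (@munimulti K n).
Proof.
move=> p; rewrite -[RHS]/(idfun p).
apply: (mpoly_rmorph_ext (f := (@munimulti K n) \o (@muni n K)) (g := idfun)).
  by move=> c /=; rewrite muniC /munimulti map_polyC /= hornerC mwidenC.
move=> i /=; have [j ->|->] := unliftP ord_max i.
  have -> : lift ord_max j = widen_ord (leqnSn n) j.
    by apply: val_inj; rewrite /= /bump leqNgt ltn_ord.
  by rewrite muniX_widen /munimulti map_polyC /= hornerC mwidenX mnmwiden1.
by rewrite muniX_max /munimulti map_polyX hornerX.
Qed.

Lemma horner_muni (p : {mpoly K[n.+1]}) (z : 'I_n -> K) (x : K) :
  (map_poly (meval z) (muni p)).[x] =
  p.@[fun i => if unlift ord_max i is Some j then z j else x].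
Proof.
have := mpoly_rmorph_ext (f := horner_eval x \o (map_poly (meval z)) \o (@muni n K))
  (g := meval (fun i => if unlift ord_max i is Some j then z j else x)).
apply; first by move=> c; rewrite /= muniC map_polyC /= !mevalC /horner_eval hornerC.
move=> i; rewrite /= mevalXU; case: unliftP => [j ->|->].
  have -> : lift ord_max j = widen_ord (leqnSn n) j.
    by apply: val_inj; rewrite /= /bump leqNgt ltn_ord.
  by rewrite muniX_widen map_polyC /horner_eval hornerC /= mevalXU.
by rewrite muniX_max map_polyX /horner_eval hornerX.
Qed.

End MpolyUniIso.

Section MpolyField.
Variable K : fieldType.

Lemma factorial_mpoly n : factorial_ring {mpoly K[n]}.
Proof.
elim: n => [|n IH].
  move=> p; rewrite (nvar0_mpolyC_eq p (erefl _)) mpolyC_eq0 => c0.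
  apply: prime_product_unit; exists ((p@_0%MM)^-1)%:MP.
  by rewrite -mpolyCM mulVf.
exact: (factorial_transfer (@munimultiK K n) (@muniK K n) (factorial_poly IH)).
Qed.

Lemma mpoly_dvd1 n (p : {mpoly K[n]}) : divides p 1 -> exists2 c : K, c != 0 & p = c%:MP.
Proof.
move=> [q e]; have p0 : p != 0 by apply: contra_eq_neq e => ->; rewrite mulr0 oner_neq0.
have q0 : q != 0 by apply: contra_eq_neq e => ->; rewrite mul0r oner_neq0.
have h : (1 = (msize p + msize q).-1)%N by rewrite addnC -msizeM // (esym e : (q : {mpoly K[n]}) * p = 1) msize1.
have sp : (msize p <= 1)%N.
  by move: p0 q0 h; rewrite -!msize_poly_eq0; lia.
have pE := msize1_polyC sp; exists p@_0%MM => //.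
by apply: contra_neq p0 => c0; rewrite pE c0 mpolyC0.
Qed.

End MpolyField.

(** * Points of hypersurfaces over an algebraically closed field *)

Section ClosedPoints.
Variable K : closedFieldType.

Lemma mpoly_nonzero n (p : {mpoly K[n]}) : p != 0 -> exists z, p.@[z] != 0.
Proof.
elim: n p => [|n IH] p p0.
  exists (fun=> 0); move: p0; rewrite (nvar0_mpolyC_eq p (erefl _)) mevalC.
  by rewrite mpolyC_eq0.
have m0 : muni p != 0 by apply: contra_neq p0 => e; rewrite -[p]muniK e rmorph0.
have [|z hz] := IH (lead_coef (muni p)); first by rewrite lead_coef_eq0.
have : map_poly (meval z) (muni p) != 0.
  by rewrite -size_poly_eq0 size_map_poly_id0 // size_poly_eq0.
by move=> /closed_nonrootP [x]; rewrite /root horner_muni; exists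
  (fun i => if unlift ord_max i is Some j then z j else x).
Qed.

End ClosedPoints.

Section PrimeZero.
Variable K : closedFieldType.

(** In the Bezout case [z] avoids the zeros of [r] and of the leading coefficient of [Q]: the
    specialized [Q] keeps its positive degree and has a root [x], where [B] cannot vanish because u
    Q + v B = r. The maps [ev] stand for evaluation of the other variables. *)
Lemma prime_zero_step (R S : idomainType) (Z : Type) (ev : Z -> {rmorphism R -> K})
    (f : {rmorphism S -> {poly R}}) (g : {rmorphism {poly R} -> S}) (q b : S) :
  cancel f g -> cancel g f -> factorial_ring R ->
  (forall r : R, r != 0 -> exists z, ev z r != 0) ->
  (forall a c : R, prime_elt a -> ~ divides a c -> exists2 z, ev z a = 0 & ev z c != 0) ->
  prime_elt q -> ~ divides q b -> exists z x,
    (map_poly (ev z) (f q)).[x] = 0 /\ (map_poly (ev z) (f b)).[x] != 0.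
Proof.
move=> fK gK fac nz IH pq qb.
have pQ := prime_transfer fK gK pq.
have QB : ~ divides (f q) (f b) by move/(dvd_transfer fK).
move: (f q) (f b) pQ QB => Q B pQ QB.
have [[a [QE pa [i aB]]]|[s1 [u [v [r r0 rE]]]]] := prime_poly_cases fac pQ QB.
  have [z az Bz] := IH _ _ pa aB.
  have B0 : map_poly (ev z) B != 0.
    apply: contra_neq Bz => e; have := congr1 (fun r : {poly K} => r`_i) e.
    by rewrite coef_map coef0.
  have /closed_nonrootP [x hx] := B0.
  by exists z, x; split=> //; rewrite QE map_polyC /= hornerC.
have Q0 : Q != 0 by case: pQ.
have : r * lead_coef Q != 0 by rewrite mulf_neq0 ?lead_coef_eq0.
case/nz => z; rewrite rmorphM mulf_eq0 negb_or => /andP[rz lz].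
have sQ : size (map_poly (ev z) Q) = size Q by apply: size_map_poly_id0.
have : size (map_poly (ev z) Q) != 1 by rewrite sQ; move: s1; lia.
move=> /closed_rootP [x /rootP hx]; exists z, x; split=> //.
apply: contra_neq rz => hB.
have := congr1 (fun p => (map_poly (ev z) p).[x]) rE.
by rewrite rmorphD !rmorphM /= map_polyC hornerD !hornerM hx hB !mulr0 addr0 hornerC.
Qed.

(** The Nullstellensatz for one hypersurface; it supplies the points at which prime divisors are
    examined. *)
Lemma prime_zero n (q b : {mpoly K[n]}) : prime_elt q -> ~ divides q b ->
  exists2 z, q.@[z] = 0 & b.@[z] != 0.
Proof.
elim: n q b => [|n IH] q b pq qb.
  move: pq; rewrite (nvar0_mpolyC_eq q (erefl _)); move: (q@_0%MM) => c [].
  by rewrite mpolyC_eq0 => c0 []; exists (c^-1)%:MP; rewrite -mpolyCM mulVf.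
have [z [x [h1 h2]]] := prime_zero_step (ev := fun z : 'I_n -> K => meval z)
  (@muniK K n) (@munimultiK K n) (@factorial_mpoly K n) (@mpoly_nonzero K n) IH pq qb.
by exists (fun i => if unlift ord_max i is Some j then z j else x); rewrite -horner_muni.
Qed.

End PrimeZero.

(** * Noetherian rings and the Krull intersection theorem *)

Section Ideals.
Variable R : comNzRingType.
Implicit Types (P Q : R -> Prop) (s t : seq R).

Inductive ideal_gen P : R -> Prop :=
| ideal_gen0 : ideal_gen P 0
| ideal_gen_cons c x y : P x -> ideal_gen P y -> ideal_gen P (c * x + y).

Definition is_ideal P :=
  [/\ P 0, forall x y, P x -> P y -> P (x + y) & forall c x, P x -> P (c * x)].

Lemma ideal_gen_add P x y : ideal_gen P x -> ideal_gen P y -> ideal_gen P (x + y).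
Proof.
move=> gx gy; elim: gx => [|c {}x z Px _ IH]; first by rewrite add0r.
by rewrite -addrA; apply: ideal_gen_cons.
Qed.

Lemma ideal_gen_mul P c x : ideal_gen P x -> ideal_gen P (c * x).
Proof.
elim=> [|d {}x y Px _ IH]; first by rewrite mulr0; apply: ideal_gen0.
by rewrite mulrDr mulrA; apply: ideal_gen_cons.
Qed.

Lemma ideal_gen_ideal P : is_ideal (ideal_gen P).
Proof.
split; [exact: ideal_gen0|exact: ideal_gen_add|exact: ideal_gen_mul].
Qed.

Lemma ideal_gen_in P x : P x -> ideal_gen P x.
Proof.
by move=> Px; rewrite -[x]mul1r -[1 * x]addr0; apply: ideal_gen_cons => //; apply: ideal_gen0.
Qed.

Lemma ideal_gen_min P Q x : is_ideal Q -> (forall y, P y -> Q y) -> ideal_gen P x -> Q x.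
Proof.
move=> [Q0 QD QM] PQ; elim=> // c {}x y Px _ Qy.
by apply: QD => //; apply/QM/PQ.
Qed.

Lemma ideal_gen_sub P Q x : (forall y, P y -> ideal_gen Q y) -> ideal_gen P x -> ideal_gen Q x.
Proof. by move=> h; apply: ideal_gen_min => //; apply: ideal_gen_ideal. Qed.

Lemma ideal_gen_mono P Q x : (forall y, P y -> Q y) -> ideal_gen P x -> ideal_gen Q x.
Proof. by move=> h; apply: ideal_gen_sub => y /h; apply: ideal_gen_in. Qed.

Lemma ideal_sum P (I : Type) (r : seq I) (F : I -> R) :
  is_ideal P -> (forall i, P (F i)) -> P (\sum_(i <- r) F i).
Proof. by move=> [P0 PD _] h; apply: (big_ind P). Qed.

(** Quantified over arbitrary subsets, with generators taken in the subset itself, so that finitely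
    many elements with a given property can be selected; [noetherianP] reduces this to ideals. *)
Definition noetherian := forall P, exists2 s : seq R, (forall x, x \in s -> P x) &
  forall x, P x -> ideal_gen (fun y => y \in s) x.

Lemma noetherianP :
  (forall P, is_ideal P -> exists2 s : seq R, (forall x, x \in s -> P x) &
     forall x, P x -> ideal_gen (fun y => y \in s) x) -> noetherian.
Proof.
move=> H P; have [s sP sg] := H _ (ideal_gen_ideal P).
have fin x : ideal_gen P x -> exists2 t : seq R, (forall y, y \in t -> P y) &
    ideal_gen (fun y => y \in t) x.
  elim=> [|c {}x y Px _ [t tP ty]]; first by exists [::] => //; apply: ideal_gen0.
  exists (x :: t); first by move=> z; rewrite inE => /orP[/eqP->|/tP].
  apply: ideal_gen_cons; rewrite ?mem_head //.
  by apply: ideal_gen_mono ty => z zt; rewrite inE zt orbT.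
have [t tP ts] : exists2 t : seq R, (forall y, y \in t -> P y) &
    forall x, x \in s -> ideal_gen (fun y => y \in t) x.
  elim: s sP {sg} => [|x s IH] sP; first by exists [::].
  have [t tP ts] := IH (fun y ys => sP y (@mem_behead _ (x :: s) y ys)).
  have [t' t'P t'x] := fin x (sP _ (mem_head _ _)).
  exists (t ++ t'); first by move=> z; rewrite mem_cat => /orP[/tP|/t'P].
  move=> z; rewrite inE => /orP[/eqP->|zs].
    by apply: ideal_gen_mono t'x => y yt; rewrite mem_cat yt orbT.
  by apply: ideal_gen_mono (ts _ zs) => y yt; rewrite mem_cat yt.
exists t => // x Px; apply: ideal_gen_sub (sg x (ideal_gen_in Px)).
exact: ts.
Qed.

End Ideals.

Lemma noetherian_transfer (R S : comNzRingType) (f : {rmorphism R -> S})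
    (g : {rmorphism S -> R}) : cancel g f -> noetherian R -> noetherian S.
Proof.
move=> gK nR P; have [s sP sg] := nR (fun x => P (f x)).
exists (map f s); first by move=> x /mapP [y ys ->]; apply: sP.
move=> x Px; have: P (f (g x)) by rewrite gK.
move=> /sg; rewrite -{2}[x]gK; elim=> [|c y z ys _ IH].
  by rewrite rmorph0; apply: ideal_gen0.
rewrite rmorphD rmorphM; apply: ideal_gen_cons => //.
exact: map_f.
Qed.

Lemma noetherian_field (K : fieldType) : noetherian K.
Proof.
move=> P; have [[x [Px x0]]|H] := EM (exists x, P x /\ x != 0).
  exists [:: x]; first by move=> y; rewrite inE => /eqP->.
  move=> y Py; rewrite -[y](divfK x0) -[_ * _]addr0.
  by apply: ideal_gen_cons; rewrite ?mem_head //; apply: ideal_gen0.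
exists [::] => // x Px; have [->|x0] := eqVneq x 0; first exact: ideal_gen0.
by case: H; exists x.
Qed.

Lemma noetherian_poly (R : comNzRingType) : noetherian R -> noetherian {poly R}.
Proof.
move=> nR; apply: noetherianP => I [I0 ID IM].
pose L d a := exists f : {poly R}, [/\ I f, (size f <= d.+1)%N & f`_d = a].
have /choice [s0 hs] d : exists s : seq {poly R},
   (forall f, f \in s -> I f /\ (size f <= d.+1)%N) /\
   forall a, L d a -> ideal_gen (fun y => y \in map (fun f : {poly R} => f`_d) s) a.
  have [s sP sg] := nR (L d).
  have [s' [s'P s'E]] : exists s' : seq {poly R}, (forall f, f \in s' -> I f /\ (size f <= d.+1)%N) /\
      map (fun f : {poly R} => f`_d) s' = s.
    elim: s sP {sg} => [|x s IH] sP; first by exists [::].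
    have [s' [s'P <-]] := IH (fun y ys => sP y (@mem_behead _ (x :: s) y ys)).
    have [f [If sf fx]] := sP _ (mem_head _ _).
    exists (f :: s'); rewrite /= fx; split=> // h.
    by rewrite inE => /orP[/eqP->|/s'P].
  by exists s'; split=> //; rewrite s'E.
(* Multiplication by powers of X makes the ideals of leading coefficients increase with the degree,
   so finitely many generators of their union lie in a single [L D]. *)
have Lmono d e a : (d <= e)%N -> L d a -> L e a.
  move=> de [f [If sf fa]]; exists ('X^(e - d) * f); split; first exact: IM.
    apply: leq_trans (size_polyMleq _ _) _; rewrite size_polyXn; lia.
  by rewrite coefXnM ltnNge leq_subr /= subKn.
have [D hD] : exists D, forall d a, L d a -> L D a.
  have [t tP tg] := nR (fun a => exists d, L d a).
  have [D tD] : exists D, forall x, x \in t -> L D x.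
    elim: t tP {tg} => [|x t IH] tP; first by exists 0%N.
    have [D hD] := IH (fun y ys => tP y (@mem_behead _ (x :: t) y ys)).
    have [d hd] := tP _ (mem_head _ _).
    exists (maxn d D) => y; rewrite inE => /orP[/eqP->|/hD].
      by apply: Lmono hd; apply: leq_maxl.
    by apply: Lmono; apply: leq_maxr.
  exists D => d a La; have : ideal_gen (fun y => y \in t) a by apply: tg; exists d.
  apply: ideal_gen_min => //; split.
  - by exists 0; rewrite size_poly0 coef0.
  - move=> x y [f [If sf <-]] [g [Ig sg <-]]; exists (f + g).
    rewrite coefD; split=> //; first exact: ID.
    by apply: leq_trans (size_polyD _ _) _; rewrite geq_max sf.
  - move=> c x [f [If sf <-]]; exists (c%:P * f); rewrite coefCM; split=> //.
      exact: IM.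
    by rewrite mul_polyC; apply: leq_trans (size_scale_leq _ _) _.
pose S := flatten [seq s0 d | d <- iota 0 D.+1].
have S0 d : (d <= D)%N -> forall f, f \in s0 d -> f \in S.
  move=> dD f fs; apply/flattenP; exists (s0 d) => //.
  by apply: map_f; rewrite mem_iota.
exists S.
  by move=> f /flattenP [s' /mapP [d _ ->]] /(proj1 (hs d)) [].
move=> f If; have [n] := ubnP (size f); elim: n f If => // n IH f If sf.
have [->|f0] := eqVneq f 0; first exact: ideal_gen0.
have fd : (0 < size f)%N by rewrite size_poly_gt0.
pose d := (size f).-1; pose e := minn d D.
have Le : L e f`_d.
  have : L d f`_d by exists f; split=> //; rewrite /d prednK.
  by rewrite /e; case: leqP => // /ltnW _; exact: hD.
have eD : (e <= D)%N by apply: geq_minr.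
have ed : (e <= d)%N by apply: geq_minl.
have [g [gS Ig sg gE]] : exists g : {poly R},
    [/\ ideal_gen (fun y => y \in S) g, I g, (size g <= e.+1)%N & g`_e = f`_d].
  have := proj2 (hs e) _ Le; elim=> [|c x y /mapP [h hs' ->] _ [g [gS Ig sg <-]]].
    by exists 0; rewrite size_poly0 coef0; split=> //; apply: ideal_gen0.
  have [Ih sh] := proj1 (hs e) _ hs'.
  exists (c%:P * h + g); split; last by rewrite coefD coefCM.
  - by apply: ideal_gen_cons => //; apply: S0 hs'.
  - by apply: ID => //; apply: IM.
  - rewrite (leq_trans (size_polyD _ _)) // geq_max sg andbT mul_polyC.
    by rewrite (leq_trans (size_scale_leq _ _)).
rewrite -[f](subrK ('X^(d - e) * g)); apply: ideal_gen_add; last exact: ideal_gen_mul.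
apply: IH; first by rewrite -mulNr; apply: ID => //; apply: IM.
have dE : d.+1 = size f by rewrite /d prednK.
suff h : (size (f - 'X^(d - e) * g)%R <= d)%N by apply: leq_ltn_trans h _; rewrite -ltnS dE.
apply/leq_sizeP => j hj; rewrite coefB coefXnM; have [jd|jd] := ltnP j (d - e)%N.
  by have := leq_trans jd (leq_subr e d); rewrite ltnNge hj.
have [->|jd'] := eqVneq j d; first by rewrite subKn // gE subrr.
have hj' : (d < j)%N by rewrite ltn_neqAle eq_sym jd'.
rewrite !nth_default ?subrr -?dE //.
by apply: leq_trans sg _; move: hj' ed; clearbody e d; lia.
Qed.

Lemma noetherian_mpoly (R : comNzRingType) n : noetherian R ->
  noetherian {mpoly R[n]}.
Proof.
move=> nR; elim: n => [|n IH].
  apply: (noetherian_transfer (f := @mpolyC 0 R) (g := mcoeff 0)) nR.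
  by move=> p; rewrite [RHS](nvar0_mpolyC_eq p (erefl _)).
exact: (noetherian_transfer (@muniK R n) (noetherian_poly IH)).
Qed.

Section Krull.
Variables (A : comNzRingType) (r : nat) (y : 'I_r -> A).

(* b X^k lies in the Rees algebra A[y_1 X, ..., y_r X] iff b is in (y)^k. *)
Definition rees : {mpoly A[r]} -> {poly A} := mmap polyC (fun i => y i *: 'X).

Definition ideal_pow k b := exists h, rees h = b *: 'X^k.

Definition vars_ideal := ideal_gen (fun x => exists i, x = y i).

Fact rees_zmod : zmod_morphism rees.
Proof. by move=> p q; rewrite /rees mmapB. Qed.
Fact rees_monoid : monoid_morphism rees.
Proof. by split=> [|p q]; rewrite /rees ?rmorph1 ?rmorphM. Qed.
HB.instance Definition _ := GRing.isZmodMorphism.Build _ _ rees rees_zmod.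
HB.instance Definition _ := GRing.isMonoidMorphism.Build _ _ rees rees_monoid.

Lemma ideal_powD k b c : ideal_pow k b -> ideal_pow k c -> ideal_pow k (b + c).
Proof. by move=> [h hE] [g gE]; exists (h + g); rewrite rmorphD /= hE gE scalerDl. Qed.

Lemma ideal_powM k b c : ideal_pow k b -> ideal_pow k (c * b).
Proof.
move=> [h hE]; exists (c%:MP * h).
by rewrite rmorphM /= hE /rees mmapC mul_polyC scalerA.
Qed.

Lemma ideal_pow0 k : ideal_pow k 0.
Proof. by exists 0; rewrite rmorph0 scale0r. Qed.

Lemma ideal_powS k i b : ideal_pow k b -> ideal_pow k.+1 (y i * b).
Proof.
move=> [h hE]; exists ('X_i * h); rewrite rmorphM /= hE /rees mmapX mmap1U.
by rewrite -scalerAl -scalerAr scalerA -exprS.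
Qed.

Lemma ideal_pow0T b : ideal_pow 0 b.
Proof. by exists b%:MP; rewrite /rees mmapC expr0 alg_polyC. Qed.

Lemma rees_coef h j : vars_ideal (rees h)`_j.+1.
Proof.
have [v0 vD vM] := ideal_gen_ideal (fun x => exists i, x = y i).
rewrite [h]mpolyE rmorph_sum coef_sum; apply: ideal_sum; first exact: ideal_gen_ideal.
move=> m; rewrite -mul_mpolyC rmorphM /= {1}/rees mmapC coefCM; apply/vM.
rewrite /rees mmapX /mmap1.
have [m0|[i mi]] : (forall i, m i = 0%N) \/ exists i, m i != 0%N.
  by apply: contrapT => /not_orP [/existsNP [i /eqP hi]] []; exists i.
  by rewrite big1 ?coef1 => [|i _]; [exact: v0 | rewrite m0 expr0].
rewrite (bigD1 i) //=; case: (m i) mi => // k _.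
rewrite exprS -scalerAl -scalerAl coefZ mulrC; apply/vM.
by apply: ideal_gen_in; exists i.
Qed.

(** Consider the [h] representing some b in exponent k with b = a modulo [J]; finitely many of them
    generate the others and have exponents below some [N]. A representative in exponent [N] is a
    combination of these, and its coefficient of X^N involves only coefficients of positive index of
    the multipliers, which lie in (y). Hence a = mu a modulo [J]. *)
Theorem krull_intersection (J : A -> Prop) (a : A) : noetherian A -> is_ideal J ->
  (forall k, exists2 b, ideal_pow k b & J (a - b)) ->
  exists2 mu, vars_ideal mu & J (a * (1 - mu)).
Proof.
move=> nA [J0 JD JM] H.
have [s sP sg] := noetherian_mpoly nA
  (fun h : {mpoly A[r]} => exists k b, rees h = b *: 'X^k /\ J (a - b)).
have [N hN] : exists N, forall h, h \in s ->
    exists k b, [/\ (k < N)%N, rees h = b *: 'X^k & J (a - b)].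
  elim: s sP {sg} => [|h s IH] sP; first by exists 0%N.
  have [N hN] := IH (fun g gs => sP g (@mem_behead _ (h :: s) g gs)).
  have [k [b [hE Jb]]] := sP _ (mem_head _ _).
  exists (maxn N k.+1) => g; rewrite inE => /orP[/eqP->|/hN [k' [b' [kN gE Jb']]]].
    by exists k, b; split=> //; apply: leq_maxr.
  by exists k', b'; split=> //; apply: leq_trans kN (leq_maxl _ _).
have key h : ideal_gen (fun g => g \in s) h ->
    exists2 mu, vars_ideal mu & J ((rees h)`_N - mu * a).
  elim=> [|c g {}h /hN [k [b [kN gE Jb]]] _ [mu vmu Jmu]].
    by exists 0; [exact: ideal_gen0 | rewrite rmorph0 coef0 mul0r subr0].
  exists ((rees c)`_(N - k) + mu).
    apply: ideal_gen_add => //; case: (N - k)%N (subn_gt0 k N) => [|j _]; first by rewrite kN.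
    exact: rees_coef.
  rewrite rmorphD rmorphM /= gE coefD -scalerAr coefZ coefMXn ltnNge (ltnW kN) /=.
  have -> : b * (rees c)`_(N - k) + (rees h)`_N - ((rees c)`_(N - k) + mu) * a
     = (- (rees c)`_(N - k)) * (a - b) + ((rees h)`_N - mu * a) by ring.
  by apply: JD => //; apply: JM.
have [b [h hE] Jb] := H N.
have /key [mu vmu] : ideal_gen (fun g => g \in s) h by apply: sg; exists N, b.
rewrite hE coefZ coefXn eqxx mulr1 => Jmu; exists mu => //.
have -> : a * (1 - mu) = (a - b) + (b - mu * a) by ring.
exact: JD.
Qed.

End Krull.

(** * Fields of fractions *)

(* A field of fractions of R, kept abstract so that computations in it never
   unfold a quotient construction. *)
Record frac_field (R : idomainType) := FracFieldOf {
  ff_sort :> fieldType;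
  ff_emb : {rmorphism R -> ff_sort};
  ff_emb_inj : forall p, ff_emb p = 0 -> p = 0;
  ff_frac : forall f : ff_sort, exists p q, q != 0 /\ f = ff_emb p / ff_emb q
}.

Section FractionLift.
Variables (R : idomainType) (F : frac_field R).
Local Notation "x %:F" := (ff_emb F x).

Lemma emb_eq0 p : (p%:F == 0) = (p == 0).
Proof.
by apply/eqP/eqP => [|->]; [exact: ff_emb_inj | rewrite rmorph0].
Qed.

Lemma emb_neq0 p : p != 0 -> p%:F != 0. Proof. by rewrite emb_eq0. Qed.

Lemma emb_inj : injective (ff_emb F).
Proof.
by move=> p q /eqP; rewrite -subr_eq0 -rmorphB emb_eq0 subr_eq0 => /eqP.
Qed.

Lemma frac_eq (p q p' q' : R) : q != 0 -> q' != 0 ->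
  p%:F / q%:F = p'%:F / q'%:F -> p * q' = p' * q.
Proof.
move=> q0 q'0 e; apply: emb_inj; rewrite !rmorphM /=.
by rewrite -(divfK (emb_neq0 q0) p%:F) e mulrAC divfK ?emb_neq0.
Qed.

Variables (L : fieldType) (phi : {rmorphism R -> L}).
Hypothesis phi_inj : forall p, phi p = 0 -> p = 0.

Lemma frac_lift_subproof (f : F) :
  exists c, exists p q, [/\ q != 0, f = p%:F / q%:F & c = phi p / phi q].
Proof. by have [p [q [q0 ->]]] := ff_frac f; exists (phi p / phi q), p, q. Qed.

(* The dummy [let] makes the injectivity proof a parameter, so that the morphism
   instances below can be inferred. *)
Definition frac_lift (f : F) : L :=
  let _ := phi_inj in sval (cid (frac_lift_subproof f)).

Let phi_neq0 p : p != 0 -> phi p != 0.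
Proof. by apply: contra_neq => /phi_inj. Qed.

Lemma frac_liftE p q : q != 0 -> frac_lift (p%:F / q%:F) = phi p / phi q.
Proof.
move=> q0; rewrite /frac_lift; case: cid => c /= [p' [q' [q'0 e ->]]].
have := frac_eq q0 q'0 e => e'; apply: (mulIf (phi_neq0 q0)).
apply: (mulIf (phi_neq0 q'0)); rewrite divfK ?phi_neq0 //.
by rewrite mulrAC divfK ?phi_neq0 // -!rmorphM /= e'.
Qed.

Fact frac_lift_zmod : zmod_morphism frac_lift.
Proof.
move=> f g; have [p [q [q0 ->]]] := ff_frac f; have [p' [q' [q'0 ->]]] := ff_frac g.
have qF := emb_neq0 q0; have q'F := emb_neq0 q'0.
have -> : p%:F / q%:F - p'%:F / q'%:F = (p * q' - p' * q)%:F / (q * q')%:F.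
  by rewrite rmorphB !rmorphM /=; field; rewrite ?qF ?q'F.
rewrite !frac_liftE ?mulf_neq0 // rmorphB !rmorphM /=.
by field; rewrite !phi_neq0.
Qed.

Fact frac_lift_monoid : monoid_morphism frac_lift.
Proof.
split=> [|f g].
  by rewrite -[1]divr1 -(rmorph1 (ff_emb F)) frac_liftE ?oner_neq0 // rmorph1 divr1.
have [p [q [q0 ->]]] := ff_frac f; have [p' [q' [q'0 ->]]] := ff_frac g.
by rewrite mulf_div -!rmorphM !frac_liftE ?mulf_neq0 // !rmorphM /= mulf_div.
Qed.

HB.instance Definition _ := GRing.isZmodMorphism.Build _ _ frac_lift frac_lift_zmod.
HB.instance Definition _ := GRing.isMonoidMorphism.Build _ _ frac_lift frac_lift_monoid.

Lemma frac_lift_emb p : frac_lift p%:F = phi p.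
Proof.
by rewrite -[p%:F]divr1 -(rmorph1 (ff_emb F)) frac_liftE ?oner_neq0 // rmorph1 divr1.
Qed.

End FractionLift.

Section Order.
Variables (R : idomainType) (F : frac_field R).
Hypothesis facR : factorial_ring R.
Local Notation "x %:F" := (ff_emb F x).
Implicit Types (q a b : R) (f g : F) (e : int).

Definition order_rel q f e := exists a b,
  [/\ ~ divides q a, ~ divides q b & f = q%:F ^ e * (a%:F / b%:F)].

(** Induction on a prime factorization of [a]: only the factors divisible by [q] contribute, and
    these are associated to [q]. *)
Lemma order_poly q a : prime_elt q -> a != 0 ->
  exists (e : nat) b, ~ divides q b /\ a = q ^+ e * b.
Proof.
move=> pq a0; have pa := facR a0.
have: exists (e : nat) c, [/\ prime_product c, ~ divides q c & a = q ^+ e * c].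
  elim: pa => [u du|p b pp pb [e [c [pc qc ->]]]].
    exists 0%N, u; split; [exact: prime_product_unit| |by rewrite mul1r].
    by move=> qu; case: pq => _ h _; apply: h; apply: dvd_trans qu du.
  have [[d pE]|qp] := EM (divides q p); last first.
    exists e, (p * c); split; [exact: prime_product_mul| |by rewrite mulrCA].
    by case: pq => _ _ qP /qP [].
  exists e.+1, (d * c); rewrite exprS pE; split; [|  |by ring].
    apply: prime_prodM => //; apply: prime_product_unit.
    have [p0 p1 pP] := pp; have := dvdxx p; rewrite {2}pE => /pP [[t dE]|[t qE]].
      case: pq => q0 q1 _; case: q1; exists t; apply: (mulIf p0).
      by rewrite mul1r {1}pE dE mulrAC.
    exists t; apply: (mulIf p0); rewrite mul1r {1}pE qE; ring.
  case: pq => q0 q1 qP /qP [[t dE]|//].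
  have [p0 p1 pP] := pp; have := dvdxx p; rewrite {2}pE => /pP [[w dE']|[w qE]].
    by apply: q1; exists w; apply: (mulIf p0); rewrite mul1r {1}pE dE' mulrAC.
  apply: q1; exists (w * t); apply: (mulIf q0); rewrite mul1r.
  by rewrite {1}qE pE dE; ring.
by case=> e [c [_ qc aE]]; exists e, c.
Qed.

Lemma prime_neq0 q : prime_elt q -> q != 0. Proof. by case. Qed.
Hint Resolve prime_neq0 : core.

Lemma ndvd_neq0 q a : ~ divides q a -> a != 0.
Proof. by move=> h; apply/eqP => a0; apply: h; rewrite a0; apply: dvd0. Qed.

Lemma order_rel_exists q f : prime_elt q -> f != 0 -> exists e, order_rel q f e.
Proof.
move=> pq; have [a [b [b0 ->]]] := ff_frac f => ab.
have a0 : a != 0 by apply: contra_neq ab => ->; rewrite rmorph0 mul0r.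
have [e [a' [qa aE]]] := order_poly pq a0.
have [d [b' [qb bE]]] := order_poly pq b0.
exists (e%:Z - d%:Z), a', b'; split=> //.
have qF : q%:F != 0 by rewrite emb_eq0 prime_neq0.
rewrite expfzDr // -exprnN -exprnP aE bE !rmorphM /= !rmorphXn -mulf_div.
by [].
Qed.

Lemma order_rel_uniq q f e d : prime_elt q -> order_rel q f e -> order_rel q f d -> e = d.
Proof.
move=> pq.
suff H e' d' : order_rel q f e' -> order_rel q f d' -> (e' <= d')%R.
  by move=> h1 h2; apply/eqP; rewrite eq_le !H.
move=> [a [b [qa qb ->]]] [a' [b' [qa' qb' E]]]; rewrite leNgt; apply/negP => ed.
have qF : q%:F != 0 by rewrite emb_eq0 prime_neq0.
have [k kE] : exists k : nat, e' = d' + k.+1%:Z by exists (absz (e' - d')).-1; lia.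
apply: qa'; have [_ _ qP] := pq.
have : divides q (a' * b).
  exists (q ^+ k * a * b'); apply: (@emb_inj _ F).
  have b0 : b%:F != 0 by rewrite emb_eq0 (ndvd_neq0 qb).
  have b'0 : b'%:F != 0 by rewrite emb_eq0 (ndvd_neq0 qb').
  have qd : q%:F ^ d' != 0 by rewrite expfz_neq0.
  have : q%:F ^+ k.+1 * (a%:F / b%:F) = a'%:F / b'%:F.
    by apply: (mulfI qd); rewrite -E kE expfzDr // -mulrA.
  move=> E'; rewrite !rmorphM /= -(divfK b'0 a'%:F) -E' rmorphXn /= exprS.
  by move: (q%:F ^+ k) => t; field.
by case/qP.
Qed.

(** The q-adic valuation, with 0 in place of infinity as the value at f = 0. *)
Definition order q f : int :=
  match pselect (exists e, order_rel q f e) with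
  | left h => sval (cid h)
  | right _ => 0
  end.

Lemma orderE q f e : prime_elt q -> order_rel q f e -> order q f = e.
Proof.
move=> pq h; rewrite /order; case: pselect => [h'|[]]; last by exists e.
by case: cid => d /= hd; apply: order_rel_uniq hd h.
Qed.

Lemma orderP q f : prime_elt q -> f != 0 -> order_rel q f (order q f).
Proof.
move=> pq f0; have [e he] := order_rel_exists pq f0.
by rewrite (orderE pq he).
Qed.

Lemma orderM q f g : prime_elt q -> f != 0 -> g != 0 ->
  order q (f * g) = order q f + order q g.
Proof.
move=> pq f0 g0; apply: orderE => //.
have [a [b [qa qb {1}->]]] := orderP pq f0; have [a' [b' [qa' qb' {1}->]]] := orderP pq g0.
have [_ _ qP] := pq; exists (a * a'), (b * b'); split; try by case/qP.
by rewrite expfzDr ?emb_eq0 ?prime_neq0 // !rmorphM /= mulrACA mulf_div.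
Qed.

Lemma order1 q : prime_elt q -> order q 1 = 0.
Proof.
move=> pq; have := orderM pq (oner_neq0 _) (oner_neq0 _); rewrite mulr1.
by move/eqP; rewrite -{1}[order q 1]addr0 (inj_eq (addrI _)) eq_sym => /eqP.
Qed.

Lemma orderV q f : prime_elt q -> f != 0 -> order q f^-1 = - order q f.
Proof.
move=> pq f0; have := orderM pq f0 (invr_neq0 f0).
by rewrite divff // order1 // => /eqP; rewrite eq_sym addrC addr_eq0 => /eqP.
Qed.

Lemma order_emb_ge0 q a : prime_elt q -> a != 0 -> 0 <= order q a%:F.
Proof.
move=> pq a0; have [e [b [qb ->]]] := order_poly pq a0.
suff -> : order q (q ^+ e * b)%:F = e%:Z by [].
apply: orderE => //; exists b, 1; split=> //; first by case: pq.
by rewrite rmorph1 divr1 rmorphM /= rmorphXn /=.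
Qed.

Lemma order_ndvd q a : prime_elt q -> ~ divides q a -> order q a%:F = 0.
Proof.
move=> pq qa; apply: orderE => //; exists a, 1; split=> //; first by case: pq.
by rewrite expr0z mul1r rmorph1 divr1.
Qed.

Lemma order_self q : prime_elt q -> order q q%:F = 1.
Proof.
move=> pq; apply: orderE => //; have [_ q1 _] := pq; exists 1, 1; split=> //.
by rewrite expr1z divff ?mulr1 // rmorph1 oner_neq0.
Qed.

Lemma order_dvd q a : prime_elt q -> a != 0 -> order q a%:F > 0 -> divides q a.
Proof.
by move=> pq a0; apply: contraPP => qa; rewrite (order_ndvd pq qa).
Qed.

End Order.

(** * Local rings and monomial substitutions in a rational function field *)

Section RationalFunctions.
Variables (K : closedFieldType) (n : nat) (F : frac_field {mpoly K[n]}).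
Implicit Types (V : F -> K -> Prop) (f g : F) (c : K) (A B : 'M[int]_n) (m : 'rV[int]_n).

Definition cst : K -> F := ff_emb F \o @mpolyC n K.
HB.instance Definition _ := GRing.RMorphism.on cst.
Definition coord (i : 'I_n) : F := ff_emb F 'X_i.
Definition peval r (y : 'I_r -> F) : {mpoly K[r]} -> F := mmap cst y.

Fact peval_zmod r (y : 'I_r -> F) : zmod_morphism (peval y).
Proof. by move=> p q; rewrite /peval mmapB. Qed.
Fact peval_monoid r (y : 'I_r -> F) : monoid_morphism (peval y).
Proof. by split=> [|p q]; rewrite /peval ?rmorph1 ?rmorphM. Qed.
HB.instance Definition _ r (y : 'I_r -> F) :=
  GRing.isZmodMorphism.Build _ _ (peval y) (peval_zmod y).
HB.instance Definition _ r (y : 'I_r -> F) :=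
  GRing.isMonoidMorphism.Build _ _ (peval y) (peval_monoid y).

Lemma pevalC r (y : 'I_r -> F) c : peval y c%:MP = cst c.
Proof. exact: mmapC. Qed.
Lemma pevalX r (y : 'I_r -> F) i : peval y 'X_i = y i.
Proof. by rewrite /peval mmapX mmap1U. Qed.
Lemma peval_coord p : peval coord p = ff_emb F p.
Proof.
by apply: (mpoly_rmorph_ext (f := peval coord) (g := ff_emb F)) => [c|i] /=;
  rewrite ?pevalC ?pevalX.
Qed.

Lemma peval_rmorph r (y : 'I_r -> F) (t : {rmorphism F -> F}) p :
  (forall c, t (cst c) = cst c) -> t (peval y p) = peval (t \o y) p.
Proof.
move=> tc; apply: (mpoly_rmorph_ext (f := t \o peval y)) => [c|i] /=.
  by rewrite !pevalC.
by rewrite !pevalX.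
Qed.

Lemma cst_eq0 c : (cst c == 0) = (c == 0).
Proof. by rewrite /cst /= emb_eq0 mpolyC_eq0. Qed.

Lemma ff_rmorph_ext (s t : {rmorphism F -> F}) :
  (forall c, s (cst c) = t (cst c)) -> (forall i, s (coord i) = t (coord i)) -> s =1 t.
Proof.
move=> hc hX f; have [p [q [q0 ->]]] := ff_frac f; rewrite !fmorph_div /=.
have E p' : s (ff_emb F p') = t (ff_emb F p').
  exact: (mpoly_rmorph_ext (f := s \o ff_emb F) (g := t \o ff_emb F)).
by rewrite !E.
Qed.

(** The graph of a K-algebra morphism to K from a subring of [F]; [loc_rel] adds that the subring is
    local with the kernel as maximal ideal. Points and places thus have the same form. *)
Record val_rel V : Prop := ValRel {
  vr_cst : forall c, V (cst c) c;
  vr_add : forall f g a b, V f a -> V g b -> V (f + g) (a + b);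
  vr_mul : forall f g a b, V f a -> V g b -> V (f * g) (a * b);
  vr_0 : forall c, V 0 c -> c = 0 }.

Record loc_rel V : Prop := LocRel {
  lr_val :> val_rel V;
  lr_inv : forall f c, V f c -> c != 0 -> V f^-1 c^-1 }.

Section ValRel.
Variable V : F -> K -> Prop.
Hypothesis vV : val_rel V.

Lemma vr_opp f c : V f c -> V (- f) (- c).
Proof.
move=> h; rewrite -mulN1r -[- c]mulN1r; apply: (vr_mul vV) => //.
have := vr_cst vV (- 1); congr (V _ _).
by rewrite rmorphN rmorph1.
Qed.

Lemma vr_uniq f c d : V f c -> V f d -> c = d.
Proof.
move=> h1 h2; apply/eqP; rewrite -subr_eq0; apply/eqP/(vr_0 vV).
by rewrite -(subrr f); apply: (vr_add vV) => //; apply: vr_opp.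
Qed.

Lemma vr_sub f g c d : V f c -> V g d -> V (f - g) (c - d).
Proof. by move=> h1 h2; apply: (vr_add vV) => //; apply: vr_opp. Qed.

Lemma vr_exp f c k : V f c -> V (f ^+ k) (c ^+ k).
Proof.
move=> h; elim: k => [|k IH]; last by rewrite !exprS; apply: (vr_mul vV).
by rewrite !expr0 -(rmorph1 cst); apply: (vr_cst vV).
Qed.

Lemma vr_one : V 1 1.
Proof. by rewrite -(rmorph1 cst); apply: (vr_cst vV). Qed.

Lemma vr_zero : V 0 0.
Proof. by rewrite -(rmorph0 cst); apply: (vr_cst vV). Qed.

Lemma vr_prod (I : Type) (r : seq I) (f : I -> F) (c : I -> K) :
  (forall i, V (f i) (c i)) -> V (\prod_(i <- r) f i) (\prod_(i <- r) c i).
Proof. by move=> h; apply: (big_ind2 V) => //; [exact: vr_one|move=> *; exact: (vr_mul vV)]. Qed.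

Lemma vr_sum (I : Type) (r : seq I) (f : I -> F) (c : I -> K) :
  (forall i, V (f i) (c i)) -> V (\sum_(i <- r) f i) (\sum_(i <- r) c i).
Proof. by move=> h; apply: (big_ind2 V) => //; [exact: vr_zero|move=> *; exact: (vr_add vV)]. Qed.

Lemma vr_peval r (y : 'I_r -> F) (c : 'I_r -> K) p :
  (forall i, V (y i) (c i)) -> V (peval y p) p.@[c].
Proof.
move=> h; rewrite /peval /meval /mmap; apply: vr_sum => m.
by apply: (vr_mul vV); [exact: (vr_cst vV)|apply: vr_prod => i; exact: vr_exp].
Qed.

End ValRel.

Lemma lr_expz V f c (k : int) : loc_rel V -> c != 0 -> V f c -> V (f ^ k) (c ^ k).
Proof.
move=> lV c0 h; case: k => k; first exact: (vr_exp lV).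
by rewrite !NegzE -!exprnN; apply: lr_inv; rewrite ?expf_neq0 //; exact: (vr_exp lV).
Qed.

Lemma lr_div V f g a b : loc_rel V -> V f a -> V g b -> b != 0 -> V (f / g) (a / b).
Proof. by move=> lV h1 h2 b0; apply: (vr_mul lV) => //; apply: lr_inv. Qed.

(* Local ring at the point c of the affine variety with coordinate functions y. *)
Definition local r (y : 'I_r -> F) (c : 'I_r -> K) f v := exists p q,
  [/\ q.@[c] != 0, f = peval y p / peval y q & v = p.@[c] / q.@[c]].

(** [c] is a point of the affine variety with coordinate ring K[y]. *)
Definition on_relations r (y : 'I_r -> F) (c : 'I_r -> K) :=
  forall p, peval y p = 0 -> p.@[c] = 0.

Lemma on_neq0 r (y : 'I_r -> F) (c : 'I_r -> K) q : on_relations y c -> q.@[c] != 0 -> peval y q != 0.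
Proof. by move=> on; apply: contra_neq => /on. Qed.

Lemma local_rel r (y : 'I_r -> F) (c : 'I_r -> K) : on_relations y c -> loc_rel (local y c).
Proof.
move=> on; have n0 := on_neq0 on.
split; first split.
- move=> a; exists a%:MP, 1; rewrite meval1 oner_neq0 !rmorph1 !divr1 pevalC mevalC.
  by split.
- move=> f g a b [p [q [q0 -> ->]]] [p' [q' [q'0 -> ->]]].
  exists (p * q' + p' * q), (q * q'); rewrite mevalM mulf_neq0 // mevalD !mevalM.
  rewrite rmorphD !rmorphM /=; split=> //.
    by rewrite addf_div ?n0.
  by rewrite addf_div.
- move=> f g a b [p [q [q0 -> ->]]] [p' [q' [q'0 -> ->]]].
  exists (p * p'), (q * q'); rewrite !mevalM mulf_neq0 // !rmorphM /=.
  by split=> //; rewrite mulf_div.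
- move=> a [p [q [q0 /esym/eqP e ->]]].
  move: e; rewrite mulf_eq0 invr_eq0 (negbTE (n0 _ q0)) orbF => /eqP /on ->.
  by rewrite mul0r.
- move=> f a [p [q [q0 -> ->]]]; rewrite mulf_eq0 negb_or => /andP[p0 _].
  by exists q, p; rewrite !invf_div; split.
Qed.

Lemma local_coord r (y : 'I_r -> F) (c : 'I_r -> K) i : on_relations y c -> local y c (y i) (c i).
Proof.
move=> on; exists 'X_i, 1; rewrite meval1 oner_neq0 rmorph1 !divr1 pevalX mevalXU.
by split.
Qed.

Lemma local_peval r (y : 'I_r -> F) (c : 'I_r -> K) p : on_relations y c -> local y c (peval y p) p.@[c].
Proof.
by move=> on; apply: (vr_peval (local_rel on)) => i; apply: local_coord.
Qed.

Lemma local_sub r (y : 'I_r -> F) (c : 'I_r -> K) V : loc_rel V -> (forall i, V (y i) (c i)) ->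
  forall f v, local y c f v -> V f v.
Proof.
move=> lV h f v [p [q [q0 -> ->]]].
by apply: lr_div => //; apply: (vr_peval lV).
Qed.

Lemma on_rel V r (y : 'I_r -> F) (c : 'I_r -> K) : val_rel V -> (forall i, V (y i) (c i)) ->
  on_relations y c.
Proof.
by move=> vV h p p0; apply: (vr_0 vV); rewrite -p0; apply: (vr_peval vV).
Qed.

Lemma on_coord z : on_relations coord z.
Proof. by move=> p; rewrite peval_coord => /(ff_emb_inj) ->; rewrite meval0. Qed.

Lemma torus_nonzero (p : {mpoly K[n]}) : p != 0 ->
  exists2 z : 'I_n -> K, (forall i, z i != 0) & p.@[z] != 0.
Proof.
move=> p0; have X0 (i : 'I_n) : ('X_i : {mpoly K[n]}) != 0.
  by rewrite -msize_poly_eq0 msizeX.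
have : p * \prod_(i < n) 'X_i != 0.
  by rewrite mulf_neq0 //; apply/prodf_neq0 => i _.
move=> /mpoly_nonzero [z]; rewrite mevalM mulf_eq0 negb_or => /andP[pz Xz].
exists z => // i; apply: contra_neq Xz => zi.
by rewrite rmorph_prod (bigD1 i) //= mevalXU zi mul0r.
Qed.

Lemma coord_neq0 i : coord i != 0.
Proof. by rewrite emb_neq0 // -msize_poly_eq0 msizeX. Qed.

Definition chi m : F := \prod_i coord i ^ m 0 i.
Definition chival (z : 'I_n -> K) m : K := \prod_i z i ^ m 0 i.

Lemma chiD m m' : chi (m + m') = chi m * chi m'.
Proof.
rewrite -big_split; apply: eq_bigr => i _.
by rewrite mxE expfzDr ?coord_neq0.
Qed.
Lemma chi0 : chi 0 = 1.
Proof. by rewrite /chi big1 // => i _; rewrite mxE expr0z. Qed.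
Lemma chi_neq0 m : chi m != 0.
Proof. by apply/prodf_neq0 => i _; rewrite expfz_neq0 ?coord_neq0. Qed.
Lemma chiN m : chi (- m) = (chi m)^-1.
Proof.
by apply: (mulfI (chi_neq0 m)); rewrite -chiD subrr chi0 divff ?chi_neq0.
Qed.
Lemma chi_delta j : chi (delta_mx 0 j) = coord j.
Proof.
rewrite /chi (bigD1 j) //= mxE !eqxx expr1z big1 ?mulr1 // => i ij.
by rewrite mxE (negbTE ij) andbF expr0z.
Qed.

Lemma chivalD z m m' : (forall i, z i != 0) -> chival z (m + m') = chival z m * chival z m'.
Proof.
by move=> z0; rewrite -big_split; apply: eq_bigr => i _; rewrite mxE expfzDr.
Qed.
Lemma chival0 z : chival z 0 = 1.
Proof. by rewrite /chival big1 // => i _; rewrite mxE expr0z. Qed.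
Lemma chival_neq0 z m : (forall i, z i != 0) -> chival z m != 0.
Proof. by move=> z0; apply/prodf_neq0 => i _; rewrite expfz_neq0. Qed.
Lemma chival_delta z j : chival z (delta_mx 0 j) = z j.
Proof.
rewrite /chival (bigD1 j) //= mxE !eqxx expr1z big1 ?mulr1 // => i ij.
by rewrite mxE (negbTE ij) andbF expr0z.
Qed.

Lemma local_chi z m : (forall i, z i != 0) -> local coord z (chi m) (chival z m).
Proof.
move=> z0; have on := on_coord z; apply: (vr_prod (local_rel on)) => i.
by apply: lr_expz => //; [exact: local_rel|exact: local_coord].
Qed.

Definition monoval A z : 'I_n -> K := fun j => chival z (row j A).

Lemma chival_mono A z m : (forall i, z i != 0) ->
  chival (monoval A z) m = chival z (m *m A).
Proof.
move=> z0; have expz m' (k : int) : chival z m' ^ k = chival z (k *: m').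
  rewrite /chival; elim/big_rec2: _ => [|i x y _ IH]; first by rewrite exp1rz.
  by rewrite expfzMl IH mxE exprz_exp [k * _]mulrC.
rewrite mulmx_sum_row (big_morph (chival z) (fun a b => @chivalD z a b z0) (chival0 z)).
by apply: eq_bigr => i _; apply: expz.
Qed.

Lemma monoval_neq0 A z : (forall i, z i != 0) -> forall j, monoval A z j != 0.
Proof. by move=> z0 j; apply: chival_neq0. Qed.

Lemma monoval_comp A B z : (forall i, z i != 0) ->
  monoval B (monoval A z) =1 monoval (B *m A) z.
Proof. by move=> z0 j; rewrite /monoval chival_mono // row_mul. Qed.

Lemma monoval1 z : monoval 1%:M z =1 z.
Proof. by move=> j; rewrite /monoval row1 chival_delta. Qed.

Definition alg_indep r (y : 'I_r -> F) := forall p, peval y p = 0 -> p = 0.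

(** Total in [y], with the identity as default for dependent families, so that the result is a
    morphism without side conditions. *)
Definition endo (y : 'I_n -> F) : {rmorphism F -> F} :=
  match pselect (alg_indep y) with
  | left h => frac_lift (F := F) h
  | right _ => idfun
  end.

Lemma endo_emb y p : alg_indep y -> endo y (ff_emb F p) = peval y p.
Proof. by move=> h; rewrite /endo; case: pselect => // h'; rewrite /= frac_lift_emb. Qed.

Lemma endo_cst y c : endo y (cst c) = cst c.
Proof. by rewrite /endo; case: pselect => // h'; rewrite /= frac_lift_emb; apply: pevalC. Qed.

Lemma endo_coord y i : alg_indep y -> endo y (coord i) = y i.
Proof. by move=> h; rewrite endo_emb // pevalX. Qed.

(** The monomial map of tori is onto, the inverse matrix giving preimages, so a relation would
    vanish at every point of the torus. *)
Lemma alg_indep_mono A : A \in unitmx -> alg_indep (fun j => chi (row j A)).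
Proof.
move=> uA p p0; apply/eqP; apply: contraT => /torus_nonzero [z z0 pz].
have z'0 := monoval_neq0 (invmx A) z0.
have h : local coord (monoval (invmx A) z) (peval (fun j => chi (row j A)) p)
    p.@[monoval A (monoval (invmx A) z)].
  apply: vr_peval; first exact/local_rel/on_coord.
  by move=> i; apply: local_chi.
move: h; rewrite p0 => /(vr_0 (local_rel (on_coord _))) h.
move: pz; rewrite -h -subr_eq0 (_ : _ - _ = 0) ?eqxx //; apply/eqP; rewrite subr_eq0.
apply/eqP/meval_eq => i; rewrite monoval_comp // mulmxV //.
by rewrite monoval1.
Qed.

Definition mono A := endo (fun j => chi (row j A)).
Definition scale (z : 'I_n -> K) := endo (fun j => cst (z j) * coord j).

Lemma mono_coord A i : A \in unitmx -> mono A (coord i) = chi (row i A).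
Proof. by move=> uA; rewrite endo_coord //; apply: alg_indep_mono. Qed.

Lemma mono_chi A m : A \in unitmx -> mono A (chi m) = chi (m *m A).
Proof.
move=> uA; have expz m' (k : int) : chi m' ^ k = chi (k *: m').
  rewrite /chi; elim/big_rec2: _ => [|i x y _ IH]; first by rewrite exp1rz.
  by rewrite expfzMl IH mxE exprz_exp [k * _]mulrC.
rewrite mulmx_sum_row (big_morph chi chiD chi0) /chi rmorph_prod.
by apply: eq_bigr => i _; rewrite fmorphXz /= mono_coord // expz.
Qed.

Lemma mono_comp A B f : A \in unitmx -> B \in unitmx -> mono A (mono B f) = mono (B *m A) f.
Proof.
move=> uA uB; apply: (ff_rmorph_ext (s := mono A \o mono B)) => [c|i] /=.
  by rewrite !endo_cst.
by rewrite !mono_coord ?unitmx_mul ?uA ?uB // mono_chi // row_mul.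
Qed.

Lemma mono1 f : mono 1%:M f = f.
Proof.
apply: (ff_rmorph_ext (t := idfun)) => [c|i] /=; first by rewrite endo_cst.
by rewrite mono_coord ?unitmx1 // row1 chi_delta.
Qed.

Lemma monoK A : A \in unitmx -> cancel (mono A) (mono (invmx A)).
Proof. by move=> uA f; rewrite mono_comp ?unitmx_inv // mulmxV ?mono1. Qed.

Lemma monoVK A : A \in unitmx -> cancel (mono (invmx A)) (mono A).
Proof. by move=> uA f; rewrite mono_comp ?unitmx_inv // mulVmx ?mono1. Qed.

Lemma alg_indep_scale (z : 'I_n -> K) : (forall i, z i != 0) ->
  alg_indep (fun j => cst (z j) * coord j).
Proof.
move=> z0 p p0; apply/eqP; apply: contraT => /mpoly_nonzero [w pw].
have h : local coord (fun i => w i / z i) (peval (fun j => cst (z j) * coord j) p)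
    p.@[fun i => z i * (w i / z i)].
  have on := on_coord (fun i => w i / z i).
  apply: vr_peval; first exact: local_rel.
  move=> i; apply: (vr_mul (local_rel on)); first exact: (vr_cst (local_rel on)).
  exact: local_coord.
move: h; rewrite p0 => /(vr_0 (local_rel (on_coord _))) h.
move: pw; rewrite -h -subr_eq0 (_ : _ - _ = 0) ?eqxx //; apply/eqP; rewrite subr_eq0.
by apply/eqP/meval_eq => i; rewrite mulrC divfK.
Qed.

Lemma scale_coord z i : (forall i, z i != 0) -> scale z (coord i) = cst (z i) * coord i.
Proof. by move=> z0; rewrite endo_coord //; apply: alg_indep_scale. Qed.

End RationalFunctions.

(** * A bound on the transcendence degree by counting monomials *)

Section DegreeBound.
Variables (K : fieldType) (n : nat).
Implicit Types p q : {mpoly K[n]}.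

Definition deg_le k p := forall m, m \in msupp p -> (mdeg m <= k)%N.

Lemma deg_le_msize p : deg_le (msize p) p.
Proof. by move=> m /msize_mdeg_lt /ltnW. Qed.

Lemma deg_leW k l p : (k <= l)%N -> deg_le k p -> deg_le l p.
Proof. by move=> kl h m /h /leq_trans; apply. Qed.

Lemma deg_leM k l p q : deg_le k p -> deg_le l q -> deg_le (k + l) (p * q).
Proof.
move=> hp hq m /msuppM_le /allpairsP [[m1 m2] /= [h1 h2 ->]].
by rewrite mdegD leq_add ?hp ?hq.
Qed.

Lemma deg_le1 : deg_le 0 1.
Proof. by move=> m; rewrite msupp1 inE => /eqP->; rewrite mdeg0. Qed.

Lemma deg_leX k l p : deg_le k p -> deg_le (l * k) (p ^+ l).
Proof.
move=> h; elim: l => [|l IH]; first by rewrite mul0n expr0; apply: deg_le1.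
by rewrite exprS mulSn; apply: deg_leM.
Qed.

Lemma deg_le_prod (I : finType) (f : I -> {mpoly K[n]}) (k : I -> nat) :
  (forall i, deg_le (k i) (f i)) -> deg_le (\sum_i k i) (\prod_i f i).
Proof.
move=> h; apply: (big_ind2 (fun k p => deg_le k p)) => //; first exact: deg_le1.
by move=> *; apply: deg_leM.
Qed.

(** The matrix of coefficients has independent rows, and its columns are indexed by monomials, of
    which (k + 1)^n is a crude upper bound. *)
Lemma card_deg_le (I : finType) (G : I -> {mpoly K[n]}) k :
  (forall i, deg_le k (G i)) ->
  (forall c : I -> K, \sum_i c i *: G i = 0 -> forall i, c i = 0) ->
  (#|I| <= k.+1 ^ n)%N.
Proof.
move=> hd ind; pose B := 'X_{1..n < k.+1}.
pose M := \matrix_(i < #|I|, j < #|{: B}|) (G (enum_val i))@_(enum_val j : B).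
have rf : row_free M.
  rewrite -kermx_eq0; apply: contraT => /rowV0Pn [v /sub_kermxP vM v0].
  pose c i := v 0 (enum_rank i).
  have c0 : forall i, c i = 0.
    apply: ind; apply/mpolyP => m; rewrite mcoeff0 raddf_sum /=.
    have [mk|mk] := ltnP (mdeg m) k.+1; last first.
      rewrite big1 // => i _; rewrite mcoeffZ memN_msupp_eq0 ?mulr0 //.
      by apply: contraTN mk => /hd; rewrite -ltnS -ltnNge.
    have := congr1 (fun A : 'rV_#|{: B}| => A 0 (enum_rank (BMultinom mk))) vM.
    rewrite !mxE => E; rewrite -[RHS]E.
    rewrite (reindex (fun i : 'I_#|I| => enum_val i)) /=; last first.
      by apply: onW_bij; apply: enum_val_bij.
    by apply: eq_bigr => i _; rewrite mcoeffZ mxE /c enum_valK enum_rankK.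
  case/negP: v0; apply/eqP/matrixP => i j; rewrite ord1 mxE.
  by have := c0 (enum_val j); rewrite /c enum_valK.
have := rank_leq_col M; rewrite (eqP rf) => h; apply: (leq_trans h).
pose g (m : B) : {ffun 'I_n -> 'I_k.+1} := [ffun i => inord (m i)].
have -> : (k.+1 ^ n)%N = #|{: {ffun 'I_n -> 'I_k.+1}}| by rewrite card_ffun !card_ord.
apply: (leq_card g) => m m' /ffunP E; apply/val_inj/mnmP => i.
have := E i; rewrite !ffunE => /(congr1 (@nat_of_ord _)).
have bnd (m0 : B) : (m0 i < k.+1)%N.
  apply: leq_ltn_trans (bmdeg m0); rewrite mdegE (bigD1 i) //=; apply: leq_addr.
by rewrite !inordK.
Qed.

End DegreeBound.

Section TranscendenceDegree.
Variables (K : closedFieldType) (n : nat) (F : frac_field {mpoly K[n]}).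

Lemma common_denominator d (y : 'I_d -> F) :
  exists (b : {mpoly K[n]}) (a : 'I_d -> {mpoly K[n]}),
    b != 0 /\ forall i, y i = ff_emb F (a i) / ff_emb F b.
Proof.
have /choice [pq hpq] i : exists pq : {mpoly K[n]} * {mpoly K[n]},
    pq.2 != 0 /\ y i = ff_emb F pq.1 / ff_emb F pq.2.
  by have [p [q H]] := ff_frac (y i); exists (p, q).
exists (\prod_i (pq i).2), (fun i => (pq i).1 * \prod_(j | j != i) (pq j).2).
split; first by apply/prodf_neq0 => i _; case: (hpq i).
move=> i; case: (hpq i) => q0 ->.
rewrite [X in _ = _ / ff_emb F X](bigD1 i) //= !rmorphM /=.
have h0 : ff_emb F (\prod_(j | j != i) (pq j).2) != 0.
  by rewrite emb_neq0 //; apply/prodf_neq0 => j _; case: (hpq j).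
by rewrite -mulf_div divff // mulr1.
Qed.

(** With [b] a common denominator, the monomials in [y] with exponents at most [D], multiplied by
    b^(d D), are (D + 1)^d independent polynomials of degree at most d D e. For large [D] these are
    too many if d > n. *)
Theorem alg_indep_leq d (y : 'I_d -> F) : alg_indep y -> (d <= n)%N.
Proof.
move=> ind; have [b [a [b0 yE]]] := common_denominator y.
have [e [be ae]] : exists e, deg_le e b /\ forall i, deg_le e (a i).
  exists (msize b + \sum_i msize (a i))%N; split.
    exact: deg_leW (leq_addr _ _) (@deg_le_msize _ _ _).
  move=> i; apply: deg_leW (@deg_le_msize _ _ _).
  by rewrite (bigD1 i) //= addnCA leq_addr.
have key D : (D.+1 ^ d <= (d * D * e).+1 ^ n)%N.
  pose I := {ffun 'I_d -> 'I_D.+1}.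
  pose s (g : I) := (\sum_i (D - g i))%N.
  pose G (g : I) := (\prod_i (a i ^+ g i * b ^+ (D - g i))).
  have bF := emb_neq0 F b0.
  have GE g : ff_emb F (G g) = ff_emb F b ^+ (d * D) * \prod_i y i ^+ g i.
    have -> : ff_emb F b ^+ (d * D) = \prod_(i < d) ff_emb F b ^+ D.
      by rewrite prodr_const card_ord -exprM mulnC.
    rewrite -big_split /G rmorph_prod /=; apply: eq_bigr => i _.
    have gD : (g i <= D)%N by rewrite -ltnS.
    rewrite rmorphM !rmorphXn /= yE; move: (nat_of_ord (g i)) gD => k kD.
    rewrite -[in RHS](subnK kD) exprD expr_div_n -mulrA [X in _ = _ * X]mulrC.
    by rewrite divfK ?expf_neq0 // mulrC.
  have := card_deg_le (G := G) (k := (d * D * e)%N); rewrite card_ffun !card_ord; apply.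
    move=> g; have -> : (d * D * e = \sum_(i < d) (g i * e + (D - g i) * e))%N.
      rewrite (eq_bigr (fun=> (D * e)%N)) ?sum_nat_const ?card_ord ?mulnA // => i _.
      by rewrite -mulnDl subnKC // -ltnS.
    by apply: deg_le_prod => i; apply: deg_leM; apply: deg_leX.
  move=> c cG; pose p := \sum_(g : I) c g *: 'X_[[multinom (g i : nat) | i < d]] : {mpoly K[d]}.
  have p0 : p = 0.
    apply: ind; apply: (mulfI (expf_neq0 (d * D) bF)); rewrite mulr0.
    rewrite /p rmorph_sum mulr_sumr /=; rewrite -[RHS](rmorph0 (ff_emb F)) -cG rmorph_sum.
    apply: eq_bigr => g _; rewrite -!mul_mpolyC !rmorphM /= GE pevalC mulrCA.
    congr (_ * (_ * _)); rewrite /peval mmapX; apply: eq_bigr => i _.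
    by rewrite mnmE.
  move=> g; have := congr1 (mcoeff [multinom (g i : nat) | i < d]) p0.
  rewrite mcoeff0 /p raddf_sum /= (bigD1 g) //= mcoeffZ mcoeffX eqxx mulr1 big1 ?addr0 //.
  move=> h hg; rewrite mcoeffZ mcoeffX; case: eqP => [E|_]; last by rewrite mulr0.
  case/eqP: hg; apply/ffunP => i; apply: val_inj.
  by have := congr1 (fun m : 'X_{1..d} => m i) E; rewrite !mnmE.
(* For this [D] the count would give (D + 1)^(n + 1) <= C^n (D + 1)^n = D (D + 1)^n. *)
rewrite leqNgt; apply/negP => nd; pose C := (d * e).+1; pose D := (C ^ n)%N.
have h1 : (D.+1 ^ n.+1 <= (C * D.+1) ^ n)%N.
  apply: leq_trans (leq_pexp2l _ nd) _ => //; apply: leq_trans (key D) _.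
  have pw k l m : (k <= l)%N -> (k ^ m <= l ^ m)%N.
    by move=> kl; elim: m => // m IH; rewrite !expnS leq_mul.
  by apply: pw; rewrite /C; move: D; clear; nia.
move: h1; rewrite expnMn expnS leq_pmul2r ?expn_gt0 //.
by rewrite -/D ltnn.
Qed.

End TranscendenceDegree.

(** * Taylor polynomials at the origin *)

Section Vanishing.
Variables (K : fieldType) (n : nat).
Implicit Types (p q L : {mpoly K[n]}) (m : 'X_{1..n}).

Definition vanish k p := forall m, (mdeg m < k)%N -> p@_m = 0.

Lemma vanish0 k : vanish k 0. Proof. by move=> m _; rewrite mcoeff0. Qed.
Lemma vanishW k l p : (k <= l)%N -> vanish l p -> vanish k p.
Proof. by move=> kl h m mk; apply: h; apply: leq_trans kl. Qed.
Lemma vanishD k p q : vanish k p -> vanish k q -> vanish k (p + q).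
Proof. by move=> hp hq m mk; rewrite mcoeffD hp ?hq ?addr0. Qed.
Lemma vanishN k p : vanish k p -> vanish k (- p).
Proof. by move=> hp m mk; rewrite mcoeffN hp ?oppr0. Qed.
Lemma vanishB k p q : vanish k p -> vanish k q -> vanish k (p - q).
Proof. by move=> hp hq; apply/vanishD/vanishN. Qed.
Lemma vanish_supp k p : vanish k p <-> (forall m, m \in msupp p -> (k <= mdeg m)%N).
Proof.
split=> h m; first by rewrite mcoeff_msupp leqNgt; apply: contra => /h ->.
by move=> mk; apply: memN_msupp_eq0; apply: contraTN mk => /h; rewrite leqNgt.
Qed.
Lemma vanishM k l p q : vanish k p -> vanish l q -> vanish (k + l) (p * q).
Proof.
move=> /vanish_supp hp /vanish_supp hq; apply/vanish_supp => m.
move=> /msuppM_le /allpairsP [[m1 m2] /= [/hp h1 /hq h2 ->]].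
by rewrite mdegD leq_add.
Qed.
Lemma vanish_mull k p q : vanish k p -> vanish k (q * p).
Proof. exact: (@vanishM 0). Qed.
Lemma vanishX k p : vanish 1 p -> vanish k (p ^+ k).
Proof. by move=> h; elim: k => // k IH; rewrite exprS -add1n; apply: vanishM. Qed.
Lemma vanish1 p : p@_0%MM = 0 -> vanish 1 p.
Proof. by move=> p0 m; rewrite ltnS leqn0 mdeg_eq0 => /eqP ->. Qed.

Lemma meval_0 p : p.@[fun=> 0] = p@_0%MM.
Proof.
rewrite {1}[p]mpolyE rmorph_sum /=.
have h (m : 'X_{1..n}) : m != 0%MM -> ('X_[m] : {mpoly K[n]}).@[fun=> 0] = 0.
  move=> m0; rewrite mevalX; have [i mi] : exists i, m i != 0%N.
    apply: contrapT => /forallNP H; case/eqP: m0; apply/mnmP => i.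
    by rewrite mnm0E; apply/eqP; case: eqP => // hi; case: (H i); apply/eqP.
  by rewrite (bigD1 i) //= expr0n (negbTE mi) mul0r.
have [m0|m0] := boolP (0%MM \in msupp p); last first.
  rewrite (memN_msupp_eq0 m0) big_seq big1 // => m hm; rewrite mevalZ h ?mulr0 //.
  by apply: contraNneq m0 => <-.
rewrite (bigD1_seq 0%MM) ?msupp_uniq //= mevalZ mpolyX0 meval1 mulr1.
by rewrite big1 ?addr0 // => m hm; rewrite mevalZ h ?mulr0.
Qed.

(** The geometric series in 1 - q / q(0), truncated at [k]. *)
Lemma approx_inverse k q : q@_0%MM != 0 -> exists s, vanish k (1 - q * s).
Proof.
move=> q0; pose b := 1 - (q@_0%MM)^-1 *: q.
have vb : vanish 1 b.
  by apply: vanish1; rewrite mcoeffB mcoeffZ mcoeff1 eqxx mulVf // subrr.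
exists ((q@_0%MM)^-1 *: \sum_(i < k) b ^+ i).
rewrite -scalerAr scalerAl (_ : _ *: q = 1 - b); last by rewrite /b opprB addrC subrK.
have -> : 1 - (1 - b) * (\sum_(i < k) b ^+ i) = b ^+ k.
  have := subrX1 b k; move: (\sum_(i < k) _) => S E.
  by rewrite -[RHS](subrK 1) E; ring.
exact: vanishX.
Qed.

Lemma vanish_unit k q p : q@_0%MM != 0 -> vanish k (q * p) -> vanish k p.
Proof.
move=> /(approx_inverse k) [s hs] h.
have -> : p = (1 - q * s) * p + s * (q * p) by ring.
by apply: vanishD; [rewrite mulrC|]; apply: vanish_mull.
Qed.

Definition mscale (z : 'I_n -> K) : {mpoly K[n]} -> {mpoly K[n]} :=
  mmap (@mpolyC n K) (fun i => z i *: 'X_i).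
Fact mscale_zmod z : zmod_morphism (mscale z).
Proof. by move=> p q; rewrite /mscale mmapB. Qed.
Fact mscale_monoid z : monoid_morphism (mscale z).
Proof. by split=> [|p q]; rewrite /mscale ?rmorph1 ?rmorphM. Qed.
HB.instance Definition _ z := GRing.isZmodMorphism.Build _ _ (mscale z) (mscale_zmod z).
HB.instance Definition _ z := GRing.isMonoidMorphism.Build _ _ (mscale z) (mscale_monoid z).

Lemma mscaleX z m : mscale z 'X_[m] = ('X_[m]).@[z] *: 'X_[m].
Proof.
rewrite /mscale mmapX /mmap1 mevalX [in RHS]mpolyXE_id.
rewrite -mul_mpolyC rmorph_prod /= -big_split /=; apply: eq_bigr => i _.
by rewrite exprZn -mul_mpolyC.
Qed.

Lemma mcoeff_mscale z p m : (mscale z p)@_m = p@_m * ('X_[m]).@[z].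
Proof.
rewrite [X in mscale z X]mpolyE [X in _ = X@_m * _]mpolyE rmorph_sum /=.
rewrite !(raddf_sum (mcoeff m)) mulr_suml /=; apply: eq_bigr => m' _.
rewrite -mul_mpolyC rmorphM /= mscaleX {1}/mscale mmapC mul_mpolyC !mcoeffZ mcoeffX.
rewrite mcoeffCM mcoeffZ mcoeffX.
by case: eqP => [->|]; rewrite ?mulr0 ?mul0r // !mulr1.
Qed.

Lemma vanish_mscale k z p : vanish k p -> vanish k (mscale z p).
Proof. by move=> h m /h e; rewrite mcoeff_mscale e mul0r. Qed.

End Vanishing.

Section Approximation.
Variables (K : closedFieldType) (n : nat) (F : frac_field {mpoly K[n]}).
Implicit Types (p q L : {mpoly K[n]}) (m : 'X_{1..n}) (f g : F) (c v : K).
Local Notation loc0 := (local (coord F) (fun=> 0)).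
Local Notation "x %:F" := (ff_emb F x).

(** [L] agrees with the Taylor series of [f] at the origin in degrees below [k]; truncations of all
    orders take the place of the completed local ring. *)
Definition approx k f L := exists p q,
  [/\ q@_0%MM != 0, f = p%:F / q%:F & vanish k (p - q * L)].

Lemma loc0E f c : loc0 f c -> exists p q,
  [/\ q@_0%MM != 0, f = p%:F / q%:F & c = p@_0%MM / q@_0%MM].
Proof.
move=> [p [q [q0 -> ->]]]; exists p, q.
by rewrite -!meval_0 !peval_coord; split.
Qed.

Let c0_neq0 q : q@_0%MM != 0 -> q != 0.
Proof. by apply: contra_neq => ->; rewrite mcoeff0. Qed.

Lemma approx_exists k f c : loc0 f c -> exists L, approx k f L.
Proof.
move=> /loc0E [p [q [q0 -> _]]]; have [s hs] := approx_inverse k q0.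
exists (p * s), p, q; split=> //.
have -> : p - q * (p * s) = p * (1 - q * s) by ring.
exact: vanish_mull.
Qed.

Lemma approx_emb k p : approx k p%:F p.
Proof.
exists p, 1; rewrite mcoeff1 eqxx oner_neq0 rmorph1 divr1 mul1r subrr.
by split=> //; apply: vanish0.
Qed.

Lemma approxW k l f L : (k <= l)%N -> approx l f L -> approx k f L.
Proof. by move=> kl [p [q [q0 fE h]]]; exists p, q; split=> //; apply: vanishW h. Qed.

Lemma approx_ext k f L L' : vanish k (L - L') -> approx k f L -> approx k f L'.
Proof.
move=> h [p [q [q0 fE h']]]; exists p, q; split=> //.
have -> : p - q * L' = (p - q * L) + q * (L - L') by ring.
by apply: vanishD => //; apply: vanish_mull.
Qed.

Lemma approxD k f g L L' : approx k f L -> approx k g L' -> approx k (f + g) (L + L').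
Proof.
move=> [p [q [q0 -> h]]] [p' [q' [q'0 -> h']]]; exists (p * q' + p' * q), (q * q').
have e0 : (q * q')@_0%MM = q@_0%MM * q'@_0%MM by rewrite -!meval_0 mevalM.
split.
- by rewrite e0 mulf_neq0.
- by rewrite addf_div ?emb_neq0 ?c0_neq0 // rmorphD !rmorphM.
have -> : p * q' + p' * q - q * q' * (L + L') = q' * (p - q * L) + q * (p' - q' * L').
  by ring.
by apply: vanishD; apply: vanish_mull.
Qed.

Lemma approxM k f g L L' : approx k f L -> approx k g L' -> approx k (f * g) (L * L').
Proof.
move=> [p [q [q0 -> h]]] [p' [q' [q'0 -> h']]]; exists (p * p'), (q * q').
have e0 : (q * q')@_0%MM = q@_0%MM * q'@_0%MM by rewrite -!meval_0 mevalM.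
split.
- by rewrite e0 mulf_neq0.
- by rewrite mulf_div !rmorphM.
have -> : p * p' - q * q' * (L * L') = p' * (p - q * L) + (q * L) * (p' - q' * L').
  by ring.
by apply: vanishD; apply: vanish_mull.
Qed.

Lemma approx_cst k c : approx k (cst F c) c%:MP.
Proof. exact: approx_emb. Qed.

Lemma approxB k f g L L' : approx k f L -> approx k g L' -> approx k (f - g) (L - L').
Proof.
move=> h h'; apply: approxD => //; rewrite -mulN1r -[- L']mulN1r.
apply: approxM => //; have := approx_cst k (- 1).
by rewrite !rmorphN !rmorph1.
Qed.

Lemma approx_sum k (I : Type) (r : seq I) (f : I -> F) (L : I -> {mpoly K[n]}) :
  (forall i, approx k (f i) (L i)) -> approx k (\sum_(i <- r) f i) (\sum_(i <- r) L i).
Proof.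
move=> h; apply: (big_ind2 (approx k)) => //; last by move=> *; apply: approxD.
by have := approx_emb k 0; rewrite rmorph0.
Qed.

Lemma approxX k f L l : approx k f L -> approx k (f ^+ l) (L ^+ l).
Proof.
move=> h; elim: l => [|l IH]; last by rewrite !exprS; apply: approxM.
by rewrite !expr0; have := approx_emb k 1; rewrite rmorph1.
Qed.

Lemma approx_prod k (I : Type) (r : seq I) (f : I -> F) (L : I -> {mpoly K[n]}) :
  (forall i, approx k (f i) (L i)) -> approx k (\prod_(i <- r) f i) (\prod_(i <- r) L i).
Proof.
move=> h; apply: (big_ind2 (approx k)) => //; last by move=> *; apply: approxM.
by have := approx_emb k 1; rewrite rmorph1.
Qed.

Lemma approx_uniq k f L L' : approx k f L -> approx k f L' -> vanish k (L - L').
Proof.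
move=> [p [q [q0 -> h]]] [p' [q' [q'0 e h']]].
have e1 := frac_eq (c0_neq0 q0) (c0_neq0 q'0) e.
apply: (@vanish_unit _ _ _ (q * q')).
  by rewrite -meval_0 mevalM !meval_0 mulf_neq0.
have -> : q * q' * (L - L') = q * (p' - q' * L') - q' * (p - q * L) + (p * q' - p' * q).
  by ring.
rewrite e1 subrr addr0; apply: vanishB; exact: vanish_mull.
Qed.

Lemma approx_value k f c L : approx k.+1 f L -> loc0 f c -> c = L@_0%MM.
Proof.
move=> h /loc0E [p [q [q0 fE cE]]]; have [s hs] := approx_inverse k.+1 q0.
have : approx k.+1 f (p * s).
  exists p, q; split=> //; have -> : p - q * (p * s) = p * (1 - q * s) by ring.
  exact: vanish_mull.
move=> /(approx_uniq h) /(_ 0%MM); rewrite mdeg0 mcoeffB => /(_ isT) /eqP.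
rewrite subr_eq0 => /eqP ->; rewrite cE -!meval_0 mevalM !meval_0; congr (_ * _).
have := hs 0%MM; rewrite mdeg0 mcoeffB mcoeff1 eqxx => /(_ isT) /eqP.
rewrite subr_eq0 -meval_0 mevalM !meval_0 => /eqP /esym e1.
by apply: (mulfI q0); rewrite e1 divff.
Qed.

Lemma scale_emb z p : (forall i, z i != 0) -> scale F z p%:F = (mscale z p)%:F.
Proof.
move=> z0; apply: (mpoly_rmorph_ext (f := scale F z \o ff_emb F) (g := ff_emb F \o mscale z)).
  by move=> c /=; rewrite /mscale mmapC; apply: endo_cst.
move=> i /=; rewrite scale_coord // /mscale mmapX mmap1U.
by rewrite -mul_mpolyC rmorphM.
Qed.

Lemma approx_scale k z f L : (forall i, z i != 0) -> approx k f L ->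
  approx k (scale F z f) (mscale z L).
Proof.
move=> z0 [p [q [q0 -> h]]]; exists (mscale z p), (mscale z q); split.
- by rewrite mcoeff_mscale mpolyX0 meval1 mulr1.
- by rewrite fmorph_div /= !scale_emb.
- by rewrite -rmorphM -rmorphB; apply: vanish_mscale.
Qed.

Lemma approx0_eq0 f : (forall k, approx k f 0) -> f = 0.
Proof.
move=> h; have [p [q [q0 fE _]]] := h 0%N; rewrite fE.
suff -> : p = 0 by rewrite rmorph0 mul0r.
apply/mpolyP => m; rewrite mcoeff0.
have h1 : approx (mdeg m).+1 p%:F 0.
  have -> : p%:F = f * q%:F by rewrite fE divfK // emb_neq0 // c0_neq0.
  by rewrite -[0 : {mpoly K[n]}](mul0r q); apply: approxM => //; apply: approx_emb.
by have := approx_uniq (approx_emb _ _) h1 (ltnSn _); rewrite subr0.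
Qed.

End Approximation.

(** * Exponents of a torus-stable local ring *)

Section MonomialLocalRing.
Variables (K : closedFieldType) (n : nat) (F : frac_field {mpoly K[n]}).
Local Notation loc0 := (local (coord F) (fun=> 0)).
Local Notation "x %:F" := (ff_emb F x).
Implicit Types (L : {mpoly K[n]}) (al be : 'X_{1..n}) (f g : F) (c : K).

Variable O : F -> K -> Prop.
Hypothesis lO : loc_rel O.
Hypothesis sub0 : forall f c, O f c -> loc0 f c.
Hypothesis scaleO : forall z, (forall i, z i != 0) -> forall f c, O f c -> O (scale F z f) c.

Definition dom_rel f := exists c, O f c.

(* Exponents occurring in the Taylor expansions of elements of O. *)
Definition exponent al := forall k, exists2 f, dom_rel f & approx k f 'X_[al].

Lemma domD f g : dom_rel f -> dom_rel g -> dom_rel (f + g).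
Proof. by move=> [c h] [d h']; exists (c + d); apply: (vr_add lO). Qed.
Lemma domM f g : dom_rel f -> dom_rel g -> dom_rel (f * g).
Proof. by move=> [c h] [d h']; exists (c * d); apply: (vr_mul lO). Qed.
Lemma dom_cst c : dom_rel (cst F c). Proof. by exists c; apply: (vr_cst lO). Qed.
Lemma domB f g : dom_rel f -> dom_rel g -> dom_rel (f - g).
Proof. by move=> [c h] [d h']; exists (c - d); apply: (vr_sub lO). Qed.
Lemma dom_approx k f : dom_rel f -> exists L, approx k f L.
Proof. by move=> [c /sub0 h]; apply: approx_exists h. Qed.

(** The product of the differences of the monomials of degree below [k] is a nonzero polynomial. *)
Lemma separating_point k : exists2 z : 'I_n -> K, (forall i, z i != 0) &
  forall al be, (mdeg al < k)%N -> (mdeg be < k)%N ->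
    ('X_[al] : {mpoly K[n]}).@[z] = ('X_[be]).@[z] -> al = be.
Proof.
pose P : {mpoly K[n]} := \prod_(a : 'X_{1..n < k}) \prod_(b : 'X_{1..n < k} | b != a)
  ('X_[a] - 'X_[b]).
have P0 : P != 0.
  apply/prodf_neq0 => a _; apply/prodf_neq0 => b ba; rewrite subr_eq0.
  apply: contra ba => /eqP /(congr1 (mcoeff a)).
  rewrite !mcoeffX eqxx; case: eqP => [e _|_ /eqP]; last by rewrite oner_eq0.
  by apply/eqP/val_inj.
have [z z0 Pz] := torus_nonzero P0; exists z => // al be ha hb e.
apply: contraNeq Pz => ab; rewrite rmorph_prod (bigD1 (BMultinom ha)) //=.
rewrite rmorph_prod (bigD1 (BMultinom hb)) /=; last first.
  by rewrite -val_eqE /= eq_sym.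
by rewrite mevalB e subrr !mul0r.
Qed.

(** Scaling by a separating [z] multiplies each coefficient by the value of its monomial at [z].
    Subtracting the function times the value of the monomial [b] removes [b] and keeps the
    coefficient of [al] nonzero; this is repeated for all other monomials of degree below [k]. *)
Lemma isolate k f L al : dom_rel f -> approx k f L -> (mdeg al < k)%N -> L@_al != 0 ->
  exists2 g, dom_rel g & approx k g 'X_[al].
Proof.
move=> df hf ak La; have [z z0 zinj] := separating_point k.
pose v m := ('X_[m] : {mpoly K[n]}).@[z].
have [g [G [dg hg Ga G0]]] : exists g G, [/\ dom_rel g, approx k g G, G@_al != 0 &
    forall m, (mdeg m < k)%N -> m != al -> G@_m = 0].
  suff H (s : seq 'X_{1..n < k}) : exists g G, [/\ dom_rel g, approx k g G, G@_al != 0 &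
      forall m : 'X_{1..n < k}, m \in s -> (m : 'X_{1..n}) != al -> G@_m = 0].
    have [g [G [dg hg Ga G0]]] := H (enum {: 'X_{1..n < k}}).
    exists g, G; split=> // m mk ma; apply: (G0 (BMultinom mk)) => //.
    by rewrite mem_enum.
  elim: s => [|b s [g [G [dg hg Ga G0]]]]; first by exists f, L.
  have [ba|ba] := eqVneq (b : 'X_{1..n}) al.
    exists g, G; split=> // m; rewrite inE => /orP[/eqP->|]; last exact: G0.
    by rewrite ba eqxx.
  exists (scale F z g - cst F (v b) * g), (mscale z G - (v b)%:MP * G); split.
  - apply: domB; last by apply: domM => //; apply: dom_cst.
    by case: dg => c hc; exists c; apply: scaleO.
  - by apply: approxB; [exact: approx_scale | apply: approxM => //; apply: approx_cst].
  - rewrite mcoeffB mcoeff_mscale mcoeffCM [v b * _]mulrC -mulrBr mulf_neq0 // subr_eq0.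
    by apply: contraNneq ba => /zinj -> //; apply: bmdeg.
  - move=> m; rewrite inE mcoeffB mcoeff_mscale mcoeffCM => /orP[/eqP-> _|ms ma].
      by rewrite /v mulrC subrr.
    by rewrite G0 // mulr0 mul0r subrr.
exists (cst F (G@_al)^-1 * g); first by apply: domM => //; apply: dom_cst.
apply: (approx_ext (L := (G@_al)^-1%:MP * G)); last by apply: approxM => //; apply: approx_cst.
move=> m mk; rewrite mcoeffB mcoeffCM mcoeffX.
have [<-|ma] := eqVneq al m; first by rewrite mulVf // subrr.
by rewrite (G0 m mk) ?mulr0 ?subrr // eq_sym.
Qed.

(** A Taylor coefficient does not depend on the precision, so [f] can be expanded as far as required
    before the monomial is isolated. *)
Lemma exponentP k f L al : dom_rel f -> approx k f L -> (mdeg al < k)%N -> L@_al != 0 ->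
  exponent al.
Proof.
move=> df hf ak La l; have [L' hL'] := dom_approx (maxn k l) df.
have h : L'@_al = L@_al.
  have := approx_uniq (approxW (leq_maxl k l) hL') hf ak.
  by rewrite mcoeffB => /eqP; rewrite subr_eq0 => /eqP.
have [||g dg hg] := @isolate (maxn k l) f L' al df hL'.
- by apply: leq_trans ak _; apply: leq_maxl.
- by rewrite h.
by exists g => //; apply: approxW hg; apply: leq_maxr.
Qed.

Definition irred_exp w := [/\ exponent w, w != 0%MM &
  forall a b, exponent a -> exponent b -> w = (a + b)%MM -> a = 0%MM \/ b = 0%MM].

Lemma exponent_dec al : exponent al -> al != 0%MM -> ~ irred_exp al ->
  exists a b, [/\ exponent a, exponent b, al = (a + b)%MM, a != 0%MM & b != 0%MM].
Proof.
move=> ha a0 nirr; apply: contrapT => H; apply: nirr; split=> // a b hA hB E.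
apply: contrapT => /not_orP [/eqP aa /eqP bb]; apply: H.
by exists a, b; split=> //; apply/negPn.
Qed.

Lemma O0_coef k f L : O f 0 -> approx k f L -> (0 < k)%N -> L@_0%MM = 0.
Proof. by case: k => // k h /approx_value h' _; rewrite -(h' _ (sub0 h)). Qed.

Lemma exponent_O0 k al : exponent al -> al != 0%MM -> (0 < k)%N ->
  exists2 f, O f 0 & approx k f 'X_[al].
Proof.
case: k => // k ha a0 _; have [f [c hc] hf] := ha k.+1; exists f => //.
have := approx_value hf (sub0 hc); rewrite mcoeffX (negbTE a0) => c0.
by rewrite c0 in hc.
Qed.

Variable tau : 'I_n -> F.
Hypothesis tau0 : forall i, O (tau i) 0.
Hypothesis tauM : forall f, O f 0 -> exists (a : 'I_n -> F) (v : 'I_n -> K),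
  (forall i, O (a i) (v i)) /\ f = \sum_i a i * tau i.

(* Modulo the square of the maximal ideal, f is the combination of the tau's with
   the given coefficients. *)
Lemma irred_indep r (w : 'I_r -> 'X_{1..n}) (f : 'I_r -> F) (A : 'M[K]_(r, n))
    (a : 'I_r -> 'I_n -> F) k :
  injective w -> (forall i, irred_exp (w i)) -> (forall i, (mdeg (w i) < k)%N) ->
  (forall i, approx k (f i) 'X_[w i]) -> (forall i j, O (a i j) (A i j)) ->
  (forall i, f i = \sum_j a i j * tau j) -> row_free A.
Proof.
move=> winj wirr wk hf ha fE; rewrite -kermx_eq0; apply: contraT => /rowV0Pn [v /sub_kermxP vA v0].
case/negP: v0; apply/eqP/rowP => i0; rewrite mxE; apply/eqP; apply: contraT => vi.
pose b j := \sum_i cst F (v 0 i) * a i j.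
have hb j : O (b j) 0.
  have := congr1 (fun B : 'rV[K]_n => B 0 j) vA; rewrite !mxE => <-.
  by apply: (vr_sum lO) => i; apply: (vr_mul lO) => //; apply: (vr_cst lO).
have gE : \sum_i cst F (v 0 i) * f i = \sum_j b j * tau j.
  rewrite (eq_bigr (fun i => \sum_j cst F (v 0 i) * a i j * tau j)); last first.
    by move=> i _; rewrite fE mulr_sumr; apply: eq_bigr => j _; rewrite mulrA.
  by rewrite exchange_big /=; apply: eq_bigr => j _; rewrite mulr_suml.
have h1 : approx k (\sum_i cst F (v 0 i) * f i) (\sum_i (v 0 i)%:MP * 'X_[w i]).
  by apply: approx_sum => i; apply: approxM => //; apply: approx_cst.
have /choice [LB hLB] j : exists L, approx k (b j) L by apply: dom_approx; exists 0.
have /choice [LT hLT] j : exists L, approx k (tau j) L by apply: dom_approx; exists 0.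
have h2 : approx k (\sum_j b j * tau j) (\sum_j LB j * LT j).
  by apply: approx_sum => j; apply: approxM.
rewrite gE in h1; have k0 : (0 < k)%N by apply: leq_ltn_trans (wk i0).
have := approx_uniq h1 h2 (wk i0); rewrite mcoeffB !raddf_sum /=.
rewrite (bigD1 i0) //= mcoeffCM mcoeffX eqxx mulr1 big1 ?addr0; last first.
  by move=> i ii; rewrite mcoeffCM mcoeffX (inj_eq winj) (negbTE ii) mulr0.
rewrite sumrN => /eqP; rewrite subr_eq0 => /eqP E; rewrite E in vi.
have [j hj] : exists j, (LB j * LT j)@_(w i0) != 0.
  apply: contrapT => /forallNP H; case/negP: vi; apply/eqP/big1 => j _.
  by apply/eqP; apply: contrapT => hj; apply: (H j); apply/negP.
have : w i0 \in msupp (LB j * LT j) by rewrite mcoeff_msupp.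
move=> /msuppM_le /allpairsP [[al be] /= []]; rewrite !mcoeff_msupp => ha1 hb1 wE.
have lw : (mdeg al < k)%N /\ (mdeg be < k)%N.
  by have := wk i0; rewrite wE mdegD; lia.
have ea : exponent al by apply: (exponentP _ (hLB j)) => //; [exists 0|case: lw].
have eb : exponent be by apply: (exponentP _ (hLT j)) => //; [exists 0|case: lw].
case: (wirr i0) => _ _ /(_ _ _ ea eb wE) [e|e].
  by move: ha1; rewrite e (O0_coef (hb j) (hLB j)) ?eqxx.
by move: hb1; rewrite e (O0_coef (tau0 j) (hLT j)) ?eqxx.
Qed.

Lemma irred_family r (w : 'I_r -> 'X_{1..n}) k : (forall i, irred_exp (w i)) ->
  (0 < k)%N -> exists (f : 'I_r -> F) (A : 'M[K]_(r, n)) (a : 'I_r -> 'I_n -> F),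
  [/\ forall i, O (f i) 0, forall i, approx k (f i) 'X_[w i],
      forall i j, O (a i j) (A i j) & forall i, f i = \sum_j a i j * tau j].
Proof.
move=> wirr k0.
have /choice [f hf] i : exists f, O f 0 /\ approx k f 'X_[w i].
  by case: (wirr i) => e n0 _; have [f] := exponent_O0 e n0 k0; exists f.
have /choice [av hav] i : exists av : ('I_n -> F) * ('I_n -> K),
    (forall j, O (av.1 j) (av.2 j)) /\ f i = \sum_j av.1 j * tau j.
  by have [a [v H]] := tauM (proj1 (hf i)); exists (a, v).
exists f, (\matrix_(i, j) (av i).2 j), (fun i => (av i).1); split.
- by move=> i; case: (hf i).
- by move=> i; case: (hf i).
- by move=> i j; rewrite mxE; case: (hav i).
- by move=> i; case: (hav i).
Qed.

(** Irreducible exponents give independent classes modulo the square of the maximal ideal, and this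
    ideal has n generators. *)
Lemma irred_leq r (w : 'I_r -> 'X_{1..n}) : injective w ->
  (forall i, irred_exp (w i)) -> (r <= n)%N.
Proof.
move=> winj wirr; pose k := (\sum_i mdeg (w i)).+1.
have wk i : (mdeg (w i) < k)%N by rewrite ltnS (bigD1 i) //= leq_addr.
have [f [A [a [_ hf ha fE]]]] := irred_family wirr (ltn0Sn _ : (0 < k)%N).
have := irred_indep winj wirr wk hf ha fE; rewrite /row_free => /eqP <-.
exact: rank_leq_col.
Qed.

(** The number of irreducible exponents is bounded, so a family of maximal size contains them all;
    every exponent is a sum of irreducible ones by induction on its degree. *)
Lemma exponent_gen : exists r (w : 'I_r -> 'X_{1..n}),
  [/\ (r <= n)%N, forall i, irred_exp (w i) &
    forall al, exponent al -> exists e : 'I_r -> nat, al = (\sum_i w i *+ e i)%MM].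
Proof.
pose P r := `[< exists s : seq 'X_{1..n}, [/\ uniq s, size s = r &
  forall x, x \in s -> irred_exp x] >].
have exP : exists r, P r by exists 0%N; apply/asboolP; exists [::].
have Pn r : P r -> (r <= n)%N.
  move=> /asboolP [s [us sr hs]]; rewrite -sr.
  apply: (@irred_leq _ (fun i => tnth (in_tuple s) i)); first exact/tuple_uniqP.
  by move=> i; apply/hs/mem_tnth.
case: (ex_maxnP exP Pn) => r /asboolP [s [us sr hs]] rmax.
have all_irr x : irred_exp x -> x \in s.
  move=> ix; apply: contraT => xs; have := rmax r.+1; rewrite ltnn; apply.
  apply/asboolP; exists (x :: s); rewrite /= xs us sr; split=> // y.
  by rewrite inE => /orP[/eqP->|/hs].
exists (size s), (fun i => tnth (in_tuple s) i); split.
- by rewrite sr; apply: Pn; apply/asboolP; exists s.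
- by move=> i; apply/hs/mem_tnth.
move=> al; have [k] := ubnP (mdeg al); elim: k al => // k IH al ak ha.
have [->|a0] := eqVneq al 0%MM.
  by exists (fun=> 0%N); rewrite big1 // => i _; rewrite mulm0n.
have [ia|/(exponent_dec ha a0)] := EM (irred_exp al).
  have : (index al s < size s)%N by rewrite index_mem all_irr.
  move=> li; exists (fun i => (i == Ordinal li) : nat).
  rewrite (bigD1 (Ordinal li)) //= eqxx mulm1n (tnth_nth 0%MM) /= nth_index ?all_irr //.
  by rewrite big1 ?addm0 // => i /negbTE ->; rewrite mulm0n.
move=> [a [b [ea eb aE na nb]]].
have lt : (mdeg a < k)%N /\ (mdeg b < k)%N.
  by move: ak na nb; rewrite aE mdegD -!mdeg_eq0; lia.
have [e he] := IH a (proj1 lt) ea; have [e' he'] := IH b (proj2 lt) eb.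
exists (fun i => e i + e' i)%N; rewrite aE he he' -big_split /=.
by apply: eq_bigr => i _; apply/mnmP => j; rewrite mnmDE !mulmnE mulnDr.
Qed.

Hypothesis fracO : forall f, exists a b, [/\ dom_rel a, dom_rel b, b != 0 & f = a / b].

(** If the j-th coordinate is a / b in the local ring, an exponent of [b] shifted by U_j is an
    exponent of [a]. Hence the exponents generate the whole lattice. *)
Lemma exponent_diff j : exists a b, [/\ exponent a, exponent b & b = (a + U_(j))%MM].
Proof.
have [a [b [da db b0 e]]] := fracO (coord F j).
have aE : a = b * coord F j by rewrite e mulrC divfK.
have [k [L [al [hL ak La]]]] : exists k L al,
    [/\ approx k b L, (mdeg al < k)%N & L@_al != 0].
  apply: contrapT => H; case/eqP: b0; apply: approx0_eq0 => k.
  have [L hL] := dom_approx k db; apply: approx_ext (hL).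
  rewrite subr0 => m mk; apply/eqP; apply: contrapT => /negP Lm; apply: H.
  by exists k, L, m.
exists al, (al + U_(j))%MM; split=> //; first exact: exponentP db hL ak La.
have ak' : (mdeg al < k.+1)%N by apply: leqW.
have [L' hL'] := dom_approx k.+1 db.
have h : approx k.+1 a (L' * 'X_j) by rewrite aE; apply: approxM => //; apply: approx_emb.
apply: (exponentP da h); first by rewrite mdegD mdeg1 addn1.
rewrite addmC mcoeffMX; apply: contraNneq La => L0.
have := approx_uniq hL (approxW (leqnSn k) hL') ak.
by rewrite mcoeffB L0 subr0 => ->.
Qed.

Definition exp_matrix r (w : 'I_r -> 'X_{1..n}) : 'M[int]_(r, n) := \matrix_(i, j) (w i j)%:Z.

(** At most n vectors that generate a lattice of rank n form a basis of it. *)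
Lemma exponent_basis : exists w : 'I_n -> 'X_{1..n},
  [/\ forall i, irred_exp (w i), exp_matrix w \in unitmx &
    forall al, exponent al -> exists e : 'X_{1..n}, al = (\sum_i w i *+ e i)%MM].
Proof.
have [r [w [rn wirr wgen]]] := exponent_gen.
have /choice [C hC] j : exists c : 'rV[int]_r, c *m exp_matrix w = delta_mx 0 j.
  have [a [b [ea eb bE]]] := exponent_diff j.
  have [e eE] := wgen _ ea; have [e' eE'] := wgen _ eb.
  exists (\row_i ((e' i)%:Z - (e i)%:Z)); apply/rowP => l; rewrite !mxE /=.
  rewrite (eq_bigr (fun i => (e' i * w i l)%N%:Z - (e i * w i l)%N%:Z)); last first.
    by move=> i _; rewrite !mxE mulrBl -!PoszM.
  rewrite sumrB -!(big_morph Posz PoszD (erefl _)).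
  have sE (x : 'I_r -> nat) : (\sum_i x i * w i l)%N = (\sum_i w i *+ x i)%MM l.
    by rewrite mnm_sumE; apply: eq_bigr => i _; rewrite mulmnE mulnC.
  rewrite !sE -eE -eE' bE mnmDE mnm1E PoszD addrAC subrr add0r.
  by rewrite ?eqxx /= [l == j]eq_sym; case: (j == l).
pose M := \matrix_j C j; have MW : M *m exp_matrix w = 1%:M.
  by apply/row_matrixP => j; rewrite row_mul rowK hC row1.
have nr := mulmx1_min MW.
have rE : r = n by apply/eqP; rewrite eqn_leq rn nr.
subst r; exists w; split=> //; first by case: (mulmx1_unit MW).
move=> al /wgen [e ->]; exists [multinom e i | i < n].
by apply: eq_bigr => i _; rewrite mnmE.
Qed.

End MonomialLocalRing.

(** * Powers of the maximal ideal *)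

Section MaximalPowers.
Variables (K : closedFieldType) (n : nat) (F : frac_field {mpoly K[n]}).
Implicit Types (f g h e : F) (c : K).
Variable O : F -> K -> Prop.
Hypothesis lO : loc_rel O.
Local Notation dom := (dom_rel O).

Inductive max_pow : nat -> F -> Prop :=
| max_pow_dom f : dom f -> max_pow 0 f
| max_pow_zero k : max_pow k 0
| max_pow_cons k g h e : O g 0 -> max_pow k h -> max_pow k.+1 e -> max_pow k.+1 (g * h + e).

Lemma dom0 : dom 0. Proof. by exists 0; apply: vr_zero lO. Qed.
Lemma dom1 : dom 1. Proof. by exists 1; apply: vr_one lO. Qed.

Lemma max_powD k f g : max_pow k f -> max_pow k g -> max_pow k (f + g).
Proof.
move=> hf; elim: hf g => [{}f df g hg|{}k g hg|{}k a b e Oa hb _ he IH g hg].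
- apply: max_pow_dom; apply: domD => //.
  by inversion hg => //; apply: dom0.
- by rewrite add0r.
- by rewrite -addrA; apply: max_pow_cons => //; apply: IH.
Qed.

Lemma max_pow_in k f : max_pow k f -> dom f.
Proof.
elim=> [//|_|{}k g h e Og _ dh _ de]; first exact: dom0.
by apply: domD => //; apply: domM => //; exists 0.
Qed.

Lemma max_powM k d f : dom d -> max_pow k f -> max_pow k (d * f).
Proof.
move=> [c dd]; elim=> [{}f df|{}k|{}k g h e Og hh IHh _ IHe].
- by apply/max_pow_dom/domM => //; exists c.
- by rewrite mulr0; apply: max_pow_zero.
- rewrite mulrDr mulrCA; apply: max_pow_cons => //.
Qed.

Lemma max_powS k g h : O g 0 -> max_pow k h -> max_pow k.+1 (g * h).
Proof. by move=> Og hh; rewrite -[_ * _]addr0; apply: max_pow_cons => //; apply: max_pow_zero. Qed.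

Lemma max_pow1 g : O g 0 -> max_pow 1 g.
Proof. by move=> Og; rewrite -[g]mulr1; apply: max_powS => //; apply/max_pow_dom/dom1. Qed.

Lemma max_pow_sum k (I : Type) (r : seq I) (f : I -> F) :
  (forall i, max_pow k (f i)) -> max_pow k (\sum_(i <- r) f i).
Proof.
move=> h; apply: (big_ind (max_pow k)) => //; first exact: max_pow_zero.
by move=> *; apply: max_powD.
Qed.

Lemma max_powMM a b f g : max_pow a f -> max_pow b g -> max_pow (a + b) (f * g).
Proof.
move=> hf hg; elim: hf => [{}f df|k|k u v e Ou _ IHv _ IHe].
- exact: max_powM.
- by rewrite mul0r; apply: max_pow_zero.
- by rewrite mulrDl -mulrA; apply: max_pow_cons.
Qed.

Lemma max_powW k l f : (k <= l)%N -> max_pow l f -> max_pow k f.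
Proof.
move=> kl hf; elim: hf k kl => [{}f df k|{}l k _|{}l g h e Og hh IHh he IHe k kl].
- by rewrite leqn0 => /eqP ->; apply: max_pow_dom.
- exact: max_pow_zero.
- apply: max_powD; last exact: IHe.
  case: k kl => [_|k kl]; last by apply: max_powS => //; apply: IHh.
  by apply: max_pow_dom; apply: domM => //; [exists 0 | apply: max_pow_in hh].
Qed.

Lemma peval_max_pow r (f : 'I_r -> F) (L : {mpoly K[r]}) l : (forall i, O (f i) 0) ->
  vanish l L -> max_pow l (peval f L).
Proof.
move=> f0 /vanish_supp h; rewrite /peval /mmap big_seq.
apply: (big_ind (max_pow l)); [exact: max_pow_zero|by move=> *; apply: max_powD|].
move=> m /h lm; apply: max_powM; first exact: dom_cst.
have H : max_pow (mdeg m) (mmap1 f m).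
  rewrite /mmap1 mdegE; apply: (big_ind2 (fun k x => max_pow k x)).
  - exact/max_pow_dom/dom1.
  - by move=> *; apply: max_powMM.
  - move=> i _; elim: (m i) => [|j IH]; first exact/max_pow_dom/dom1.
    by rewrite exprS; apply: max_powS.
exact: max_powW H.
Qed.

Variables (r : nat) (y : 'I_r -> F).
Hypothesis OE : forall f c, O f c <-> local y (fun=> 0) f c.

Let Oy i : O (y i) 0.
Proof.
apply/OE; exists 'X_i, 1; rewrite meval1 oner_neq0 rmorph1 !divr1 pevalX mevalXU.
by split.
Qed.

Let ony : on_relations y (fun=> 0).
Proof. exact: on_rel lO Oy. Qed.

Let Opeval p : O (peval y p) p@_0%MM.
Proof. by rewrite -meval_0; apply: (vr_peval lO) => i; apply: Oy. Qed.

Let Y : 'I_r -> {mpoly K[r]} := fun i => 'X_i.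

Lemma vars_idealP (p : {mpoly K[r]}) : p@_0%MM = 0 -> vars_ideal Y p.
Proof.
move=> p0; have vI := ideal_gen_ideal (fun x => exists i, x = Y i).
rewrite [p]mpolyE; case: (vI) => v0 vD vM.
rewrite big_seq; apply: (big_ind (vars_ideal Y)) => // m ms; rewrite -mul_mpolyC.
apply: (vM); have [i mi] : exists i, m i != 0%N.
  apply: contrapT => /forallNP H; move: ms; rewrite mcoeff_msupp.
  rewrite (_ : m = 0%MM) ?p0 ?eqxx //; apply/mnmP => i; rewrite mnm0E.
  by apply/eqP; apply: contrapT => hi; apply: (H i); apply/negP.
rewrite mpolyXE_id (bigD1 i) //=; case: (m i) mi => // k _; rewrite exprS -mulrA mulrC.
by apply: (vM); apply: ideal_gen_in; exists i.
Qed.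

Lemma vars_ideal_pow k p q : vars_ideal Y p -> ideal_pow Y k q -> ideal_pow Y k.+1 (p * q).
Proof.
move=> vp hq; elim: vp => [|c x p' [i ->] _ IH]; first by rewrite mul0r; apply: ideal_pow0.
by rewrite mulrDl -mulrA; apply: ideal_powD => //; apply/ideal_powM/ideal_powS.
Qed.

Lemma vars_ideal_exp k p : vars_ideal Y p -> ideal_pow Y k (p ^+ k).
Proof.
move=> vp; elim: k => [|k IH]; first exact: ideal_pow0T.
by rewrite exprS; apply: vars_ideal_pow.
Qed.

Lemma max_pow_repr k e : max_pow k e -> exists E D,
  [/\ ideal_pow Y k E, D@_0%MM = 1 & e = peval y E / peval y D].
Proof.
have norm f c : O f c -> exists p q, [/\ q@_0%MM = 1, p@_0%MM = c & f = peval y p / peval y q].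
  move=> /OE [p [q [q0 -> ->]]]; rewrite !meval_0 in q0 *.
  exists ((q@_0%MM)^-1%:MP * p), ((q@_0%MM)^-1%:MP * q).
  rewrite !mcoeffCM mulVf // mulrC !rmorphM /= -mulf_div divff ?mul1r //.
  by rewrite pevalC cst_eq0 invr_eq0.
have n0 D : D@_0%MM = 1 -> peval y D != 0.
  by move=> D1; apply: (on_neq0 ony); rewrite meval_0 D1 oner_neq0.
have M1 D D' : D@_0%MM = 1 -> D'@_0%MM = 1 -> (D * D')@_0%MM = 1 :> K.
  by move=> h h'; rewrite -meval_0 mevalM !meval_0 h h' mulr1.
elim=> [f [c /norm [p [q [q1 _ ->]]]]|{}k|{}k g h {}e Og _ [E [D [hE D1 ->]]] _ [E' [D' [hE' D'1 ->]]]].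
- by exists p, q; split=> //; apply: ideal_pow0T.
- exists 0, 1; rewrite mcoeff1 eqxx !rmorph0 mul0r; split=> //; exact: ideal_pow0.
have [p [q [q1 p0 ->]]] := norm _ _ Og.
exists ((p * E) * D' + E' * (q * D)), (q * D * D'); split.
- apply: ideal_powD; first by rewrite mulrC; apply/ideal_powM/vars_ideal_pow/hE/vars_idealP.
  by rewrite mulrC; apply: ideal_powM.
- by rewrite !M1.
- by rewrite mulf_div addf_div ?mulf_neq0 ?n0 // rmorphD !rmorphM.
Qed.

(** Clearing denominators leads to [krull_intersection] in the polynomial ring mapping onto K[y],
    with [J] the preimage of the ideal of [b]; the factor 1 - mu is invertible in [O] because mu
    vanishes at the origin. In other words, principal ideals are closed for the powers of the
    maximal ideal. *)
Theorem dom_krull a b : dom a -> dom b ->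
  (forall k, exists h, dom h /\ max_pow k (a - b * h)) -> exists h, dom h /\ a = b * h.
Proof.
move=> [ca /OE [A [Qa [Qa0 aE _]]]] db H.
have Qan : peval y Qa != 0 by apply: (on_neq0 ony).
have dp p : dom (peval y p) by exists p@_0%MM.
have di p : p@_0%MM != 0 -> dom (peval y p)^-1.
  by move=> p0; exists (p@_0%MM)^-1; apply: lr_inv.
pose J p := exists h, dom h /\ peval y p = b * h.
have JI : is_ideal J.
  split.
  - by exists 0; split; [exact: dom0 | rewrite rmorph0 mulr0].
  - move=> p q [h [dh hE]] [g [dg gE]]; exists (h + g).
    by split; [exact: domD | rewrite rmorphD /= hE gE mulrDr].
  - move=> c p [h [dh hE]]; exists (peval y c * h).
    by split; [exact: domM | rewrite rmorphM /= hE mulrCA].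
have [J0 JD JM] := JI.
have [|mu vmu [h [dh hE]]] := krull_intersection (y := Y) (a := A)
   (noetherian_mpoly (@noetherian_field K)) JI.
  move=> k; have [h [dh /max_pow_repr [E [D [hEk D1 eE]]]]] := H k.
  have Dn : peval y D != 0 by apply: (on_neq0 ony); rewrite meval_0 D1 oner_neq0.
  have v1 : vars_ideal Y (1 - D) by apply: vars_idealP; rewrite mcoeffB mcoeff1 eqxx D1 subrr.
  pose s := \sum_(i < k) (1 - D) ^+ i.
  have sE : 1 - (1 - D) ^+ k = D * s.
    by have := subrX1 (1 - D) k; rewrite -/s => /(congr1 -%R); rewrite opprB => ->; ring.
  (* [s] inverts [D] up to (1 - D)^k, which lies in the k-th power like [E]; the difference to [A]
     is (A D - E Qa) s, whose image is a multiple of [b]. *)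
  exists (E * Qa * s + A * (1 - D) ^+ k).
    apply: ideal_powD; last by apply/ideal_powM/vars_ideal_exp.
    by rewrite -mulrA mulrC; apply: ideal_powM.
  have -> : A - (E * Qa * s + A * (1 - D) ^+ k) = (A * D - E * Qa) * s.
    transitivity (A * (1 - (1 - D) ^+ k) - E * Qa * s); first by ring.
    by rewrite sE; ring.
  rewrite mulrC; apply: (JM); exists (h * peval y Qa * peval y D); split.
    by apply: domM => //; apply: domM.
  rewrite rmorphB !rmorphM /=; move: eE; rewrite aE => eE.
  have -> : peval y E = (peval y A / peval y Qa - b * h) * peval y D by rewrite eE divfK.
  by move: (peval y A) (peval y Qa) Qan => x z z0; field.
have mu0 : mu@_0%MM = 0.
  elim: vmu => [|c x p [i ->] _ IH]; first by rewrite mcoeff0.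
  by rewrite -meval_0 mevalD mevalM mevalXU mulr0 add0r meval_0.
have nz : (1 - mu)@_0%MM != 0 by rewrite mcoeffB mcoeff1 eqxx mu0 subr0 oner_neq0.
exists (h * (peval y (1 - mu))^-1 * (peval y Qa)^-1); split.
  by apply: (domM lO); [apply: (domM lO) => //; apply: di | apply: di; rewrite -meval_0].
have nz' : peval y (1 - mu) != 0 by apply: (on_neq0 ony); rewrite meval_0.
rewrite !mulrA -hE rmorphM /= aE; move: (peval y (1 - mu)) nz' => z z0.
by rewrite mulfK.
Qed.

End MaximalPowers.

(** * Monomial coordinates of a torus-stable local ring *)

Section MonomialSubstitution.
Variables (K : fieldType) (n r : nat) (w : 'I_r -> 'X_{1..n}).

Definition wsum (e : 'X_{1..r}) : 'X_{1..n} := (\sum_i w i *+ e i)%MM.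

Lemma wsumD e e' : wsum (e + e') = (wsum e + wsum e')%MM.
Proof.
rewrite /wsum -big_split; apply: eq_bigr => i _; apply/mnmP => j.
by rewrite !(mnmDE, mulmnE) mulnDr.
Qed.

Lemma wsum0 : wsum 0 = 0%MM.
Proof. by rewrite /wsum big1 // => i _; rewrite mnm0E mulm0n. Qed.

Lemma mdeg_wsum e : mdeg (wsum e) = (\sum_i mdeg (w i) * e i)%N.
Proof.
rewrite /wsum (big_morph mdeg mdegD (@mdeg0 n)); apply: eq_bigr => i _.
by rewrite mdegMn.
Qed.

Lemma mdeg_wsum_le e : (mdeg (wsum e) <= (\sum_i mdeg (w i)) * mdeg e)%N.
Proof.
rewrite mdeg_wsum big_distrl; apply: leq_sum => i _ /=.
by rewrite leq_mul2l [mdeg e]mdegE (bigD1 i) //= leq_addr orbT.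
Qed.

Definition wsub : {mpoly K[r]} -> {mpoly K[n]} := mmap (@mpolyC n K) (fun i => 'X_[w i]).
Fact wsub_zmod : zmod_morphism wsub.
Proof. by move=> p q; rewrite /wsub mmapB. Qed.
Fact wsub_monoid : monoid_morphism wsub.
Proof. by split=> [|p q]; rewrite /wsub ?rmorph1 ?rmorphM. Qed.
HB.instance Definition _ := GRing.isZmodMorphism.Build _ _ wsub wsub_zmod.
HB.instance Definition _ := GRing.isMonoidMorphism.Build _ _ wsub wsub_monoid.

Lemma wsubX e : wsub 'X_[e] = 'X_[wsum e].
Proof.
rewrite /wsub mmapX /mmap1 /wsum (big_morph (fun m => 'X_[m] : {mpoly K[n]}) (@mpolyXD n K) (@mpolyX0 n K)).
apply: eq_bigr => i _.
by rewrite mpolyXn.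
Qed.

Lemma wsub_expand p : wsub p = \sum_(e <- msupp p) p@_e *: 'X_[wsum e].
Proof.
rewrite {1}[p]mpolyE rmorph_sum; apply: eq_bigr => e _ /=.
by rewrite -mul_mpolyC rmorphM /= wsubX /wsub mmapC mul_mpolyC.
Qed.

Lemma mcoeff_wsub p e : injective wsum -> (wsub p)@_(wsum e) = p@_e.
Proof.
move=> inj; rewrite wsub_expand [X in _ = X@_e]mpolyE !raddf_sum /=.
by apply: eq_bigr => e' _; rewrite !mcoeffZ !mcoeffX (inj_eq inj).
Qed.

End MonomialSubstitution.

Section MonomialBasis.
Variables (K : closedFieldType) (n : nat) (F : frac_field {mpoly K[n]}).
Variable w : 'I_n -> 'X_{1..n}.
Local Notation W := (exp_matrix w).
Hypothesis uW : W \in unitmx.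

Lemma wsum_inj : injective (wsum w).
Proof.
move=> e e' E; have H (x : 'X_{1..n}) :
    (\row_i (x i)%:Z) *m W = \row_j ((wsum w x) j)%:Z :> 'rV[int]_n.
  apply/rowP => j; rewrite !mxE mnm_sumE (big_morph Posz PoszD (erefl _)).
  by apply: eq_bigr => i _; rewrite !mxE mulmnE mulnC PoszM.
have : (\row_i (e i)%:Z) *m W = (\row_i (e' i)%:Z) *m W by rewrite !H E.
move=> /(congr1 (mulmx^~ (invmx W))); rewrite !mulmxK // => R.
apply/mnmP => i; have := congr1 (fun v : 'rV[int]_n => v 0 i) R.
by rewrite !mxE => - [].
Qed.

Lemma chi_expmx i : chi F (row i W) = ff_emb F 'X_[w i].
Proof.
rewrite mpolyXE_id rmorph_prod /=; apply: eq_bigr => j _.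
by rewrite !mxE rmorphXn.
Qed.

Lemma mono_emb p : mono F W (ff_emb F p) = ff_emb F (wsub w p).
Proof.
apply: (mpoly_rmorph_ext (f := mono F W \o ff_emb F) (g := ff_emb F \o wsub w)).
  by move=> c /=; rewrite /wsub mmapC; apply: endo_cst.
by move=> i /=; rewrite mono_coord // /wsub mmapX mmap1U chi_expmx.
Qed.

End MonomialBasis.

Section MonomialCoordinates.
Variables (K : closedFieldType) (n : nat) (F : frac_field {mpoly K[n]}).
Local Notation loc0 := (local (coord F) (fun=> 0)).
Local Notation "x %:F" := (ff_emb F x).
Implicit Types (L : {mpoly K[n]}) (al be : 'X_{1..n}) (f g : F) (c : K).

Variable O : F -> K -> Prop.
Hypothesis lO : loc_rel O.
Hypothesis sub0 : forall f c, O f c -> loc0 f c.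
Hypothesis scaleO : forall z, (forall i, z i != 0) -> forall f c, O f c -> O (scale F z f) c.
Variable tau : 'I_n -> F.
Hypothesis tau0 : forall i, O (tau i) 0.
Hypothesis tauM : forall f, O f 0 -> exists (a : 'I_n -> F) (v : 'I_n -> K),
  (forall i, O (a i) (v i)) /\ f = \sum_i a i * tau i.
Variable w : 'I_n -> 'X_{1..n}.
Local Notation W := (exp_matrix w).
Hypothesis wirr : forall i, irred_exp O (w i).
Hypothesis uW : W \in unitmx.
Hypothesis wgen : forall al, exponent O al -> exists e, al = wsum w e.
Local Notation dom := (dom_rel O).
Local Notation max_pow := (max_pow O).

Let w0 i : w i != 0%MM. Proof. by case: (wirr i). Qed.
Let D := (\sum_i mdeg (w i))%N.
Let wD i : (mdeg (w i) <= D)%N. Proof. by rewrite /D (bigD1 i) //= leq_addr. Qed.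

Lemma winj : injective w.
Proof.
move=> i j E; have : wsum w U_(i) = wsum w U_(j).
  have h k : wsum w U_(k) = w k.
    rewrite /wsum (bigD1 k) //= mnm1E eqxx mulm1n big1 ?addm0 // => l lk.
    by rewrite mnm1E eq_sym (negbTE lk) mulm0n.
  by rewrite !h.
move/(wsum_inj uW) => /(congr1 (fun m : 'X_{1..n} => m i)); rewrite !mnm1E eqxx.
by case: eqP.
Qed.

Section Family.
Variables (f : 'I_n -> F) (A : 'M[K]_n) (a : 'I_n -> 'I_n -> F) (k : nat).
Hypothesis Dk : (D < k)%N.
Hypothesis f0 : forall i, O (f i) 0.
Hypothesis fX : forall i, approx k (f i) 'X_[w i].
Hypothesis aA : forall i j, O (a i j) (A i j).
Hypothesis fE : forall i, f i = \sum_j a i j * tau j.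

(** Consequently the [f i], which lift the irreducible monomials, generate the maximal ideal modulo
    its square as the [tau j] do. *)
Lemma family_unit : A \in unitmx.
Proof.
rewrite -row_free_unit; apply: (irred_indep lO sub0 scaleO tau0 winj wirr _ fX aA fE).
by move=> i; apply: leq_ltn_trans Dk.
Qed.

Lemma family_linear g : O g 0 -> exists d : 'I_n -> K,
  max_pow 2 (g - \sum_i cst F (d i) * f i).
Proof.
move=> /tauM [b [be [hb gE]]]; pose d := (\row_j be j) *m invmx A.
exists (fun i => d 0 i).
have -> : g - \sum_i cst F (d 0 i) * f i =
    \sum_j (b j - \sum_i cst F (d 0 i) * a i j) * tau j.
  rewrite gE [X in _ - X](eq_bigr (fun i => \sum_j cst F (d 0 i) * a i j * tau j)); last first.
    by move=> i _; rewrite fE mulr_sumr; apply: eq_bigr => j _; rewrite mulrA.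
  rewrite exchange_big /= -sumrB; apply: eq_bigr => j _.
  by rewrite mulrBl mulr_suml.
apply: (max_pow_sum lO) => j; apply: max_powS; last exact: (max_pow1 lO).
have -> : 0 = be j - \sum_i d 0 i * A i j.
  have := congr1 (fun B : 'rV[K]_n => B 0 j) (mulmxKV family_unit (\row_j be j)).
  by rewrite -/d !mxE => ->; rewrite subrr.
apply: (vr_sub lO) => //; apply: (vr_sum lO) => i.
by apply: (vr_mul lO) => //; apply: (vr_cst lO).
Qed.

(** The leading part of a product is the product of the leading parts, which [family_linear]
    provides for the factors in the maximal ideal. *)
Lemma max_pow_step l e : max_pow l e -> exists L, vanish l L /\ max_pow l.+1 (e - peval f L).
Proof.
elim=> [{}e [c he]|{}l|{}l g h {}e Og hh [Lh [vh hLh]] he [Le [ve hLe]]].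
- exists c%:MP; split=> //; rewrite pevalC; apply: (max_pow1 lO).
  by rewrite -(subrr c); apply: (vr_sub lO) => //; apply: (vr_cst lO).
- by exists 0; split; [exact: vanish0 | rewrite rmorph0 subr0; apply: max_pow_zero].
have [d hd] := family_linear Og; pose Ld := \sum_i (d i)%:MP * 'X_i : {mpoly K[n]}.
have LdE : peval f Ld = \sum_i cst F (d i) * f i.
  by rewrite rmorph_sum; apply: eq_bigr => i _; rewrite rmorphM /= pevalC pevalX.
have vd : vanish 1 Ld.
  move=> m; rewrite ltnS leqn0 mdeg_eq0 => /eqP ->; rewrite raddf_sum /= big1 // => i _.
  by rewrite mcoeffCM mcoeffX mnm1_eq0 mulr0.
exists (Ld * Lh + Le); split; first by apply: vanishD => //; rewrite -add1n; apply: vanishM.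
rewrite rmorphD rmorphM /= LdE.
set u := \sum_i _ in hd *.
have -> : g * h + e - (u * peval f Lh + peval f Le) =
  u * (h - peval f Lh) + (g - u) * h + (e - peval f Le) by ring.
have hu : O u 0.
  have -> : 0 = \sum_i d i * 0 :> K by rewrite big1 // => i _; rewrite mulr0.
  by apply: (vr_sum lO) => i; apply: (vr_mul lO) => //; apply: (vr_cst lO).
apply: (max_powD lO) => //; apply: (max_powD lO); first exact: max_powS.
by rewrite -[l.+2]add2n; apply: (max_powMM lO).
Qed.

Lemma max_pow_peval l h : dom h -> exists L, max_pow l (h - peval f L).
Proof.
move=> dh; elim: l => [|l [L hL]].
  by exists 0; rewrite rmorph0 subr0; apply: max_pow_dom.
have [L' [_ hL']] := max_pow_step hL; exists (L + L').
by rewrite rmorphD opprD addrA.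
Qed.

Lemma approx_peval L : approx k (peval f L) (wsub w L).
Proof.
rewrite wsub_expand /peval /mmap; apply: approx_sum => m; rewrite -mul_mpolyC.
apply: approxM; first exact: approx_cst.
rewrite /mmap1 -wsubX /wsub mmapX /mmap1.
by apply: approx_prod => i; apply: approxX.
Qed.

End Family.

(** Each factor in the maximal ideal has no constant term, so it contributes a nonzero exponent,
    that is, at least one of the [w i]. *)
Lemma max_pow_exponents l k e E al : max_pow l e -> approx k e E -> (mdeg al < k)%N ->
  E@_al != 0 -> exists2 ga, al = wsum w ga & (l <= mdeg ga)%N.
Proof.
move=> he; elim: he E al => [{}e de E al hE ak Eal|{}l E al hE ak|{}l g h {}e Og hh IHh he IHe E al hE ak Eal].
- have [ga alE] := wgen (exponentP lO sub0 scaleO de hE ak Eal).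
  by exists ga.
- have z0 := approx_emb F k 0; rewrite rmorph0 in z0; have := approx_uniq hE z0 ak.
  by rewrite subr0 => ->; rewrite eqxx.
have dg : dom g by exists 0.
have [Lg hg] := dom_approx sub0 k dg.
have [Lh hLh] := dom_approx sub0 k (max_pow_in lO hh).
have [Le hLe] := dom_approx sub0 k (max_pow_in lO he).
have := approx_uniq hE (approxD (approxM hg hLh) hLe) ak.
rewrite mcoeffB mcoeffD => /eqP; rewrite subr_eq0 => /eqP E1.
have [e0|/(IHe _ _ hLe ak)//] := eqVneq (Le@_al) 0.
move: Eal; rewrite E1 e0 addr0 -mcoeff_msupp => /msuppM_le /allpairsP.
move=> [[a b] /= []]; rewrite !mcoeff_msupp => ha hb alE.
have [ak' bk'] : (mdeg a < k)%N /\ (mdeg b < k)%N by move: ak; rewrite alE mdegD; lia.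
have [ga aE] := wgen (exponentP lO sub0 scaleO dg hg ak' ha).
have [gb bE lgb] := IHh _ _ hLh bk' hb.
exists (ga + gb)%MM; first by rewrite alE aE bE wsumD.
rewrite mdegD -add1n leq_add // lt0n mdeg_eq0; apply: contraNneq ha => ga0.
by rewrite aE ga0 wsum0 (O0_coef sub0 Og hg) // (leq_ltn_trans _ ak).
Qed.

(* The two topologies on O, by powers of its maximal ideal and by vanishing order,
   coincide. *)
Lemma max_pow_top l : exists k, forall g, dom g -> approx k g 0 -> max_pow l g.
Proof.
(* D l bounds the degrees of the sums of fewer than [l] of the [w i]; the further summand [D] puts
   every [w i] below the precision. *)
exists (D * l + D).+1 => g dg hg; set k := (_).+1 in hg.
have Dk : (D < k)%N by rewrite /k ltnS leq_addl.
have [f [A [a [f0 fX aA fE]]]] := irred_family sub0 tauM wirr (ltn0Sn _ : (0 < k)%N).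
have [L hL] := max_pow_peval Dk f0 fX aA fE l dg.
rewrite -[g](subrK (peval f L)); apply: max_powD => //; apply: (peval_max_pow lO f0) => ga gal.
have hga : (mdeg (wsum w ga) < k)%N.
  rewrite ltnS; apply: leq_trans (mdeg_wsum_le _ _) _; rewrite -/D.
  by apply: leq_trans (leq_addr _ _); rewrite leq_mul2l ltnW ?orbT.
apply: contrapT => /eqP L0.
have h1 : approx k (g - peval f L) (0 - wsub w L) by apply: approxB => //; apply: approx_peval.
have [|ga' /(wsum_inj uW) <-] := max_pow_exponents hL h1 hga; last by rewrite leqNgt gal.
by rewrite sub0r mcoeffN oppr_eq0 mcoeff_wsub //; apply: wsum_inj.
Qed.

Variables (r : nat) (y : 'I_r -> F).
Hypothesis OE : forall f c, O f c <-> local y (fun=> 0) f c.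
Hypothesis fracO : forall f, exists a b, [/\ dom a, dom b, b != 0 & f = a / b].

(** By definition of an exponent, the monomial is only approximated by elements of [O]. It is a
    fraction a / b of such elements; since the two topologies agree, [a] is approximated by
    multiples of [b], and [dom_krull] makes it a multiple of [b]. *)
Lemma wmono_in i : O ('X_[w i])%:F 0.
Proof.
have [a [b [da db b0 E]]] := fracO ('X_[w i])%:F.
have aE : a = b * ('X_[w i])%:F by rewrite E mulrC divfK.
have [|h [[c hc] hE]] := dom_krull lO OE da db.
  move=> l; have [k hk] := max_pow_top l.
  have [f [cf hf] fX] : exists2 f, dom f & approx k f 'X_[w i] by case: (wirr i) => /(_ k).
  exists f; split; first by exists cf.
  apply: hk; first by apply: domB => //; apply: domM => //; exists cf.
  have [Lb hb] := dom_approx sub0 k db.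
  rewrite aE -mulrBr -[0 : {mpoly K[n]}](mulr0 Lb); apply: approxM => //.
  by rewrite -(subrr 'X_[w i]); apply: approxB => //; apply: approx_emb.
have hX : h = ('X_[w i])%:F by apply: (mulfI b0); rewrite -hE.
rewrite hX in hc; have := approx_value (approx_emb F 1 'X_[w i]) (sub0 hc).
by rewrite mcoeffX (negbTE (w0 i)) => c0; rewrite c0 in hc.
Qed.

(** From right to left this is [wmono_in]. Conversely let f = p / q have image in [O]. The Taylor
    polynomials of the image involve only sums of the [w i], hence come from polynomials [L'] with p
    = q L' to any given order, and [dom_krull] at the origin shows that [q] divides [p] there. *)
Theorem monomial_coordinates f c : O (mono F W f) c <-> loc0 f c.
Proof.
have on := on_coord (F := F) (fun=> 0).
pose V f c := O (mono F W f) c.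
have lV : loc_rel V.
  split; first split; rewrite /V.
  - by move=> d; rewrite endo_cst; apply: (vr_cst lO).
  - by move=> g h d e hg hh; rewrite rmorphD; apply: (vr_add lO).
  - by move=> g h d e hg hh; rewrite rmorphM; apply: (vr_mul lO).
  - by move=> d; rewrite rmorph0; apply: (vr_0 lO).
  - by move=> g d hg d0; rewrite fmorphV; apply: lr_inv.
have loc_V g d : loc0 g d -> V g d.
  by apply: local_sub => // i; rewrite /V mono_coord // chi_expmx; apply: wmono_in.
split=> [hf|]; last exact: loc_V.
have [p [q [q0 fE]]] := ff_frac f.
pose g := mono F W f; have dg : dom g by exists c.
have pE : (wsub w p)%:F = (wsub w q)%:F * g.
  rewrite -!mono_emb // -rmorphM fE mulrC divfK //.
  by rewrite emb_neq0.
have dl p' : dom_rel loc0 p'%:F.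
  by exists p'@_0%MM; rewrite -meval_0 -peval_coord; apply: local_peval.
have [|h [[d hd] hE]] := dom_krull (local_rel on) (fun _ _ => iff_refl _) (dl p) (dl q).
  (* Monomials of degree below [l] are sent to monomials of degree at most D l, hence are seen at
     this precision. *)
  move=> l; pose k := (D * l + 1)%N.
  have [L hL] := dom_approx sub0 k dg.
  have wg (m : 'X_{1..n < k}) : exists e : 'X_{1..n}, L@_m != 0 -> (m : 'X_{1..n}) = wsum w e.
    have [L0|L0] := eqVneq L@_m 0; first by exists 0%MM.
    have [e eE] := wgen (exponentP lO sub0 scaleO dg hL (bmdeg m) L0).
    by exists e.
  have /choice [s hs] := wg.
  pose L' := \sum_(m : 'X_{1..n < k}) L@_m *: 'X_[s m] : {mpoly K[n]}.
  have vL : vanish k (L - wsub w L').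
    move=> m mk; rewrite mcoeffB rmorph_sum raddf_sum /=.
    rewrite (bigD1 (BMultinom mk)) //= -mul_mpolyC rmorphM /= wsubX {1}/wsub mmapC.
    rewrite mcoeffCM mcoeffX big1 ?addr0 => [|m' mm'].
      have [->|L0] := eqVneq L@_m 0; first by rewrite mul0r subrr.
      by rewrite -(hs (BMultinom mk) L0) eqxx mulr1 subrr.
    rewrite -mul_mpolyC rmorphM /= wsubX {1}/wsub mmapC mcoeffCM mcoeffX.
    have [->|L0] := eqVneq L@_m' 0; first by rewrite mul0r.
    rewrite -(hs m' L0); case: eqP => [E|_]; last by rewrite mulr0.
    by case/eqP: mm'; apply: val_inj.
  exists L'%:F; split; first exact: dl.
  rewrite -rmorphM -rmorphB.
  have van : vanish l (p - q * L').
    move=> e el; rewrite -(mcoeff_wsub _ _ (wsum_inj uW)) rmorphB rmorphM /=.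
    have hX : approx k (wsub w p)%:F (wsub w q * wsub w L').
      by rewrite pE; apply: approxM; [exact: approx_emb | apply: approx_ext hL].
    apply: (approx_uniq (approx_emb F k _) hX).
    apply: leq_ltn_trans (mdeg_wsum_le _ _) _; rewrite /k addn1 ltnS -/D.
    by rewrite leq_mul2l ltnW ?orbT.
  rewrite -peval_coord; apply: (peval_max_pow (local_rel on) _ van) => i.
  exact: local_coord.
have pqE : f = h by rewrite fE hE mulrC mulKf // emb_neq0.
have := loc_V _ _ hd; rewrite /V -pqE => hfd.
by rewrite (vr_uniq lO hf hfd) pqE.
Qed.

End MonomialCoordinates.

Section LocalTransport.
Variables (K : closedFieldType) (n : nat) (F : frac_field {mpoly K[n]}).
Implicit Types (f g : F) (c v : K) (A B : 'M[int]_n).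

Lemma pullback_rel (V : F -> K -> Prop) (t : {rmorphism F -> F}) :
  (forall c, t (cst F c) = cst F c) -> loc_rel V -> loc_rel (fun f c => V (t f) c).
Proof.
move=> tc lV; split; first split.
- by move=> d; rewrite tc; apply: (vr_cst lV).
- by move=> g h d e hg hh; rewrite rmorphD; apply: (vr_add lV).
- by move=> g h d e hg hh; rewrite rmorphM; apply: (vr_mul lV).
- by move=> d; rewrite rmorph0; apply: (vr_0 lV).
- by move=> g d hg d0; rewrite fmorphV; apply: lr_inv.
Qed.

Lemma local_morph r (y : 'I_r -> F) (c : 'I_r -> K) (t : {rmorphism F -> F}) f v :
  (forall c, t (cst F c) = cst F c) -> local y c f v -> local (t \o y) c (t f) v.
Proof.
move=> tc [p [q [q0 -> ->]]]; exists p, q; split=> //.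
by rewrite fmorph_div /= !peval_rmorph.
Qed.

Lemma local_mono r (y : 'I_r -> F) (c : 'I_r -> K) A f v : A \in unitmx ->
  local y c (mono F (invmx A) f) v <-> local (mono F A \o y) c f v.
Proof.
move=> uA; split=> h.
  have := local_morph (t := mono F A) (endo_cst _) h.
  by rewrite monoVK.
have := local_morph (t := mono F (invmx A)) (endo_cst _) h.
rewrite (_ : _ \o _ = y) //; apply/funext => i /=.
by rewrite monoK.
Qed.

Lemma local_shift r (y : 'I_r -> F) (c : 'I_r -> K) f v : on_relations y c ->
  local y c f v <-> local (fun i => y i - cst F (c i)) (fun=> 0) f v.
Proof.
move=> on; have lV := local_rel on.
have h0 i : local y c (y i - cst F (c i)) 0.
  by rewrite -(subrr (c i)); apply: (vr_sub lV); [exact: local_coord|exact: (vr_cst lV)].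
have on0 : on_relations (fun i => y i - cst F (c i)) (fun=> 0) by apply: on_rel lV h0.
have lV0 := local_rel on0.
split; apply: local_sub => // i.
rewrite -[y i](subrK (cst F (c i))) -[X in local _ _ _ X]add0r.
apply: (vr_add lV0); last exact: (vr_cst lV0).
exact: (local_coord _ on0).
Qed.

Lemma scaleK z : (forall i, z i != 0) -> cancel (scale F z) (scale F (fun i => (z i)^-1)).
Proof.
move=> z0 f; have z'0 i : (z i)^-1 != 0 by rewrite invr_neq0.
apply: (ff_rmorph_ext (s := scale F (fun i => (z i)^-1) \o scale F z) (t := idfun)).
  by move=> c /=; rewrite !endo_cst.
move=> i /=; rewrite scale_coord // rmorphM /= scale_coord // endo_cst mulrA -rmorphM.
by rewrite divff // rmorph1 mul1r.
Qed.

Lemma scale_chi z m : (forall i, z i != 0) ->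
  scale F z (chi F m) = cst F (chival z m) * chi F m.
Proof.
move=> z0; rewrite /chi /chival !rmorph_prod -big_split /=; apply: eq_bigr => i _.
by rewrite !fmorphXz /= scale_coord // expfzMl.
Qed.

Lemma mono_scale A z f : A \in unitmx -> (forall i, z i != 0) ->
  mono F A (scale F (monoval A z) f) = scale F z (mono F A f).
Proof.
move=> uA z0; apply: (ff_rmorph_ext (s := mono F A \o scale F (monoval A z))
  (t := scale F z \o mono F A)) => [c|i] /=; first by rewrite !endo_cst.
rewrite scale_coord; last exact: monoval_neq0.
by rewrite rmorphM /= endo_cst !mono_coord // scale_chi.
Qed.

Lemma local_scale z w f v : (forall i, z i != 0) ->
  local (coord F) w (scale F z f) v <-> local (coord F) (fun i => z i * w i) f v.
Proof.
move=> z0; have onw := on_coord (F := F) w.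
have onzw := on_coord (F := F) (fun i => z i * w i).
have H f' v' : local (coord F) (fun i => z i * w i) f' v' -> local (coord F) w (scale F z f') v'.
  move=> h; apply: (local_sub (pullback_rel (endo_cst _) (local_rel onw)) _ h) => i.
  rewrite -/(scale F z) scale_coord //; apply: (vr_mul (local_rel onw)).
    exact: (vr_cst (local_rel onw)).
  exact: local_coord.
split=> [h|]; last exact: H.
have z'0 i : (z i)^-1 != 0 by rewrite invr_neq0.
rewrite -[f](scaleK z0).
apply: (local_sub (pullback_rel (endo_cst _) (local_rel onzw)) _ h) => i.
rewrite -/(scale F (fun i => (z i)^-1)) scale_coord // -[w i](mulKf (z0 i)).
apply: (vr_mul (local_rel onzw)); first exact: (vr_cst (local_rel onzw)).
exact: (local_coord _ onzw).
Qed.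

Lemma local_mono_coord A z f v : A \in unitmx -> (forall i, z i != 0) ->
  local (coord F) z (mono F A f) v <-> local (coord F) (monoval A z) f v.
Proof.
move=> uA z0; have H A' z' f' v' : A' \in unitmx -> (forall i, z' i != 0) ->
    local (coord F) (monoval A' z') f' v' -> local (coord F) z' (mono F A' f') v'.
  move=> uA' z'0 h; have onz := on_coord (F := F) z'.
  apply: (local_sub (pullback_rel (endo_cst _) (local_rel onz)) _ h) => i.
  by rewrite -/(mono F A') mono_coord //; apply: local_chi.
split=> [h|]; last exact: H.
rewrite -[f](monoK uA); apply: H; rewrite ?unitmx_inv //; first exact: monoval_neq0.
move: h; congr local; apply/funext => i; rewrite monoval_comp // mulVmx //.
by rewrite monoval1.
Qed.

End LocalTransport.

(** * Charts *)

Section ToricFamily.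
Variables (K : closedFieldType) (n : nat) (F : frac_field {mpoly K[n]}).
Implicit Types (f g : F) (c v : K) (A B : 'M[int]_n).

(* The local rings, with evaluation, of the points of a complete non-singular toric
   variety inside its function field: [Reg x f c] means that f is regular at x with
   value c. *)
Record toric_family (X : Type) (Reg : X -> F -> K -> Prop) : Prop := ToricFamily {
  tf_local : forall x, loc_rel (Reg x);
  tf_center : forall V, val_rel V ->
    (forall f, f != 0 -> (exists c, V f c) \/ V f^-1 0) ->
    exists x, forall f c, Reg x f c -> V f c;
  tf_separated : forall V x x', val_rel V -> (forall f c, Reg x f c -> V f c) ->
    (forall f c, Reg x' f c -> V f c) -> x = x';
  tf_torus : forall z, (forall i, z i != 0) ->
    exists x, forall f c, Reg x f c <-> local (coord F) z f c;
  tf_scale : forall z x, (forall i, z i != 0) ->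
    exists x', forall f c, Reg x' f c <-> Reg x (scale F z f) c;
  tf_affine : exists (m : nat) (r : 'I_m -> nat) (y : forall j, 'I_(r j) -> F),
    [/\ forall x, exists j (c : 'I_(r j) -> K), on_relations (y j) c /\
          forall f v, Reg x f v <-> local (y j) c f v,
        forall j (c : 'I_(r j) -> K), on_relations (y j) c ->
          exists x, forall f v, Reg x f v <-> local (y j) c f v &
        forall j f, exists p q, peval (y j) q != 0 /\ f = peval (y j) p / peval (y j) q];
  tf_maximal : forall x, exists tau : 'I_n -> F, (forall i, Reg x (tau i) 0) /\
    forall f, Reg x f 0 -> exists (a : 'I_n -> F) (v : 'I_n -> K),
      (forall i, Reg x (a i) (v i)) /\ f = \sum_i a i * tau i }.

(* X contains a copy of affine space with the monomial coordinates given by the rows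
   of A. *)
Definition chart (X : Type) (Reg : X -> F -> K -> Prop) A := A \in unitmx /\
  forall z, exists x, forall f c, Reg x (mono F A f) c <-> local (coord F) z f c.

Lemma toric_family_mono X (Reg : X -> F -> K -> Prop) A : A \in unitmx ->
  toric_family Reg -> toric_family (fun x f c => Reg x (mono F A f) c).
Proof.
move=> uA tf; have uA' : invmx A \in unitmx by rewrite unitmx_inv.
split.
- by move=> x; apply: (pullback_rel (endo_cst _)); apply: tf_local tf x.
- move=> V vV hV; have [||x hx] := tf_center tf (V := fun f c => V (mono F (invmx A) f) c).
  + split.
    * by move=> d; rewrite endo_cst; apply: (vr_cst vV).
    * by move=> g h d e hg hh; rewrite rmorphD; apply: (vr_add vV).
    * by move=> g h d e hg hh; rewrite rmorphM; apply: (vr_mul vV).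
    * by move=> d; rewrite rmorph0; apply: (vr_0 vV).
  + by move=> f f0; rewrite fmorphV; apply: hV; rewrite fmorph_eq0.
  by exists x => f c /hx; rewrite monoK.
- move=> V x x' vV h h'; apply: (tf_separated tf (V := fun f c => V (mono F (invmx A) f) c)).
  + split.
    * by move=> d; rewrite endo_cst; apply: (vr_cst vV).
    * by move=> g k d e hg hh; rewrite rmorphD; apply: (vr_add vV).
    * by move=> g k d e hg hh; rewrite rmorphM; apply: (vr_mul vV).
    * by move=> d; rewrite rmorph0; apply: (vr_0 vV).
  + by move=> f c hf; apply: h; rewrite monoVK.
  + by move=> f c hf; apply: h'; rewrite monoVK.
- move=> z z0; have z'0 := monoval_neq0 (invmx A) z0.
  have [x hx] := tf_torus tf z'0; exists x => f c.
  rewrite hx local_mono_coord //.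
  suff -> : monoval A (monoval (invmx A) z) = z by [].
  by apply/funext => i; rewrite monoval_comp // mulmxV // monoval1.
- move=> z x z0; have z'0 := monoval_neq0 (invmx A) z0.
  have [x' hx'] := tf_scale tf x z'0; exists x' => f c.
  rewrite hx' -mono_scale //.
  suff -> : monoval A (monoval (invmx A) z) = z by [].
  by apply/funext => i; rewrite monoval_comp // mulmxV // monoval1.
- have [m [r [y [h1 h2 h3]]]] := tf_affine tf.
  exists m, r, (fun j i => mono F (invmx A) (y j i)).
  have on_iff j (c : 'I_(r j) -> K) :
      on_relations (fun i => mono F (invmx A) (y j i)) c <-> on_relations (y j) c.
    have E p : peval (fun i => mono F (invmx A) (y j i)) p = mono F (invmx A) (peval (y j) p).
      by rewrite peval_rmorph // => d; rewrite endo_cst.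
    split=> h p hp; apply: h; first by rewrite E hp rmorph0.
    by apply/eqP; rewrite -(fmorph_eq0 (mono F (invmx A))) -E hp.
  have lm j (c : 'I_(r j) -> K) f v :
      local (fun i => mono F (invmx A) (y j i)) c f v <-> local (y j) c (mono F A f) v.
    by rewrite -[in X in _ <-> X](invmxK A) local_mono.
  split.
  + move=> x; have [j [c [on hc]]] := h1 x; exists j, c; split; first exact/on_iff.
    by move=> f v; rewrite lm.
  + by move=> j c /on_iff /h2 [x hx]; exists x => f v; rewrite lm.
  + move=> j f; have [p [q [q0 fE]]] := h3 j (mono F A f); exists p, q.
    have E p' : peval (fun i => mono F (invmx A) (y j i)) p' = mono F (invmx A) (peval (y j) p').
      by rewrite peval_rmorph // => d; rewrite endo_cst.
    by rewrite !E fmorph_eq0 -fmorph_div -fE monoK.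
- move=> x; have [tau [t0 tM]] := tf_maximal tf x.
  exists (fun i => mono F (invmx A) (tau i)); split=> [i|f /tM [a [v [ha fE]]]].
    by rewrite monoVK.
  exists (fun i => mono F (invmx A) (a i)), v; split=> [i|]; first by rewrite monoVK.
  rewrite -[f](monoK uA) fE rmorph_sum; apply: eq_bigr => i _.
  by rewrite rmorphM.
Qed.

End ToricFamily.

(** * The lexicographic place *)

Section LexPlace.
Variables (K : closedFieldType) (n : nat) (F : frac_field {mpoly K[n]}).
Local Notation loc0 := (local (coord F) (fun=> 0)).
Implicit Types (f g : F) (c v : K) (d : 'rV[int]_n).

(* Iterated blow-up of the origin, t_i |-> prod_(k >= i) t_k^(B^(k - i)); for large B it
   makes all monomials of lexicographically positive exponent regular. *)
Definition lex_matrix (B : nat) : 'M[int]_n :=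
  \matrix_(i, k) (if (i <= k)%N then (B ^ (k - i))%N%:Z else 0).

Lemma lex_matrix_unit B : lex_matrix B \in unitmx.
Proof.
rewrite unitmxE -det_tr det_trig ?big1 ?unitr1 // => [i _|].
  by rewrite !mxE leqnn subnn.
apply/is_trig_mxP => i j ij; rewrite !mxE leqNgt.
by rewrite ij.
Qed.

Definition lexpos d := exists i, 0 < d 0 i /\ forall j : 'I_n, (j < i)%N -> d 0 j = 0.

Lemma lexposD d d' : lexpos d -> lexpos d' -> lexpos (d + d').
Proof.
move=> [i [di hi]] [j [dj hj]]; have [ij|ij] := leqP i j.
  exists i; split=> [|k ki]; last first.
    by rewrite mxE hi // hj ?addr0 //; apply: leq_trans ki ij.
  rewrite mxE; move: ij; rewrite leq_eqVlt => /orP[/eqP/val_inj E|ij].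
    by rewrite E in di *; apply: addr_gt0.
  by rewrite hj // addr0.
exists j; rewrite mxE hi // add0r; split=> // k kj.
by rewrite mxE hj // addr0 hi //; apply: ltn_trans kj ij.
Qed.

Lemma lex_trichotomy d : [\/ d = 0, lexpos d | lexpos (- d)].
Proof.
have [->|d0] := eqVneq d 0; first by constructor 1.
have [i0 hi0] : exists i, d 0 i != 0.
  apply: contrapT => /forallNP H; case/eqP: d0; apply/rowP => i; rewrite mxE.
  by apply/eqP; apply: contrapT => hi; apply: (H i); apply/negP.
case: (@arg_minnP _ i0 (fun i => d 0 i != 0) (fun i : 'I_n => i : nat) hi0) => i di imin.
have hz (j : 'I_n) : (j < i)%N -> d 0 j = 0.
  by move=> ji; apply/eqP; apply: contraTT ji => /imin; rewrite -leqNgt.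
have [dp|dn|dz] := ltrgt0P (d 0 i).
- by constructor 2; exists i.
- constructor 3; exists i; rewrite mxE oppr_gt0; split=> // j /hz.
  by rewrite mxE => ->; rewrite oppr0.
- by rewrite dz eqxx in di.
Qed.

(** The entries of the product obey the Horner recursion s_(k+1) = B s_k + d_(k+1). They vanish
    before the leading entry of [d], are positive there, and stay positive once [B] exceeds the sum
    of the |d_j|. *)
Lemma lex_matrix_pos d : lexpos d -> exists B0, forall B, (B0 <= B)%N ->
  (forall k, 0 <= (d *m lex_matrix B) 0 k) /\ exists k, (d *m lex_matrix B) 0 k != 0.
Proof.
move=> [i [di hi]]; pose e j : int := if insub j is Some j' then d 0 (j' : 'I_n) else 0.
have eE (j : 'I_n) : e j = d 0 j by rewrite /e valK.
pose C := \sum_j absz (d 0 j); have Ce j : (absz (e j) <= C)%N.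
  rewrite /e; case: insubP => // j' _ _; rewrite /C (bigD1 j') //=.
  exact: leq_addr.
exists C.+1 => B CB; pose s k := \sum_(j < k.+1) e j * (B ^ (k - j))%N%:Z.
have sE (k : 'I_n) : (d *m lex_matrix B) 0 k = s k.
  rewrite !mxE /s (big_ord_widen n (fun j => e j * (B ^ (k - j))%N%:Z)) //.
  rewrite [RHS]big_mkcond /=; apply: eq_bigr => j _; rewrite !mxE eE ltnS.
  by case: ifP; rewrite ?mulr0.
have sS k : s k.+1 = B%:Z * s k + e k.+1.
  rewrite /s big_ord_recr /= subnn expn0 mulr1 mulr_sumr; congr (_ + _).
  apply: eq_bigr => j _; rewrite mulrCA -PoszM -expnS subSn //.
  by rewrite -ltnS.
have s0 k : (k < i)%N -> s k = 0.
  move=> ki; rewrite /s big1 // => j _.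
  have jn : (j < n)%N by apply: leq_ltn_trans (ltn_trans ki (ltn_ord i)); rewrite -ltnS.
  by rewrite -[nat_of_ord j]/(nat_of_ord (Ordinal jn)) eE hi ?mul0r //=; apply: leq_trans ki.
have spos k : (i <= k)%N -> 1 <= s k.
  elim: k => [|k IH].
    rewrite leqn0 => /eqP i0; rewrite /s big_ord_recr /= big_ord0 add0r subnn mulr1.
    by rewrite -i0 eE; lia.
  rewrite leq_eqVlt => /orP[/eqP ik|]; rewrite sS.
    by rewrite s0 -?ik // mulr0 add0r eE; lia.
  rewrite ltnS => /IH h; have := Ce k.+1; move: (e k.+1) (s k) h => x t h hx.
  nia.
split=> [k|]; last by exists i; rewrite sE; have := spos i (leqnn i); lia.
rewrite sE; have [/s0 ->//|/spos] := ltnP k i; lia.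
Qed.

Lemma loc0_chi d : (forall k, 0 <= d 0 k) -> (exists k, d 0 k != 0) -> loc0 (chi F d) 0.
Proof.
move=> dge [k dk]; have on := on_coord (F := F) (fun=> 0).
have E i : coord F i ^ d 0 i = coord F i ^+ absz (d 0 i).
  by have := dge i; case: (d 0 i).
rewrite /chi (eq_bigr (fun i => coord F i ^+ absz (d 0 i))); last by move=> i _; exact: E.
have E0 : \prod_(i < n) (0 : K) ^+ absz (d 0 i) = 0.
  by rewrite (bigD1 k) //= expr0n absz_eq0 (negbTE dk) mul0r.
rewrite -[X in local _ _ _ X]E0; apply: (vr_prod (local_rel on)) => i; apply: (vr_exp (local_rel on)).
exact: (local_coord _ on).
Qed.

(** The bound on [B] grows with the exponents, so the value is the one reached for all large [B]. *)
Definition lex_place f c := exists B0, forall B, (B0 <= B)%N ->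
  loc0 (mono F (lex_matrix B) f) c.

Lemma lex_place_rel : loc_rel lex_place.
Proof.
have on := on_coord (F := F) (fun=> 0).
have lB B := pullback_rel (t := mono F (lex_matrix B)) (endo_cst _) (local_rel on).
split; first split.
- by move=> c; exists 0%N => B _; apply: (vr_cst (lB B)).
- move=> f g a b [B0 h] [B1 h']; exists (maxn B0 B1) => B; rewrite geq_max => /andP[/h h1 /h' h2].
  exact: (vr_add (lB B)).
- move=> f g a b [B0 h] [B1 h']; exists (maxn B0 B1) => B; rewrite geq_max => /andP[/h h1 /h' h2].
  exact: (vr_mul (lB B)).
- by move=> c [B0 h]; apply: (vr_0 (lB B0)); apply: h.
- by move=> f c [B0 h] c0; exists B0 => B /h hB; apply: (lr_inv (lB B)).
Qed.

Lemma lex_place_pos d : lexpos d -> lex_place (chi F d) 0.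
Proof.
move=> /lex_matrix_pos [B0 h]; exists B0 => B /h [h1 h2].
rewrite mono_chi ?lex_matrix_unit //; exact: loc0_chi.
Qed.

Definition mexp (m : 'X_{1..n}) : 'rV[int]_n := \row_i (m i)%:Z.

Lemma mexp_inj : injective mexp.
Proof.
by move=> m m' /rowP E; apply/mnmP => i; have := E i; rewrite !mxE => - [].
Qed.

Lemma chi_mexp m : chi F (mexp m) = ff_emb F 'X_[m].
Proof.
rewrite mpolyXE_id rmorph_prod /=; apply: eq_bigr => j _.
by rewrite !mxE rmorphXn.
Qed.

Lemma lex_min (s : seq 'X_{1..n}) : s != [::] -> exists2 m0, m0 \in s &
  forall m, m \in s -> m = m0 \/ lexpos (mexp m - mexp m0).
Proof.
elim: s => // m s IH _; have [->|s0] := eqVneq s [::].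
  by exists m; rewrite ?mem_head // => m'; rewrite inE => /eqP; left.
have [m0 m0s hm0] := IH s0.
have [/subr0_eq/mexp_inj E|h|h] := lex_trichotomy (mexp m - mexp m0).
- exists m0; first by rewrite inE m0s orbT.
  by move=> m'; rewrite inE => /orP[/eqP->|/hm0 //]; left.
- exists m0; first by rewrite inE m0s orbT.
  by move=> m'; rewrite inE => /orP[/eqP->|/hm0 //]; right.
- rewrite opprB in h; exists m; first exact: mem_head.
  move=> m'; rewrite inE => /orP[/eqP->|/hm0 [->|h']]; [by left|by right|right].
  by have := lexposD h' h; rewrite addrA subrK.
Qed.

(** Division by the lexicographically least monomial leaves its coefficient plus monomials of
    positive exponent, which have value 0. *)
Lemma lex_lead (p : {mpoly K[n]}) : p != 0 -> exists m0 c, c != 0 /\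
  lex_place (ff_emb F p / chi F (mexp m0)) c.
Proof.
rewrite -msupp_eq0 => /lex_min [m0 m0p hm0]; exists m0, p@_m0.
have lV := lex_place_rel; split; first by rewrite -mcoeff_msupp.
rewrite {1}[p]mpolyE rmorph_sum mulr_suml.
have -> : p@_m0 = \sum_(m <- msupp p) if m == m0 then p@_m0 else 0.
  by rewrite (bigD1_seq m0) ?msupp_uniq //= eqxx big1 ?addr0 // => m /negbTE ->.
rewrite big_seq [X in lex_place _ X]big_seq.
apply: (big_ind2 lex_place); [exact: vr_zero lV|by move=> *; apply: (vr_add lV)|].
move=> m /hm0 hm; rewrite -mul_mpolyC rmorphM /= -chi_mexp -mulrA -chiN -chiD.
have [->|mm0] := eqVneq m m0.
  by rewrite subrr chi0 mulr1; apply: (vr_cst lV).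
rewrite -(mulr0 p@_m); apply: (vr_mul lV); first exact: (vr_cst lV).
by case: hm => [E|/lex_place_pos //]; rewrite E eqxx in mm0.
Qed.

Lemma lex_place_total f : f != 0 -> (exists c, lex_place f c) \/ lex_place f^-1 0.
Proof.
have [p [q [q0 ->]]] := ff_frac f => f0; have lV := lex_place_rel.
have p0 : p != 0 by apply: contra_neq f0 => ->; rewrite rmorph0 mul0r.
have [m [c [c0 hp]]] := lex_lead p0; have [m' [c' [c'0 hq]]] := lex_lead q0.
set a := _ / _ in hp; set b := _ / _ in hq.
have pE : ff_emb F p = a * chi F (mexp m) by rewrite /a divfK // chi_neq0.
have qE : ff_emb F q = b * chi F (mexp m') by rewrite /b divfK // chi_neq0.
have E : ff_emb F p / ff_emb F q = (a / b) * chi F (mexp m - mexp m').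
  by rewrite pE qE -mulf_div chiD chiN.
have hab := lr_div lV hp hq c'0; have hba := lr_div lV hq hp c0.
rewrite E; have [->|h|h] := lex_trichotomy (mexp m - mexp m').
- by left; exists (c / c'); rewrite chi0 mulr1.
- by left; exists 0; rewrite -(mulr0 (c / c')); apply: (vr_mul lV) => //; apply: lex_place_pos.
- right; rewrite invfM invf_div -chiN -(mulr0 (c' / c)).
  by apply: (vr_mul lV) => //; apply: lex_place_pos.
Qed.

End LexPlace.

Lemma pointwise_bound r (P : 'I_r -> nat -> Prop) :
  (forall i, exists B0, forall B, (B0 <= B)%N -> P i B) -> exists B, forall i, P i B.
Proof.
move=> /choice [b hb]; exists (\sum_i b i)%N => i; apply: hb.
by rewrite (bigD1 i) //= leq_addr.
Qed.

(** * Construction of charts *)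

Section Charts.
Variables (K : closedFieldType) (n : nat) (F : frac_field {mpoly K[n]}).
Implicit Types (f g : F) (c v : K) (A B : 'M[int]_n).
Variables (X : Type) (Reg : X -> F -> K -> Prop).
Hypothesis tf : toric_family Reg.
Local Notation loc0 := (local (coord F) (fun=> 0)).

(** Both local rings are described by finitely many fractions, so they still agree at the points
    near the origin where [h], the product of all polynomials required to be nonzero, does not
    vanish. Some multiple s z of any given [z] is such a point, and the torus brings it back to
    [z]. *)
Lemma origin_chart A x0 : A \in unitmx ->
  (forall f c, Reg x0 (mono F A f) c <-> loc0 f c) -> chart Reg A.
Proof.
move=> uA h0; split=> // z.
have [m [r [ys [h1 h2 h3]]]] := tf_affine tf.
have [j [c [on hc]]] := h1 x0; move: (r j) (ys j) c on hc (h2 j) => {ys h3 h1 h2} {}r y c on hc h2.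
have onz := on_coord (F := F).
pose y' i := mono F (invmx A) (y i).
have y'E p : peval y' p = mono F (invmx A) (peval y p).
  by rewrite peval_rmorph // => d; rewrite endo_cst.
have /choice [pq hpq] i : exists pq : {mpoly K[n]} * {mpoly K[n]},
    [/\ pq.2.@[fun=> 0] != 0, y' i = peval (coord F) pq.1 / peval (coord F) pq.2 &
        c i = pq.1.@[fun=> 0] / pq.2.@[fun=> 0]].
  have : loc0 (y' i) (c i) by apply/h0; rewrite monoVK // hc; apply: local_coord.
  by move=> [p [q H]]; exists (p, q).
have /choice [PQ hPQ] k : exists PQ : {mpoly K[r]} * {mpoly K[r]},
    PQ.2.@[c] != 0 /\ mono F A (coord F k) = peval y PQ.1 / peval y PQ.2.
  have : Reg x0 (mono F A (coord F k)) 0 by apply/h0; apply: local_coord (onz _).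
  by move=> /hc [P [Q [Q0 E _]]]; exists (P, Q).
have /choice [ab hab] k : exists ab : {mpoly K[n]} * {mpoly K[n]},
    [/\ ab.1.@[fun=> 0] != 0, ab.2.@[fun=> 0] != 0 &
        peval y' (PQ k).2 = peval (coord F) ab.1 / peval (coord F) ab.2].
  have : loc0 (peval y' (PQ k).2) (PQ k).2.@[c].
    by apply/h0; rewrite y'E monoVK // hc; apply: local_peval.
  move=> [a [b [b0 E vE]]]; exists (a, b); split=> //=; case: (hPQ k) => + _.
  by apply: contra_neq => a0; rewrite vE a0 mul0r.
pose h : {mpoly K[n]} := (\prod_i (pq i).2) * \prod_k ((ab k).1 * (ab k).2).
have near0 w : h.@[w] != 0 -> exists x, forall f v, Reg x (mono F A f) v <-> local (coord F) w f v.
  rewrite mevalM mulf_eq0 negb_or !rmorph_prod => /andP[/prodf_neq0 q0 /prodf_neq0 ab0].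
  have lw := local_rel (onz w).
  pose c' i := (pq i).1.@[w] / (pq i).2.@[w].
  have hc' i : local (coord F) w (y' i) (c' i).
    by case: (hpq i) => _ -> _; exists (pq i).1, (pq i).2; split=> //; apply: q0.
  have on' : on_relations y c'.
    move=> P P0; apply: (on_rel lw hc'); by rewrite y'E P0 rmorph0.
  have [x hx] := h2 _ on'; exists x.
  have fwd f v : Reg x (mono F A f) v -> local (coord F) w f v.
    move=> /hx /(local_morph (t := mono F (invmx A)) (endo_cst _)); rewrite monoK // => H.
    exact: local_sub lw hc' _ _ H.
  move=> f v; split; first exact: fwd.
  apply: (local_sub (pullback_rel (endo_cst _) (tf_local tf x))) => k.
  rewrite -/(mono F A); case: (hPQ k) => _ E.
  have Qc : (PQ k).2.@[c'] != 0.
    have H := vr_peval lw (PQ k).2 hc'.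
    have H' : local (coord F) w (peval y' (PQ k).2) ((ab k).1.@[w] / (ab k).2.@[w]).
      have := ab0 k isT; rewrite /= mevalM mulf_eq0 negb_or => /andP[_ b0].
      by case: (hab k) => _ _ ->; exists (ab k).1, (ab k).2.
    rewrite (vr_uniq lw H H'); have := ab0 k isT.
    by rewrite /= mevalM mulf_eq0 negb_or => /andP[a0 b0]; rewrite mulf_neq0 ?invr_eq0.
  have R : Reg x (mono F A (coord F k)) ((PQ k).1.@[c'] / (PQ k).2.@[c']).
    by apply/hx; exists (PQ k).1, (PQ k).2.
  have := vr_uniq lw (fwd _ _ R) (local_coord k (onz w)).
  by move=> <-.
have h00 : h.@[fun=> 0] != 0.
  rewrite mevalM !rmorph_prod mulf_neq0 //; apply/prodf_neq0 => i _; first by case: (hpq i).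
  by rewrite /= mevalM; case: (hab i) => *; rewrite mulf_neq0.
(* Along the line through [z], [h] is a polynomial in [s] with nonzero value at s = 0; the factor X
   serves to exclude that parameter. *)
have [s s0 hs] : exists2 s : K, s != 0 & h.@[fun i => s * z i] != 0.
  pose H : {poly K} := mmap polyC (fun i => z i *: 'X) h.
  have HE s : H.[s] = h.@[fun i => s * z i].
    apply: (mpoly_rmorph_ext (f := horner_eval s \o mmap polyC (fun i => z i *: 'X))
      (g := meval (fun i => s * z i))) => [d|i] /=.
      by rewrite mmapC /horner_eval hornerC mevalC.
    by rewrite mmapX mmap1U /horner_eval hornerZ hornerX mevalXU mulrC.
  have : H * 'X != 0.
    rewrite mulf_neq0 ?polyX_eq0 //; apply: contra_neq h00 => H0.
    have := HE 0; rewrite H0 horner0 => e; rewrite [RHS]e; apply: meval_eq => i.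
    by rewrite mul0r.
  move=> /closed_nonrootP [s]; rewrite /root hornerM hornerX mulf_eq0 negb_or HE.
  by move=> /andP[hs s0]; exists s.
have [x hx] := near0 _ hs.
have t0 (i : 'I_n) : s^-1 != 0 by rewrite invr_neq0.
have u0 := monoval_neq0 (invmx A) t0.
have [x' hx'] := tf_scale tf x u0; exists x' => f v.
rewrite hx' -mono_scale ?hx // local_scale; last first.
  by apply: monoval_neq0.
suff -> : (fun i => monoval A (monoval (invmx A) (fun=> s^-1)) i * (s * z i)) = z by [].
apply/funext => i; rewrite monoval_comp // mulmxV // monoval1.
by rewrite mulKf.
Qed.

(** The torus preserves the lexicographic place, hence fixes its centre, and [monomial_coordinates]
    applies to the local ring there. The resulting coordinates vanish at the centre, so their
    exponents are not lexicographically negative and have nonnegative first entries. The column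
    index is given by its value so that n = 0 is covered. *)
Lemma lex_chart : exists2 A, chart Reg A &
  forall (i k : 'I_n), (k = 0 :> nat) -> 0 <= A i k.
Proof.
have lV := lex_place_rel F.
have [x hx] := tf_center tf lV (@lex_place_total _ _ _).
have fixed z : (forall i, z i != 0) -> forall f c, Reg x f c -> Reg x (scale F z f) c.
  move=> z0; have [x' hx'] := tf_scale tf x z0.
  suff E : x' = x by move=> f c; rewrite -{1}E hx'.
  apply: (tf_separated tf lV _ hx) => f c /hx' /hx [B0 hB]; exists B0 => B /hB.
  have uB := lex_matrix_unit n B.
  have w0 := monoval_neq0 (invmx (lex_matrix n B)) z0.
  have -> : z = monoval (lex_matrix n B) (monoval (invmx (lex_matrix n B)) z).
    by apply/funext => i; rewrite monoval_comp // mulmxV // monoval1.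
  rewrite mono_scale // local_scale //.
  by congr (local _ _ _ _); apply/funext => i; rewrite mulr0.
have [m [r [ys [h1 h2 h3]]]] := tf_affine tf.
have [j [c [on hc]]] := h1 x; have {h1 h2 h3} := h3 j.
move: (r j) (ys j) c on hc => {ys}{}r y c on hc frac.
(* One [B] serves the finitely many affine coordinates at the centre, hence the whole local ring,
   which thereby lies in that of the origin. *)
have [B hB] : exists B : nat, forall i, loc0 (mono F (lex_matrix n B) (y i)) (c i).
  apply: (pointwise_bound (P := fun i (B : nat) => loc0 (mono F (lex_matrix n B) (y i)) (c i))) => i.
  by apply: hx; apply/hc; apply: local_coord.
have on0 := on_coord (F := F) (fun=> 0).
have uB := lex_matrix_unit n B; set th := lex_matrix n B in hB uB.
have uB' : invmx th \in unitmx by rewrite unitmx_inv.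
pose O f v := Reg x (mono F (invmx th) f) v.
have lO : loc_rel O by apply: (pullback_rel (endo_cst _)); apply: tf_local tf x.
have sub0 f v : O f v -> loc0 f v.
  move=> /hc H; rewrite -[f](monoVK uB).
  exact: (local_sub (pullback_rel (endo_cst _) (local_rel on0)) hB H).
have scaleO z : (forall i, z i != 0) -> forall f v, O f v -> O (scale F z f) v.
  move=> z0 f v; have w0 := monoval_neq0 th z0.
  have -> : z = monoval (invmx th) (monoval th z).
    by apply/funext => i; rewrite monoval_comp // mulVmx // monoval1.
  by rewrite /O mono_scale //; apply: fixed.
have [tau0 [htau0 htauM]] := tf_maximal tf x.
pose tau i := mono F th (tau0 i).
have tauO i : O (tau i) 0 by rewrite /O /tau monoK.
have tauM f : O f 0 -> exists (a : 'I_n -> F) (v : 'I_n -> K),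
    (forall i, O (a i) (v i)) /\ f = \sum_i a i * tau i.
  move=> /htauM [a [v [ha fE]]]; exists (fun i => mono F th (a i)), v.
  split=> [i|]; first by rewrite /O monoK.
  rewrite -[f](monoVK uB) fE rmorph_sum; apply: eq_bigr => i _.
  by rewrite rmorphM.
have ony : on_relations (fun i => mono F th (y i)) c.
  by apply: on_rel (local_rel on0) hB.
have OE f v : O f v <-> local (fun i => mono F th (y i) - cst F (c i)) (fun=> 0) f v.
  by rewrite -local_shift // /O hc local_mono.
have fracO f : exists a b, [/\ dom_rel O a, dom_rel O b, b != 0 & f = a / b].
  have [p [q [q0 E]]] := frac (mono F (invmx th) f).
  exists (mono F th (peval y p)), (mono F th (peval y q)); split.
  - by exists p.@[c]; rewrite /O monoK // hc; apply: local_peval.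
  - by exists q.@[c]; rewrite /O monoK // hc; apply: local_peval.
  - by rewrite fmorph_eq0.
  - by rewrite -fmorph_div -E monoVK.
have [w [wirr uW wgen]] := exponent_basis lO sub0 scaleO tauO tauM fracO.
have main := monomial_coordinates lO sub0 scaleO tauO tauM wirr uW wgen OE fracO.
pose A := exp_matrix w *m invmx th.
have uA : A \in unitmx by rewrite unitmx_mul uW.
have hA f v : Reg x (mono F A f) v <-> loc0 f v.
  by rewrite -main /O mono_comp.
exists A; first exact: origin_chart uA hA.
move=> i k k0; rewrite leNgt; apply/negP => Aik.
have : lex_place (chi F (row i A)) 0.
  apply: hx; rewrite -mono_coord //; apply/hA; exact: (local_coord _ on0).
have : lexpos (- row i A).
  exists k; split; last by move=> l; rewrite k0 ltn0.
  by rewrite mxE [row _ _ _ _]mxE oppr_gt0.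
move=> /(lex_place_pos F) h1 /(vr_mul lV h1); rewrite -chiD addNr chi0 mul0r.
move=> /(vr_uniq lV (vr_one lV)) /eqP; rewrite oner_eq0.
by [].
Qed.

End Charts.

Lemma chart_mono (K : closedFieldType) (n : nat) (F : frac_field {mpoly K[n]})
    (X : Type) (Reg : X -> F -> K -> Prop) (A B : 'M[int]_n) : B \in unitmx ->
  chart (fun x f c => Reg x (mono F B f) c) A -> chart Reg (A *m B).
Proof.
move=> uB [uA h]; split; first by rewrite unitmx_mul uA.
by move=> z; have [x hx] := h z; exists x => f c; rewrite -hx mono_comp.
Qed.

(* The fan of a complete toric variety covers everything: every one-parameter
   subgroup la lies in the cone of some chart. *)
Theorem chart_exists (K : closedFieldType) (n : nat) (F : frac_field {mpoly K[n]})
    (X : Type) (Reg : X -> F -> K -> Prop) (la : 'cV[int]_n) :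
  toric_family Reg -> exists2 A, chart Reg A & forall i, 0 <= (A *m la) i 0.
Proof.
case: n F Reg la => [|n] F Reg la tf.
  by have [A cA _] := lex_chart tf; exists A => // - [].
(* A unimodular change of coordinates makes [la] a multiple of the first basis vector, nonnegative
   up to the sign [e] below; then only the first column of a lexicographic chart matters. *)
have [L uL [R uR [d _ laE]]] := int_Smith_normal_form la^T.
pose s := L 0 0 * d`_0.
have uRt : R^T \in unitmx by rewrite unitmx_tr.
have sE : invmx R^T *m la = s *: delta_mx 0 0.
  rewrite -[la]trmxK laE !trmx_mul mulKmx //.
  apply/colP => i; rewrite !mxE big_ord1 !mxE /s /= eqxx andbT eq_sym.
  rewrite -[i == 0]/(i == 0%N :> nat).
  by case: (_ == _) => /=; rewrite ?mulr0n ?mulr1n ?mul0r ?mulr0 ?mulr1 // mulrC.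
have fin (e : int) : e * s = `|s| -> e * e = 1 -> exists2 A, chart Reg A &
    forall i, 0 <= (A *m la) i 0.
  move=> es ee; pose B := e *: invmx R^T.
  have uB : B \in unitmx.
    suff /mulmx1_unit [] : B *m (e *: R^T) = 1%:M by [].
    by rewrite -scalemxAl -scalemxAr scalerA ee scale1r mulVmx.
  have [A cA A0] := lex_chart (toric_family_mono uB tf).
  exists (A *m B); first exact: chart_mono cA.
  move=> i; rewrite -mulmxA -scalemxAl sE scalerA es -scalemxAr mxE.
  by rewrite -colE mxE mulr_ge0 // A0.
have [s0|s0] := leP 0 s; first by apply: (fin 1); rewrite ?mul1r // ger0_norm.
by apply: (fin (-1)); rewrite ?mulN1r ?opprK // ltr0_norm.
Qed.

(** * Prime divisors *)

Section OrderMore.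
Variables (R : idomainType) (F : frac_field R).
Hypothesis facR : factorial_ring R.
Local Notation "x %:F" := (ff_emb F x).
Implicit Types (q a b : R) (f g : F) (e : int).

Lemma order0 q : prime_elt q -> order q (0 : F) = 0.
Proof.
move=> pq; rewrite /order; case: pselect => // h; exfalso; case: h => e [a [b [qa qb]]].
move=> /esym/eqP; rewrite !mulf_eq0 invr_eq0 !emb_eq0.
rewrite (negbTE (ndvd_neq0 qa)) (negbTE (ndvd_neq0 qb)) !orbF.
by rewrite (negbTE (expfz_neq0 _ _)) // emb_eq0; case: pq.
Qed.

Lemma order_expz q f e : prime_elt q -> f != 0 -> order q (f ^ e) = e * order q f.
Proof.
move=> pq f0; have H k : order q (f ^+ k) = k%:Z * order q f.
  elim: k => [|k IH]; first by rewrite order1 ?mul0r.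
  by rewrite exprS orderM ?expf_neq0 // IH; lia.
case: e => k; first by rewrite -exprnP H.
by rewrite NegzE -exprnN orderV ?expf_neq0 // H mulNr.
Qed.

Lemma order_prod q (I : Type) (s : seq I) (f : I -> F) : prime_elt q ->
  (forall i, f i != 0) -> order q (\prod_(i <- s) f i) = \sum_(i <- s) order q (f i).
Proof.
move=> pq f0; elim: s => [|i s IH]; first by rewrite !big_nil order1.
rewrite !big_cons orderM // ?IH //.
by apply: (big_ind (fun x => x != 0)) => [|x y|//]; [exact: oner_neq0|exact: mulf_neq0].
Qed.

Lemma order_frac q f : prime_elt q -> f != 0 -> 0 <= order q f ->
  exists a b, ~ divides q b /\ f = a%:F / b%:F.
Proof.
move=> pq f0; have [a [b [qa qb {2}->]]] := orderP facR pq f0.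
case: (order q f) => // k _; exists (q ^+ k * a), b; split=> //.
by rewrite rmorphM rmorphXn /= mulrA.
Qed.

Lemma order_div_ge0 q a b : prime_elt q -> ~ divides q b -> a != 0 ->
  0 <= order q (a%:F / b%:F).
Proof.
move=> pq qb a0; have b0 := ndvd_neq0 qb.
by rewrite orderM ?invr_neq0 ?emb_eq0 // orderV ?emb_eq0 // (order_ndvd F pq qb)
  ?subr0 ?order_emb_ge0.
Qed.

Lemma dvd_order q a : prime_elt q -> a != 0 -> divides q a -> 0 < order q a%:F.
Proof.
move=> pq a0 [c cE]; rewrite cE rmorphM orderM //; last 2 first.
- by rewrite emb_eq0; apply: contra_neq a0 => c0; rewrite cE c0 mul0r.
- by rewrite emb_eq0; case: pq.
rewrite (order_self F pq); suff : 0 <= order q c%:F by lia.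
by apply: order_emb_ge0 => //; apply: contra_neq a0 => c0; rewrite cE c0 mul0r.
Qed.

Lemma order_assoc q p f : prime_elt q -> prime_elt p -> divides q p -> order q f = order p f.
Proof.
move=> pq pp qp; have pdq : divides p q.
  have [c cE] := qp; have [_ _ pP] := pp; have := dvdxx p; rewrite {2}cE => /pP [[d dE]|//].
  case: pq => q0 q1 _; case: q1; exists d; apply: (mulfI (x := c)).
    by case: pp => + _ _; rewrite cE mulf_eq0 negb_or => /andP[].
  by rewrite mulr1 [in LHS]dE cE; ring.
have [->|f0] := eqVneq f 0; first by rewrite !order0.
apply: orderE => //.
have [a [b [pa pb {1}->]]] := orderP facR pp f0; set e := order p f.
have [c cE] := qp; have [d dE] := pdq.
have p0 : p != 0 by case: pp.
have c0 : c != 0 by apply: contra_neq p0 => c0; rewrite cE c0 mul0r.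
have qc : ~ divides q c.
  move=> /(dvd_trans pdq) [s sE]; case: pp => _ p1 _; case: pq => _ q1 _; apply: q1.
  exists s; apply: (mulIf p0); rewrite mul1r {1}cE {1}sE; ring.
have [_ _ qP] := pq.
have qa : ~ divides q a by move/(dvd_trans pdq).
have qb : ~ divides q b by move/(dvd_trans pdq).
have nX k : ~ divides q (c ^+ k).
  by elim: k => [|k IH]; [case: pq|rewrite exprS => /qP []].
have cF : c%:F != 0 by rewrite emb_eq0.
case: e => k.
  exists (c ^+ k * a), b; split=> //; first by case/qP => //; apply: nX.
  rewrite cE !rmorphM rmorphXn /= -!exprnP exprMn -!mulrA.
  by rewrite mulrCA.
exists a, (c ^+ k.+1 * b); split=> //; first by case/qP => //; apply: nX.
rewrite NegzE -!exprnN cE !rmorphM rmorphXn /= exprMn !invfM -!mulrA mulrCA.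
by congr (_ * _); rewrite mulrCA.
Qed.

End OrderMore.

Lemma sum1_int (x y : int) : x + y = 1 -> 0 <= x -> 0 <= y -> x != 1 -> y = 1.
Proof. lia. Qed.

Section Divisors.
Variables (K : closedFieldType) (n : nat) (F : frac_field {mpoly K[n]}).
Implicit Types (f g : F) (c v : K) (A B : 'M[int]_n).
Let facR : factorial_ring {mpoly K[n]} := @factorial_mpoly K n.

Lemma local_emb z p : local (coord F) z (ff_emb F p) p.@[z].
Proof. by rewrite -peval_coord; apply: local_peval; apply: on_coord. Qed.

Lemma local_order_ge0 y f c q : prime_elt q -> q.@[y] = 0 -> f != 0 ->
  local (coord F) y f c -> 0 <= order q f.
Proof.
move=> pq qy f0 [a [b [b0 fE _]]]; rewrite !peval_coord in fE; rewrite fE.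
apply: (@order_div_ge0 _ F facR q a b pq) => //.
  by move=> [d dE]; rewrite dE mevalM qy mulr0 eqxx in b0.
by apply: contra_neq f0 => a0; rewrite fE a0 rmorph0 mul0r.
Qed.

Lemma local_order_unit y f c q : prime_elt q -> q.@[y] = 0 -> c != 0 ->
  local (coord F) y f c -> order q f = 0.
Proof.
move=> pq qy c0 h; have ly := local_rel (on_coord (F := F) y).
have h' := lr_inv ly h c0.
have f0 : f != 0.
  apply: contra_neq c0 => f0; apply: (vr_uniq ly h); rewrite f0; exact: vr_zero ly.
have h1 := local_order_ge0 pq qy f0 h.
have := local_order_ge0 pq qy (invr_neq0 f0) h'.
rewrite orderV //; lia.
Qed.

Lemma local_divide y f c q : prime_elt q -> q.@[y] = 0 -> f != 0 ->
  local (coord F) y f c -> 0 < order q f ->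
  exists u v, f = ff_emb F q * u /\ local (coord F) y u v.
Proof.
move=> pq qy f0 [a [b [b0 fE _]]] o; rewrite !peval_coord in fE.
have a0 : a != 0 by apply: contra_neq f0 => a0; rewrite fE a0 rmorph0 mul0r.
have bn0 : b != 0 by apply: contra_neq b0 => ->; rewrite meval0.
have qb : ~ divides q b by move=> [d dE]; rewrite dE mevalM qy mulr0 eqxx in b0.
have [d dE] : divides q a.
  apply: (order_dvd (F := F) pq a0); move: o.
  rewrite fE (orderM facR) ?invr_neq0 ?emb_eq0 // (orderV facR) ?emb_eq0 //.
  by rewrite (order_ndvd F pq qb) subr0.
exists (ff_emb F d / ff_emb F b), (d.@[y] / b.@[y]); split.
  by rewrite fE dE rmorphM mulrCA mulrA.
by exists d, b; rewrite !peval_coord.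
Qed.

(* The local rings at z and y are isomorphic and factorial, so the preimage of q is a
   unit times a prime polynomial p vanishing at z. *)
Lemma order_match (phi : {rmorphism F -> F}) y z q :
  (forall f, exists g, phi g = f) ->
  (forall f c, local (coord F) z f c <-> local (coord F) y (phi f) c) ->
  prime_elt q -> q.@[y] = 0 ->
  exists2 p, prime_elt p & forall f, order q (phi f) = order p f.
Proof.
move=> phiS yz pq qy; have ly := local_rel (on_coord (F := F) y).
have lz := local_rel (on_coord (F := F) z).
have [f0 f0E] := phiS (ff_emb F q).
have : local (coord F) z f0 0 by apply/yz; rewrite f0E -qy; apply: local_emb.
move=> [a [b [b0 f0ab /esym/eqP]]]; rewrite mulf_eq0 invr_eq0 (negbTE b0) orbF => /eqP az.
rewrite !peval_coord in f0ab.
have bn0 : b != 0 by apply: contra_neq b0 => ->; rewrite meval0.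
have phib : order q (phi (ff_emb F b)) = 0.
  by apply: (local_order_unit pq qy b0); apply/yz; apply: local_emb.
have phiaE : phi (ff_emb F a) = ff_emb F q * phi (ff_emb F b).
  by rewrite -f0E -rmorphM f0ab divfK // emb_eq0.
have q0 : ff_emb F q != 0 by rewrite emb_eq0; case: pq.
have phiem p : p != 0 -> phi (ff_emb F p) != 0 by move=> p0; rewrite fmorph_eq0 emb_eq0.
have oa : order q (phi (ff_emb F a)) = 1.
  by rewrite phiaE (orderM facR) ?phiem // (order_self F pq) phib.
have ge p : p != 0 -> 0 <= order q (phi (ff_emb F p)).
  move=> p0; apply: (local_order_ge0 pq qy (phiem _ p0)); apply/yz; exact: local_emb.
have an0 : a != 0.
  by apply: contra_eq_neq oa => ->; rewrite !rmorph0 (order0 F pq).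
(* The orders at [q] of the images of the prime factors of [a] are nonnegative with sum 1, so one
   factor has order 1. *)
have [p [a' [pp aE op]]] : exists p a', [/\ prime_elt p, a = p * a' &
    order q (phi (ff_emb F p)) = 1].
  elim: (facR an0) oa => [u [w uw]|p' a' pp' pa' IH] o1.
    have uw0 := oner_neq0 {mpoly K[n]}; rewrite uw mulf_eq0 negb_or in uw0.
    case/andP: uw0 => w0 u0; have := congr1 (fun s => order q (phi (ff_emb F s))) uw.
    rewrite !rmorphM /= (orderM facR) ?phiem // !rmorph1 (order1 F facR pq) o1.
    by move: (order q (phi (ff_emb F w))) (ge _ w0) => k k0 k1; exfalso; lia.
  have p'0 : p' != 0 by case: pp'.
  have a'0 := prime_prod_neq0 pa'.
  move: o1; rewrite !rmorphM (orderM facR) ?phiem // => o1.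
  have h1 := ge _ p'0; have h2 := ge _ a'0.
  have [op1|op1] := eqVneq (order q (phi (ff_emb F p'))) 1.
    by exists p', a'.
  have [|p [b' [pp -> op]]] := IH; first exact: sum1_int o1 h1 h2 op1.
  by exists p, (p' * b'); rewrite mulrCA.
have [p0 p1 pP] := pp.
have lp : local (coord F) y (phi (ff_emb F p)) p.@[z] by apply/yz; apply: local_emb.
have [|u [v [pE hu]]] := local_divide pq qy (phiem _ p0) lp; first by rewrite op.
have pz : p.@[z] = 0.
  apply: (vr_uniq ly lp); rewrite pE -(mul0r v) -qy.
  by apply: (vr_mul ly) => //; apply: local_emb.
have v0 : v != 0.
  have E : u * phi (ff_emb F a') = phi (ff_emb F b).
    by apply: (mulfI q0); rewrite mulrA -pE -phiaE aE !rmorphM.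
  have h1 : local (coord F) y (phi (ff_emb F a')) a'.@[z] by apply/yz; apply: local_emb.
  have h2 : local (coord F) y (phi (ff_emb F b)) b.@[z] by apply/yz; apply: local_emb.
  have := vr_mul ly hu h1; rewrite E => /(vr_uniq ly h2).
  by move=> e; apply: contra_neq b0 => v0; rewrite e v0 mul0r.
have u0 : u != 0 by apply: contra_neq (phiem _ p0) => u0; rewrite pE u0 mulr0.
exists p => //.
(* Otherwise w / p would be regular at [z], giving w d = c p with d(z) nonzero; then [p] would
   divide [d], although it vanishes at [z]. *)
have nd w : ~ divides p w -> order q (phi (ff_emb F w)) = 0.
  move=> pw; have w0 := ndvd_neq0 pw.
  have hw : local (coord F) y (phi (ff_emb F w)) w.@[z] by apply/yz; apply: local_emb.
  apply/eqP; apply: contraPT pw => ow; have oge := ge _ w0.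
  have [|s [t [wE hs]]] := local_divide pq qy (phiem _ w0) hw.
    by rewrite lt_def ow.
  have : local (coord F) z (ff_emb F w / ff_emb F p) (t / v).
    apply/yz; rewrite fmorph_div wE pE invfM mulrACA divff // mul1r.
    exact: lr_div.
  move=> [c [d [d0 E _]]]; rewrite !peval_coord in E.
  have dn0 : d != 0 by apply: contra_neq d0 => ->; rewrite meval0.
  have : w * d = c * p.
    apply: (@emb_inj _ F); apply/eqP; rewrite !rmorphM -eqr_div ?emb_eq0 //.
    exact/eqP.
  move=> wd np; have /pP [//|[e eE]] : divides p (w * d) by exists c.
  by case/eqP: d0; rewrite eE mevalM pz mulr0.
move=> f; have [->|fn0] := eqVneq f 0; first by rewrite rmorph0 !order0.
have [a1 [b1 [pa pb {1}->]]] := orderP facR pp fn0.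
have n1 := ndvd_neq0 pa; have n2 := ndvd_neq0 pb.
have pF : ff_emb F p != 0 by rewrite emb_eq0.
rewrite rmorphM fmorphXz fmorph_div /= (orderM facR) ?expfz_neq0 ?mulf_neq0 ?invr_neq0 ?phiem //.
rewrite (order_expz facR) ?phiem // op (orderM facR) ?invr_neq0 ?phiem // (orderV facR) ?phiem //.
rewrite !nd // mulr1; exact: addr0.
Qed.

End Divisors.

Section MonomialOrders.
Variables (K : closedFieldType) (n : nat) (F : frac_field {mpoly K[n]}).
Implicit Types (f g : F) (c v : K) (A B : 'M[int]_n).
Let facR : factorial_ring {mpoly K[n]} := @factorial_mpoly K n.

Lemma divides_X (q : {mpoly K[n]}) l : ~ divides q 1 -> divides q 'X_l ->
  exists c, c != 0 /\ 'X_l = c%:MP * q.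
Proof.
move=> q1 [a aE]; have X0 : ('X_l : {mpoly K[n]}) != 0 by rewrite -msize_poly_eq0 msizeX.
have a0 : a != 0 by apply: contra_neq X0 => a0; rewrite aE a0 mul0r.
have q0 : q != 0 by apply: contra_neq X0 => q0; rewrite aE q0 mulr0.
have := msizeX K (U_(l))%MM; rewrite mdeg1 aE msizeM //.
have nq : (1 < msize q)%N.
  rewrite ltnNge; apply/negP => /msize1_polyC qE; apply: q1.
  have c0 : q@_0%MM != 0 by apply: contra_neq q0 => c0; rewrite qE c0 mpolyC0.
  by exists (q@_0%MM)^-1%:MP; rewrite {2}qE -mpolyCM mulVf.
have := a0; rewrite -msize_poly_eq0 -lt0n; move: (msize a) (msize q) nq (@msize1_polyC _ _ a).
move=> i j ij aC i0 sE; have sa : (i <= 1)%N by move: ij i0 sE; clear; lia.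
exists a@_0%MM; rewrite -aC //; split=> //.
by apply: contra_neq a0 => c0; rewrite aC // c0 mpolyC0.
Qed.

Lemma prime_unit_mul (R : idomainType) (u q : R) : divides u 1 -> prime_elt q -> prime_elt (u * q).
Proof.
move=> [w uw] [q0 q1 qP]; split.
- by rewrite mulf_neq0 //; apply: contra_eq_neq uw => ->; rewrite mulr0 oner_neq0.
- by move=> [s sE]; apply: q1; exists (s * u); rewrite -mulrA.
- move=> a b [s sE]; have /qP [[t tE]|[t tE]] : divides q (a * b) by exists (s * u); rewrite -mulrA.
    by left; exists (t * w); rewrite mulrA -(mulrA t) -uw mulr1.
  by right; exists (t * w); rewrite mulrA -(mulrA t) -uw mulr1.
Qed.

Lemma prime_X l : prime_elt ('X_l : {mpoly K[n]}).
Proof.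
have X0 : ('X_l : {mpoly K[n]}) != 0 by rewrite -msize_poly_eq0 msizeX.
have N1 : ~ divides ('X_l : {mpoly K[n]}) 1.
  by move=> [s /(congr1 (meval (fun=> 0)))]; rewrite mevalM mevalXU mulr0 meval1 => /eqP; rewrite oner_eq0.
case: {-1}_ / (facR X0) (erefl ('X_l : {mpoly K[n]})) => [u du uE|q a pq pa qE].
  by case: N1; rewrite uE.
have [||c [c0 XE]] := @divides_X q l _ _; [by case: pq|by exists a; rewrite mulrC|].
rewrite -?qE XE; apply: prime_unit_mul => //; exists (c^-1)%:MP.
by rewrite -mpolyCM mulVf.
Qed.

(** Some coordinate must then have nonzero order, so [q] divides this prime polynomial and is
    associated to it. *)
Lemma order_boundary q m : prime_elt q -> order q (chi F m) != 0 ->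
  exists l, forall f, order q f = order 'X_l f.
Proof.
move=> pq h; have [l hl] : exists l, order q (coord F l) != 0.
  apply: contrapT => /forallNP H; case/eqP: h.
  rewrite (order_prod facR) // => [|i]; last by rewrite expfz_neq0 ?coord_neq0.
  rewrite big1 // => i _; rewrite (order_expz facR) ?coord_neq0 //.
  by have /negP := H i; rewrite negbK => /eqP ->; rewrite mulr0.
exists l => f; apply: (@order_assoc _ F facR q 'X_l f pq (prime_X l)).
have X0 : ('X_l : {mpoly K[n]}) != 0 by case: (prime_X l).
apply: (order_dvd (F := F) pq X0); rewrite lt_def hl.
exact: order_emb_ge0.
Qed.

Lemma order_X_coord l j : order 'X_l (coord F j) = (l == j)%:Z.
Proof.
have [<-|lj] := eqVneq; first exact: (order_self F (prime_X l)).
apply: (order_ndvd F (prime_X l)) => - [c /(congr1 (meval (fun i => (i != l)%:R)))].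
rewrite mevalM !mevalXU eqxx mulr0 eq_sym (negbTE lj) => /eqP.
by rewrite oner_eq0.
Qed.

Lemma order_X_chi l m : order 'X_l (chi F m) = m 0 l.
Proof.
rewrite (order_prod facR _ (prime_X l)) => [|i]; last by rewrite expfz_neq0 ?coord_neq0.
rewrite (bigD1 l) //= big1 ?addr0 => [|i il]; rewrite (order_expz facR _ (prime_X l)) ?coord_neq0 //.
  by rewrite order_X_coord eqxx mulr1.
by rewrite order_X_coord eq_sym (negbTE il) mulr0.
Qed.

Lemma order_X_msupp l (p : {mpoly K[n]}) m : m \in msupp p -> order 'X_l (ff_emb F p) <= (m l)%:Z.
Proof.
move=> mp; have p0 : p != 0 by apply: contraTneq mp => ->; rewrite msupp0.
have [e [b [qb pE]]] := order_poly facR (prime_X l) p0.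
have b0 := ndvd_neq0 qb.
rewrite pE rmorphM rmorphXn (orderM facR (prime_X l)) ?expf_neq0 ?coord_neq0 ?emb_eq0 //.
have -> : order 'X_l (ff_emb F 'X_l ^+ e) = e by rewrite exprnP (order_expz facR _ (prime_X l)) ?coord_neq0 // order_X_coord eqxx mulr1.
rewrite (order_ndvd F (prime_X l) qb) addr0.
have : m \in msupp (b * 'X_[U_(l) *+ e]) by rewrite -mpolyXn mulrC -pE.
rewrite (perm_mem (msuppMX _ _)) => /mapP [m' _ ->].
by rewrite mnmDE mulmnE mnm1E eqxx ?mul1n ?mulr1n lez_nat leq_addr.
Qed.

(** Distinct monomials keep distinct exponents under a unimodular matrix, so nothing cancels; the
    shift by [T] turns the Laurent polynomial into a polynomial. *)
Lemma order_X_laurent l B (p : {mpoly K[n]}) m : B \in unitmx -> m \in msupp p ->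
  order 'X_l (mono F B (ff_emb F p)) <= (mexp m *m B) 0 l.
Proof.
move=> uB mp; have p0 : p != 0 by apply: contraTneq mp => ->; rewrite msupp0.
have [T hT] : exists T : nat, forall m' k, m' \in msupp p -> (absz ((mexp m' *m B) 0%R k) <= T)%N.
  exists (\sum_(m' <- msupp p) \sum_k absz ((mexp m' *m B) 0%R k))%N => m' k m'p.
  by rewrite (bigD1_seq m') //= (bigD1 k) //= -addnA leq_addr.
pose e (m' : 'X_{1..n}) : 'X_{1..n} := [multinom absz ((mexp m' *m B) 0 k + T%:Z)%R | k < n].
have eE m' k : m' \in msupp p -> (e m' k)%:Z = (mexp m' *m B) 0 k + T%:Z.
  move=> m'p; rewrite mnmE gez0_abs //.
  by have := hT _ k m'p; move: (_ 0 k) => x; lia.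
have einj : {in msupp p &, injective e}.
  move=> m1 m2 h1 h2 E; apply: mexp_inj; rewrite -[mexp m1](mulmxK uB) -[mexp m2](mulmxK uB).
  congr (_ *m _); apply/rowP => k; apply: (addIr T%:Z); rewrite -!eE //.
  by rewrite E.
pose p' : {mpoly K[n]} := \sum_(m' <- msupp p) p@_m' *: 'X_[e m'].
have p'E : ff_emb F p' = mono F B (ff_emb F p) * chi F (const_mx T%:Z).
  rewrite [p]mpolyE /p' !rmorph_sum mulr_suml big_seq [RHS]big_seq.
  apply: eq_bigr => m' m'p; rewrite -!mul_mpolyC !rmorphM /= -!chi_mexp mono_chi //.
  rewrite -mulrA -chiD; congr (_ * chi _ _); first exact: esym (endo_cst _ _).
  by apply/rowP => k; rewrite [LHS]mxE eE // [RHS]mxE [const_mx _ _ _]mxE.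
have p'm : e m \in msupp p'.
  rewrite mcoeff_msupp raddf_sum (bigD1_seq m) //= big_seq_cond big1 ?addr0.
    by rewrite mcoeffZ mcoeffX eqxx mulr1 -mcoeff_msupp.
  move=> m' /andP[m'p m'm]; rewrite mcoeffZ mcoeffX.
  case: eqP => [/einj E|]; last by rewrite mulr0.
  by rewrite E ?eqxx in m'm.
have := order_X_msupp l p'm; rewrite p'E (orderM facR (prime_X l)) ?chi_neq0 //; last first.
  by rewrite fmorph_eq0 emb_eq0.
by rewrite order_X_chi mxE eE // lerD2r.
Qed.

(** The primes of the denominator are removed one at a time: a coordinate goes into the monomial,
    and any other prime must divide the numerator. *)
Lemma laurent_form f : f != 0 ->
  (forall q, prime_elt q -> (forall m, order q (chi F m) = 0) -> 0 <= order q f) ->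
  exists m p, f = chi F m * ff_emb F p.
Proof.
have [a [b [b0 ->]]] := ff_frac f => {f}.
elim: (facR b0) a => {b b0} [u du|q b pq pb IH] a f0 H.
  have [c c0 ->] := mpoly_dvd1 du; exists 0, (c^-1 *: a).
  rewrite chi0 mul1r -mul_mpolyC rmorphM /= mulrC; congr (_ * _).
  exact: esym (fmorphV (cst F) c).
have a0 : a != 0 by apply: contra_neq f0 => ->; rewrite rmorph0 mul0r.
have b0 := prime_prod_neq0 pb; have q0 : q != 0 by case: pq.
have [[m hm]|/forallNP qm] := EM (exists m, order q (chi F m) != 0).
  have [l hl] := order_boundary pq hm.
  have [||c [c0 XE]] := @divides_X q l _ _; first by case: pq.
    have X0 : ('X_l : {mpoly K[n]}) != 0 by case: (prime_X l).
    apply: (order_dvd (F := F) pq X0); rewrite hl.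
    by rewrite (order_self F (prime_X l)).
  have E : ff_emb F a / ff_emb F (q * b) = chi F (- delta_mx 0 l) * (ff_emb F (c *: a) / ff_emb F b).
    have cc : ff_emb F c%:MP != 0 by rewrite emb_eq0 mpolyC_eq0.
    have qq : ff_emb F q != 0 by rewrite emb_eq0.
    have bb : ff_emb F b != 0 by rewrite emb_eq0.
    rewrite chiN chi_delta /coord XE -mul_mpolyC !rmorphM /=.
    move: (ff_emb F c%:MP) (ff_emb F q) (ff_emb F b) (ff_emb F a) cc qq bb => x y z t x0 y0 z0.
    by field; rewrite x0 y0 z0.
  have [||m' [p pE]] := IH (c *: a); last by exists (- delta_mx 0 l + m'), p; rewrite E pE chiD mulrA.
    by apply: contra_neq f0; rewrite E => ->; rewrite mulr0.
  move=> r pr rm; have := H r pr rm; rewrite E (orderM facR pr) ?chi_neq0 ?rm ?add0r //.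
  by rewrite mulf_neq0 ?invr_eq0 ?emb_eq0 // scaler_eq0 negb_or c0.
have qm0 m : order q (chi F m) = 0 by apply/eqP; apply: contrapT => /negP /qm.
have [a' aE] : divides q a.
  apply: (order_dvd (F := F) pq a0); have := H q pq qm0.
  rewrite (orderM facR pq) ?invr_neq0 ?emb_eq0 ?mulf_neq0 // (orderV facR pq) ?emb_eq0 ?mulf_neq0 //.
  rewrite rmorphM (orderM facR pq) ?emb_eq0 // (order_self F pq).
  have := order_emb_ge0 F facR pq b0.
  move: (order q (ff_emb F b)) (order q (ff_emb F a)) => x y; lia.
have E : ff_emb F a / ff_emb F (q * b) = ff_emb F a' / ff_emb F b.
  by rewrite aE !rmorphM invfM -mulrA mulVKf ?emb_eq0.
rewrite E; apply: IH; first by rewrite -E.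
by move=> r pr rm; rewrite -E; apply: H.
Qed.

End MonomialOrders.

Lemma ideal_gen_meval (K : fieldType) r (P : {mpoly K[r]} -> Prop) (c : 'I_r -> K) q :
  ideal_gen P q -> q.@[c] != 0 -> exists2 p, P p & p.@[c] != 0.
Proof.
elim=> [|a x y Px _ IH]; first by rewrite meval0 eqxx.
rewrite mevalD mevalM; have [x0|x0] := eqVneq x.@[c] 0; last by exists x.
by rewrite x0 mulr0 add0r.
Qed.

(** * Prime divisors of a toric family *)

Section ToricDivisors.
Variables (K : closedFieldType) (n : nat) (F : frac_field {mpoly K[n]}).
Implicit Types (f g : F) (c v : K) (A B : 'M[int]_n).
Let facR : factorial_ring {mpoly K[n]} := @factorial_mpoly K n.
Variables (X : Type) (Reg : X -> F -> K -> Prop).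
Hypothesis tf : toric_family Reg.
Local Notation loc0 := (local (coord F) (fun=> 0)).

(* The valuations of the function field attached to the prime divisors of X. *)
Definition divisor (w : F -> int) := exists A q,
  [/\ chart Reg A, prime_elt q & forall f, w f = order q (mono F (invmx A) f)].

Lemma divisor_mul w f g : divisor w -> f != 0 -> g != 0 -> w (f * g) = w f + w g.
Proof.
move=> [A [q [_ pq wE]]] f0 g0; rewrite !wE rmorphM /= (orderM facR pq) ?fmorph_eq0 //.
Qed.

Lemma divisor_inv w f : divisor w -> f != 0 -> w f^-1 = - w f.
Proof.
by move=> [A [q [_ pq wE]]] f0; rewrite !wE fmorphV (orderV facR pq) ?fmorph_eq0.
Qed.

Lemma divisor1 w : divisor w -> w 1 = 0.
Proof. by move=> [A [q [_ pq wE]]]; rewrite wE rmorph1 (order1 F facR pq). Qed.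

Lemma divisor_expz w f (e : int) : divisor w -> f != 0 -> w (f ^ e) = e * w f.
Proof.
by move=> [A [q [_ pq wE]]] f0; rewrite !wE fmorphXz (order_expz facR _ pq) ?fmorph_eq0.
Qed.

Lemma divisor_prod w (I : Type) (s : seq I) (f : I -> F) : divisor w ->
  (forall i, f i != 0) -> w (\prod_(i <- s) f i) = \sum_(i <- s) w (f i).
Proof.
move=> [A [q [_ pq wE]]] f0; rewrite wE rmorph_prod (order_prod facR _ pq).
  by apply: eq_bigr => i _; rewrite wE.
by move=> i; rewrite fmorph_eq0.
Qed.

Lemma divisor_chi w m : divisor w -> w (chi F m) = \sum_j m 0 j * w (coord F j).
Proof.
move=> dw; rewrite (divisor_prod _ dw) => [|j]; last by rewrite expfz_neq0 ?coord_neq0.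
by apply: eq_bigr => j _; rewrite (divisor_expz _ dw) ?coord_neq0.
Qed.

(* The restriction of w o t to monomials is a one-parameter subgroup, which lies in the
   cone of some chart; separatedness identifies the local ring of that chart with the
   one at the generic point of w transported by t. *)
Lemma divisor_pullback (t : {rmorphism F -> F}) w : (forall c, t (cst F c) = cst F c) ->
  (forall f, exists g, t g = f) ->
  (forall x, exists x', forall f c, Reg x' f c <-> Reg x (t f) c) ->
  divisor w -> divisor (w \o t).
Proof.
move=> tc tS tR dw; pose la : 'cV[int]_n := \col_j w (t (coord F j)).
have laE m : w (t (chi F m)) = (m *m la) 0 0.
  rewrite /chi rmorph_prod (divisor_prod _ dw) => [|j].
    rewrite mxE; apply: eq_bigr => j _; rewrite fmorphXz mxE.
    by rewrite (divisor_expz _ dw) // fmorph_eq0 coord_neq0.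
  by rewrite fmorph_eq0 expfz_neq0 ?coord_neq0.
have [A' [uA' cA'] pos] := chart_exists la tf.
have [A [q [[uA cA] pq wE]]] := dw.
pose G : {rmorphism F -> F} := mono F (invmx A) \o (t \o mono F A').
have GE f : G f = mono F (invmx A) (t (mono F A' f)) by [].
(* Since [A'] is nonnegative on [la], the transported coordinates have no pole along [q]; at a point
   [y] of q = 0 off their denominators they take values [z]. *)
have /choice [ab hab] i : exists ab : {mpoly K[n]} * {mpoly K[n]},
    ~ divides q ab.2 /\ G (coord F i) = ff_emb F ab.1 / ff_emb F ab.2.
  have [||a [b H]] := @order_frac _ F facR q (G (coord F i)) pq; last by exists (a, b).
    by rewrite !fmorph_eq0 coord_neq0.
  by rewrite GE -wE mono_coord // laE -row_mul mxE pos.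
have qb : ~ divides q (\prod_i (ab i).2).
  have [_ q1 qP] := pq.
  elim/big_rec: _ => // i x _ IH /qP [|//]; by case: (hab i).
have [y qy by0] := prime_zero pq qb.
rewrite rmorph_prod in by0; move/prodf_neq0: by0 => by0.
have ly := local_rel (on_coord (F := F) y).
have lyG : loc_rel (fun f c => local (coord F) y (G f) c).
  by apply: (pullback_rel (t := G)) => // c; rewrite GE [mono F A' _]endo_cst tc [LHS]endo_cst.
pose z i := (ab i).1.@[y] / (ab i).2.@[y].
have hz i : local (coord F) y (G (coord F i)) (z i).
  case: (hab i) => _ ->; apply: (lr_div ly); [exact: local_emb|exact: local_emb|].
  exact: by0.
have sub f c : local (coord F) z f c -> local (coord F) y (G f) c.
  exact: (local_sub lyG hz).
have [x hx] := cA y; have [x' hx'] := cA' z; have [x1 hx1] := tR x.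
pose V f c := Reg x1 f c.
have VE f c : Reg x1 f c <-> local (coord F) y (mono F (invmx A) (t f)) c.
  by rewrite hx1 -hx monoVK.
have xx : x' = x1.
  apply: (tf_separated tf (V := V)) => //; first exact: lr_val (tf_local tf x1).
  move=> f c h; apply/VE; rewrite -[f](monoVK uA'); apply: sub.
  by apply/hx'; rewrite monoVK.
have yz f c : local (coord F) z f c <-> local (coord F) y (G f) c.
  by rewrite -hx' xx VE.
have GS f : exists g, G g = f.
  have [g gE] := tS (mono F A f); exists (mono F (invmx A') g).
  by rewrite GE monoVK // gE monoK.
have [p pp pE] := order_match GS yz pq qy.
exists A', p; split=> // f; rewrite /= wE -pE GE monoVK //.
Qed.

Lemma divisor_chart A A' w : chart Reg A -> chart Reg A' ->
  (exists y z q, [/\ prime_elt q, q.@[y] = 0, forall f, w f = order q (mono F (invmx A) f) &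
    forall f c, local (coord F) z f c <-> local (coord F) y (mono F (A' *m invmx A) f) c]) ->
  exists2 p, prime_elt p & forall f, w f = order p (mono F (invmx A') f).
Proof.
move=> [uA _] [uA' _] [y [z [q [pq qy wE yz]]]].
have uB : A' *m invmx A \in unitmx by rewrite unitmx_mul uA' unitmx_inv.
have [|p pp pE] := @order_match K n F (mono F (A' *m invmx A)) y z q _ yz pq qy.
  by move=> f; exists (mono F (invmx (A' *m invmx A)) f); rewrite monoVK.
exists p => // f; rewrite wE -pE mono_comp ?unitmx_inv //.
by rewrite mulKmx.
Qed.

(** Such a divisor is no coordinate hyperplane of its chart, so it has a point in the torus, and the
    torus lies in every chart. *)
Lemma divisor_interior A w : chart Reg A -> divisor w -> (forall m, w (chi F m) = 0) ->
  exists2 p, prime_elt p & forall f, w f = order p (mono F (invmx A) f).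
Proof.
move=> cA [A1 [q [cA1 pq wE]]] w0; have [uA _] := cA; have [uA1 _] := cA1.
have qX : ~ divides q (\prod_i 'X_i).
  have [_ q1 qP] := pq; elim/big_rec: _ => // i x _ IH /qP [|//] qX.
  have X0 : ('X_i : {mpoly K[n]}) != 0 by case: (prime_X K i).
  have := dvd_order F facR pq X0 qX; have := w0 (delta_mx 0 i *m A1).
  rewrite wE mono_chi ?unitmx_inv // mulmxK // chi_delta => ->.
  by rewrite ltxx.
have [y qy] := prime_zero pq qX; rewrite rmorph_prod => /prodf_neq0 y0'.
have y0 i : y i != 0 by have := y0' i isT; rewrite /= mevalXU.
apply: (divisor_chart cA1 cA); exists y, (monoval (A *m invmx A1) y), q; split=> // f c.
by rewrite local_mono_coord // unitmx_mul uA unitmx_inv.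
Qed.

(** On each affine piece, finitely many of the polynomials [q] attached to the charts centred there
    generate all of them. At the centre of any chart one of these is nonzero, so the coordinates of
    the corresponding chart [A'] are regular there, and separatedness puts the centre in [A']. *)
Lemma finite_charts : exists2 s : seq 'M[int]_n, (forall A, A \in s -> chart Reg A) &
  forall A, chart Reg A -> exists2 A', A' \in s & exists z, forall f c,
    local (coord F) z f c <-> loc0 (mono F (A' *m invmx A) f) c.
Proof.
have [m [r [y [h1 h2 h3]]]] := tf_affine tf.
(* [good j A c q]: the chart A is centred on piece j at c, and its coordinates are
   regular wherever q does not vanish. *)
pose good j A (c : 'I_(r j) -> K) (q : {mpoly K[r j]}) := [/\ chart Reg A, on_relations (y j) c,
  (forall f v, loc0 (mono F (invmx A) f) v <-> local (y j) c f v), q.@[c] != 0 &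
  forall i, exists a b, divides b q /\ chi F (row i A) = peval (y j) a / peval (y j) b].
have goodE A : chart Reg A -> exists j (c : 'I_(r j) -> K) q, good j A c q.
  move=> cA; have [uA hA] := cA; have [x hx] := hA (fun=> 0).
  have [j [c [on hc]]] := h1 x; exists j, c.
  have E f v : loc0 (mono F (invmx A) f) v <-> local (y j) c f v.
    by rewrite -hc -hx monoVK.
  have /choice [ab hab] i : exists ab : {mpoly K[r j]} * {mpoly K[r j]},
      ab.2.@[c] != 0 /\ chi F (row i A) = peval (y j) ab.1 / peval (y j) ab.2.
    have : local (y j) c (chi F (row i A)) 0.
      by apply/E; rewrite -mono_coord // monoK //; apply: (local_coord i (on_coord (fun=> 0))).
    by move=> [a [b [b0 aE _]]]; exists (a, b).
  exists (\prod_i (ab i).2); split=> //.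
    by rewrite rmorph_prod; apply/prodf_neq0 => i _; case: (hab i).
  move=> i; exists (ab i).1, (ab i).2; split; last by case: (hab i).
  by rewrite (bigD1 i) //=; exists (\prod_(k | k != i) (ab k).2); rewrite mulrC.
have /choice [s hs] j : exists s : seq 'M[int]_n, (forall A, A \in s -> chart Reg A) /\
    forall A (c : 'I_(r j) -> K) q, good j A c q -> exists2 A', A' \in s & exists z, forall f c,
      local (coord F) z f c <-> loc0 (mono F (A' *m invmx A) f) c.
  have [s sP sG] := noetherian_mpoly (@noetherian_field K) (fun q : {mpoly K[r j]} => exists A (c : 'I_(r j) -> K), good j A c q).
  have /choice [pick hpick] q : exists A, q \in s -> exists c : 'I_(r j) -> K, good j A c q.
    have [qs|nqs] := boolP (q \in s); last by exists 0.
    by have [A H] := sP _ qs; exists A.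
  exists [seq pick q | q <- s]; split=> [A /mapP[q qs ->]|A c q g].
    by have [c []] := hpick _ qs.
  have /sG : exists A (c : 'I_(r j) -> K), good j A c q by exists A, c.
  case: g => cA on E qc qi /ideal_gen_meval /(_ qc) [p ps pc].
  exists (pick p); first by apply/mapP; exists p.
  have [c' [cA' on' E' pc' pi]] := hpick _ ps; set A' := pick p in cA' E' pi *.
  have [uA hA] := cA; have [uA' hA'] := cA'.
  have uB : A' *m invmx A \in unitmx by rewrite unitmx_mul uA' unitmx_inv.
  have l0 := local_rel (on_coord (F := F) (fun=> 0)).
  have /choice [z hz] i : exists v, loc0 (chi F (row i A' *m invmx A)) v.
    have [a [b [[d dE] aE]]] := pi i; exists (a.@[c] / b.@[c]).
    rewrite -mono_chi ?unitmx_inv //; apply/E; exists a, b; split=> //; apply: contraNneq pc => b0.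
    by rewrite dE mevalM b0 mulr0.
  exists z; have [x hx] := hA (fun=> 0); have [x' hx'] := hA' z.
  have sub f v : local (coord F) z f v -> loc0 (mono F (A' *m invmx A) f) v.
    apply: (local_sub (pullback_rel (endo_cst _) l0)) => i.
    by rewrite -/(mono F _) mono_coord // row_mul.
  have xx : x' = x.
    apply: (tf_separated tf (V := Reg x)) => //; first exact: lr_val (tf_local tf x).
    move=> f v; rewrite -[f](monoVK uA') hx' => /sub.
    by rewrite monoVK // mono_comp ?unitmx_inv // mulKmx // -hx monoVK.
  move=> f v; split; first exact: sub.
  rewrite -hx' xx -hx => h; suff <- : mono F A (mono F (A' *m invmx A) f) = mono F A' f by [].
  by rewrite mono_comp // mulmxKV.
exists (flatten [seq s j | j <- enum 'I_m]).
  by move=> A /flattenP [_ /mapP[j _ ->]]; case: (hs j) => h _ /h.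
move=> A cA; have [j [c [q g]]] := goodE A cA.
have [A' A's hA'] := (hs j).2 _ _ _ g; exists A' => //.
by apply/flattenP; exists (s j) => //; apply: map_f; rewrite mem_enum.
Qed.

(** A boundary divisor is a coordinate hyperplane of a chart, hence passes through its origin, which
    lies in one of the finitely many selected charts. *)
Lemma finite_boundary : exists s : seq ('M[int]_n * 'I_n), 
  (forall Al, Al \in s -> chart Reg Al.1) /\
  forall w, divisor w -> (exists m, w (chi F m) != 0) ->
    exists2 Al, Al \in s & forall f, w f = order 'X_(Al.2) (mono F (invmx Al.1) f).
Proof.
have [s sc sP] := finite_charts; exists [seq (A, l) | A <- s, l <- enum 'I_n].
split=> [Al /allpairsP [[A l] [/= /sc cA _ ->]] //|w dw [m hm]].
have [A [q [cA pq wE]]] := dw; have [uA _] := cA.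
have [A' A's [z hz]] := sP A cA; have cA' := sc _ A's; have [uA' _] := cA'.
have [l hl] : exists l, forall f, order q f = order 'X_l f.
  by apply: (order_boundary (m := m *m invmx A) pq); rewrite -mono_chi ?unitmx_inv // -wE.
have [|p pp pE] := @divisor_chart A A' w cA cA'.
  exists (fun=> 0), z, 'X_l; split=> //; [exact: prime_X|by rewrite mevalXU|].
  by move=> f; rewrite wE hl.
have [l' hl'] : exists l, forall f, order p f = order 'X_l f.
  by apply: (order_boundary (m := m *m invmx A') pp); rewrite -mono_chi ?unitmx_inv // -pE.
exists (A', l'); last by move=> f; rewrite pE hl'.
by apply/allpairsP; exists (A', l'); rewrite mem_enum.
Qed.

End ToricDivisors.

(** Serves to remove repetitions: the same boundary divisor is visible in several charts. *)
Lemma distinct_family (T : Type) k (u : 'I_k -> T) : exists N (e : 'I_N -> 'I_k),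
  injective (u \o e) /\ forall i, exists j, u i = u (e j).
Proof.
elim: k u => [|k IH] u.
  by exists 0%N, id; split=> [|i]; [case|exists i].
have [N [e [einj ecov]]] := IH (u \o lift ord0).
have [[j jE]|H] := EM (exists j, u ord0 = u (lift ord0 (e j))).
  exists N, (lift ord0 \o e); split=> // i.
  have [i'|->] := unliftP ord0 i; last by exists j.
  by move=> ->; have [j' j'E] := ecov i'; exists j'.
exists N.+1, (fun i => if unlift ord0 i is Some j then lift ord0 (e j) else ord0).
split=> [i1 i2 /=|i].
  have [j1 ->|->] := unliftP ord0 i1; have [j2 ->|->] := unliftP ord0 i2 => //.
  - by move=> /einj ->.
  - by move=> E; case: H; exists j1.
  - by move=> E; case: H; exists j2.
have [i' ->|->] := unliftP ord0 i; last by exists ord0; rewrite unlift_none.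
by have [j' j'E] := ecov i'; exists (lift ord0 j'); rewrite liftK.
Qed.

(** * Homogeneous coordinates *)

Section TorusQuotient.
Variables (K : closedFieldType) (n N : nat) (F : frac_field {mpoly K[n]}).
Variables (FN : frac_field {mpoly K[N]}) (V : 'M[int]_(n, N)) (W : 'M[int]_(N, n)).
Hypothesis VW : V *m W = 1%:M.
Implicit Types (f g : F) (c : K).

(* The homomorphism of tori dual to V. *)
Definition piv (z : 'I_N -> K) : 'I_n -> K := fun j => chival z (row j V).

Lemma chival_scale r (z : 'I_r -> K) m (k : int) : chival z m ^ k = chival z (k *: m).
Proof.
rewrite /chival; elim/big_rec2: _ => [|i x y _ IH]; first by rewrite exp1rz.
by rewrite expfzMl IH mxE exprz_exp [k * _]mulrC.
Qed.

Lemma chival_comb r (z : 'I_r -> K) (I : Type) (s : seq I) (k : I -> int) (m : I -> 'rV[int]_r) :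
  (forall i, z i != 0) ->
  \prod_(i <- s) chival z (m i) ^ k i = chival z (\sum_(i <- s) k i *: m i).
Proof.
move=> z0; rewrite (big_morph (chival z) (fun a b => @chivalD _ _ z a b z0) (chival0 z)).
by apply: eq_bigr => i _; rewrite chival_scale.
Qed.

Lemma chi_comb r (L : frac_field {mpoly K[r]}) (I : Type) (s : seq I) (k : I -> int)
    (m : I -> 'rV[int]_r) :
  \prod_(i <- s) chi L (m i) ^ k i = chi L (\sum_(i <- s) k i *: m i).
Proof.
rewrite (big_morph (chi L) (@chiD _ _ L) (@chi0 _ _ L)).
apply: eq_bigr => i _; rewrite /chi; elim/big_rec2: _ => [|j x y _ IH]; first by rewrite exp1rz.
by rewrite expfzMl IH mxE exprz_exp [k i * _]mulrC.
Qed.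

Lemma piv_neq0 z : (forall i, z i != 0) -> forall j, piv z j != 0.
Proof. by move=> z0 j; apply: chival_neq0. Qed.

Lemma chival_piv z m : (forall i, z i != 0) -> chival (piv z) m = chival z (m *m V).
Proof. by move=> z0; rewrite mulmx_sum_row -chival_comb. Qed.

Lemma chivalM r (y z : 'I_r -> K) m : chival (fun i => y i * z i) m = chival y m * chival z m.
Proof. by rewrite /chival -big_split; apply: eq_bigr => i _; rewrite /= expfzMl. Qed.

Lemma pivM y z j : piv (fun i => y i * z i) j = piv y j * piv z j.
Proof. exact: chivalM. Qed.

(** The section of [piv] given by the right inverse [W] of [V]. *)
Definition pisec (c : 'I_n -> K) : 'I_N -> K := fun i => chival c (row i W).

Lemma pisec_neq0 (c : 'I_n -> K) : (forall i, c i != 0) -> forall j, pisec c j != 0.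
Proof. by move=> z0 j; apply: chival_neq0. Qed.

Lemma piv_sec (c : 'I_n -> K) : (forall j, c j != 0) -> piv (pisec c) =1 c.
Proof.
move=> c0 j; rewrite /piv /chival /pisec (chival_comb _ (fun i => row j V 0 i) (fun i => row i W)) //.
by rewrite -mulmx_sum_row -row_mul VW row1 chival_delta.
Qed.

Lemma alg_indep_quotient : alg_indep (fun j => chi FN (row j V)).
Proof.
move=> p p0; apply/eqP; apply: contraT => /torus_nonzero [z z0 pz].
have z'0 := pisec_neq0 z0; have on := on_coord (F := FN) (pisec z).
have := vr_peval (local_rel on) p (fun j => local_chi FN (row j V) z'0).
rewrite p0 => /(vr_0 (local_rel on)) h; case/eqP: pz; rewrite -[RHS]h.
by apply: meval_eq => j; rewrite -[LHS]piv_sec.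
Qed.

Definition pistar : {rmorphism F -> FN} := frac_lift (F := F) alg_indep_quotient.

Lemma pistar_emb p : pistar (ff_emb F p) = peval (fun j => chi FN (row j V)) p.
Proof. exact: frac_lift_emb. Qed.

Lemma pistar_cst c : pistar (cst F c) = cst FN c.
Proof. by rewrite /cst /= pistar_emb; apply: pevalC. Qed.

Lemma pistar_coord j : pistar (coord F j) = chi FN (row j V).
Proof. by rewrite pistar_emb pevalX. Qed.

Lemma pistar_chi m : pistar (chi F m) = chi FN (m *m V).
Proof.
rewrite mulmx_sum_row -chi_comb rmorph_prod; apply: eq_bigr => i _.
by rewrite fmorphXz /= pistar_coord.
Qed.

Lemma local_pistar z f c : (forall i, z i != 0) ->
  local (coord F) (piv z) f c -> local (coord FN) z (pistar f) c.
Proof.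
move=> z0 h; have lz := local_rel (on_coord (F := FN) z).
have lV : loc_rel (fun f c => local (coord FN) z (pistar f) c).
  split; first split.
  - by move=> d; rewrite pistar_cst; apply: (vr_cst lz).
  - by move=> g k d e hg hh; rewrite rmorphD; apply: (vr_add lz).
  - by move=> g k d e hg hh; rewrite rmorphM; apply: (vr_mul lz).
  - by move=> d; rewrite rmorph0; apply: (vr_0 lz).
  - by move=> g d hg d0; rewrite fmorphV; apply: lr_inv.
by apply: (local_sub lV _ h) => j; rewrite pistar_coord; apply: local_chi.
Qed.

(** The pullback of [D] is a nonzero fraction a / b, and a nonzero [p] would have a point of the
    torus with p, a and b all nonzero. *)
Lemma piv_dense (D : {mpoly K[n]}) (p : {mpoly K[N]}) : D != 0 ->
  (forall z, (forall i, z i != 0) -> D.@[piv z] != 0 -> p.@[z] = 0) -> p = 0.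
Proof.
move=> D0 H; apply/eqP; apply: contraT => p0.
have [a [b [b0 abE]]] := ff_frac (pistar (ff_emb F D)).
have a0 : a != 0.
  have : pistar (ff_emb F D) != 0 by rewrite fmorph_eq0 emb_eq0.
  by apply: contraNneq => a0; rewrite abE a0 rmorph0 mul0r.
have [z z0] := torus_nonzero (mulf_neq0 p0 (mulf_neq0 a0 b0)).
rewrite !rmorphM !mulf_eq0 !negb_or => /and3P[pz az bz].
have lz := local_rel (on_coord (F := FN) z).
have h1 := local_pistar z0 (local_emb F (piv z) D).
have h2 : local (coord FN) z (pistar (ff_emb F D)) (a.@[z] / b.@[z]).
  by rewrite abE; apply: (lr_div lz) => //; apply: local_emb.
have Dz : D.@[piv z] != 0 by rewrite (vr_uniq lz h1 h2) mulf_neq0 ?invr_eq0.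
by case/eqP: pz; apply: H.
Qed.

End TorusQuotient.

Section HomogeneousElements.
Variables (K : closedFieldType) (n : nat) (F : frac_field {mpoly K[n]}).
Implicit Types (f g h : F) (c : K).
Let facR : factorial_ring {mpoly K[n]} := @factorial_mpoly K n.
Variables (X : Type) (Reg : X -> F -> K -> Prop).
Hypothesis tf : toric_family Reg.
Hypothesis chart1 : chart Reg 1%:M.
Variables (N : nat) (FN : frac_field {mpoly K[N]}) (v : 'I_N -> F -> int).
Hypothesis v_inj : injective v.
Hypothesis v_chart : forall k, exists A l, chart Reg A /\
  forall f, v k f = order 'X_l (mono F (invmx A) f).
Hypothesis v_bd : forall w, divisor Reg w -> (exists m, w (chi F m) != 0) ->
  exists k, w = v k.

(** Column [k] is the generator of a ray of the fan: the valuation [v k] read on monomials. *)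
Definition rays : 'M[int]_(n, N) := \matrix_(j, k) v k (coord F j).
Local Notation V := rays.
Implicit Types (al be : 'rV[int]_N) (w : F -> int).

Lemma v_div k : divisor Reg (v k).
Proof. by have [A [l [cA vE]]] := v_chart k; exists A, 'X_l; split=> //; apply: prime_X. Qed.

Lemma v_chi k m : v k (chi F m) = (m *m V) 0 k.
Proof.
rewrite (divisor_chi m (v_div k)) mxE; apply: eq_bigr => j _.
by rewrite !mxE.
Qed.

Lemma v_nontrivial k : exists m, v k (chi F m) != 0.
Proof.
have [A [l [[uA _] vE]]] := v_chart k; exists (row l A).
by rewrite vE -mono_coord // monoK // order_X_coord eqxx.
Qed.

(** The chart with identity matrix has the coordinate hyperplanes as boundary, so the unit vectors
    occur among the rays. *)
Lemma rays_section : exists W, V *m W = 1%:M.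
Proof.
have /choice [k hk] j : exists k, order 'X_j = v k :> (F -> int).
  apply: v_bd; last by exists (delta_mx 0 j); rewrite chi_delta order_X_coord eqxx.
  exists 1%:M, 'X_j; split=> // [|f]; first exact: prime_X.
  by rewrite invmx1 mono1.
exists (\matrix_(i, j) (i == k j)%:R); apply/matrixP => i j; rewrite !mxE (bigD1 (k j)) //= big1.
  by rewrite !mxE eqxx mulr1 addr0 -hk order_X_coord eq_sym; case: (i == j).
by move=> l lk; rewrite !mxE (negbTE lk) mulr0.
Qed.

Variable W : 'M[int]_(N, n).
Hypothesis VW : V *m W = 1%:M.
Local Notation pst := (pistar F FN VW).

Definition ext w al : int := \sum_k al 0 k *+ `[< w = v k >].
(* hom_elt al h is the homogeneous rational function x^al h(piv x), and hdiv its
   divisor: the k-th coordinate contributes at the boundary divisor v k. *)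
Definition hom_elt al h : FN := chi FN al * pst h.
Definition hdiv w al h : int := w h + ext w al.

Lemma extE k al : ext (v k) al = al 0 k.
Proof.
rewrite /ext (bigD1 k) //= asboolT // big1 ?addr0 // => i ik.
by rewrite asboolF // => /v_inj E; rewrite E eqxx in ik.
Qed.

Lemma ext0 w al : (forall k, w <> v k) -> ext w al = 0.
Proof. by move=> H; rewrite /ext big1 // => k _; rewrite asboolF. Qed.

Lemma extD w al be : ext w (al + be) = ext w al + ext w be.
Proof. by rewrite /ext -big_split; apply: eq_bigr => k _; rewrite /= mxE mulrnDl. Qed.

Lemma extN w al : ext w (- al) = - ext w al.
Proof. by rewrite /ext -sumrN; apply: eq_bigr => k _; rewrite /= mxE mulNrn. Qed.

Lemma extZ w (e : int) al : ext w (e *: al) = e * ext w al.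
Proof. by rewrite /ext mulr_sumr; apply: eq_bigr => k _; rewrite /= mxE mulrnAr. Qed.

Lemma ext_sum w (I : Type) (s : seq I) (al : I -> 'rV[int]_N) :
  ext w (\sum_(i <- s) al i) = \sum_(i <- s) ext w (al i).
Proof.
elim: s => [|i s IH]; last by rewrite !big_cons extD IH.
by rewrite !big_nil /ext big1 // => k _; rewrite mxE mul0rn.
Qed.

Lemma hom_neq0 al h : h != 0 -> hom_elt al h != 0.
Proof. by move=> h0; rewrite mulf_neq0 ?chi_neq0 // fmorph_eq0. Qed.

Lemma homM al be f h : hom_elt (al + be) (f * h) = hom_elt al f * hom_elt be h.
Proof. by rewrite /hom_elt chiD rmorphM mulrACA. Qed.

Lemma homV al h : hom_elt (- al) h^-1 = (hom_elt al h)^-1.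
Proof. by rewrite /hom_elt chiN fmorphV invfM. Qed.

Lemma hom_prod (I : Type) (s : seq I) (al : I -> 'rV[int]_N) (h : I -> F) (e : I -> int) :
  hom_elt (\sum_(i <- s) e i *: al i) (\prod_(i <- s) h i ^ e i) = \prod_(i <- s) hom_elt (al i) (h i) ^ e i.
Proof.
rewrite /hom_elt -chi_comb rmorph_prod -big_split; apply: eq_bigr => i _ /=.
by rewrite fmorphXz expfzMl.
Qed.

Lemma hdivM w al be f h : divisor Reg w -> f != 0 -> h != 0 ->
  hdiv w (al + be) (f * h) = hdiv w al f + hdiv w be h.
Proof. by move=> dw f0 h0; rewrite /hdiv (divisor_mul dw) // extD addrACA. Qed.

Lemma hdivV w al h : divisor Reg w -> h != 0 -> hdiv w (- al) h^-1 = - hdiv w al h.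
Proof. by move=> dw h0; rewrite /hdiv (divisor_inv dw) // extN opprD. Qed.

Lemma hdiv_prod w (I : Type) (s : seq I) (al : I -> 'rV[int]_N) (h : I -> F) (e : I -> int) :
  divisor Reg w -> (forall i, h i != 0) ->
  hdiv w (\sum_(i <- s) e i *: al i) (\prod_(i <- s) h i ^ e i) =
  \sum_(i <- s) e i * hdiv w (al i) (h i).
Proof.
move=> dw h0; rewrite /hdiv ext_sum (divisor_prod _ dw) => [|i]; last exact: expfz_neq0 (h0 i).
rewrite -big_split; apply: eq_bigr => i _ /=.
by rewrite (divisor_expz _ dw (h0 i)) extZ mulrDr.
Qed.

(** Without poles off the boundary, [h] is a Laurent polynomial. Along the k-th boundary divisor the
    order is at most each exponent of the k-th variable, so these exponents are nonnegative. *)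
Lemma hom_poly al h : h != 0 -> (forall w, divisor Reg w -> 0 <= hdiv w al h) ->
  exists P, hom_elt al h = ff_emb FN P /\
    forall m, m \in msupp P -> exists m', mexp m = al + m' *m V.
Proof.
move=> h0 H; have [q pq qm|m0 [p hE]] := laurent_form h0.
  have dq : divisor Reg (order q).
    by exists 1%:M, q; split=> // f; rewrite invmx1 mono1.
  have := H _ dq; rewrite /hdiv ext0 ?addr0 // => k qk.
  by have [m] := v_nontrivial k; rewrite -qk qm eqxx.
have p0 : p != 0 by apply: contra_neq h0 => p0; rewrite hE p0 rmorph0 mulr0.
pose e (m : 'X_{1..n}) := al + m0 *m V + mexp m *m V.
have eE m k : e m 0 k = al 0 k + (m0 *m V) 0 k + (mexp m *m V) 0 k.
  by rewrite /e [LHS]mxE; congr (_ + _); rewrite mxE.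
have epos m k : m \in msupp p -> 0 <= e m 0 k.
  move=> mp; have := H _ (v_div k); rewrite /hdiv extE hE (divisor_mul (v_div k)) ?chi_neq0 ?emb_eq0 //.
  rewrite v_chi eE; have [A [l [[uA _] vE]]] := v_chart k.
  have uA' : invmx A \in unitmx by rewrite unitmx_inv.
  have := order_X_laurent F l uA' mp; rewrite -vE.
  have -> : (mexp m *m invmx A) 0 l = (mexp m *m V) 0 k.
    by rewrite -v_chi vE mono_chi // order_X_chi.
  move: (v k _) (al 0 k) ((m0 *m V) 0 k) ((mexp m *m V) 0 k) => x1 x2 x3 x4; lia.
pose P : {mpoly K[N]} := \sum_(m <- msupp p) p@_m *: 'X_[[multinom absz (e m 0 k)%R | k < N]].
exists P; split=> [|m].
  rewrite /hom_elt hE rmorphM /= pistar_chi mulrA -chiD [in LHS](mpolyE p) !rmorph_sum mulr_sumr.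
  rewrite [LHS]big_seq [RHS]big_seq; apply: eq_bigr => m mp.
  rewrite -!mul_mpolyC !rmorphM /= -!chi_mexp pistar_chi mulrCA -chiD.
  congr (_ * chi _ _); first exact: (pistar_cst F FN VW).
  by apply/rowP => k; rewrite [RHS]mxE mnmE gez0_abs ?epos.
move=> mP; have /hasP [m' m'p] : has (fun m' => m == [multinom absz (e m' 0 k)%R | k < N]) (msupp p).
  apply: contraLR mP => /hasPn H'; rewrite mcoeff_msupp negbK raddf_sum big_seq big1 // => m' m'p.
  by rewrite /= mcoeffZ mcoeffX eq_sym (negbTE (H' _ m'p)) mulr0.
move=> /eqP ->; exists (m0 + mexp m'); rewrite mulmxDl addrA; apply/rowP => k.
by rewrite [LHS]mxE mnmE gez0_abs ?epos.
Qed.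

(** The element and its inverse are both polynomials. Its degree is a character of the quotient
    torus because the exponent 0 occurs. *)
Lemma hom_const al h : h != 0 -> (forall w, divisor Reg w -> hdiv w al h = 0) ->
  (exists2 c, c != 0 & hom_elt al h = cst FN c) /\ exists m, al = m *m V.
Proof.
move=> h0 H; have [|P [PE PV]] := @hom_poly al h h0; first by move=> w /H ->.
have [||Q [QE _]] := @hom_poly (- al) h^-1; first by rewrite invr_neq0.
  by move=> w dw; rewrite hdivV // H ?oppr0.
have : divides P 1.
  exists Q; apply: (@emb_inj _ FN); rewrite rmorphM -PE -QE homV mulVf ?hom_neq0 //.
  by rewrite rmorph1.
move=> /mpoly_dvd1 [c c0 Pc]; split; first by exists c => //; rewrite PE Pc.
have [|m mE] := PV 0%MM; first by rewrite Pc mcoeff_msupp mcoeffC eqxx mulr1.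
exists (- m); rewrite mulNmx; apply/eqP; rewrite -addr_eq0 -mE.
by apply/eqP/rowP => k; rewrite !mxE mnm0E.
Qed.

Lemma hom_eq al be f h : f != 0 -> h != 0 ->
  (forall w, divisor Reg w -> hdiv w al f = hdiv w be h) ->
  (exists2 c, c != 0 & hom_elt al f = cst FN c * hom_elt be h) /\ exists m, al = be + m *m V.
Proof.
move=> f0 h0 H; have [||[c c0 E] [m mE]] := @hom_const (al - be) (f / h).
- by rewrite mulf_neq0 ?invr_eq0.
- by move=> w dw; rewrite hdivM ?invr_neq0 // hdivV // H // subrr.
split; last by exists m; rewrite -mE addrC subrK.
by exists c => //; rewrite -E homM homV divfK ?hom_neq0.
Qed.

(** A boundary divisor is cut out by its own variable. Any other divisor has a prime equation [p] in
    the chart with identity matrix, and the orders of [p] along the boundary are compensated by a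
    monomial. *)
Lemma hom_prime w : divisor Reg w -> exists al h, h != 0 /\
  forall w', divisor Reg w' -> hdiv w' al h = `[< w' = w >].
Proof.
move=> dw; have [[k ->]|/forallNP nk] := EM (exists k, w = v k).
  exists (delta_mx 0 k), 1; split; first exact: oner_neq0.
  move=> w' dw'; rewrite /hdiv (divisor1 dw') add0r /ext (bigD1 k) //= mxE !eqxx big1 ?addr0.
    by case: asboolP.
  by move=> i ik; rewrite mxE (negbTE ik) andbF mul0rn.
have bd u : divisor Reg u -> (forall k, u <> v k) -> forall m, u (chi F m) = 0.
  move=> du uk m; apply/eqP; apply: contrapT => /negP h.
  by have [|k /uk] := v_bd du; first by exists m.
have interior u : divisor Reg u -> (forall k, u <> v k) ->
    exists2 p, prime_elt p & u = order p.
  move=> du uk; have [p pp pE] := divisor_interior chart1 du (bd u du uk).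
  by exists p => //; apply/funext => f; rewrite pE invmx1 mono1.
have [p pp wE] := interior _ dw nk.
exists (- \row_k v k (ff_emb F p)), (ff_emb F p); split; first by rewrite emb_eq0; case: pp.
move=> w' dw'; rewrite /hdiv.
have [[k ->]|/forallNP nk'] := EM (exists k, w' = v k).
  rewrite extE !mxE subrr asboolF // => E; exact: nk (esym E).
rewrite ext0 // addr0; case: asboolP => [->|ww].
  by rewrite wE (order_self F pp).
have [p' pp' w'E] := interior _ dw' nk'; rewrite w'E.
apply: (order_ndvd F pp') => p'p; apply: ww; rewrite wE w'E; apply/funext => f.
exact: (@order_assoc _ F facR p' p f pp' pp p'p).
Qed.

End HomogeneousElements.

(** * Lifts of a group action to homogeneous coordinates *)

Definition inker (K : closedFieldType) n N (V : 'M[int]_(n, N)) (s : 'I_N -> K) :=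
  (forall i, s i != 0) /\ forall j, piv V s j = 1.

(* The action of a finite group on X lifted to homogeneous coordinates.  The torus of
   dimension N acts on affine N-space, piv V is its quotient by ker (piv V), and the
   polynomial self-maps P a lift the group elements, only up to that kernel. *)
Record cox_system (K : closedFieldType) n (F : frac_field {mpoly K[n]}) (gT : finGroupType)
    (st : gT -> {rmorphism F -> F}) N (V : 'M[int]_(n, N)) (W : 'M[int]_(N, n))
    (P : gT -> 'I_N -> {mpoly K[N]}) (al : gT -> 'I_N -> 'rV[int]_N) (d : 'I_N -> nat) : Prop :=
  CoxSystem {
    cs_split : V *m W = 1%:M;
    cs_geom : forall a, exists2 D : {mpoly K[n]}, D != 0 & forall z, (forall i, z i != 0) ->
      D.@[piv V z] != 0 -> (forall i, (P a i).@[z] != 0) /\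
      forall j, local (coord F) (piv V z) (st a (coord F j)) (piv V (fun i => (P a i).@[z]) j);
    cs_comp : forall a b, exists2 ga, inker V ga & forall z i,
      (P b i).@[fun k => (P a k).@[z]] = ga i * (P (a * b)%g i).@[z];
    cs_equiv : forall a s, inker V s -> inker V (fun i => chival s (al a i)) /\
      forall z i, (P a i).@[fun k => s k * z k] = chival s (al a i) * (P a i).@[z];
    cs_weight : forall a i m, m \in msupp (P a i) -> (\sum_k m k * d k)%N = d i;
    cs_pos : forall i, (0 < d i)%N }.

Lemma chival1 (K : fieldType) n (m : 'rV[int]_n) :
  \prod_i (1 : K) ^ m 0 i = 1.
Proof. by rewrite big1 // => i _; rewrite exp1rz. Qed.

Section CoxConstruction.
Variables (K : closedFieldType) (n : nat) (F : frac_field {mpoly K[n]}).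
Implicit Types (f g h : F) (c : K).
Let facR : factorial_ring {mpoly K[n]} := @factorial_mpoly K n.
Variables (X : Type) (Reg : X -> F -> K -> Prop).
Hypothesis tf : toric_family Reg.
Hypothesis chart1 : chart Reg 1%:M.
Variables (N : nat) (FN : frac_field {mpoly K[N]}) (v : 'I_N -> F -> int).
Hypothesis v_inj : injective v.
Hypothesis v_chart : forall k, exists A l, chart Reg A /\
  forall f, v k f = order 'X_l (mono F (invmx A) f).
Hypothesis v_bd : forall w, divisor Reg w -> (exists m, w (chi F m) != 0) ->
  exists k, w = v k.
Variables (gT : finGroupType) (st : gT -> {rmorphism F -> F}).
Hypothesis st_cst : forall a c, st a (cst F c) = cst F c.
Hypothesis st1 : forall f, st 1%g f = f.
Hypothesis stM : forall a b f, st (a * b)%g f = st a (st b f).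
Hypothesis stR : forall a x, exists x', forall f c, Reg x' f c <-> Reg x (st a f) c.
Local Notation V := (rays v).
Variable W : 'M[int]_(N, n).
Hypothesis VW : V *m W = 1%:M.
Local Notation pst := (pistar F FN VW).
Local Notation hom := (hom_elt FN VW).
Implicit Types (w : F -> int) (a b : gT).

Let stK a : cancel (st a) (st a^-1%g).
Proof. by move=> f; rewrite -stM mulVg st1. Qed.
Let stKV a : cancel (st a^-1%g) (st a).
Proof. by move=> f; rewrite -stM mulgV st1. Qed.

Let st_div a w : divisor Reg w -> divisor Reg (w \o st a).
Proof.
move=> dw; apply: (divisor_pullback tf (st_cst a) _ (stR a) dw) => f.
by exists (st a^-1%g f); rewrite stKV.
Qed.

Let rayg a i : F -> int := v i \o st a^-1%g.

Let raygE a b i w : (w = rayg (a * b)%g i) <-> (w \o st a = rayg b i).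
Proof.
split=> [->|E]; apply/funext => f.
  by rewrite /rayg /= invMg stM stK.
have := congr1 (fun u : F -> int => u (st a^-1%g f)) E.
by rewrite /rayg /= stKV invMg stM.
Qed.

Let ray1 i : rayg 1%g i = v i.
Proof. by apply/funext => f; rewrite /rayg /= invg1 st1. Qed.

Let raygV a i w : (w = rayg a i) <-> (w \o st a = v i).
Proof. by rewrite -{1}(mulg1 a) raygE ray1. Qed.

Let vk_div k : divisor Reg (v k) := v_div v_chart k.

Let pairs_exist : exists ah : gT -> 'I_N -> 'rV[int]_N * F, forall a i, (ah a i).2 != 0 /\
  forall w, divisor Reg w -> hdiv v w (ah a i).1 (ah a i).2 = `[< w = rayg a i >].
Proof.
have H (ai : gT * 'I_N) : exists ah : 'rV[int]_N * F, ah.2 != 0 /\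
    forall w, divisor Reg w -> hdiv v w ah.1 ah.2 = `[< w = rayg ai.1 ai.2 >].
  have [al [h H]] := hom_prime chart1 v_inj v_bd (st_div ai.1^-1%g (vk_div ai.2)).
  by exists (al, h).
have [ah hah] := choice H.
by exists (fun a i => ah (a, i)) => a i; apply: hah (a, i).
Qed.

Lemma nonzero_dense f : f != 0 -> exists2 D : {mpoly K[n]}, D != 0 & forall t, D.@[t] != 0 ->
  exists2 c, c != 0 & local (coord F) t f c.
Proof.
have [p [q [q0 ->]]] := ff_frac f => f0.
have p0 : p != 0 by apply: contra_neq f0 => ->; rewrite rmorph0 mul0r.
exists (p * q); first by rewrite mulf_neq0.
move=> t; rewrite mevalM mulf_eq0 negb_or => /andP[pt qt].
exists (p.@[t] / q.@[t]); first by rewrite mulf_neq0 ?invr_eq0.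
by exists p, q; rewrite !peval_coord.
Qed.

Lemma nonzero_dense_family (I : finType) (f : I -> F) : (forall i, f i != 0) ->
  exists2 D : {mpoly K[n]}, D != 0 & forall t, D.@[t] != 0 ->
  forall i, exists2 c, c != 0 & local (coord F) t (f i) c.
Proof.
move=> f0; have /choice [D hD] i : exists D : {mpoly K[n]}, D != 0 /\
    forall t, D.@[t] != 0 -> exists2 c, c != 0 & local (coord F) t (f i) c.
  by have [D] := nonzero_dense (f0 i); exists D.
exists (\prod_i D i); first by apply/prodf_neq0 => i _; case: (hD i).
move=> t; rewrite rmorph_prod => /prodf_neq0 Dt i.
by case: (hD i) => _; apply; apply: Dt.
Qed.

(** The opposite of ray [i] lies in the cone of some chart, so ray [i] plus a nonnegative
    combination of the rays of that cone is 0. *)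
Lemma positive_relation i : exists r : 'cV[int]_N,
  [/\ V *m r = 0, forall k, 0 <= r k 0 & 1 <= r i 0].
Proof.
have [A cA Ala] := chart_exists (- col i V) tf; have [uA _] := cA.
have /choice [k hk] l : exists k, (fun f => order 'X_l (mono F (invmx A) f)) = v k.
  apply: v_bd; last first.
    by exists (row l A); rewrite -mono_coord // monoK // order_X_coord eqxx.
  by exists A, 'X_l; split=> //; apply: prime_X.
have Vk l : V *m delta_mx (k l) 0 = col l (invmx A).
  rewrite -colE; apply/colP => j; rewrite !mxE -hk mono_coord ?unitmx_inv //.
  by rewrite order_X_chi mxE.
exists (delta_mx i 0 + \sum_l (A *m - col i V) l 0 *: delta_mx (k l) 0); split.
- rewrite mulmxDr -colE mulmx_sumr -[RHS](subrr (col i V)) -[- col i V](mulKmx uA).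
  congr (_ + _); apply/colP => j; rewrite summxE [RHS]mxE; apply: eq_bigr => l _.
  by rewrite -scalemxAr Vk mxE [col l _ _ _]mxE mulrC mulKmx.
- move=> l; rewrite mxE summxE; apply: addr_ge0; first by rewrite mxE; case: (_ && _).
  by apply: sumr_ge0 => j _; rewrite mxE mulr_ge0 // mxE; case: (_ && _).
- rewrite mxE summxE mxE !eqxx lerDl; apply: sumr_ge0 => j _.
  by rewrite mxE mulr_ge0 // mxE; case: (_ && _).
Qed.

Lemma positive_weight : exists2 r : 'cV[int]_N, V *m r = 0 & forall i, 1 <= r i 0.
Proof.
have /choice [r hr] := positive_relation; exists (\sum_i r i).
  by rewrite mulmx_sumr big1 // => i _; case: (hr i).
move=> i; rewrite summxE (bigD1 i) //=; case: (hr i) => _ _ h1.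
rewrite -[1]addr0 lerD //; apply: sumr_ge0 => j _.
by case: (hr j).
Qed.

(* The divisors of the components of P a are the translates of the boundary divisors;
   everything else follows since an element with trivial divisor is constant.  The
   weights come from a positive relation between the rays, averaged over the group. *)
Theorem cox_construction : exists P al d, cox_system st V W P al d.
Proof.
have [ah hah] := pairs_exist.
pose al a i := (ah a i).1; pose h a i := (ah a i).2.
have h0 a i : h a i != 0 by case: (hah a i).
have hE a i w : divisor Reg w -> hdiv v w (al a i) (h a i) = `[< w = rayg a i >].
  by case: (hah a i) => _; apply.
have /choice [P0' hP0'] (ai : gT * 'I_N) : exists P, hom (al ai.1 ai.2) (h ai.1 ai.2) = ff_emb FN P /\
    forall m, m \in msupp P -> exists m', mexp m = al ai.1 ai.2 + m' *m V.
  by apply: (hom_poly chart1 FN v_inj v_chart VW) => // w dw; rewrite hE //; case: asboolP.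
pose P0 a i := P0' (a, i).
have P0E a i : hom (al a i) (h a i) = ff_emb FN (P0 a i) := (hP0' (a, i)).1.
have P0V a i m : m \in msupp (P0 a i) -> exists m', mexp m = al a i + m' *m V := (hP0' (a, i)).2 m.
have P0n a i : P0 a i != 0 by rewrite -(emb_eq0 FN) -P0E hom_neq0.
have sumE a w (be : 'rV[int]_N) : \sum_k be 0 k * (`[< w = rayg a k >] : int) = ext v (w \o st a) be.
  apply: eq_bigr => k _; rewrite -[in RHS](mulr_natr _ (asbool _)).
  congr (_ * _); rewrite natz; congr Posz; congr nat_of_bool.
  by apply/asboolP/asboolP => /raygV.
(* The transported coordinate and the product of powers of the [P0 a i] have the same divisor, so
   they differ by a constant and their degrees by a character of the quotient. *)
have L1 a j : (exists2 c, c != 0 & pst (st a (coord F j)) =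
      cst FN c * \prod_i ff_emb FN (P0 a i) ^ V j i) /\
    exists m, \sum_i V j i *: al a i = m *m V.
  have [|||[c c0 cE] [m mE]] := hom_eq chart1 FN v_inj v_chart VW (al := 0)
    (be := \sum_i V j i *: al a i) (f := st a (coord F j)) (h := \prod_i h a i ^ V j i).
  - by rewrite fmorph_eq0 coord_neq0.
  - by apply/prodf_neq0 => i _; rewrite expfz_neq0.
  - move=> w dw; rewrite (hdiv_prod _ _ _ _ dw) //.
    rewrite (eq_bigr (fun i => (row j V) 0 i * (`[< w = rayg a i >] : int))); last first.
      by move=> i _; rewrite hE // [row j V _ _]mxE.
    have -> : hdiv v w 0 (st a (coord F j)) = (w \o st a) (coord F j).
      by rewrite /hdiv /ext big1 ?addr0 // => k _; rewrite mxE mul0rn.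
    rewrite sumE; have [[k wk]|/forallNP nk] := EM (exists k, w \o st a = v k).
      by rewrite wk (extE v_inj) !mxE.
    rewrite (ext0 _ nk); apply/eqP; apply: contrapT => /negP hn.
    have [|k /nk //] := v_bd (st_div a dw).
    by exists (delta_mx 0 j); rewrite chi_delta.
  split; first exists c => //.
    rewrite -(eq_bigr _ (fun i _ => congr1 (fun x => x ^ V j i) (P0E a i))) -hom_prod -cE.
    by rewrite /hom_elt chi0 mul1r.
  exists (- m); rewrite mulNmx; apply/eqP; rewrite -addr_eq0; apply/eqP; exact: esym mE.
have /choice [cc hcc] (aj : gT * 'I_n) : exists c, c != 0 /\ pst (st aj.1 (coord F aj.2)) =
    cst FN c * \prod_i ff_emb FN (P0 aj.1 i) ^ V aj.2 i.
  by have [[c c0 cE] _] := L1 aj.1 aj.2; exists c.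
pose c1 a j := cc (a, j).
have c10 a j : c1 a j != 0 by case: (hcc (a, j)).
have c1E a j : pst (st a (coord F j)) = cst FN (c1 a j) * \prod_i ff_emb FN (P0 a i) ^ V j i.
  by case: (hcc (a, j)).
(* Rescaling by the section of the constants [c1 a] absorbs them, as [Pst] records. *)
pose la a := pisec W (c1 a); have la0 a i : la a i != 0 by apply: pisec_neq0.
pose P a i := la a i *: P0 a i.
have PE a i z : (P a i).@[z] = la a i * (P0 a i).@[z] by rewrite mevalZ.
have PV a i m : m \in msupp (P a i) -> exists m', mexp m = al a i + m' *m V.
  rewrite mcoeff_msupp mcoeffZ mulf_eq0 negb_or -mcoeff_msupp => /andP[_]; exact: P0V.
have PF a i : ff_emb FN (P a i) = cst FN (la a i) * ff_emb FN (P0 a i).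
  by rewrite /P -mul_mpolyC rmorphM.
have Pst a j : pst (st a (coord F j)) = \prod_i ff_emb FN (P a i) ^ V j i.
  rewrite c1E -(piv_sec VW (c10 a) j) /piv /chival [cst FN _]rmorph_prod -big_split.
  apply: eq_bigr => i _; rewrite PF expfzMl [row j V _ _]mxE; congr (_ * _).
  exact: (fmorphXz (cst FN)).
have lz z := local_rel (on_coord (F := FN) z).
have lF t := local_rel (on_coord (F := F) t).
have P0val a i z c : (forall k, z k != 0) -> local (coord F) (piv V z) (h a i) c ->
    (P0 a i).@[z] = chival z (al a i) * c.
  move=> z0 hc; apply: (vr_uniq (lz z) (local_emb FN z (P0 a i))); rewrite -P0E.
  by apply: (vr_mul (lz z)); [exact: local_chi|exact: local_pistar].
have geom a : exists2 D : {mpoly K[n]}, D != 0 & forall z, (forall i, z i != 0) ->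
    D.@[piv V z] != 0 -> [/\ forall i, exists2 c, c != 0 & local (coord F) (piv V z) (h a i) c,
      forall i, (P a i).@[z] != 0 &
      forall j, local (coord F) (piv V z) (st a (coord F j)) (piv V (fun i => (P a i).@[z]) j)].
  have [D1 D10 HD1] := nonzero_dense_family (h0 a).
  have [|D2 D20 HD2] := @nonzero_dense_family _ (fun j => st a (coord F j)).
    by move=> j; rewrite fmorph_eq0 coord_neq0.
  exists (D1 * D2); first exact: mulf_neq0.
  move=> z z0; rewrite mevalM mulf_eq0 negb_or => /andP[/HD1 H1 /HD2 H2].
  have Pz i : (P a i).@[z] != 0.
    have [c c0 hc] := H1 i; rewrite PE (P0val _ _ _ _ z0 hc).
    by rewrite !mulf_neq0 ?chival_neq0.
  split=> // j; have [c c0 hc] := H2 j.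
  have := local_pistar FN VW z0 hc; rewrite Pst => h1.
  have h2 : local (coord FN) z (\prod_i ff_emb FN (P a i) ^ V j i) (piv V (fun i => (P a i).@[z]) j).
    apply: (vr_prod (lz z)) => i; rewrite [row j V _ _]mxE; apply: lr_expz => //; exact: local_emb.
  by rewrite -(vr_uniq (lz z) h1 h2).
have transport a z f c : (forall j, local (coord F) (piv V z) (st a (coord F j)) (piv V (fun i => (P a i).@[z]) j)) ->
    local (coord F) (piv V (fun i => (P a i).@[z])) f c -> local (coord F) (piv V z) (st a f) c.
  move=> H hc; apply: (local_sub (pullback_rel (st_cst a) (lF _)) _ hc) => j; exact: H.
(* Both sides have the translate of the i-th boundary divisor by a b as their divisor. *)
have alM a b i : (exists2 c, c != 0 &
      \prod_k ff_emb FN (P0 a k) ^ (al b i) 0 k * pst (st a (h b i)) =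
      cst FN c * ff_emb FN (P0 (a * b)%g i)) /\
    exists m, \sum_k (al b i) 0 k *: al a k = al (a * b)%g i + m *m V.
  have [|||[c c0 cE] [m mE]] := hom_eq chart1 FN v_inj v_chart VW
    (al := \sum_k (al b i) 0 k *: al a k + 0) (be := al (a * b)%g i)
    (f := \prod_k h a k ^ (al b i) 0 k * st a (h b i)) (h := h (a * b)%g i).
  - rewrite mulf_neq0 ?fmorph_eq0 //; apply/prodf_neq0 => k _; exact: expfz_neq0.
  - by [].
  - move=> w dw; rewrite (hdivM _ _ _ dw) ?fmorph_eq0 //; last first.
      by apply/prodf_neq0 => k _; exact: expfz_neq0.
    rewrite (hdiv_prod _ _ _ _ dw) // hE //.
    rewrite (eq_bigr (fun k => (al b i) 0 k * (`[< w = rayg a k >] : int))); last first.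
      by move=> k _; rewrite hE.
    rewrite sumE addrC.
    have -> : hdiv v w 0 (st a (h b i)) = (w \o st a) (h b i).
      by rewrite /hdiv /ext big1 ?addr0 // => k _; rewrite mxE mul0rn.
    rewrite -/(hdiv v (w \o st a) (al b i) (h b i)) hE; last exact: st_div.
    by congr Posz; congr nat_of_bool; apply/asboolP/asboolP => /raygE.
  split; last by exists m; rewrite -mE addr0.
  exists c => //; rewrite -P0E -cE homM hom_prod; congr (_ * _).
    by apply: eq_bigr => k _; rewrite P0E.
  by rewrite /hom_elt chi0 mul1r.
have [r Vr rpos] := positive_weight.
have al1 i : exists m, al 1%g i = delta_mx 0 i + m *m V.
  have [|||_ //] := hom_eq chart1 FN v_inj v_chart VW
    (al := al 1%g i) (be := delta_mx 0 i) (f := h 1%g i) (h := 1).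
  - by [].
  - exact: oner_neq0.
  - move=> w dw; rewrite hE // ray1 /hdiv (divisor1 dw) add0r /ext (bigD1 i) //= mxE !eqxx.
    rewrite big1 ?addr0 => [|k ki]; last by rewrite mxE (negbTE ki) andbF mul0rn.
    by case: asboolP.
(* Summing over the group the degrees that the relation [r] gives to the lifts yields weights for
   which component i of every lift has the weight of variable i. All terms are nonnegative and the
   one for a = 1 is at least 1. *)
pose dbar : 'cV[int]_N := \col_i \sum_a (al a i *m r) 0 0.
have rV m : (m *m V) *m r = 0 by rewrite -mulmxA Vr mulmx0.
have Vd : V *m dbar = 0.
  apply/colP => j; rewrite !mxE.
  have -> : \sum_i V j i * dbar i 0 = \sum_a ((\sum_i V j i *: al a i) *m r) 0 0.
    under eq_bigr => i _ do rewrite [dbar i 0]mxE mulr_sumr.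
    rewrite exchange_big; apply: eq_bigr => a _; rewrite mulmx_suml summxE.
    by apply: eq_bigr => i _; rewrite -scalemxAl [RHS]mxE.
  by rewrite big1 // => a _; have [_ [m ->]] := L1 a j; rewrite rV mxE.
have dV m : (m *m V) *m dbar = 0 by rewrite -mulmxA Vd mulmx0.
have ald b i : (al b i *m dbar) 0 0 = dbar i 0.
  rewrite [LHS]mxE [RHS]mxE (reindex_inj (mulIg b)) /=.
  under eq_bigr => k _ do rewrite [dbar k 0]mxE mulr_sumr.
  rewrite exchange_big; apply: eq_bigr => a _ /=.
  have [_ [m mE]] := alM a b i.
  transitivity (((\sum_k (al b i) 0 k *: al a k) *m r) 0 0); last first.
    by rewrite mE mulmxDl rV addr0.
  by rewrite mulmx_suml summxE; apply: eq_bigr => k _; rewrite -scalemxAl [RHS]mxE.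
have dpos i : 1 <= dbar i 0.
  rewrite mxE (bigD1 1%g) //= -[1]addr0 lerD //.
    by have [m ->] := al1 i; rewrite mulmxDl rV addr0 -rowE mxE.
  apply: sumr_ge0 => a _; have : msupp (P0 a i) != [::] by rewrite msupp_eq0.
  case: msupp (P0V a i) => // m s /(_ m (mem_head _ _)) [m' mE] _.
  have -> : (al a i *m r) 0 0 = (mexp m *m r) 0 0 by rewrite mE mulmxDl rV addr0.
  rewrite mxE; apply: sumr_ge0 => k _; rewrite mulr_ge0 //; first by rewrite mxE.
  by apply: le_trans (rpos k).
exists P, al, (fun i => absz (dbar i 0)); split => //.
- by move=> a; have [D D0 HD] := geom a; exists D => // z z0 /(HD z z0) [].
- move=> a b; have [Da Da0 HDa] := geom a; have [Db Db0 HDb] := geom b.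
  have [Dc Dc0 HDc] := geom (a * b)%g.
  have [|De De0 HDe] := @nonzero_dense (st a (ff_emb F Db)).
    by rewrite fmorph_eq0 emb_eq0.
  have generic z : (forall k, z k != 0) -> (Da * (Dc * De)).@[piv V z] != 0 ->
      let y := fun k => (P a k).@[z] in [/\ forall k, y k != 0,
       forall j, local (coord F) (piv V z) (st a (coord F j)) (piv V y j),
       Db.@[piv V y] != 0 & Dc.@[piv V z] != 0].
    move=> z0; rewrite !mevalM !mulf_eq0 !negb_or => /and3P[/(HDa z z0) [_ ay aj] cz /HDe [c c0 hc]].
    split=> //.
    have := transport _ _ _ _ aj (local_emb F _ Db).
    by move=> /(vr_uniq (lF _) hc) <-.
  have D0 : Da * (Dc * De) != 0 by rewrite !mulf_neq0.
  have /choice [c hc] i : exists c, c != 0 /\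
      \prod_k ff_emb FN (P0 a k) ^ (al b i) 0 k * pst (st a (h b i)) =
      cst FN c * ff_emb FN (P0 (a * b)%g i).
    by have [[c c0 cE] _] := alM a b i; exists c.
  pose ga i := la b i * chival (la a) (al b i) * c i / la (a * b)%g i.
  have comp_generic z i : (forall k, z k != 0) -> (Da * (Dc * De)).@[piv V z] != 0 ->
      (P b i).@[fun k => (P a k).@[z]] = ga i * (P (a * b)%g i).@[z].
    move=> z0 Dz; have [y0 aj by0 cz] := generic z z0 Dz; set y := fun k => _ in y0 aj by0 *.
    have [/(_ i) [c' c'0 hc'] _ _] := HDb y y0 by0.
    have hst := transport _ _ _ _ aj hc'.
    have P0z k : (P0 a k).@[z] != 0.
      by have := y0 k; rewrite /y PE mulf_eq0 negb_or => /andP[].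
    have h1 : local (coord FN) z (\prod_k ff_emb FN (P0 a k) ^ (al b i) 0 k * pst (st a (h b i)))
        (chival (fun k => (P0 a k).@[z]) (al b i) * c').
      apply: (vr_mul (lz z)); last exact: local_pistar.
      apply: (vr_prod (lz z)) => k; apply: lr_expz => //; exact: local_emb.
    have h2 : local (coord FN) z (cst FN (c i) * ff_emb FN (P0 (a * b)%g i))
        (c i * (P0 (a * b)%g i).@[z]).
      by apply: (vr_mul (lz z)); [exact: (vr_cst (lz z))|exact: local_emb].
    rewrite -(hc i).2 in h2; have E := vr_uniq (lz z) h1 h2.
    rewrite PE (P0val _ _ _ _ y0 hc').
    have -> : chival y (al b i) = chival (la a) (al b i) * chival (fun k => (P0 a k).@[z]) (al b i).
      by rewrite -chivalM; congr chival; apply/funext => k; rewrite /y PE.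
    by rewrite -[_ * _ * c']mulrA E /ga PE [RHS]mulrA divfK // -!mulrA.
  have compE z i : (P b i).@[fun k => (P a k).@[z]] = ga i * (P (a * b)%g i).@[z].
    pose q : {mpoly K[N]} := mmap (@mpolyC N K) (P a) (P b i).
    have qE u : q.@[u] = (P b i).@[fun k => (P a k).@[u]].
      apply: (mpoly_rmorph_ext (f := meval u \o mmap (@mpolyC N K) (P a))
        (g := meval (fun k => (P a k).@[u]))) => [d|k] /=.
        by rewrite mmapC !mevalC.
      by rewrite mmapX mmap1U mevalXU.
    have : q - ga i *: P (a * b)%g i = 0.
      refine (piv_dense F FN VW D0 _) => w w0 Dw.
      by rewrite mevalB mevalZ qE comp_generic // subrr.
    by move/eqP; rewrite subr_eq0 => /eqP qq; rewrite -qE qq mevalZ.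
  exists ga => //; split=> [i|j].
    by rewrite /ga !mulf_neq0 ?invr_eq0 ?chival_neq0 //; case: (hc i).
  (* [ga] is constant in [z], so that it lies in the kernel can be read off at one generic point. *)
  have [z [z0 Dz]] : exists z, (forall k, z k != 0) /\ (Da * (Dc * De)).@[piv V z] != 0.
    apply: contrapT => H; have /eqP : (1 : {mpoly K[N]}) = 0.
      by refine (piv_dense F FN VW D0 _) => w w0 Dw; case: H; exists w.
    by rewrite oner_eq0.
  have [y0 aj by0 cz] := generic z z0 Dz; set y := fun k => _ in y0 aj by0.
  have [_ _ /(_ j) h1] := HDb y y0 by0; have [_ z1 /(_ j) h2] := HDc z z0 cz.
  have := transport _ _ _ _ aj h1; rewrite -stM => /(vr_uniq (lF _) h2).
  have -> : (fun i => (P b i).@[y]) = (fun i => ga i * (P (a * b)%g i).@[z]).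
    by apply/funext => i; rewrite compE.
  rewrite pivM -[LHS]mul1r => /mulIf E; apply/esym/E.
  exact: piv_neq0.
- move=> a s [s0 s1]; split.
    split=> [i|j]; first exact: chival_neq0.
    rewrite /piv /chival (chival_comb _ (fun i => row j V 0 i) (al a)) //.
    rewrite (eq_bigr (fun i => V j i *: al a i)) => [|i _]; last by rewrite [row j V _ _]mxE.
    have [_ [m ->]] := L1 a j; rewrite -chival_piv //.
    by rewrite /chival -[RHS](chival1 K m); apply: eq_bigr => k _; rewrite s1.
  move=> z i; rewrite !mevalE mulr_sumr big_seq [RHS]big_seq; apply: eq_bigr => m /PV [m' mE].
  rewrite mulrCA; congr (_ * _).
  have -> : chival s (al a i) = \prod_k s k ^+ m k.
    transitivity (chival s (mexp m)); last first.
      by rewrite /chival; apply: eq_bigr => k _; rewrite mxE exprnP.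
    rewrite mE chivalD // -chival_piv // /chival [X in _ = _ * X]big1 ?mulr1 // => k _.
    by rewrite s1 exp1rz.
  by rewrite -big_split; apply: eq_bigr => k _; rewrite /= exprMn.
- move=> a i m mP; apply/eqP; rewrite -eqz_nat; apply/eqP; rewrite gez0_abs; last first.
    by apply: le_trans (dpos i).
  have [m' mE] := PV _ _ _ mP; rewrite -(ald a i).
  have -> : (al a i *m dbar) 0 0 = (mexp m *m dbar) 0 0 by rewrite mE mulmxDl dV addr0.
  rewrite mxE (big_morph Posz PoszD (erefl _)); apply: eq_bigr => k _.
  have dge : 0 <= dbar k 0 by apply: le_trans (dpos k).
  by rewrite PoszM gez0_abs // [mexp m _ _]mxE.
- by move=> i; have := dpos i; move: (dbar i 0) => x; lia.
Qed.

End CoxConstruction.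

Lemma frac_field_exists (R : idomainType) : inhabited (frac_field R).
Proof.
have inj (p : R) : FracField.tofrac p = 0 -> p = 0.
  by move/eqP; rewrite tofrac_eq0 => /eqP.
suff fr (f : {fraction R}) : exists p q : R, q != 0 /\
    f = FracField.tofrac p / FracField.tofrac q.
  by split; exact: (@FracFieldOf R {fraction R} (@FracField.tofrac R) inj fr).
elim/quotW: f => x; have d0 := denom_ratioP x; exists (frac x).1, (frac x).2; split=> //.
have dF : FracField.tofrac (frac x).2 != 0 by rewrite tofrac_eq0.
apply: (mulIf dF); rewrite divfK //; unlock FracField.tofrac.
rewrite -[LHS]FracField.pi_mul; apply/eqmodP; rewrite /= FracField.equivfE /FracField.mulf.
by rewrite !numden_Ratio ?oner_neq0 ?mulr1 // mulrC.
Qed.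

Theorem cox_exists (K : closedFieldType) n (F : frac_field {mpoly K[n]}) (X : Type)
    (Reg : X -> F -> K -> Prop) (gT : finGroupType) (st : gT -> {rmorphism F -> F}) :
  toric_family Reg -> (forall a c, st a (cst F c) = cst F c) -> (forall f, st 1%g f = f) ->
  (forall a b f, st (a * b)%g f = st a (st b f)) ->
  (forall a x, exists x', forall f c, Reg x' f c <-> Reg x (st a f) c) ->
  exists N (V : 'M_(n, N)) W P al d, cox_system st V W P al d.
Proof.
(* Any chart will do here; monomial coordinates are changed so that its matrix becomes the identity,
   and the system found is carried back. *)
move=> tf st_cst st1 stM stR; have [A cA _] := chart_exists 0 tf; have [uA hA] := cA.
have uA' : invmx A \in unitmx by rewrite unitmx_inv.
pose Reg' x f c := Reg x (mono F A f) c.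
have tf' : toric_family Reg' by apply: toric_family_mono.
have chart1 : chart Reg' 1%:M.
  by split; [exact: unitmx1|move=> z; have [x hx] := hA z; exists x => f c; rewrite /Reg' mono1].
pose st' a : {rmorphism F -> F} := mono F (invmx A) \o (st a \o mono F A).
have st'E a f : st' a f = mono F (invmx A) (st a (mono F A f)) by [].
have [s [sc sP]] := finite_boundary tf'.
pose u (i : 'I_(size s)) : F -> int :=
  let Al := tnth (in_tuple s) i in fun f => order 'X_(Al.2) (mono F (invmx Al.1) f).
have [N [e [v_inj v_cov]]] := distinct_family u; pose v := u \o e.
have v_chart k : exists A l, chart Reg' A /\ forall f, v k f = order 'X_l (mono F (invmx A) f).
  exists (tnth (in_tuple s) (e k)).1, (tnth (in_tuple s) (e k)).2; split=> //.
  by apply: sc; apply: mem_tnth.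
have v_bd w : divisor Reg' w -> (exists m, w (chi F m) != 0) -> exists k, w = v k.
  move=> dw /(sP w dw) [Al Als wE]; have /tuple.tnthP [i iE] : Al \in in_tuple s by [].
  have [k kE] := v_cov i; exists k.
  by rewrite /v /= -kE /u; apply/funext => f; rewrite -iE wE.
have [W VW] := rays_section chart1 v_bd.
have [FN] := frac_field_exists {mpoly K[N]}.
have [||||P [al [d [cs1 cs2 cs3 cs4 cs5 cs6]]]] := @cox_construction K n F X Reg' tf' chart1 N FN v v_inj
    v_chart v_bd gT st' _ _ _ _ W VW.
- by move=> a c; rewrite st'E [mono F A _]endo_cst st_cst [LHS]endo_cst.
- by move=> f; rewrite st'E st1 monoK.
- by move=> a b f; rewrite !st'E stM monoVK.
- move=> a x; have [x' hx'] := stR a x; exists x' => f c.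
  by rewrite /Reg' hx' st'E monoVK.
exists N, (invmx A *m rays v), (W *m A), P, al, d.
have pivE z : (forall i, z i != 0) -> piv (invmx A *m rays v) z = monoval (invmx A) (piv (rays v) z).
  by move=> z0; apply/funext => j; rewrite /monoval chival_piv // -row_mul.
have inkE t : inker (invmx A *m rays v) t <-> inker (rays v) t.
  split=> - [t0 t1]; split=> // j.
    have : monoval A (monoval (invmx A) (piv (rays v) t)) j = 1.
      rewrite -pivE // /monoval /chival big1 // => i _.
      by rewrite t1 exp1rz.
    by rewrite monoval_comp ?mulmxV ?monoval1 //; apply: piv_neq0.
  by rewrite pivE // /monoval /chival big1 // => i _; rewrite t1 exp1rz.
split.
- by rewrite mulmxA -[_ *m rays v *m W]mulmxA cs1 mulmx1 mulVmx.
- move=> a; have [D D0 HD] := cs2 a.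
  have [|D' D'0 HD'] := @nonzero_dense K n F (mono F A (ff_emb F D)).
    by rewrite fmorph_eq0 emb_eq0.
  exists D' => // z z0; have p0 := piv_neq0 (rays v) z0; have p'0 := monoval_neq0 (invmx A) p0.
  rewrite pivE // => /HD' [c c0].
  rewrite local_mono_coord //.
  have -> : monoval A (monoval (invmx A) (piv (rays v) z)) = piv (rays v) z.
    by apply/funext => j; rewrite monoval_comp // mulmxV // monoval1.
  move=> /(vr_uniq (local_rel (on_coord _)) (local_emb F _ D)) cE; rewrite -cE in c0.
  have [Pz hj] := HD z z0 c0; split=> // j.
  have Pz' : (forall i, (P a i).@[z] != 0) := Pz.
  have lt := local_rel (on_coord (F := F) (piv (rays v) z)).
  rewrite pivE // -local_mono_coord // /monoval.
  have -> : mono F (invmx A) (st a (coord F j)) = st' a (chi F (row j (invmx A))).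
    by rewrite st'E mono_chi // -row_mul mulVmx // row1 chi_delta.
  rewrite /chi rmorph_prod; apply: (vr_prod lt) => k; rewrite fmorphXz.
  by apply: lr_expz => //; exact: piv_neq0.
- by move=> a b; have [ga /inkE] := cs3 a b; exists ga.
- by move=> a t /inkE /(cs4 a) [/inkE].
- exact: cs5.
- exact: cs6.
Qed.

Local Open Scope classical_set_scope.

(** * Regular functions and partially defined morphisms *)

Section RegularFunctions.
Variables (K : closedFieldType) (X : fspace K).
Implicit Types (U V W : set X) (f g : X -> K).

Lemma reg_ext U f g : (forall x, U x -> f x = g x) -> regular U f -> regular U g.
Proof. by move=> fg; apply: regular_ext => x /set_mem /fg. Qed.

Lemma reg_opp U f : regular U f -> regular U (fun x => - f x).
Proof.
move=> rf; apply: (@reg_ext _ (fun x => (-1) * f x)) => [x _|]; first by rewrite mulN1r.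
by apply: regular_mul => //; apply: regular_cst; apply: regular_open rf.
Qed.

Lemma reg_sub U f g : regular U f -> regular U g -> regular U (fun x => f x - g x).
Proof. by move=> rf rg; apply: regular_add => //; apply: reg_opp. Qed.

Lemma reg_nz U f : regular U f -> open (U `&` [set x | f x != 0]).
Proof. by move=> rf; apply: regular_open (regular_inv rf). Qed.

Lemma reg_inv U f : regular U f -> (forall x, U x -> f x != 0) -> regular U (fun x => (f x)^-1).
Proof.
move=> rf f0; apply: regular_restrict (regular_inv rf); first exact: regular_open rf.
by move=> x Ux; split=> //; apply: f0.
Qed.

Lemma reg_exp U f k : regular U f -> regular U (fun x => f x ^+ k).
Proof.
move=> rf; elim: k => [|k IH]; first by apply: regular_cst; apply: regular_open rf.
by apply: (@reg_ext _ (fun x => f x * f x ^+ k)) => [x _|]; [rewrite exprS|apply: regular_mul].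
Qed.

Lemma reg_expz U f (k : int) : regular U f -> (forall x, U x -> f x != 0) ->
  regular U (fun x => f x ^ k).
Proof.
move=> rf f0; case: k => k; first exact: reg_exp.
apply: (@reg_ext _ (fun x => (f x)^-1 ^+ k.+1)) => [x _|]; first by rewrite NegzE -exprnN exprVn.
by apply: reg_exp; apply: reg_inv.
Qed.

Lemma reg_prod U (I : Type) (s : seq I) (P : pred I) (f : I -> X -> K) : open U ->
  (forall i, regular U (f i)) -> regular U (fun x => \prod_(i <- s | P i) f i x).
Proof.
move=> oU rf; elim: s => [|i s IH].
  by apply: (@reg_ext _ (fun=> 1)) => [x _|]; [rewrite big_nil|apply: regular_cst].
apply: (@reg_ext _ (fun x => (if P i then f i x else 1) * \prod_(j <- s | P j) f j x)) => [x _|].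
  by rewrite big_cons; case: (P i); rewrite ?mul1r.
by apply: regular_mul => //; case: (P i) => //; apply: regular_cst.
Qed.

Lemma reg_sum U (I : Type) (s : seq I) (P : pred I) (f : I -> X -> K) : open U ->
  (forall i, regular U (f i)) -> regular U (fun x => \sum_(i <- s | P i) f i x).
Proof.
move=> oU rf; elim: s => [|i s IH].
  by apply: (@reg_ext _ (fun=> 0)) => [x _|]; [rewrite big_nil|apply: regular_cst].
apply: (@reg_ext _ (fun x => (if P i then f i x else 0) + \sum_(j <- s | P j) f j x)) => [x _|].
  by rewrite big_cons; case: (P i); rewrite ?add0r.
by apply: regular_add => //; case: (P i) => //; apply: regular_cst.
Qed.

Lemma reg_meval n U (f : 'I_n -> X -> K) (p : {mpoly K[n]}) : open U ->
  (forall i, regular U (f i)) -> regular U (fun x => p.@[fun i => f i x]).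
Proof.
move=> oU rf; apply: (@reg_ext _ (fun x => \sum_(m <- msupp p) p@_m * \prod_i f i x ^+ m i)).
  by move=> x _; rewrite mevalE.
apply: reg_sum => // m; apply: regular_mul; first exact: regular_cst.
by apply: reg_prod => // i; apply: reg_exp.
Qed.

Lemma reg_chival n U (f : 'I_n -> X -> K) (m : 'rV[int]_n) : open U ->
  (forall i, regular U (f i)) -> (forall i x, U x -> f i x != 0) ->
  regular U (fun x => chival (fun i => f i x) m).
Proof. by move=> oU rf f0; apply: reg_prod => // i; apply: reg_expz => // x; apply: f0. Qed.

End RegularFunctions.

Section IrreducibleSpace.
Variables (K : closedFieldType) (X : variety K).
Implicit Types (U V W : set X) (f g : X -> K).

Lemma open_meet U V : open U -> open V -> U !=set0 -> V !=set0 -> U `&` V !=set0.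
Proof.
move=> oU oV [u Uu] [v Vv]; have [_ irr] := variety_irreducible X.
apply: contrapT => H; have := irr (~` U) (~` V); case.
- exact: open_closedC.
- exact: open_closedC.
- move=> x _; have [Ux|] := EM (U x); last by left.
  by right => Vx; apply: H; exists x.
- by move/(_ u I).
- by move/(_ v I).
Qed.

Lemma open_meets (I : finType) (U : I -> set X) : (forall i, open (U i)) ->
  (forall i, U i !=set0) -> open (\bigcap_i U i) /\ \bigcap_i U i !=set0.
Proof.
move=> oU nU.
have H (s : seq I) : open [set x | forall i, i \in s -> U i x] /\
    [set x | forall i, i \in s -> U i x] !=set0.
  elim: s => [|i s [IH1 IH2]].
    have E0 : [set x | forall i, i \in [::] -> U i x] = setT by apply/seteqP; split.
    split; first by rewrite E0; exact: openT.
    by have [[x _] _] := variety_irreducible X; exists x.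
  have E : [set x | forall j, j \in i :: s -> U j x] = U i `&` [set x | forall i, i \in s -> U i x].
    apply/seteqP; split=> x /= H; first by split=> [|j js]; apply: H; rewrite inE ?eqxx ?js ?orbT.
    by move=> j; rewrite inE => /orP[/eqP->|]; [case: H|case: H => _; apply].
  by rewrite E; split; [exact: openI|exact: open_meet].
have E : \bigcap_i U i = [set x | forall i, i \in enum I -> U i x].
  by apply/seteqP; split=> x Hx i _; apply: Hx => //; rewrite mem_enum.
by rewrite E; apply: H.
Qed.

Lemma reg_dense0 U W f : regular U f -> open W -> W !=set0 ->
  (forall x, W x -> U x -> f x = 0) -> forall x, U x -> f x = 0.
Proof.
move=> rf oW nW f0 x Ux; apply/eqP; apply: contrapT => /negP fx.
have [|y [[Uy fy] Wy]] := open_meet (reg_nz rf) oW _ nW; first by exists x.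
by case/eqP: fy; apply: f0.
Qed.

Lemma reg_dense U V W f g : regular U f -> regular V g -> open W -> W !=set0 ->
  (forall x, W x -> U x -> V x -> f x = g x) -> forall x, U x -> V x -> f x = g x.
Proof.
move=> rf rg oW nW fg x Ux Vx.
have oUV : open (U `&` V) by apply: openI; apply: regular_open; eassumption.
have r1 : regular (U `&` V) (fun x => f x - g x).
  by apply: reg_sub; [apply: regular_restrict rf|apply: regular_restrict rg] => // y [].
apply/eqP; rewrite -subr_eq0; apply/eqP.
apply: (reg_dense0 r1 oW nW) => // y Wy [Uy Vy].
by rewrite fg // subrr.
Qed.

End IrreducibleSpace.

Section PartialMaps.
Variable K : closedFieldType.
Implicit Types X Y Z : fspace K.

(* phi is a morphism on V; its values outside V are junk. *)
Definition rmap Y X (V : set Y) (phi : Y -> X) := open V /\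
  forall (W : set X) g, regular W g -> regular (V `&` phi @^-1` W) (g \o phi).

Lemma rmap_open Y X (V : set Y) (phi : Y -> X) (W : set X) : rmap V phi -> open W ->
  open (V `&` phi @^-1` W).
Proof. by move=> [_ h] oW; apply: regular_open (h W (fun=> 0) _); apply: regular_cst. Qed.

Lemma rmap_restrict Y X (V V' : set Y) (phi : Y -> X) : open V' -> V' `<=` V ->
  rmap V phi -> rmap V' phi.
Proof.
move=> oV' sV h; split=> // W g rg; have oW := regular_open rg.
have E : V' `&` phi @^-1` W = V' `&` (V `&` phi @^-1` W).
  by apply/seteqP; split=> x [H1 H2]; [split=> //; split=> //; apply: sV|case: H2].
rewrite E; apply: regular_restrict (h.2 _ _ rg); last by move=> x [_].
by apply: openI => //; apply: rmap_open.
Qed.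

Lemma rmap_comp Y X Z (V : set Y) (W : set X) (phi : Y -> X) (psi : X -> Z) :
  rmap V phi -> rmap W psi -> rmap (V `&` phi @^-1` W) (psi \o phi).
Proof.
move=> h1 [oW h2]; split=> [|A g /h2 /h1.2]; first exact: rmap_open.
by rewrite (_ : V `&` _ `&` _ = V `&` phi @^-1` (W `&` psi @^-1` A)) // setIA.
Qed.

Lemma rmap_total Y X (f : Y -> X) : regular_map f -> rmap setT f.
Proof. by move=> [_ h]; split=> [|W g /h]; [exact: openT|rewrite setTI]. Qed.

Lemma rmap_induced Y X (V : set Y) (U : set X) (phi : Y -> X) (hU : forall y, V y -> U (phi y)) :
  rmap V phi ->
  regular_map (fun v : induced_space V =>
    (exist U (phi (sval v)) (hU _ (svalP v)) : induced_space U)).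
Proof.
move=> [oV h]; split.
  apply/continuousP => W oW; move=> v Wv.
  have [W0 [g [[U1 [g1 [r1 -> E1]]] W0v sW]]] := oW _ Wv.
  exists (sval @^-1` (V `&` phi @^-1` U1)), (g1 \o phi \o sval); split.
  - exists (V `&` phi @^-1` U1), (g1 \o phi); split=> //; exact: h.
  - by split=> //; apply: svalP.
  - by move=> w [_ Uw]; apply: sW.
move=> W g rg v Wv; have [W0 [g0 [[U1 [g1 [r1 -> E1]]] W0v sW E]]] := rg _ Wv.
exists (sval @^-1` (V `&` phi @^-1` U1)), (g1 \o phi \o sval); split.
- exists (V `&` phi @^-1` U1), (g1 \o phi); split=> //; exact: h.
- by split=> //; apply: svalP.
- by move=> w [_ Uw]; apply: sW.
- by move=> w [_ Uw] /=; rewrite E // E1.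
Qed.

(** Makes functions on an induced space total, with junk value [t0] off [V]; this relates the
    morphisms of the definitions to [rmap]. *)
Definition extend Y (V : set Y) T (t0 : T) (f : {y | V y} -> T) (y : Y) : T :=
  if pselect (V y) is left h then f (exist _ y h) else t0.

Lemma extendE Y (V : set Y) T (t0 : T) (f : {y | V y} -> T) v : extend t0 f (sval v) = f v.
Proof.
rewrite /extend; case: v => y h /=; case: pselect => // h'.
by congr f; congr exist; apply: Prop_irrelevance.
Qed.

Lemma induced_regular Y (V : set Y) (W : set (induced_space V)) f : open V -> regular W f ->
  regular (V `&` [set y | forall h : V y, W (exist _ y h)]) (extend 0 f).
Proof.
move=> oV rf; apply: regular_glue => y [Vy /(_ Vy) Wy].
have [W0 [g0 [[U1 [g1 [r1 -> E1]]] W0v sW E]]] := rf _ Wy.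
exists (V `&` U1); split=> //.
  move=> z [Vz Uz]; split=> // h; exact: sW.
apply: (reg_ext (f := g1)) => [z [Vz Uz]|].
  by rewrite -[z]/(sval (exist V z Vz)) extendE E // E1.
by apply: regular_restrict (r1) => [|z []//]; apply: openI => //; apply: regular_open r1.
Qed.

Lemma regular_incl X (U W : set X) g : regular W g ->
  regular (sval @^-1` W : set (induced_space U)) (g \o sval).
Proof.
move=> rg x Wx; exists (sval @^-1` W), (g \o sval); split=> //.
by exists W, g.
Qed.

Lemma induced_rmap Y X (V : set Y) (U : set X) (x0 : X) (f : induced_space V -> induced_space U) :
  open V -> regular_map f -> rmap V (extend x0 (fun v => incl (f v))).
Proof.
move=> oV [_ h]; split=> // W g rg.
have := induced_regular oV (h _ _ (regular_incl (U := U) rg)).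
rewrite (_ : V `&` [set y | _] = V `&` extend x0 (fun v => incl (f v)) @^-1` W); last first.
  apply/seteqP; split=> y [Vy /= H]; split=> //.
    by rewrite -[y]/(sval (exist V y Vy)) extendE; apply: H.
  by move=> h'; move: H; rewrite -[y]/(sval (exist V y h')) extendE.
apply: reg_ext => y [Vy _]; rewrite /= -[y]/(sval (exist V y Vy)) !extendE.
by [].
Qed.

Lemma rmap_affine Y n (V : set Y) (phi : Y -> affine_space K n) : open V ->
  (forall i, regular V (fun y => phi y i)) -> rmap V phi.
Proof.
move=> oV h; split=> // W g rg; apply: regular_glue => y [Vy Wy].
have [W0 [g0 [[p [q [W0E gE]]] W0y sW E]]] := rg _ Wy.
rewrite W0E /= in W0y.
have rq := reg_meval q oV h; have rp := reg_meval p oV h.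
exists (V `&` [set z | q.@[fun i => phi z i] != 0]); split=> //.
  by move=> z [Vz qz]; split=> //; apply: sW; rewrite W0E.
apply: (@reg_ext _ _ _ (fun z => p.@[fun i => phi z i] / q.@[fun i => phi z i])).
  by move=> z [Vz qz] /=; rewrite E ?W0E // gE ?W0E.
apply: regular_mul; last exact: regular_inv.
by apply: regular_restrict rp => [|z []//]; apply: reg_nz.
Qed.

End PartialMaps.

(** Unfolds the two generated sheaves, of the subset and of affine space, to obtain one fraction
    valid near [t]. *)
Lemma reg_param (K : closedFieldType) (X : fspace K) n (S : set (affine_space K n)) (V : set X)
    (phi : induced_space S -> induced_space V) (W : set X) r (t : induced_space S) :
  regular_map phi -> regular W r -> W (incl (phi t)) ->
  exists p q : {mpoly K[n]}, q.@[sval t] != 0 /\ forall t' : induced_space S, q.@[sval t'] != 0 ->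
    W (incl (phi t')) /\ r (incl (phi t')) = p.@[sval t'] / q.@[sval t'].
Proof.
move=> [_ hphi] rr Wt; have h := hphi _ _ (regular_incl (U := V) rr).
have [V0 [g0 [[U1 [g1 [r1 V0E E1]]] V0t sW E]]] := h t Wt.
rewrite V0E /= in V0t; have [V1 [g2 [[p [q [V1E g2E]]] V1t s1 E2]]] := r1 _ V0t.
exists p, q; split; first by move: V1t; rewrite V1E.
move=> t' qt'; have V1t' : V1 (sval t') by rewrite V1E.
have V0t' : V0 t' by rewrite V0E; apply: s1.
split; first exact: (sW _ V0t').
by have := E _ V0t'; rewrite E1 // E2 // g2E //= => <-.
Qed.

(** * The function field of a toric variety *)

Section FunctionField.
Variables (K : closedFieldType) (X : variety K) (n : nat) (U : set X).
Variable jt : torus K n -> induced_space U.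
Hypothesis oU : open U.
Variable ji : induced_space U -> torus K n.
Hypotheses (jtr : regular_map jt) (jir : regular_map ji) (jtK : cancel jt ji) (jiK : cancel ji jt).
Variable F : frac_field {mpoly K[n]}.
Implicit Types (W A : set X) (r : X -> K) (f g : F) (c : K) (z : 'I_n -> K).

(** [pt] and [tau] are total forms of [jt] and its inverse. The defaults are the unit of the torus
    and the constant 1, so that [pt_in] and [tau_neq0] hold without side conditions. *)
Definition pt z : X := extend (incl (jt (torus_one K n))) (fun t : torus K n => incl (jt t)) z.
Definition tau (x : X) : 'I_n -> K := extend (fun=> 1) (fun u : induced_space U => torus_coord (ji u)) x.

Lemma ptE (t : torus K n) : pt (torus_coord t) = incl (jt t).
Proof. exact: extendE. Qed.

Lemma pt_in z : U (pt z).
Proof. by rewrite /pt /extend; case: pselect => h; apply: (svalP (jt _)). Qed.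

Lemma tau_pt z : (forall i, z i != 0) -> tau (pt z) = z.
Proof.
move=> z0; rewrite -[z]/(torus_coord (torus_elt z0)) ptE /tau.
by rewrite [extend _ _ _]extendE jtK.
Qed.

Lemma tauE (u : induced_space U) : tau (incl u) = torus_coord (ji u).
Proof. exact: extendE. Qed.

Lemma tau_neq0 x i : tau x i != 0.
Proof.
rewrite /tau /extend; case: pselect => [h|_]; last exact: oner_neq0.
exact: (svalP (ji _)).
Qed.

Lemma pt_tau x : U x -> pt (tau x) = x.
Proof. by move=> Ux; rewrite -[x]/(incl (exist U x Ux)) tauE ptE jiK. Qed.

Lemma affine_coord_regular (i : 'I_n) : regular setT (fun x : affine_space K n => x i).
Proof.
move=> x _; exists setT, (fun x : 'I_n -> K => x i); split=> //.
exists 'X_i, 1; split=> [|y _]; last by rewrite mevalXU meval1 divr1.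
by apply/seteqP; split=> y //= _; rewrite meval1 oner_neq0.
Qed.

Lemma tau_reg i : regular U (fun x => tau x i).
Proof.
have := induced_regular oU (jir.2 _ _ (regular_incl (U := [set x : affine_space K n | forall i, x i != 0]) (affine_coord_regular i))).
rewrite (_ : U `&` _ = U); last by apply/seteqP; split=> [x []|x Ux]//; split.
apply: reg_ext => x Ux; pose u : induced_space U := exist U x Ux.
by rewrite -[x]/(sval u) extendE -[sval u]/(incl u) tauE.
Qed.

Lemma reg_tau (p : {mpoly K[n]}) : regular U (fun x => p.@[tau x]).
Proof. by apply: reg_meval => // i; apply: tau_reg. Qed.

Lemma reg_pt W r z : (forall i, z i != 0) -> regular W r -> W (pt z) ->
  exists p q : {mpoly K[n]}, q.@[z] != 0 /\ forall z', (forall i, z' i != 0) -> q.@[z'] != 0 ->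
    W (pt z') /\ r (pt z') = p.@[z'] / q.@[z'].
Proof.
move=> z0 rr Wz; have ptz z' (z'0 : forall i, z' i != 0) : pt z' = incl (jt (torus_elt z'0)).
  by rewrite -ptE.
rewrite (ptz z z0) in Wz; have [p [q [qz H]]] := reg_param jtr rr Wz.
exists p, q; split=> // z' z'0 qz'; rewrite (ptz z' z'0).
exact: (H (torus_elt z'0) qz').
Qed.

Lemma U_nonempty : U !=set0. Proof. by exists (pt (fun=> 1)); apply: pt_in. Qed.

Lemma dense_pt A (D : {mpoly K[n]}) : open A -> A !=set0 -> D != 0 ->
  exists z, [/\ forall i, z i != 0, A (pt z) & D.@[z] != 0].
Proof.
move=> oA nA D0; have [x [Ax Ux]] := open_meet oA oU nA U_nonempty.
have z0 := tau_neq0 x; have h : A (pt (tau x)) by rewrite pt_tau.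
have [p [q [qz H]]] := reg_pt z0 (regular_cst 0 oA) h.
have qD : q * D != 0 by rewrite mulf_neq0 //; apply: contra_neq qz => ->; rewrite meval0.
have [z z1] := torus_nonzero qD; rewrite mevalM mulf_eq0 negb_or => /andP[q1 D1].
by exists z; split=> //; case: (H z z1 q1).
Qed.

Lemma nz_open (D : {mpoly K[n]}) : D != 0 -> open (U `&` [set x | D.@[tau x] != 0]) /\
  U `&` [set x | D.@[tau x] != 0] !=set0.
Proof.
move=> D0; split; first exact: reg_nz (reg_tau D).
have [z z0 Dz] := torus_nonzero D0; exists (pt z); split; first exact: pt_in.
by rewrite /= tau_pt.
Qed.

Definition represents W r f := regular W r /\ exists p q : {mpoly K[n]},
  [/\ q != 0, f = ff_emb F p / ff_emb F q &
      forall z, (forall i, z i != 0) -> W (pt z) -> r (pt z) * q.@[z] = p.@[z]].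

Definition Reg (x : X) f c := exists W r, [/\ W x, represents W r f & r x = c].

Lemma repr_restrict W W' r f : open W' -> W' `<=` W -> represents W r f -> represents W' r f.
Proof.
move=> oW' sW [rr [p [q [q0 fE H]]]]; split; first exact: regular_restrict rr.
by exists p, q; split=> // z z0 /sW; apply: H.
Qed.

(** A fraction found near one point of the torus is valid on all of [W], because two regular
    functions that agree on a dense open set are equal. *)
Lemma repr_exists W r : regular W r -> W !=set0 -> exists f, represents W r f.
Proof.
move=> rr nW; have oW := regular_open rr.
have [z [z0 Wz _]] := dense_pt oW nW (oner_neq0 _).
have [p [q [qz H]]] := reg_pt z0 rr Wz.
have q0 : q != 0 by apply: contra_neq qz => ->; rewrite meval0.
exists (ff_emb F p / ff_emb F q); split=> //; exists p, q; split=> // z' z'0 Wz'.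
have [oq nq] := nz_open q0.
have oWU : open (W `&` U) by apply: openI.
have rd : regular (W `&` U) (fun x => r x * q.@[tau x] - p.@[tau x]).
  apply: reg_sub; last by apply: regular_restrict (reg_tau p) => // x [].
  apply: regular_mul; first by apply: regular_restrict rr => // x [].
  by apply: regular_restrict (reg_tau q) => // x [].
have := reg_dense0 rd oq nq _ (x := pt z').
rewrite tau_pt // => E; apply/eqP; rewrite -subr_eq0; apply/eqP; apply: E; last first.
  by split=> //; apply: pt_in.
move=> x [Ux qx] [Wx _]; have Wx' : W (pt (tau x)) by rewrite pt_tau.
have [_] := H (tau x) (tau_neq0 x) qx; rewrite pt_tau // => ->.
by rewrite divfK // subrr.
Qed.

Lemma repr_local W r f z : represents W r f -> (forall i, z i != 0) -> W (pt z) ->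
  local (coord F) z f (r (pt z)).
Proof.
move=> [rr [p [q [q0 fE H]]]] z0 Wz; have [p' [q' [q'z H']]] := reg_pt z0 rr Wz.
have [_ rE] := H' z z0 q'z; exists p', q'; split=> //; rewrite !peval_coord fE.
have q'0 : q' != 0 by apply: contra_neq q'z => ->; rewrite meval0.
apply/eqP; rewrite eqr_div ?emb_eq0 // -!rmorphM; apply/eqP; congr (ff_emb F _).
apply/eqP; rewrite -subr_eq0; apply: contraT => /(mulf_neq0 q'0).
move=> /torus_nonzero [z' z'0]; rewrite mevalM mulf_eq0 negb_or => /andP[q'z'].
have [Wz' rz'] := H' z' z'0 q'z'.
rewrite mevalB !mevalM -(H z' z'0 Wz') rz'.
have -> : p'.@[z'] / q'.@[z'] * q.@[z'] * q'.@[z'] - p'.@[z'] * q.@[z'] = 0 by field.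
by rewrite eqxx.
Qed.

Lemma Reg_pt z f c : (forall i, z i != 0) -> Reg (pt z) f c <-> local (coord F) z f c.
Proof.
move=> z0; split; first by move=> [W [r [Wz rf <-]]]; apply: repr_local rf _ Wz.
move=> [p [q [qz]]]; rewrite !peval_coord => fE ->.
have q0 : q != 0 by apply: contra_neq qz => ->; rewrite meval0.
exists (U `&` [set x | q.@[tau x] != 0]), (fun x => p.@[tau x] / q.@[tau x]); split.
- by split; [exact: pt_in|rewrite /= tau_pt].
- split; last first.
    by exists p, q; split=> // z' z'0 [_ /=]; rewrite tau_pt // => qz'; rewrite divfK.
  apply: regular_mul; last exact: regular_inv (reg_tau q).
  by apply: regular_restrict (reg_tau p) => [|x []//]; apply: reg_nz (reg_tau q).
- by rewrite tau_pt.
Qed.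

Lemma Reg_eq A f g : open A -> A !=set0 -> (forall x, A x -> exists c, Reg x f c /\ Reg x g c) ->
  f = g.
Proof.
move=> oA nA H; have [p [q [q0 fE]]] := ff_frac f; have [p' [q' [q'0 gE]]] := ff_frac g.
rewrite fE gE; apply/eqP; rewrite eqr_div ?emb_eq0 // -!rmorphM; apply/eqP; congr (ff_emb F _).
apply/eqP; rewrite -subr_eq0; apply: contraT => /(mulf_neq0 (mulf_neq0 q0 q'0)) D0.
have [z [z0 Az]] := dense_pt oA nA D0; rewrite !mevalM !mulf_eq0 !negb_or => /andP[/andP[qz q'z]].
have [c []] := H _ Az; rewrite !Reg_pt // => h1 h2.
have lz := local_rel (on_coord (F := F) z).
have h3 : local (coord F) z f (p.@[z] / q.@[z]) by rewrite fE; apply: lr_div => //; apply: local_emb.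
have h4 : local (coord F) z g (p'.@[z] / q'.@[z]) by rewrite gE; apply: lr_div => //; apply: local_emb.
have /eqP := vr_uniq lz h1 h3; rewrite (vr_uniq lz h2 h4) eqr_div // => /eqP E.
by rewrite mevalB !mevalM E subrr eqxx.
Qed.

Lemma repr_agree W W' r r' f x : represents W r f -> represents W' r' f -> W x -> W' x -> r x = r' x.
Proof.
move=> h h'; apply: (reg_dense h.1 h'.1 oU U_nonempty) => y Uy Wy W'y.
have E := pt_tau Uy; rewrite -E in Wy W'y *.
have h1 := repr_local h (tau_neq0 y) Wy; have h2 := repr_local h' (tau_neq0 y) W'y.
exact: (vr_uniq (local_rel (on_coord _)) h1 h2).
Qed.

Lemma repr_cst c : represents setT (fun=> c) (cst F c).
Proof.
split; first by apply: regular_cst; apply: openT.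
exists c%:MP, 1; split; [exact: oner_neq0|by rewrite rmorph1 divr1|].
by move=> z z0 _; rewrite meval1 mulr1 mevalC.
Qed.

Lemma repr_intro W A s g : regular W s -> W !=set0 -> open A -> A !=set0 ->
  (forall z, (forall i, z i != 0) -> W (pt z) -> A (pt z) -> local (coord F) z g (s (pt z))) ->
  represents W s g.
Proof.
move=> rs nW oA nA H; have [g' hg'] := repr_exists rs nW.
suff -> : g = g' by [].
have oW := regular_open rs; have oWU := openI oW oU.
apply: (@Reg_eq (A `&` (W `&` U))).
- exact: openI.
- by apply: open_meet => //; apply: open_meet => //; exact: U_nonempty.
move=> x [Ax [Wx Ux]]; exists (s x); rewrite -(pt_tau Ux) in Wx Ax *.
rewrite !Reg_pt //; try exact: tau_neq0.
have z0 := tau_neq0 x; split; last exact: repr_local hg' z0 _.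
exact: H.
Qed.

Lemma Reg_rel x : loc_rel (Reg x).
Proof.
have lz z := local_rel (on_coord (F := F) z).
split; first split.
- by move=> c; exists setT, (fun=> c); split=> //; apply: repr_cst.
- move=> f g _ _ [W [r [Wx h <-]]] [W' [r' [W'x h' <-]]].
  have oWW := openI (regular_open h.1) (regular_open h'.1).
  exists (W `&` W'), (fun y => r y + r' y); split=> //.
  apply: (repr_intro (A := setT)); [|by exists x|exact: openT|by exists x|].
    by apply: regular_add; [apply: regular_restrict h.1|apply: regular_restrict h'.1] => // y [].
  by move=> z z0 [Wz W'z] _; apply: (vr_add (lz z)); [exact: repr_local h _ _|exact: repr_local h' _ _].
- move=> f g _ _ [W [r [Wx h <-]]] [W' [r' [W'x h' <-]]].
  have oWW := openI (regular_open h.1) (regular_open h'.1).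
  exists (W `&` W'), (fun y => r y * r' y); split=> //.
  apply: (repr_intro (A := setT)); [|by exists x|exact: openT|by exists x|].
    by apply: regular_mul; [apply: regular_restrict h.1|apply: regular_restrict h'.1] => // y [].
  by move=> z z0 [Wz W'z] _; apply: (vr_mul (lz z)); [exact: repr_local h _ _|exact: repr_local h' _ _].
- move=> c [W [r [Wx h <-]]]; have h0 := repr_cst 0; rewrite rmorph0 in h0.
  exact: (repr_agree h h0 Wx I).
- move=> f c [W [r [Wx h <-]]] c0.
  exists (W `&` [set y | r y != 0]), (fun y => (r y)^-1); split=> //.
  apply: (repr_intro (A := setT)); [exact: regular_inv h.1|by exists x|exact: openT|by exists x|].
  by move=> z z0 [Wz rz] _; apply: (lr_inv (lz z)) => //; exact: repr_local h _ _.
Qed.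

Lemma reg_Reg W r f x : represents W r f -> W x -> Reg x f (r x).
Proof. by move=> h Wx; exists W, r. Qed.

Lemma Reg_open W f : open W -> W !=set0 ->
  exists A, [/\ open A, A !=set0, A `<=` W & forall x, A x -> exists c, Reg x f c].
Proof.
move=> oW nW; have [p [q [q0 fE]]] := ff_frac f; have [oq nq] := nz_open q0.
exists (W `&` (U `&` [set x | q.@[tau x] != 0])); split; [exact: openI|exact: open_meet|by move=> x []|].
move=> x [_ [Ux qx]]; exists (p.@[tau x] / q.@[tau x]); rewrite -{1}(pt_tau Ux).
by apply/Reg_pt; [exact: tau_neq0|exists p, q; rewrite !peval_coord].
Qed.

(** The endomorphism of [F] sends the coordinates to their pullbacks, independent because nonempty
    open sets have nonempty preimages. The inverse automorphism gives the other implication. *)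
Lemma pullback (al be : X -> X) : rmap setT al -> rmap setT be -> cancel al be -> cancel be al ->
  exists t : {rmorphism F -> F}, (forall c, t (cst F c) = cst F c) /\
    forall x f c, Reg (al x) f c <-> Reg x (t f) c.
Proof.
move=> ral rbe alK beK.
have fwd (a b : X -> X) : rmap setT a -> cancel b a -> exists t : {rmorphism F -> F},
    (forall c, t (cst F c) = cst F c) /\ forall x f c, Reg (a x) f c -> Reg x (t f) c.
  move=> ra bK.
  have oa W : open W -> open (a @^-1` W) by move=> oW; have := rmap_open ra oW; rewrite setTI.
  have na W : W !=set0 -> a @^-1` W !=set0 by move=> [x Wx]; exists (b x); rewrite /= bK.
  have ra' W r : regular W r -> regular (a @^-1` W) (r \o a) by move=> /ra.2; rewrite setTI.
  have /choice [y hy] j : exists y : F, represents (a @^-1` U) (fun x => tau (a x) j) y.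
    by apply: repr_exists; [apply: (ra' U (fun x => tau x j)); apply: tau_reg|apply/na/U_nonempty].
  have yval x : U (a x) -> forall p, Reg x (peval y p) p.@[tau (a x)].
    move=> Ux p; apply: (vr_peval (Reg_rel x)) => j; exact: reg_Reg (hy j) Ux.
  have ind : alg_indep y.
    move=> p p0; apply/eqP; apply: contraT => pn0; have [oq nq] := nz_open pn0.
    have [x [Ux /= px]] := na _ nq; have := yval x Ux p; rewrite p0 => /(vr_0 (Reg_rel x)) E.
    by rewrite E eqxx in px.
  exists (endo y); split=> [c|x f c [W [r [Wx h <-]]]]; first exact: endo_cst.
  have nW : a @^-1` W !=set0 by exists x.
  have [f' hf'] := repr_exists (ra' _ _ h.1) nW.
  suff -> : endo y f = f' by apply: (reg_Reg hf').
  have [p [q [q0 fE H]]] := h.2; have [oq nq] := nz_open q0.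
  apply: (@Reg_eq (a @^-1` W `&` a @^-1` (U `&` [set x | q.@[tau x] != 0]))).
  - by apply: openI; apply: oa => //; apply: regular_open h.1.
  - by apply: open_meet => //; [apply: oa; apply: regular_open h.1|exact: oa|exact: na].
  move=> w [Ww [Uw qw]]; exists (r (a w)); split; last exact: (reg_Reg hf').
  have -> : r (a w) = p.@[tau (a w)] / q.@[tau (a w)].
    have := H (tau (a w)) (tau_neq0 _); rewrite pt_tau // => <- //.
    by rewrite mulfK.
  rewrite fE fmorph_div /= !endo_emb //; apply: (lr_div (Reg_rel w)) => //; exact: yval.
have [t [tc tR]] := fwd _ _ ral beK; have [t' [t'c t'R]] := fwd _ _ rbe alK.
exists t; split=> // x f c; split; first exact: tR.
move=> h; rewrite -[f](_ : t' (t f) = f); first by apply: t'R; rewrite alK.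
have [A [oA nA _ HA]] := Reg_open f openT (ex_intro _ x I : [set: X] !=set0).
apply: (Reg_eq oA nA) => w /HA [d hd]; exists d; split=> //.
by apply/t'R/tR; rewrite beK.
Qed.

Lemma pullback_eq (t t' : {rmorphism F -> F}) (al : X -> X) : rmap setT al -> (exists be, cancel be al) ->
  (forall x f c, Reg (al x) f c -> Reg x (t f) c) ->
  (forall x f c, Reg (al x) f c -> Reg x (t' f) c) -> forall f, t f = t' f.
Proof.
move=> ral [be beK] h h' f; have [x0 _] := U_nonempty.
have [A [oA [a Aa] _ HA]] := Reg_open f openT (ex_intro _ x0 I : [set: X] !=set0).
apply: (@Reg_eq (al @^-1` A)).
- by have := rmap_open ral oA; rewrite setTI.
- by exists (be a); rewrite /= beK.
by move=> x /HA [c hc]; exists c; split; [apply: h|apply: h'].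
Qed.

(** By separatedness it suffices that the local ring at the second point be contained in the one at
    the first, which is checked on coordinates. *)
Lemma move_pt al (t : {rmorphism F -> F}) z z' : (forall i, z i != 0) -> (forall i, z' i != 0) ->
  (forall V x x', val_rel V -> (forall f c, Reg x f c -> V f c) ->
    (forall f c, Reg x' f c -> V f c) -> x = x') ->
  (forall c, t (cst F c) = cst F c) -> (forall x f c, Reg (al x) f c <-> Reg x (t f) c) ->
  (forall j, local (coord F) z (t (coord F j)) (z' j)) -> al (pt z) = pt z'.
Proof.
move=> z0 z'0 sep tc tR H; apply: (sep (Reg (al (pt z)))) => //; first exact: lr_val (Reg_rel _).
move=> f c; rewrite Reg_pt // tR Reg_pt // => h.
exact: (local_sub (pullback_rel tc (local_rel (on_coord z))) H h).
Qed.

End FunctionField.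

(** * Affine space as a variety *)

Section AffineSpaceVariety.
Variables (K : closedFieldType) (n : nat).
Local Notation A := (affine_space K n).

Lemma affine_open (W : set A) x : open W -> W x ->
  exists q : {mpoly K[n]}, q.@[x] != 0 /\ forall y, q.@[y] != 0 -> W y.
Proof.
move=> oW Wx; have [V [f [[p [q [VE _]]] Vx sV]]] := oW x Wx.
by exists q; split=> [|y qy]; [move: Vx; rewrite VE|apply: sV; rewrite VE].
Qed.

Lemma affine_irreducible : irreducible [set: A].
Proof.
split; first by exists (fun=> 0).
move=> B C cB cC BC; apply: contrapT => /not_orP [/existsNP [b /not_implyP [_ hb]]].
move=> /existsNP [c /not_implyP [_ hc]].
have [q [qb Hq]] := affine_open (closed_openC cB) hb.
have [q' [qc Hq']] := affine_open (closed_openC cC) hc.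
have q0 : q != 0 by apply: contra_neq qb => ->; rewrite meval0.
have q'0 : q' != 0 by apply: contra_neq qc => ->; rewrite meval0.
have [z] := mpoly_nonzero (mulf_neq0 q0 q'0); rewrite mevalM mulf_eq0 negb_or => /andP[qz q'z].
by case: (BC z I) => [/(Hq z qz)|/(Hq' z q'z)].
Qed.

Lemma affine_affine (S : set A) (I : set {mpoly K[n]}) : S = setT -> zero_locus I = setT ->
  affine (induced_space S).
Proof.
move=> ST IT; exists n, I.
have id1 (S1 S2 : set A) (h : forall x, S1 x -> S2 x) :
    regular_map (fun v : induced_space S1 => (exist S2 (sval v) (h _ (svalP v)) : induced_space S2)).
  split.
    apply/continuousP => W oW; move=> v Wv.
    have [W0 [g [[U1 [g1 [r1 -> E1]]] W0v sW]]] := oW _ Wv.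
    exists (sval @^-1` U1), (g1 \o sval); split=> //; last by move=> w Uw; apply: sW.
    by exists U1, g1.
  move=> W g rg v Wv; have [W0 [g0 [[U1 [g1 [r1 -> E1]]] W0v sW E]]] := rg _ Wv.
  exists (sval @^-1` U1), (g1 \o sval); split=> //; first by exists U1, g1.
  - by move=> w Uw; apply: sW.
  - by move=> w Uw /=; rewrite E // E1.
have h1 x : S x -> zero_locus I x by rewrite IT.
have h2 x : zero_locus I x -> S x by rewrite ST.
exists (fun v : induced_space S => (exist _ (sval v) (h1 _ (svalP v)) : induced_space (zero_locus I))).
split; first exact: id1.
exists (fun v : induced_space (zero_locus I) => (exist S (sval v) (h2 _ (svalP v)) : induced_space S)).
split=> [[x hx]|[x hx]|]; last exact: id1; by congr exist; apply: Prop_irrelevance.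
Qed.

Lemma affine_cover : exists (m : nat) (U : 'I_m -> set A),
  [/\ forall i, open (U i), forall i, affine (induced_space (U i)) & \bigcup_i U i = setT].
Proof.
exists 1%N, (fun=> setT); split; first by move=> _; apply: openT.
- by move=> _; apply: (@affine_affine _ set0) => //; apply/seteqP; split=> // x _ p [].
- by apply/seteqP; split=> // x _; exists ord0.
Qed.

Lemma affine_separated : closed (@Defs.diagonal K A).
Proof.
rewrite -[@Defs.diagonal K A]setCK; apply: open_closedC.
move=> [x y] /= xy; have [i xyi] : exists i, x i != y i.
  apply: contrapT => /forallNP H; apply: xy; apply/funext => i.
  by apply/eqP; apply: contrapT => /negP; apply: H.
have rc k := affine_coord_regular (K := K) (n := n) k.
pose b (z : A * A) : K := z.1 i + (-1) * z.2 i.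
have tb : tensor setT setT b.
  apply: tensor_add; first exact: (@tensor_fst _ A A setT setT (fun x => x i) (rc i)).
  apply: tensor_mul; last exact: (@tensor_snd _ A A setT setT (fun x => x i) (rc i)).
  by apply: (@tensor_fst _ A A setT setT (fun=> -1)); apply: regular_cst; exact: openT.
exists [set z | [/\ setT z.1, setT z.2 & b z != 0]], (fun z => b z / b z); split.
- by exists setT, setT, b, b; split=> //; split=> //; apply: openT.
- by split=> //; rewrite /b /= mulN1r subr_eq0.
- by move=> [u v] [_ _ /=] + uv; rewrite /Defs.diagonal /= in uv; rewrite /b /= uv mulN1r subrr eqxx.
Qed.

Definition affine_variety : variety K := Variety affine_irreducible affine_cover affine_separated.

End AffineSpaceVariety.

(** * Affine pieces and the toric family of a variety *)

Section Pieces.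
Variables (K : closedFieldType) (X : variety K) (n : nat) (U : set X).
Variable jt : torus K n -> induced_space U.
Hypothesis oU : open U.
Variable ji : induced_space U -> torus K n.
Hypotheses (jtr : regular_map jt) (jir : regular_map ji) (jtK : cancel jt ji) (jiK : cancel ji jt).
Variable F : frac_field {mpoly K[n]}.
Implicit Types (W A : set X) (f g : F) (c : K).
Local Notation Reg := (Reg jt (F := F)).
Local Notation represents := (represents jt (F := F)).
Let Regrel := Reg_rel oU jtr jir jtK jiK F.
Let Regeq := @Reg_eq K X n U jt oU ji jtr jir jtK jiK F.
Let repr_ex := @repr_exists K X n U jt oU ji jtr jir jtK jiK F.

(** An affine open set seen through its coordinate functions [s] and their images [y] in [F].
    [pc_basic] describes topology and sheaf by fractions in [s]; [pc_point] says that no point of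
    the affine variety is missing. *)
Record piece (V : set X) r (s : 'I_r -> X -> K) (y : 'I_r -> F) : Prop := Piece {
  pc_open : open V;
  pc_nonempty : V !=set0;
  pc_repr : forall i, represents V (s i) (y i);
  pc_basic : forall W (g : X -> K) x, regular W g -> V x -> W x -> exists P Q : {mpoly K[r]},
    Q.@[fun i => s i x] != 0 /\ forall x', V x' -> Q.@[fun i => s i x'] != 0 ->
    W x' /\ g x' = P.@[fun i => s i x'] / Q.@[fun i => s i x'];
  pc_point : forall c : 'I_r -> K, on_relations y c -> exists2 x, V x & forall i, s i x = c i }.

Lemma affine_piece (V : set X) : open V -> V !=set0 -> affine (induced_space V) ->
  exists r s y, @piece V r s y.
Proof.
move=> oV nV [r [J [phi [phir [psi [phiK psiK psir]]]]]].
pose s i x : K := extend 0 (fun v : induced_space V => sval (phi v) i) x.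
have sE v i : s i (sval v) = sval (phi v) i by rewrite /s extendE.
have rs i : regular V (s i).
  have := induced_regular oV (phir.2 _ _ (regular_incl (U := zero_locus J) (affine_coord_regular i))).
  by rewrite (_ : V `&` _ = V) //; apply/seteqP; split=> [x []|x Vx]//; split.
have /choice [y hy] i : exists y : F, represents V (s i) y by apply: repr_ex.
have oW : open V := oV.
exists r, s, y; split=> // [W g x rg Vx Wx|c onc].
  pose v : induced_space V := exist V x Vx.
  have Wv : W (incl (psi (phi v))) by rewrite phiK.
  have [P [Q [Qv H]]] := reg_param psir rg Wv; exists P, Q.
  have svE x' (Vx' : V x') : (fun i => s i x') = sval (phi (exist V x' Vx')).
    by apply/funext => i; rewrite -sE.
  split; first by rewrite (svE x Vx).
  move=> x' Vx'; rewrite (svE x' Vx') => /H.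
  by rewrite phiK.
have cJ : zero_locus J c.
  move=> p Jp; apply: onc.
  have [x Vx] := nV; apply: (Regeq (A := V)) => // x' Vx'; exists 0; split; last exact: vr_zero (Regrel x').
  have := vr_peval (Regrel x') p (fun i => reg_Reg (hy i) Vx').
  suff -> : p.@[fun i => s i x'] = 0 by [].
  rewrite (_ : (fun i => s i x') = sval (phi (exist V x' Vx'))); first exact: (svalP (phi _) p Jp).
  by apply/funext => i; rewrite -sE.
exists (incl (psi (exist _ c cJ))); first exact: (svalP (psi _)).
by move=> i; rewrite /incl sE psiK.
Qed.

Lemma piece_local V r s y x f v : @piece V r s y -> V x ->
  Reg x f v <-> local y (fun i => s i x) f v.
Proof.
move=> pc Vx; have hs i : Reg x (y i) (s i x) := reg_Reg (pc_repr pc i) Vx.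
split; last exact: (local_sub (V := Reg x) (Regrel x) hs (f := f)).
move=> [W [g [Wx hg <-]]]; have [P [Q [Qx H]]] := pc_basic pc hg.1 Vx Wx.
have [_ gE] := H x Vx Qx; exists P, Q; split=> //.
have oQ : open (V `&` [set x' | Q.@[fun i => s i x'] != 0]).
  by apply: reg_nz; apply: reg_meval; [exact: pc_open pc|move=> i; case: (pc_repr pc i)].
apply: (Regeq oQ); first by exists x.
move=> x' [Vx' Qx']; exists (g x'); have [Wx' gx'] := H x' Vx' Qx'.
split; first exact: reg_Reg hg Wx'.
have hs' i : Reg x' (y i) (s i x') := reg_Reg (pc_repr pc i) Vx'.
by rewrite gx'; apply: (lr_div (Regrel x')) => //; apply: (vr_peval (Regrel x')).
Qed.

Lemma piece_on V r s y x : @piece V r s y -> V x -> on_relations y (fun i => s i x).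
Proof. by move=> pc Vx; apply: (on_rel (Regrel x)) => i; apply: reg_Reg (pc_repr pc i) Vx. Qed.

Lemma pieces_exist : exists m (V : 'I_m -> set X) (r : 'I_m -> nat) (s : forall j, 'I_(r j) -> X -> K)
  (y : forall j, 'I_(r j) -> F), (forall j, piece (V j) (s j) (y j)) /\ forall x, exists j, V j x.
Proof.
have [m [V [oV aV cV]]] := variety_affine_cover X.
pose I := [pred i | `[< V i !=set0 >]].
have H (j : 'I_#|I|) : exists rsy : {r & (('I_r -> X -> K) * ('I_r -> F))%type},
    piece (V (enum_val j)) (projT2 rsy).1 (projT2 rsy).2.
  have nV : V (enum_val j) !=set0 by apply/asboolP; have := enum_valP j; rewrite inE.
  have [r [s [y pc]]] := affine_piece (oV _) nV (aV _).
  by exists (existT _ r (s, y)).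
have [rsy hrsy] := choice H.
exists #|I|, (fun j => V (enum_val j)), (fun j => projT1 (rsy j)),
  (fun j => (projT2 (rsy j)).1), (fun j => (projT2 (rsy j)).2); split=> // x.
have : (\bigcup_i V i) x by rewrite cV.
move=> [i _ Vix]; have Ii : i \in I by apply/asboolP; exists x.
by exists (enum_rank_in Ii i); rewrite enum_rankK_in.
Qed.

(** If the points differ, some function [b] near (x, x') is nonzero there and vanishes on the
    diagonal. Its restriction to the diagonal is 0 in [F], while [V] gives it the value b(x, x'). *)
Lemma Reg_separated V x x' : val_rel V -> (forall f c, Reg x f c -> V f c) ->
  (forall f c, Reg x' f c -> V f c) -> x = x'.
Proof.
move=> vV h h'; apply: contrapT => xx.
have oD := closed_openC (variety_separated (v := X)).
have [W [f [[U1 [V1 [a [b [[oU1 oV1 ta tb] WE _]]]]] Wx sW]]] := oD (x, x') xx.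
rewrite WE /= in Wx; have [Ux Vx' bxx] := Wx.
have oUV := openI oU1 oV1.
have nUV : U1 `&` V1 !=set0 by apply: open_meet => //; [exists x|exists x'].
have [g [hg Vg]] : exists g : F, represents (U1 `&` V1) (fun u => b (u, u)) g /\ V g (b (x, x')).
  elim: tb => {a ta b WE Wx bxx}.
  - move=> g rg; have [f' hf'] := repr_ex rg (ex_intro _ x Ux : U1 !=set0).
    exists f'; split; last by apply/h/(reg_Reg hf').
    by apply: (repr_restrict oUV _ hf') => u [].
  - move=> g rg; have [f' hf'] := repr_ex rg (ex_intro _ x' Vx' : V1 !=set0).
    exists f'; split; last by apply/h'/(reg_Reg hf').
    by apply: (repr_restrict oUV _ hf') => u [].
  - move=> a b _ [fa [ha Va]] _ [fb [hb Vb]]; exists (fa + fb); split; last exact: (vr_add vV).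
    apply: (repr_intro oU jtr jir jtK jiK (A := setT)) => //; first exact: regular_add ha.1 hb.1.
    + exact: openT.
    + by exists x.
    by move=> z z0 Wz _; apply: (vr_add (local_rel (on_coord z)));
      [apply: (repr_local jtr ha)|apply: (repr_local jtr hb)].
  - move=> a b _ [fa [ha Va]] _ [fb [hb Vb]]; exists (fa * fb); split; last exact: (vr_mul vV).
    apply: (repr_intro oU jtr jir jtK jiK (A := setT)) => //; first exact: regular_mul ha.1 hb.1.
    + exact: openT.
    + by exists x.
    by move=> z z0 Wz _; apply: (vr_mul (local_rel (on_coord z)));
      [apply: (repr_local jtr ha)|apply: (repr_local jtr hb)].
have g0 : g = 0.
  apply: (Regeq oUV nUV) => u Wu; exists 0; split; last exact: vr_zero (Regrel u).
  have <- : b (u, u) = 0; last exact: reg_Reg hg Wu.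
  apply/eqP; apply: contrapT => /negP bu; have := sW (u, u).
  by rewrite WE => H; case: Wu => Uu Vu; case: (H).
by move: Vg; rewrite g0 => /(vr_0 vV) b0; rewrite b0 eqxx in bxx.
Qed.

End Pieces.

Section ToricVariety.
Variables (K : closedFieldType) (X : variety K) (n : nat) (U : set X).
Variable jt : torus K n -> induced_space U.
Hypothesis oU : open U.
Variable ji : induced_space U -> torus K n.
Hypotheses (jtr : regular_map jt) (jir : regular_map ji) (jtK : cancel jt ji) (jiK : cancel ji jt).
Variable F : frac_field {mpoly K[n]}.
Implicit Types (W A : set X) (f g : F) (c : K).
Local Notation Reg := (Reg jt (F := F)).
Local Notation represents := (represents jt (F := F)).
Let Regrel := Reg_rel oU jtr jir jtK jiK F.
Let Regeq := @Reg_eq K X n U jt oU ji jtr jir jtK jiK F.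
Let repr_ex := @repr_exists K X n U jt oU ji jtr jir jtK jiK F.
Let Regopen := @Reg_open K X n U jt oU ji jtr jir jtK jiK F.
Let pieces := @pieces_exist K X n U jt oU ji jtr jir jtK jiK F.

(* If the coordinates of no affine piece are finite at V, then each piece j has a
   coordinate with inverse u j vanishing at V.  Completeness, applied to the closure of
   the graph of u, gives a point x of X over u = 0, contradicting u j * (u j)^-1 = 1 on
   a piece containing x. *)
Lemma Reg_center (V : F -> K -> Prop) : Defs.complete X -> val_rel V ->
  (forall f, f != 0 -> (exists c, V f c) \/ V f^-1 0) ->
  exists x, forall f c, Reg x f c -> V f c.
Proof.
move=> cX vV total.
have lV : loc_rel V.
  split=> // f c hf c0; have f0 : f != 0.
    by apply: contra_neq c0 => f0; apply: (vr_0 vV); rewrite -f0.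
  have [[d hd]|h] := total f^-1 (invr_neq0 f0).
    have := vr_mul vV hf hd; rewrite divff // => /(vr_uniq vV (vr_one vV)) cd.
    suff -> : c^-1 = d by [].
    by apply: (mulfI c0); rewrite divff.
  by rewrite invrK in h; case/eqP: c0; apply: (vr_uniq vV hf h).
have [m [P [r [s [y [pc cov]]]]]] := pieces.
have [[j /choice [c hc]]|nj] := EM (exists j, forall i, exists c, V (y j i) c).
  have [x Px sx] := pc_point (pc j) (on_rel vV hc).
  exists x => f v /(piece_local oU jtr jir jtK jiK _ _ (pc j) Px).
  by rewrite (_ : (fun i => s j i x) = c); [apply: local_sub|apply/funext].
have /choice [us hus] j : exists us : F * (X -> K),
    [/\ us.1 != 0, V us.1 0 & represents (P j) us.2 us.1^-1].
  have [i hi] : exists i, forall c, ~ V (y j i) c.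
    by apply: contrapT => H; apply: nj; exists j => i; apply: contrapT => /forallNP h; apply: H; exists i.
  have y0 : y j i != 0 by apply/eqP => y0; apply: (hi 0); rewrite y0; apply: vr_zero vV.
  exists ((y j i)^-1, s j i); rewrite /= invrK invr_neq0 //; split=> //; last exact: pc_repr (pc j) i.
  by have [[d /hi]|] := total _ y0.
pose u j := (us j).1.
have [x0 _] : [set: X] !=set0 by exists (pt jt (fun=> 1)).
have /choice [A hA] j : exists A : set X, [/\ open A, A !=set0 & forall x, A x -> exists c, Reg x (u j) c].
  by have [A [oA nA _ HA]] := Regopen (u j) openT (ex_intro _ x0 I : [set: X] !=set0); exists A.
have [oW nW] : open (\bigcap_j A j) /\ \bigcap_j A j !=set0.
  by apply: open_meets => j; case: (hA j).
set W := \bigcap_j A j in oW nW.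
have /choice [uv huv] x : exists uv : 'I_m -> K, W x -> forall j, Reg x (u j) (uv j).
  have [Wx|] := EM (W x); last by exists (fun=> 0).
  by have /choice [uv H] j : exists c, Reg x (u j) c; [case: (hA j) => _ _; apply; apply: Wx|exists uv].
pose Ga : set (prod_space X (affine_space K m)) := [set z : X * ('I_m -> K) | W z.1 /\ z.2 = uv z.1].
pose Y := affine_variety K m.
have cZ := @closed_closure _ Ga.
have cC := cX Y (closure Ga) cZ.
have : ((fun z : X * Y => z.2) @` (closure Ga : set (X * Y))) (fun=> 0).
  apply: contrapT => h0; have [q [q0 Hq]] := affine_open (closed_openC cC) h0.
  have uq : peval u q = 0.
    apply: (Regeq oW nW) => x Wx; exists 0; split; last exact: vr_zero (Regrel x).
    have := vr_peval (Regrel x) q (huv x Wx).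
    suff -> : q.@[uv x] = 0 by [].
    apply/eqP; apply: contrapT => /negP /Hq; apply.
    exists (x, uv x) => //; apply: (@subset_closure _ Ga).
    by split.
  have hu j : V (u j) 0 by case: (hus j).
  have := vr_peval vV q hu; rewrite uq => /(vr_0 vV) E.
  by rewrite E eqxx in q0.
move=> [[x a] Zxa /= a0]; have [j Pjx] := cov x.
have [u0 _ hs] := hus j; set sj := (us j).2 in hs.
pose b (z : X * Y) : K := sj z.1 * z.2 j + (-1).
have rc := affine_coord_regular (K := K) (n := m) j.
have tb : tensor (P j) setT b.
  apply: tensor_add.
    apply: tensor_mul; first exact: (@tensor_fst _ X Y (P j) setT sj hs.1).
    exact: (@tensor_snd _ X Y (P j) setT (fun x => x j) rc).
  by apply: (@tensor_snd _ X Y (P j) setT (fun=> -1)); apply: regular_cst; exact: openT.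
have oN : open ([set z | [/\ P j z.1, setT z.2 & b z != 0]] : set (prod_space X Y)).
  move=> z Nz; exists [set z | [/\ P j z.1, setT z.2 & b z != 0]], (fun z => b z / b z); split=> //.
  exists (P j), setT, b, b; split=> //; split=> //; [exact: pc_open (pc j)|exact: openT].
have Nx : [set z : X * Y | [/\ P j z.1, setT z.2 & b z != 0]] (x, a).
  by split=> //; rewrite /b /= a0 mulr0 add0r oppr_eq0 oner_neq0.
have [[x' a'] [[Wx' /= aE] [Px' _]]] := Zxa _ (open_nbhs_nbhs (conj oN Nx)).
rewrite /b /= aE; case/eqP; apply/eqP; rewrite addr_eq0 opprK; apply/eqP.
apply: (vr_uniq (Regrel x') _ (vr_one (Regrel x'))).
rewrite -(mulVf u0); apply: (vr_mul (Regrel x')); first exact: reg_Reg hs Px'.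
exact: huv.
Qed.

(* Functions gg i vanishing on Z i but not on Z (i + 1) are algebraically independent. *)
Lemma chain_bound (x : X) e (Z : nat -> set X) : irreducible_chain x e Z -> (e <= n)%N.
Proof.
move=> [cZ sZ]; have [m [P [r [s [y [pc cov]]]]]] := pieces.
have [j Px] := cov x; move: (P j) (r j) (s j) (y j) (pc j) Px => {P r s y pc cov} P r s y pc Px.
have oP := pc_open pc.
have /choice [Q hQ] i : exists Q : {mpoly K[r]}, (i < e)%N ->
    (forall u, P u -> Z i u -> Q.@[fun k => s k u] = 0) /\
    exists u, [/\ P u, Z i.+1 u & Q.@[fun k => s k u] != 0].
  have [ie|] := boolP (i < e)%N; last by exists 0.
  have [cZi _ _] := cZ i (ltnW ie); have [_ [_ irr] Zx] := cZ i.+1 ie.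
  have [sub nsub] := sZ i ie.
  have [u [Pu Zu nZu]] : exists u, [/\ P u, Z i.+1 u & ~ Z i u].
    apply: contrapT => H; case: (irr (Z i) (~` P)) => //.
    - exact: open_closedC.
    - move=> u Zu; have [Pu|] := EM (P u); last by right.
      by left; apply: contrapT => h; apply: H; exists u.
    - by move/(_ x Zx).
  have [R [Q [Qu HQ]]] := pc_basic pc (regular_cst 0 (closed_openC cZi)) Pu nZu.
  exists Q => _; split; last by exists u.
  by move=> w Pw Zw; apply/eqP; apply: contrapT => /negP /(HQ w Pw) [].
pose gg (i : nat) (u : X) : K := (Q i).@[fun k => s k u].
have rs k : regular P (s k) by case: (pc_repr pc k).
have rg i : regular P (gg i) by apply: reg_meval.
have key k : (k <= e)%N -> forall p : {mpoly K[k]},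
    (forall u, P u -> Z k u -> p.@[fun i : 'I_k => gg i u] = 0) -> p = 0.
  elim: k => [|k IH] ke p hp.
    have [_ _ Zx] := cZ 0%N ke.
    have := hp x Px Zx; rewrite (nvar0_mpolyC_eq p (erefl _)) mevalC => ->.
    by rewrite mpolyC0.
  have kE (q : {mpoly K[k.+1]}) u : q.@[fun i : 'I_k.+1 => gg i u] =
      (map_poly (meval (fun i : 'I_k => gg i u)) (muni q)).[gg k u].
    rewrite horner_muni; apply: meval_eq => i.
    by have [i'|] := unliftP ord_max i => ->; rewrite ?lift_max.
  (* Induction on the size of a relation as a polynomial in gg_k. Its constant term vanishes on
     [Z k], hence is 0, and the factor gg_k can be removed because it is not identically 0 on the
     irreducible [Z k.+1]. *)
  suff H N (q : {poly {mpoly K[k]}}) : (size q <= N)%N -> (forall u, P u -> Z k.+1 u ->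
      (map_poly (meval (fun i : 'I_k => gg i u)) q).[gg k u] = 0) -> q = 0.
    have q0 : muni p = 0 by apply: (H _ _ (leqnn _)) => u Pu Zu; rewrite -kE hp.
    by rewrite -[p]muniK q0 rmorph0.
  elim: N q => [|N IHN] q sq hq; first by apply/eqP; rewrite -size_poly_leq0.
  have [g0 [w [Pw Zw gw]]] := hQ k ke.
  have q0 : q`_0 = 0.
    apply: (IH (ltnW ke)) => u Pu Zu; have Zu' : Z k.+1 u by apply: (sZ k ke).1.
    have := hq u Pu Zu'; rewrite /gg (g0 u Pu Zu) horner_coef0 coef_map /=.
    by [].
  have [q' qE] : exists q', q = q' * 'X.
    exists (\poly_(i < size q) q`_i.+1); apply/polyP => -[|i]; rewrite coefMX //=.
    by rewrite coef_poly; case: ltnP => // h; rewrite nth_default // ltnW.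
  have -> // : q = 0.
  rewrite qE; have -> : q' = 0; last by rewrite mul0r.
  have [->|q'0] := eqVneq q' 0; first by [].
  apply: IHN; first by move: sq; rewrite qE size_mulX.
  pose h1 u := (map_poly (meval (fun i : 'I_k => gg i u)) q').[gg k u].
  have rh1 : regular P h1.
    have E u : h1 u = \sum_(i < size q') (q'`_i).@[fun i : 'I_k => gg i u] * gg k u ^+ i.
      rewrite /h1 (horner_coef_wide _ (size_poly _ _)); apply: eq_bigr => i _.
      by rewrite coef_map.
    apply: (reg_ext (f := fun u => \sum_(i < size q') (q'`_i).@[fun i : 'I_k => gg i u] * gg k u ^+ i)).
      by move=> u _; rewrite E.
    by apply: reg_sum => // i; apply: regular_mul; [apply: reg_meval|apply: reg_exp].
  have [_ [_ irr] _] := cZ k.+1 ke.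
  have := irr (~` (P `&` [set u | h1 u != 0])) (~` (P `&` [set u | gg k u != 0])); case.
  - exact: (open_closedC (reg_nz rh1)).
  - exact: (open_closedC (reg_nz (rg k))).
  - move=> u Zu; have [Pu|nPu] := EM (P u); last by left => - [].
    have := hq u Pu Zu; rewrite qE rmorphM /= map_polyX hornerM hornerX => /eqP.
    rewrite mulf_eq0 => /orP[h|h]; [left|right]; case=> _ /=; by rewrite ?/h1 (eqP h) eqxx.
  - move=> H u Pu Zu; apply/eqP; apply: contrapT => /negP hu; exact: (H u Zu).
  - by move/(_ w Zw); case; split.
apply: (@alg_indep_leq K n F e (fun i => peval y (Q i))) => p p0.
apply: (key e (leqnn e)) => u Pu _; apply: (vr_0 (Regrel u)); rewrite -p0.
apply: (vr_peval (Regrel u)) => i; apply: (vr_peval (Regrel u)) => k.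
exact: reg_Reg (pc_repr pc k) Pu.
Qed.

(** Non-singularity provides as many generators as the local dimension, at most n by [chain_bound];
    the family is completed by zeros. *)
Lemma Reg_maximal x : nonsingular_at x -> exists tau : 'I_n -> F, (forall i, Reg x (tau i) 0) /\
  forall f, Reg x f 0 -> exists (a : 'I_n -> F) (v : 'I_n -> K),
    (forall i, Reg x (a i) (v i)) /\ f = \sum_i a i * tau i.
Proof.
move=> [d [[Z /chain_bound dn] _] [t [t0 tM]]].
have /choice [Wt hWt] i : exists Wg : set X * F, Wg.1 x /\ represents Wg.1 (t i) Wg.2.
  have [[W Wx rt] _] := t0 i; have [g hg] := repr_ex rt (ex_intro _ x Wx : W !=set0).
  by exists (W, g).
pose T k : F := if insub k is Some i then (Wt (i : 'I_d)).2 else 0.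
have TE (i : 'I_d) : T i = (Wt i).2 by rewrite /T valK.
exists (fun i : 'I_n => T i); split=> [i|f [W [r [Wx hr rx]]]].
  rewrite /T; case: insubP => [k _ _|_]; last exact: vr_zero (Regrel x).
  by rewrite -(t0 k).2; apply: reg_Reg (hWt k).2 (hWt k).1.
have [|a [ra near]] := tM r _ rx; first by exists W => //; case: hr.
have /choice [Wa hWa] i : exists Wg : set X * F, Wg.1 x /\ represents Wg.1 (a i) Wg.2.
  have [W' W'x rt] := ra i; have [g hg] := repr_ex rt (ex_intro _ x W'x : W' !=set0).
  by exists (W', g).
pose A k : F := if insub k is Some i then (Wa (i : 'I_d)).2 else 0.
have AE (i : 'I_d) : A i = (Wa i).2 by rewrite /A valK.
exists (fun i : 'I_n => A i), (fun i : 'I_n => if insub (i : nat) is Some k then a (k : 'I_d) x else 0).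
split=> [i|].
  rewrite /A; case: insubP => [k _ _|_]; last exact: vr_zero (Regrel x).
  by apply: reg_Reg (hWa k).2 (hWa k).1.
have -> : \sum_(i < n) A i * T i = \sum_(i < d) A i * T i.
  rewrite (big_ord_widen n (fun i => A i * T i) dn) [RHS]big_mkcond; apply: eq_bigr => i _.
  case: ifP => // id; rewrite /A insubF ?id //.
  by rewrite mul0r.
have [B [oB Bx] sB] : exists2 B, open_nbhs x B & B `<=` [set y | r y = \sum_(i < d) a i y * t i y].
  have : nbhs x [set y | r y = \sum_(i < d) a i y * t i y] := near.
  by rewrite nbhsE.
have [o1 _] : open (\bigcap_i (Wt i).1) /\ \bigcap_i (Wt i).1 !=set0.
  by apply: open_meets => i; [exact: regular_open (hWt i).2.1|exists x; exact: (hWt i).1].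
have [o2 _] : open (\bigcap_i (Wa i).1) /\ \bigcap_i (Wa i).1 !=set0.
  by apply: open_meets => i; [exact: regular_open (hWa i).2.1|exists x; exact: (hWa i).1].
apply: (Regeq (A := (B `&` W) `&` ((\bigcap_i (Wt i).1) `&` \bigcap_i (Wa i).1))).
- by apply: openI; apply: openI => //; apply: regular_open hr.1.
- exists x; split; first by split.
  by split=> i _; [exact: (hWt i).1|exact: (hWa i).1].
move=> w [[Bw Ww] [Tw Aw]]; exists (r w); split; first exact: reg_Reg hr Ww.
rewrite (sB w Bw); apply: (vr_sum (Regrel w)) => i; rewrite AE TE.
by apply: (vr_mul (Regrel w)); [apply: reg_Reg (hWa i).2 (Aw i I)|apply: reg_Reg (hWt i).2 (Tw i I)].
Qed.

Variable sg : prod_space (torus K n) X -> X.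
Hypothesis sgr : regular_map sg.
Hypothesis sg1 : forall x, sg (torus_one K n, x) = x.
Hypothesis sgM : forall s t x, sg (torus_mul s t, x) = sg (s, sg (t, x)).
Hypothesis sgt : forall s t, sg (s, incl (jt t)) = incl (jt (torus_mul s t)).

(** Fixing the first variable turns the tensors that define the sheaf of the product into regular
    functions on [X]. *)
Lemma translate_rmap (s : torus K n) : rmap setT (fun x : X => sg (s, x)).
Proof.
split=> [|W g rg]; first exact: openT.
have h := sgr.2 _ _ rg; apply: regular_glue => x [_ Wx].
have [V0 [g0 [[U1 [V1 [a [b [[oU1 oV1 ta tb] V0E gE]]]]] V0x sW E]]] := h (s, x) Wx.
rewrite V0E /= in V0x; have [Us Vx bx] := V0x.
have slice (c : torus K n * X -> K) : tensor U1 V1 c -> regular V1 (fun y => c (s, y)).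
  elim=> {c}.
  - by move=> f _; apply: (reg_ext (f := fun=> f s)) => //; apply: regular_cst.
  - by [].
  - by move=> a1 b1 _ h1 _ h2; apply: regular_add.
  - by move=> a1 b1 _ h1 _ h2; apply: regular_mul.
exists (V1 `&` [set y | b (s, y) != 0]); split=> //.
  by move=> y [Vy by0]; split=> //; apply: (sW (s, y)); rewrite V0E.
apply: (reg_ext (f := fun y => a (s, y) / b (s, y))).
  move=> y [Vy by0] /=; have V0y : V0 (s, y) by rewrite V0E.
  by rewrite -gE // -E.
apply: regular_mul; last exact: regular_inv (slice _ tb).
by apply: regular_restrict (slice _ ta) => [|y []//]; apply: reg_nz (slice _ tb).
Qed.

Lemma torus_eq (s t : torus K n) : torus_coord s = torus_coord t -> s = t.
Proof.
case: s t => [x hx] [y hy]; rewrite /torus_coord /incl /= => E.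
by move: hx hy; rewrite E => hx hy; congr exist; apply: Prop_irrelevance.
Qed.

Lemma Reg_scale z x : (forall i, z i != 0) ->
  exists x', forall f c, Reg x' f c <-> Reg x (scale F z f) c.
Proof.
move=> z0; have z'0 i : (z i)^-1 != 0 by rewrite invr_neq0.
pose s := torus_elt z0; pose s' := torus_elt z'0.
have mul1 (a b : torus K n) : (forall i, torus_coord a i * torus_coord b i = 1) ->
    cancel (fun x => sg (a, x)) (fun x => sg (b, x)).
  move=> ab w; rewrite -sgM (_ : torus_mul b a = torus_one K n) ?sg1 //.
  by apply: torus_eq; apply/funext => i; rewrite /torus_coord /= mulrC ab.
have [t [tc tR]] := @pullback K X n U jt oU ji jtr jir jtK jiK F _ _ (translate_rmap s) (translate_rmap s')
  (mul1 s s' (fun i => divff (z0 i))) (mul1 s' s (fun i => mulVf (z0 i))).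
exists (sg (s, x)) => f c; rewrite tR.
suff -> : t f = scale F z f by [].
apply: ff_rmorph_ext => [d|j]; first by rewrite tc endo_cst.
apply: (Regeq oU (U_nonempty jt)) => w Uw; rewrite -(pt_tau jiK Uw).
have w0 := tau_neq0 ji w; set y := tau ji w in w0 *; exists (z j * y j).
have zy0 i : z i * y i != 0 by rewrite mulf_neq0.
rewrite -tR !(Reg_pt oU jtr jir jtK) //; split; last first.
  rewrite scale_coord //; apply: (vr_mul (local_rel (on_coord y))); first exact: (vr_cst (local_rel (on_coord y))).
  by apply: local_coord; apply: on_coord.
have -> : sg (s, pt jt y) = pt jt (fun i => z i * y i).
  rewrite -[y]/(torus_coord (torus_elt w0)) ptE sgt -ptE; congr (pt jt _).
rewrite (Reg_pt oU jtr jir jtK) //.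
exact: (@local_coord _ _ F _ _ (fun i => z i * y i) j (on_coord _)).
Qed.

Theorem toric_family_of_variety : Defs.complete X -> nonsingular X -> toric_family Reg.
Proof.
move=> cX nX; have [m [P [r [s [y [pc cov]]]]]] := pieces.
split.
- exact: Regrel.
- by move=> V; apply: Reg_center.
- by move=> V x x'; apply: (Reg_separated oU jtr jir jtK jiK).
- by move=> z z0; exists (pt jt z) => f c; apply: (Reg_pt oU jtr jir jtK).
- by move=> z x; apply: Reg_scale.
- exists m, r, y; split.
  + move=> x; have [j Px] := cov x; exists j, (fun i => s j i x).
    split; first exact: (piece_on oU jtr jir jtK jiK (pc j) Px).
    by move=> f v; apply: (piece_local oU jtr jir jtK jiK _ _ (pc j) Px).
  + move=> j c on; have [x Px sx] := pc_point (pc j) on; exists x => f v.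
    rewrite (piece_local oU jtr jir jtK jiK _ _ (pc j) Px).
    by rewrite (_ : (fun i => s j i x) = c) //; apply/funext.
  + move=> j f; have [x Px] := pc_nonempty (pc j).
    have [A [oA [w Aw] sA HA]] := Regopen f (pc_open (pc j)) (ex_intro _ x Px : P j !=set0).
    have [c /(piece_local oU jtr jir jtK jiK _ _ (pc j) (sA _ Aw))] := HA w Aw.
    move=> [p [q [q0 fE _]]]; exists p, q; split=> //.
    by apply: on_neq0 q0; apply: (piece_on oU jtr jir jtK jiK (pc j) (sA _ Aw)).
- by move=> x; apply: Reg_maximal.
Qed.

End ToricVariety.

(** * Group actions *)

Section ActionSets.
Variables (K : closedFieldType) (gT : finGroupType) (X : variety K) (to : action [set: gT] X).
Hypothesis reg : acts_regularly to.
Implicit Types (a b : gT) (x : X).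

Lemma toM x a b : to x (a * b)%g = to (to x a) b.
Proof. by have [_ M] : is_action [set: gT]%SET to by [case: to]; apply: M; rewrite finset.in_setT. Qed.

Lemma to1 x : to x 1%g = x.
Proof. by have [inj _] : is_action [set: gT]%SET to by [case: to]; apply: (inj 1%g); rewrite -toM mulg1. Qed.

Lemma toK a : cancel (to^~ a) (to^~ a^-1%g).
Proof. by move=> x; rewrite -toM mulgV to1. Qed.

Lemma toVK a : cancel (to^~ a^-1%g) (to^~ a).
Proof. by move=> x; rewrite -toM mulVg to1. Qed.

Lemma to_rmap a : rmap setT (to^~ a).
Proof. by apply: rmap_total; apply: reg; rewrite finset.in_setT. Qed.

Lemma to_open (A : set X) a : open A -> open [set x | A (to x a)].
Proof. by move=> oA; have := rmap_open (to_rmap a) oA; rewrite setTI. Qed.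

Lemma to_regular (A : set X) f a : regular A f -> regular [set x | A (to x a)] (fun x => f (to x a)).
Proof. by move=> rf; have := (to_rmap a).2 _ _ rf; rewrite setTI. Qed.

Definition core (A : set X) : set X := [set x | forall a, A (to x a)].

Lemma core_open A : open A -> A !=set0 -> open (core A) /\ core A !=set0.
Proof.
move=> oA [x Ax]; have -> : core A = \bigcap_a [set x | A (to x a)].
  by apply/seteqP; split=> y Hy a; [move=> _|]; apply: Hy.
by apply: open_meets => a; [exact: to_open|exists (to x a^-1%g); rewrite /= toVK].
Qed.

Lemma core_sub A : core A `<=` A.
Proof. by move=> x /(_ 1%g); rewrite to1. Qed.

Lemma core_inv A x a : core A x -> core A (to x a).
Proof. by move=> Ax b; rewrite -toM. Qed.

End ActionSets.

(* The action lifted to homogeneous coordinates over a dense open invariant set. *)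
Record lift_model (K : closedFieldType) (gT : finGroupType) (X : variety K)
    (to : action [set: gT] X) n N (V : 'M[int]_(n, N)) (W : 'M[int]_(N, n))
    (P : gT -> 'I_N -> {mpoly K[N]}) (al : gT -> 'I_N -> 'rV[int]_N) (d : 'I_N -> nat)
    (good : set X) (ptt : ('I_n -> K) -> X) (tt : X -> 'I_n -> K) : Prop := LiftModel {
  lm_split : V *m W = 1%:M;
  lm_comp : forall a b, exists2 ga, inker V ga & forall z i,
    (P b i).@[fun k => (P a k).@[z]] = ga i * (P (a * b)%g i).@[z];
  lm_equiv : forall a s, inker V s -> inker V (fun i => chival s (al a i)) /\
    forall z i, (P a i).@[fun k => s k * z k] = chival s (al a i) * (P a i).@[z];
  lm_weight : forall a i m, m \in msupp (P a i) -> (\sum_k m k * d k)%N = d i;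
  lm_pos : forall i, (0 < d i)%N;
  lm_open : open good;
  lm_nonempty : good !=set0;
  lm_inv : forall x a, good x -> good (to x a);
  lm_neq0 : forall x i, tt x i != 0;
  lm_ptt : forall x, good x -> ptt (tt x) = x;
  lm_tt : forall z, (forall i, z i != 0) -> tt (ptt z) = z;
  lm_tt_reg : forall j, regular good (fun x => tt x j);
  lm_pt_reg : forall (Y : fspace K) (A : set Y) (psi : Y -> 'I_n -> K), open A ->
    (forall i, regular A (fun y => psi y i)) -> (forall i y, A y -> psi y i != 0) ->
    rmap A (ptt \o psi);
  lm_lift : forall z a, (forall i, z i != 0) -> good (ptt (piv V z)) ->
    (forall i, (P a i).@[z] != 0) /\
    to (ptt (piv V z)) a = ptt (piv V (fun i => (P a i).@[z])) }.

Theorem lift_model_exists (K : closedFieldType) (gT : finGroupType) (X : variety K)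
    (to : action [set: gT] X) :
  Defs.complete X -> nonsingular X -> toric X -> acts_regularly to ->
  exists n N (V : 'M_(n, N)) W P al d good ptt tt, @lift_model K gT X to n N V W P al d good ptt tt.
Proof.
move=> cX nX [n [U [jt [sg [oU [jtr [ji [jtK jiK jir]]] sgr [sg1 sgM] sgt]]]]] reg.
have [F] := frac_field_exists {mpoly K[n]}.
have tf := toric_family_of_variety oU jtr jir jtK jiK F sgr sg1 sgM sgt cX nX.
have /choice [st hst] a : exists t : {rmorphism F -> F}, (forall c, t (cst F c) = cst F c) /\
    forall x f c, Reg jt (to x a) f c <-> Reg jt x (t f) c.
  exact: (pullback oU jtr jir jtK jiK F (to_rmap reg a) (to_rmap reg a^-1%g) (@toK _ _ _ to a) (@toVK _ _ _ to a)).
have stc a c : st a (cst F c) = cst F c by case: (hst a).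
have stR a x f c : Reg jt (to x a) f c <-> Reg jt x (st a f) c by case: (hst a).
have st1 f : st 1%g f = f.
  apply: (pullback_eq oU jtr jir jtK jiK (t' := idfun) (to_rmap reg 1%g)).
  - by exists (to^~ 1%g) => x; rewrite !to1.
  - by move=> x g c /stR.
  - by move=> x g c; rewrite to1.
have stM a b f : st (a * b)%g f = st a (st b f).
  apply: (pullback_eq oU jtr jir jtK jiK (t := st (a * b)%g) (t' := st a \o st b) (to_rmap reg (a * b)%g)).
  - by exists (to^~ (a * b)^-1%g) => x; rewrite toVK.
  - by move=> x g c /stR.
  - by move=> x g c; rewrite toM => /stR /stR.
have [|N [V [W [P [al [d cs]]]]]] := @cox_exists K n F X (Reg jt (F := F)) gT st tf stc st1 stM.
  by move=> a x; exists (to x a) => f c; apply: stR.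
have [VW geom comp equiv weight pos] := cs.
have /choice [D hD] a : exists D : {mpoly K[n]}, D != 0 /\ forall z, (forall i, z i != 0) ->
      D.@[piv V z] != 0 -> (forall i, (P a i).@[z] != 0) /\
      forall j, local (coord F) (piv V z) (st a (coord F j)) (piv V (fun i => (P a i).@[z]) j).
  by have [D] := geom a; exists D.
have DD0 : \prod_a D a != 0 by apply/prodf_neq0 => a _; case: (hD a).
(* The good set consists of the points all of whose translates lie in the torus, off the zeros of
   the [D a], where the lifts describe the action. *)
have [oA nA] := nz_open oU jir jtK DD0.
set A := U `&` _ in oA nA; have [oG nG] := core_open reg oA nA.
exists n, N, V, W, P, al, d, (core to A), (pt jt), (tau ji).
have AU : core to A `<=` U by move=> x /core_sub [].
split=> //.
- by move=> x a; apply: core_inv.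
- exact: tau_neq0.
- by move=> x /AU; apply: pt_tau.
- exact: tau_pt.
- by move=> j; apply: regular_restrict (tau_reg oU jir j).
- move=> Y B psi oB rpsi psi0; split=> // Wx g rg; apply: regular_glue => y [By Wy].
  have psiy i : psi y i != 0 by apply: psi0.
  have [p [q [qy H]]] := reg_pt jtr psiy rg Wy.
  have rq := reg_meval q oB rpsi; have rp := reg_meval p oB rpsi.
  exists (B `&` [set z | q.@[fun i => psi z i] != 0]); split=> //.
    by move=> z [Bz qz]; split=> //; case: (H (psi z) _ qz) => // i; apply: psi0.
  apply: (reg_ext (f := fun z => p.@[fun i => psi z i] / q.@[fun i => psi z i])).
    by move=> z [Bz qz] /=; case: (H (psi z) _ qz) => // i; apply: psi0.
  apply: regular_mul; last exact: regular_inv.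
  by apply: regular_restrict rp => [|z []//]; apply: reg_nz.
- move=> z a z0 /core_sub [_ /=]; have p0 := piv_neq0 V z0.
  rewrite (tau_pt jtK) // rmorph_prod => /prodf_neq0 /(_ a isT) Da.
  have [Pz hj] := (hD a).2 z z0 Da; split=> //.
  apply: (move_pt oU jtr jir jtK jiK p0 (piv_neq0 V Pz) _ (stc a) (stR a) hj).
  exact: tf_separated tf.
Qed.

(** The complement of the diagonal is open: near a moved point it contains the locus where a
    function [b] of two variables is nonzero, and b(u, be u) is regular in [u]. *)
Lemma moved_open (K : closedFieldType) (Y : variety K) (be : Y -> Y) : rmap setT be ->
  open [set y | be y <> y].
Proof.
move=> rbe; apply: (@regular_open _ _ _ (fun=> 0)); apply: regular_glue => y yb.
have by' : y <> be y by move/esym.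
have oD := closed_openC (variety_separated (v := Y)).
have [W [f [[U1 [V1 [a [b [[oU1 oV1 ta tb] WE _]]]]] Wx sW]]] := oD (y, be y) by'.
rewrite WE /= in Wx; have [Uy Vy bn] := Wx.
have oB : open (be @^-1` V1) by have := rmap_open rbe oV1; rewrite setTI.
have oC := openI oU1 oB.
have rb : regular (U1 `&` be @^-1` V1) (fun u => b (u, be u)).
  elim: tb => {a b ta WE Wx bn}.
  - by move=> g rg; apply: (reg_ext (f := g)) => //; apply: regular_restrict rg => // u [].
  - move=> g rg; apply: (reg_ext (f := g \o be)) => //.
    have := rbe.2 _ _ rg; rewrite setTI => rg'.
    by apply: regular_restrict rg' => // u [].
  - by move=> a b _ h _ h'; apply: regular_add.
  - by move=> a b _ h _ h'; apply: regular_mul.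
exists (U1 `&` be @^-1` V1 `&` [set u | b (u, be u) != 0]); split=> //.
  move=> u [[Uu Vu] bu] E; apply: (sW (u, be u)); last by rewrite /Defs.diagonal /= E.
  by rewrite WE.
by apply: regular_cst; apply: reg_nz.
Qed.

Lemma affine_coordinates (K : closedFieldType) (Y : variety K) (V : set Y) :
  open V -> affine (induced_space V) -> exists r (s : 'I_r -> Y -> K),
  (forall i, regular V (s i)) /\ forall x x', V x -> V x' -> (forall i, s i x = s i x') -> x = x'.
Proof.
move=> oV [r [J [phi [phir [psi [phiK psiK psir]]]]]].
pose s i x : K := extend 0 (fun v : induced_space V => sval (phi v) i) x.
have sE v i : s i (sval v) = sval (phi v) i by rewrite /s extendE.
exists r, s; split=> [i|x x' Vx Vx' E].
  have := induced_regular oV (phir.2 _ _ (regular_incl (U := zero_locus J) (affine_coord_regular i))).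
  by rewrite (_ : V `&` _ = V) //; apply/seteqP; split=> [x []|x Vx]//; split.
suff : exist V x Vx = exist V x' Vx' by move/(congr1 sval).
apply: (can_inj phiK); have E' : sval (phi (exist V x Vx)) = sval (phi (exist V x' Vx')).
  by apply/funext => i; rewrite -!sE /= E.
case: (phi _) (phi _) E' => [u hu] [u' hu'] /= uu.
by move: hu hu'; rewrite uu => hu hu'; congr exist; apply: Prop_irrelevance.
Qed.

(** By faithfulness each nontrivial element moves a dense open set, so there is a free orbit whose
    points lie in one affine open set. [lam] is a Lagrange interpolation function on that orbit
    divided by the sum of its translates. *)
Lemma equivariant_bump (K : closedFieldType) (gT : finGroupType) (Y : variety K)
    (toY : action [set: gT] Y) (A : set Y) : faithful_variety toY -> open A -> A !=set0 ->
  exists (B : set Y) y0 (lam : Y -> K), [/\ [/\ open B, B `<=` A & forall y a, B y -> B (toY y a)],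
    B y0, regular B lam, lam y0 = 1 /\ forall a, a != 1%g -> lam (toY y0 a) = 0 &
    forall y, B y -> \sum_a lam (toY y a^-1%g) = 1].
Proof.
move=> [reg faith] oA nA; have rto a := to_rmap reg a.
have [m [U [oU aU cU]]] := variety_affine_cover Y.
have [p Ap] := nA; have : (\bigcup_i U i) p by rewrite cU.
move=> [i0 _ Up]; have [r [s [rs ssep]]] := affine_coordinates (oU i0) (aU i0).
move: (U i0) (oU i0) Up rs ssep => {aU cU}U' {}oU Up rs ssep; move: U' oU Up rs ssep => {U i0} U oU Up rs ssep.
pose Fr a : set Y := if a == 1%g then setT else [set y | toY y a <> y].
have [oF nF] : open (\bigcap_a Fr a) /\ \bigcap_a Fr a !=set0.
  apply: open_meets => a; rewrite /Fr; case: eqP => [_|a1].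
  - exact: openT.
  - exact: moved_open.
  - by exists p.
  apply: contrapT => H; apply: a1; apply: faith; first by rewrite finset.in_setT.
  by move=> y; apply: contrapT => h; apply: H; exists y.
set Fs := \bigcap_a Fr a in oF nF.
have oC : open (A `&` U `&` Fs) by apply: openI => //; apply: openI.
have nC : A `&` U `&` Fs !=set0 by apply: open_meet => //; [exact: openI|apply: open_meet => //; exists p].
have [oB0 [y0 By0]] := core_open reg oC nC; set B0 := core toY _ in oB0 By0.
have B0U y a : B0 y -> U (toY y a) by move=> /(_ a) [[]].
have U0 : U y0 by have := B0U y0 1%g By0; rewrite to1.
have /choice [ix hix] a : exists i : option 'I_r, a != 1%g -> exists2 i', i = Some i' & s i' y0 != s i' (toY y0 a).
  have [->|a1] := eqVneq a 1%g; first by exists None.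
  have [i hi] : exists i, s i y0 != s i (toY y0 a).
    apply: contrapT => /forallNP H; have [_ Fy] := core_sub By0.
    have := Fy a I; rewrite /Fr (negbTE a1); apply; apply/esym; apply: ssep => //; first exact: B0U.
    by move=> i; apply/eqP; apply: contrapT => /negP; apply: H.
  by exists (Some i) => _; exists i.
(* For a != 1 this is 1 at [y0] and 0 at its translate by [a]; the default is never met there. *)
pose ss a y := if ix a is Some i then (s i y - s i (toY y0 a)) / (s i y0 - s i (toY y0 a)) else 1.
pose l0 y := \prod_(a | a != 1%g) ss a y.
have rl0 : regular U l0.
  apply: reg_prod => // a; rewrite /ss; case: (ix a) => [i|]; last exact: regular_cst.
  apply: regular_mul; last exact: regular_cst.
  by apply: reg_sub => //; apply: regular_cst.
have l01 : l0 y0 = 1.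
  apply: big1 => a a1; rewrite /ss; have [i -> hi] := hix a a1.
  by rewrite divff // subr_eq0.
have l00 a : a != 1%g -> l0 (toY y0 a) = 0.
  move=> a1; rewrite /l0 (bigD1 a) //= /ss; have [i -> hi] := hix a a1.
  by rewrite subrr !mul0r.
pose mu y := \sum_a l0 (toY y a^-1%g).
have rmu : regular B0 mu.
  apply: reg_sum => // a; have := to_regular reg a^-1%g rl0.
  by apply: regular_restrict => // y By; apply: B0U.
have muV y b : mu (toY y b) = mu y.
  rewrite /mu (reindex_inj (mulIg b)) /=; apply: eq_bigr => a _.
  by rewrite -toM invMg mulgA mulgV mul1g.
have mu0 : mu y0 = 1.
  rewrite /mu (bigD1 1%g) //= invg1 to1 l01 big1 ?addr0 // => a a1.
  by apply: l00; rewrite invg_eq1.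
have oB := reg_nz rmu; exists (B0 `&` [set y | mu y != 0]), y0, (fun y => l0 y / mu y).
have BB0 : B0 `&` [set y | mu y != 0] `<=` B0 by move=> y [].
split; first split=> //.
- by move=> y [/core_sub [[]]].
- by move=> y a [By my]; split; [apply: core_inv|rewrite /= muV].
- by split=> //; rewrite /= mu0 oner_neq0.
- apply: regular_mul; last exact: regular_inv rmu.
  by apply: regular_restrict rl0 => // y [By _]; have := B0U y 1%g By; rewrite to1.
- by split=> [|a a1]; rewrite ?l01 ?mu0 ?divr1 // l00 ?mul0r.
- move=> y [By my]; rewrite -(divff my) {2}/mu mulr_suml.
  by apply: eq_bigr => a _; rewrite muV.
Qed.

(** * Cocycles *)

Section Kernel.
Variables (K : closedFieldType) (n N : nat) (V : 'M[int]_(n, N)).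

Lemma chivalV r (z : 'I_r -> K) m : chival (fun i => (z i)^-1) m = (chival z m)^-1.
Proof.
rewrite /chival; elim/big_rec2: _ => [|i x y _ ->]; first by rewrite invr1.
by rewrite invfM exprz_inv invr_expz.
Qed.

Lemma chival_prod r (I : finType) (D : pred I) (z : I -> 'I_r -> K) m :
  chival (fun i => \prod_(C | D C) z C i) m = \prod_(C | D C) chival (z C) m.
Proof.
rewrite /chival exchange_big; apply: eq_bigr => i _ /=.
elim/big_rec2: _ => [|C x y _ IH]; first by rewrite exp1rz.
by rewrite expfzMl IH.
Qed.

Lemma inkerM s t : @inker K n N V s -> inker V t -> inker V (fun i => s i * t i).
Proof.
move=> [s0 s1] [t0 t1]; split=> [i|j]; first by rewrite mulf_neq0.
by rewrite pivM s1 t1 mulr1.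
Qed.

Lemma inkerV s : @inker K n N V s -> inker V (fun i => (s i)^-1).
Proof.
move=> [s0 s1]; split=> [i|j]; first by rewrite invr_neq0.
have := s1 j; rewrite /piv => h.
by rewrite chivalV h invr1.
Qed.

Lemma inker_prod (I : finType) (D : pred I) (s : I -> 'I_N -> K) :
  (forall C, D C -> inker V (s C)) -> inker V (fun i => \prod_(C | D C) s C i).
Proof.
move=> h; split=> [i|j]; first by apply/prodf_neq0 => C /h [].
by rewrite /piv chival_prod big1 // => C /h [_ /(_ j)].
Qed.

End Kernel.

Section Cocycles.
Variables (K : closedFieldType) (gT : finGroupType) (X : variety K) (to : action [set: gT] X).
Variables (n N : nat) (V : 'M[int]_(n, N)) (W : 'M[int]_(N, n)).
Variables (P : gT -> 'I_N -> {mpoly K[N]}) (al : gT -> 'I_N -> 'rV[int]_N) (d : 'I_N -> nat).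
Variables (good : set X) (ptt : ('I_n -> K) -> X) (tt : X -> 'I_n -> K).
Hypothesis L : lift_model to V W P al d good ptt tt.
Hypothesis regX : acts_regularly to.
Variables (Y : variety K) (toY : action [set: gT] Y).
Hypothesis faithY : faithful_variety toY.
Variable ga : gT -> gT -> 'I_N -> K.
Hypothesis ga_comp : forall a b, inker V (ga a b) /\ forall z i,
  (P b i).@[fun k => (P a k).@[z]] = ga a b i * (P (a * b)%g i).@[z].
Implicit Types (a b : gT) (y : Y).

(* The e-th power of the obstruction cocycle ga to a genuine group action on
   homogeneous coordinates is a coboundary. *)
Definition coboundary (e : int) := exists (A : set Y) (be : gT -> Y -> 'I_N -> K),
  [/\ [/\ open A, A !=set0 & forall y a, A y -> A (toY y a)],
      forall a i, regular A (fun y => be a y i),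
      forall a y, A y -> inker V (be a y) &
      forall a b y i, A y -> chival (be a (toY y b^-1%g)) (al b i) * be b y i =
        ga a b i ^ e * be (a * b)%g y i].

Lemma coboundary_sub e e' : coboundary e -> coboundary e' -> coboundary (e - e').
Proof.
move=> [A [be [[oA nA iA] rb kb cb]]] [A' [be' [[oA' nA' iA'] rb' kb' cb']]].
have oI := openI oA oA'; exists (A `&` A'), (fun a y i => be a y i / be' a y i); split.
- by split=> //; [exact: open_meet|move=> y a [/iA ? /iA' ?]].
- move=> a i; apply: regular_mul; first by apply: regular_restrict (rb a i) => // y [].
  apply: reg_inv; first by apply: regular_restrict (rb' a i) => // y [].
  by move=> y [_ /(kb' a) []].
- by move=> a y [Ay A'y]; apply: inkerM; [exact: kb|apply: inkerV; apply: kb'].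
- move=> a b y i [Ay A'y]; have [[g0 _] _] := ga_comp a b.
  have [b0 _] := kb b y Ay; have [b'0 _] := kb' b y A'y; have [b''0 _] := kb' (a * b)%g y A'y.
  rewrite chivalM chivalV expfzDr // mulrACA cb // -invfM cb' // invfM.
  by rewrite invr_expz mulrACA.
Qed.

(** The exponents are closed under differences, hence under sums, obtained by subtracting a
    difference from 0; so Euclidean division applies. *)
Lemma coboundary_modn (k m : nat) : coboundary k -> coboundary m -> coboundary (k %% m)%N.
Proof.
move=> hk hm; have H q : coboundary (q * m)%N.
  elim: q => [|q IH]; first by have := coboundary_sub hm hm; rewrite subrr.
  have h0 := coboundary_sub hm hm; rewrite subrr in h0.
  have := coboundary_sub IH (coboundary_sub h0 hm).
  by rewrite sub0r opprK -PoszD mulSn addnC.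
have := coboundary_sub hk (H (k %/ m)%N).
suff -> : k%:Z - (k %/ m * m)%N%:Z = (k %% m)%N by [].
by have := divn_eq k m; move: (_ * m)%N (_ %% m)%N => u v; lia.
Qed.

(* A map equivariant for H yields maps xr r, one for each coset of H, which the group
   permutes.  Their lifts z C are permuted up to elements bb a C of the kernel, and the
   product of these over the cosets is the required cochain. *)
Lemma coboundary_index (H : {group gT}) : versal (raction to (finset.subsetT H)) ->
  coboundary #|[set: gT]%SET : H|%g.
Proof.
move=> [_ vers]; have regY : acts_regularly toY := faithY.1.
have fY : faithful_variety (raction toY (finset.subsetT H)).
  split=> a aH; first by apply: faithY.1; rewrite finset.in_setT.
  by apply: faithY.2; rewrite finset.in_setT.
have [|V0 [f [oV0 nV0 rf feq]]] := vers Y _ fY good (lm_open L) (lm_nonempty L).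
  by move=> a x _; apply: (lm_inv L).
have [x0 _] := lm_nonempty L; pose phi := extend x0 (fun v : induced_space V0 => incl (f v)).
have rphi : rmap V0 phi by apply: induced_rmap.
have phiE (v : induced_space V0) : phi (sval v) = incl (f v) by apply: extendE.
have phigood y : V0 y -> good (phi y).
  by move=> Vy; rewrite -[y]/(sval (exist V0 y Vy)) phiE; apply: (svalP (f _)).
have phieq y a : a \in H -> V0 y -> V0 (toY y a) -> phi (toY y a) = to (phi y) a.
  move=> aH Vy Vya; pose v : induced_space V0 := exist V0 y Vy.
  pose w : induced_space V0 := exist V0 (toY y a) Vya.
  by rewrite -[toY y a]/(sval w) -[y]/(sval v) !phiE; apply: (feq a v w).
have [oA nA] := core_open regY oV0 nV0; set A := core toY V0 in oA nA.
have Ainv y a : A y -> A (toY y a) by apply: core_inv.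
have AV y a : A y -> V0 (toY y a) by apply.
(* The translates of [phi]: by equivariance under [H], [xr r] depends only on the coset H r. *)
pose xr r y := to (phi (toY y r^-1%g)) r.
have xgood r y : A y -> good (xr r y) by move=> Ay; apply: (lm_inv L); apply: phigood; apply: AV.
pose z C y := pisec W (tt (xr (repr C) y)).
have z0 C y i : z C y i != 0 by apply: pisec_neq0 => j; apply: (lm_neq0 L).
have zE C y : piv V (z C y) = tt (xr (repr C) y).
  by apply/funext => j; rewrite /z (piv_sec (lm_split L)) // => k; apply: (lm_neq0 L).
have zpt C y : A y -> ptt (piv V (z C y)) = xr (repr C) y.
  by move=> Ay; rewrite zE; apply: (lm_ptt L); apply: xgood.
have rz C i : regular A (fun y => z C y i).
  apply: reg_chival => //; last by move=> j y _; apply: (lm_neq0 L).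
  move=> j; set r := repr C.
  have h1 := rmap_comp (rmap_comp (to_rmap regY r^-1%g) rphi) (to_rmap regX r).
  have := h1.2 _ _ (lm_tt_reg L j); apply: regular_restrict => // y Ay.
  by split; [split; [split=> //; apply: AV|]|apply: xgood].
pose R := rcosets H [set: gT]%SET.
have Rmul C a : (C :* a \in R)%g = (C \in R).
  have sub D b : D \in R -> (D :* b \in R)%g.
    move=> /rcosetsP [x _ ->]; rewrite -rcosetM; apply/rcosetsP; exists (x * b)%g => //.
  apply/idP/idP; last exact: sub.
  by move=> /(sub _ a^-1%g); rewrite -rcosetM mulgV rcoset1.
have xmul C a y : C \in R -> A y -> to (xr (repr C) (toY y a^-1%g)) a = xr (repr (C :* a)%g) y.
  move=> CR Ay; have [x _ CE] := rcosetsP CR.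
  have CE' : C = (H :* repr C)%g by rewrite {1}CE; apply/esym/rcoset_eqP; rewrite CE mem_repr_rcoset.
  have /rcosetP [h hH rE] : repr (C :* a)%g \in (H :* (repr C * a))%g.
    rewrite rcosetM -CE'; apply: (mem_repr (repr C * a)%g).
    by rewrite mem_rcoset mulgK CE mem_repr_rcoset.
  rewrite /xr rE invMg [toY y (_ * h^-1)%g]toM.
  have -> : phi (toY (toY y (repr C * a)^-1%g) h^-1%g) = to (phi (toY y (repr C * a)^-1%g)) h^-1%g.
    by apply: phieq; [rewrite groupV|exact: AV|apply: AV; apply: Ainv].
  by rewrite -(toM to) -(toM to _ h^-1%g) mulKg invMg -(toM toY).
(* Numerator and denominator lift the same point of [X], so their quotient lies in the kernel. *)
pose bb a C y i := (P a i).@[z C (toY y a^-1%g)] / z (C :* a)%g y i.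
have lift C a y : A y -> (forall i, (P a i).@[z C (toY y a^-1%g)] != 0) /\
    to (xr (repr C) (toY y a^-1%g)) a = ptt (piv V (fun i => (P a i).@[z C (toY y a^-1%g)])).
  move=> Ay; have Ay' := Ainv y a^-1%g Ay; rewrite -zpt //.
  apply: (lm_lift L a) => //.
  by rewrite zpt //; apply: xgood.
have bker a C y : C \in R -> A y -> inker V (bb a C y).
  move=> CR Ay; have [Pn E] := lift C a y Ay; split=> [i|j].
    by rewrite mulf_neq0 ?invr_eq0.
  rewrite /bb (pivM V (fun i => (P a i).@[z C (toY y a^-1%g)]) (fun i => (z (C :* a)%g y i)^-1)).
  rewrite [X in _ * X]chivalV -/(piv V _ j) zE -xmul // E (lm_tt L) ?divff //; exact: piv_neq0.
have bcoc a b C y i : C \in R -> A y ->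
    chival (bb a C (toY y b^-1%g)) (al b i) * bb b (C :* a)%g y i = ga a b i * bb (a * b)%g C y i.
  move=> CR Ay; have Ay' := Ainv y b^-1%g Ay; have [_ gE] := ga_comp a b.
  have [_ eqv] := lm_equiv L b (bker a C _ CR Ay').
  apply: (mulIf (z0 (C :* (a * b))%g y i)).
  rewrite -[RHS]mulrA /bb divfK // -rcosetM -mulrA divfK // -eqv.
  rewrite invMg toM -gE; apply: meval_eq => k.
  by rewrite /bb divfK.
(* [ga] does not depend on the coset, so the product raises it to the number of cosets; the shift of
   C to C a in [bcoc] is undone by reindexing. *)
exists A, (fun a y i => \prod_(C in R) bb a C y i); split=> //.
- move=> a i; apply: reg_prod => // C; apply: regular_mul.
    apply: reg_meval => // k; have := to_regular regY a^-1%g (rz C k).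
    by apply: regular_restrict => // y; apply: Ainv.
  by apply: reg_inv.
- by move=> a y Ay; apply: inker_prod => C CR; apply: bker.
move=> a b y i Ay; rewrite chival_prod.
have -> : \prod_(C in R) bb b C y i = \prod_(C in R) bb b (C :* a)%g y i.
  rewrite (reindex_inj (h := fun C : {set gT} => (C :* a)%g)) /=.
    by apply: eq_bigl => C; rewrite Rmul.
  by move=> C C' E; rewrite -[C]rcoset1 -[C']rcoset1 -(mulgV a) !rcosetM E.
rewrite -big_split /= (eq_bigr (fun C => ga a b i * bb (a * b)%g C y i)); last first.
  by move=> C CR; rewrite bcoc.
by rewrite big_split /= prodr_const.
Qed.

(** The least positive exponent divides all the others; a prime p dividing it would divide the index
    of a Sylow p-subgroup. *)
Lemma coboundary_one (Gp : nat -> {group gT}) :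
  (forall p, prime p -> p.-Sylow([set: gT]%SET) (Gp p))%g ->
  (forall p, prime p -> versal (raction to (finset.subsetT (Gp p)))) -> coboundary 1.
Proof.
move=> syl vers; have ind p : prime p -> coboundary #|[set: gT]%SET : Gp p|%g.
  by move=> /vers /coboundary_index.
have ex : exists m, (0 < m)%N && `[< coboundary m%:Z >].
  (* Any prime would do; 2 only provides some positive exponent. *)
  exists #|[set: gT]%SET : Gp 2|%g; rewrite indexg_gt0 /=; apply/asboolP; exact: ind.
case: (ex_minnP ex) => m /andP[m0 /asboolP hm] min.
have dvd k : coboundary k%:Z -> (m %| k)%N.
  move=> hk; rewrite /dvdn; apply: contraTT (ltn_pmod k m0) => r0; rewrite -leqNgt.
  apply: min; rewrite lt0n r0; apply/asboolP; exact: coboundary_modn.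
suff -> : 1 = m%:Z by [].
congr Posz; apply/eqP; rewrite eq_sym; apply: contraT => m1.
have m2 : (1 < m)%N by rewrite ltn_neqAle eq_sym m1 m0.
have pp := pdiv_prime m2; have pm := dvdn_trans (pdiv_dvd m) (dvd _ (ind _ pp)).
have := syl _ pp; rewrite /pHall => /and3P[_ _ /pnatP].
by move=> /(_ (indexg_gt0 _ _) _ pp pm); rewrite inE /= inE /= eqxx.
Qed.

End Cocycles.

(* In a monomial of weight k, a variable of weight k can only occur alone. *)
Lemma weighted_affine (K : closedFieldType) N (d : 'I_N -> nat) (p : {mpoly K[N]}) k
    (I : finType) (c : I -> K) (w : I -> 'I_N -> K) (w' : 'I_N -> K) :
  (forall m, m \in msupp p -> (\sum_j m j * d j)%N = k) -> (forall j, (0 < d j)%N) ->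
  \sum_g c g = 1 -> (forall j g, (d j < k)%N -> w g j = w' j) ->
  (forall j, d j = k -> w' j = \sum_g c g * w g j) ->
  p.@[w'] = \sum_g c g * p.@[w g].
Proof.
move=> hm d0 c1 lo eq; rewrite mevalE.
under [RHS]eq_bigr => g _ do rewrite mevalE mulr_sumr.
rewrite exchange_big big_seq [RHS]big_seq; apply: eq_bigr => m /hm mk /=.
transitivity (p@_m * \sum_g c g * \prod_i w g i ^+ m i); last first.
  by rewrite mulr_sumr; apply: eq_bigr => g _; rewrite mulrCA.
congr (_ * _); have [[j [mj dj]]|H] := EM (exists j, m j != 0%N /\ (k <= d j)%N).
  have := mk; rewrite (bigD1 j) //= => mk'.
  have mj1 : m j = 1%N.
    move: mj dj (d0 j) mk'; move: (m j) (d j) (\sum_(i < N | i != j) _)%N => x y s; nia.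
  have dk : d j = k by move: dj mk'; rewrite mj1; lia.
  have ml l : l != j -> m l = 0%N.
    move=> lj; have s0 : (\sum_(i < N | i != j) m i * d i = 0)%N by move: mk'; rewrite mj1 dk mul1n; move: (\sum_(i < N | i != j) _)%N => s; lia.
    have := d0 l; move/eqP: s0; rewrite sum_nat_eq0 => /forallP /(_ l); rewrite lj /= muln_eq0.
    by move=> /orP[/eqP //|/eqP ->].
  have E (z : 'I_N -> K) : \prod_i z i ^+ m i = z j.
    by rewrite (bigD1 j) //= mj1 expr1 big1 ?mulr1 // => l /ml ->; rewrite expr0.
  by rewrite E eq //; apply: eq_bigr => g _; rewrite E.
have E g : \prod_i w g i ^+ m i = \prod_i w' i ^+ m i.
  apply: eq_bigr => i _; have [->|mi] := eqVneq (m i) 0%N; first by rewrite !expr0.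
  rewrite lo // ltnNge; apply/negP => ki; apply: H; by exists i.
under [RHS]eq_bigr => g _ do rewrite E.
by rewrite -mulr_suml c1 mul1r.
Qed.

(** * From a trivialized cocycle to an equivariant map *)

Section Transfer.
Variables (K : closedFieldType) (gT : finGroupType) (X : variety K) (to : action [set: gT] X).
Variables (n N : nat) (V : 'M[int]_(n, N)) (W : 'M[int]_(N, n)).
Variables (P : gT -> 'I_N -> {mpoly K[N]}) (al : gT -> 'I_N -> 'rV[int]_N) (d : 'I_N -> nat).
Variables (good : set X) (ptt : ('I_n -> K) -> X) (tt : X -> 'I_n -> K).
Hypothesis L : lift_model to V W P al d good ptt tt.
Variables (Y : variety K) (toY : action [set: gT] Y).
Hypothesis faithY : faithful_variety toY.
Variable ga : gT -> gT -> 'I_N -> K.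
Hypothesis ga_comp : forall a b, inker V (ga a b) /\ forall z i,
  (P b i).@[fun k => (P a k).@[z]] = ga a b i * (P (a * b)%g i).@[z].
Implicit Types (a b : gT) (y : Y).

(* Corrected by be, the lifts act on sections z : Y -> A^N through ee.  A fixed section
   is obtained by averaging against lam, one weight at a time, keeping its value at y0. *)
Lemma coboundary_map (U : set X) : open U -> U !=set0 -> coboundary V al toY ga 1 ->
  equivariant_rational_map toY to U.
Proof.
move=> oU nU [A [be [[oA nA iA] rb kb cb]]]; have regY : acts_regularly toY := faithY.1.
pose ee a (z : Y -> 'I_N -> K) y i := (P a i).@[z (toY y a^-1%g)] / be a y i.
have be0 a y i : A y -> be a y i != 0 by move=> /(kb a) [].
(* The coboundary relation of exponent 1 cancels exactly the factor [ga] in the composition law of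
   the lifts. *)
have eeM a b z y i : A y -> ee b (ee a z) y i = ee (a * b)%g z y i.
  move=> Ay; have Ay' := iA y b^-1%g Ay; have [[g0 _] gE] := ga_comp a b.
  have [_ eqv] := lm_equiv L b (inkerV (kb a _ Ay')).
  rewrite /ee; set w := z (toY y (a * b)^-1%g).
  have -> : (P b i).@[fun k => (P a k).@[z (toY (toY y b^-1%g) a^-1%g)] / be a (toY y b^-1%g) k] =
      chival (fun k => (be a (toY y b^-1%g) k)^-1) (al b i) * (ga a b i * (P (a * b)%g i).@[w]).
    rewrite -gE -eqv; apply: meval_eq => k; rewrite mulrC; congr (_ * (P a k).@[_]).
    by rewrite /w invMg toM.
  have := cb a b y i Ay; rewrite expr1z => E.
  have c0 : chival (be a (toY y b^-1%g)) (al b i) != 0 by apply: chival_neq0 => k; apply: be0.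
  have bb := be0 b y i Ay; have bab := be0 (a * b)%g y i Ay; have gi := g0 i.
  rewrite chivalV; move: (chival _ _) (be b y i) (be (a * b)%g y i) (ga a b i) E c0 bb bab gi.
  move=> x1 x2 x3 x4 E h1 h2 h3 h4; apply: (mulIf h3); rewrite divfK //.
  have -> : x1^-1 * (x4 * (P (a * b)%g i).@[w]) / x2 * x3 = (x4 * x3) / (x1 * x2) * (P (a * b)%g i).@[w].
    by field; rewrite h1 h2.
  by rewrite -E divff ?mul1r // mulf_neq0.
have [B [y0 [lam [[oB BA iB] By0 rlam [lam1 lam0] lamS]]]] := equivariant_bump faithY oA nA.
have [x1 [gx1 Ux1]] := open_meet (lm_open L) oU (lm_nonempty L) nU.
pose ze := pisec W (tt x1); have ze0 i : ze i != 0 by apply: pisec_neq0 => j; apply: (lm_neq0 L).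
have zeE : piv V ze = tt x1.
  by apply/funext => j; rewrite (piv_sec (lm_split L)) // => k; apply: (lm_neq0 L).
have zept : ptt (piv V ze) = x1 by rewrite zeE (lm_ptt L).
have [|P1 P1E] := lm_lift L 1%g ze0; first by rewrite zept.
(* [ee 1] is idempotent but need not be the identity, so the prescribed value is this image of [ze];
   it still lies over [x1] and is fixed by [ee 1] at [y0]. *)
pose c i := ee 1%g (fun=> ze) y0 i.
have Ay0 := BA _ By0; have [b10 b11] := inkerV (kb 1%g y0 Ay0).
have c0 i : c i != 0 by rewrite mulf_neq0.
have cpt : ptt (piv V c) = x1.
  rewrite -zept -[RHS](to1 to) P1E; congr ptt; apply/funext => j.
  by rewrite (pivM V (fun i => (P 1%g i).@[ze]) (fun i => (be 1%g y0 i)^-1)) b11 mulr1.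
have ee1 z i : z y0 = c -> ee 1%g z y0 i = c i.
  move=> zc; have -> : c i = ee 1%g (ee 1%g (fun=> ze)) y0 i by rewrite eeM // mulg1.
  by rewrite /ee invg1 to1 zc.
have ree a z : (forall i, regular B (fun y => z y i)) -> forall i, regular B (fun y => ee a z y i).
  move=> rz i; apply: regular_mul.
    apply: reg_meval => // k; have := to_regular regY a^-1%g (rz k).
    by apply: regular_restrict => // y; apply: iB.
  by apply: reg_inv => [|y /BA]; [apply: regular_restrict (rb a i)|apply: be0].
have [z [rz zy0 zfix]] : exists z, [/\ forall i, regular B (fun y => z y i), z y0 = c &
    forall a y i, B y -> (d i < (\sum_j d j).+1)%N -> ee a z y i = z y i].
  move: (\sum_j d j).+1%N => k; elim: k => [|k [z [rz zy0 zfix]]].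
    by exists (fun=> c); split=> // i; apply: regular_cst.
  (* Only coordinates of weight [k] change. By [weighted_affine] the lifts are affine in them, and
     the coefficients [lam] sum to 1, so the average is fixed. At [y0] only the term g = 1
     survives. *)
  pose z' y i := if d i == k then \sum_g lam (toY y g^-1%g) * ee g z y i else z y i.
  exists z'; split.
  - move=> i; rewrite /z'; case: eqP => // _; apply: reg_sum => // g; apply: regular_mul; last exact: ree.
    by have := to_regular regY g^-1%g rlam; apply: regular_restrict => // y; apply: iB.
  - apply/funext => i; rewrite /z'; case: eqP => _; last by rewrite zy0.
    rewrite (bigD1 1%g) //= invg1 to1 lam1 mul1r ee1 // big1 ?addr0 // => g g1.
    by rewrite lam0 ?mul0r // invg_eq1.
  move=> a y i By; rewrite ltnS leq_eqVlt => dik; have By' := iB y a^-1%g By.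
  case/orP: dik => [/eqP dik|dik]; last first.
    have -> : z' y i = z y i by rewrite /z' ltn_eqF.
    rewrite -(zfix a y i By dik) /ee; congr (_ / _).
    rewrite (weighted_affine (k := d i) (c := fun _ : unit => 1) (w := fun _ => z (toY y a^-1%g))
      (lm_weight L (a := a) (i := i)) (lm_pos L)).
    + by rewrite big_const card_unit /= addr0 mul1r.
    + by rewrite big_const card_unit /= addr0.
    + by move=> j _ ji; rewrite /z' ltn_eqF // (ltn_trans ji).
    + by move=> j ji; rewrite big_const card_unit /= addr0 mul1r /z' ltn_eqF // ji.
  have -> : z' y i = \sum_g lam (toY y g^-1%g) * ee g z y i by rewrite /z' dik eqxx.
  rewrite {1}/ee (weighted_affine (k := k) (c := fun g => lam (toY (toY y a^-1%g) g^-1%g))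
    (w := fun g => ee g z (toY y a^-1%g)) _ (lm_pos L)).
  + rewrite mulr_suml [RHS](reindex_inj (mulIg a)) /=; apply: eq_bigr => g _.
    rewrite -mulrA; congr (_ * _); first by rewrite invMg toM.
    by rewrite -(eeM g a) //; apply: BA.
  + by move=> m mP; rewrite -dik; apply: (lm_weight L mP).
  + exact: lamS.
  + by move=> j g jk; rewrite zfix // /z' ltn_eqF.
  + by move=> j jk; rewrite /z' jk eqxx.
have dS i : (d i < (\sum_j d j).+1)%N by rewrite ltnS (bigD1 i) //= leq_addr.
have oB1 : open (B `&` [set y | \prod_i z y i != 0]) by apply: reg_nz; apply: reg_prod.
set B1 := B `&` _ in oB1.
have z0 i y : B1 y -> z y i != 0 by move=> [_ /prodf_neq0 H]; apply: H.
have rz1 i : regular B1 (fun y => z y i) by apply: regular_restrict (rz i) => // y [].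
have rphi : rmap B1 (ptt \o (fun y => piv V (z y))).
  apply: (lm_pt_reg L) => //; first by move=> i; apply: reg_chival.
  by move=> i y By; apply: piv_neq0 => j; apply: z0.
have oG := openI (lm_open L) oU; have oB2 := rmap_open rphi oG.
set B2 := B1 `&` _ in oB2.
have rphi2 : rmap B2 (ptt \o (fun y => piv V (z y))).
  by apply: rmap_restrict rphi => // y [].
have hU y : B2 y -> U (ptt (piv V (z y))) by move=> [_ []].
exists B2, (fun v : induced_space B2 =>
    (exist U (ptt (piv V (z (sval v)))) (hU _ (svalP v)) : induced_space U)); split=> //.
- exists y0; split; last by split; rewrite /= zy0 cpt.
  by split=> //; rewrite /= zy0; apply/prodf_neq0.
- exact: (rmap_induced hU rphi2).
move=> a v w _ wE; rewrite /incl /= in wE *; case: v w wE => [y B2y] [y' B2y'] /= wE.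
have [B1y [gy _]] := B2y; have [B1y' _] := B2y'; have By' : B y' by case: B1y'.
have [Pz ->] := lm_lift L a (fun i => z0 i y B1y) gy; congr ptt.
have [s0 s1] := inkerV (kb a y' (BA _ By')).
have -> : z y' = (fun i => (P a i).@[z y] * (be a y' i)^-1).
  apply/funext => i; rewrite -(zfix a y' i By' (dS i)) /ee wE toK.
  by [].
by apply/funext => j; rewrite pivM s1 mulr1.
Qed.

End Transfer.

Lemma rmap_regular_map (K : closedFieldType) (X Y : fspace K) (f : Y -> X) :
  rmap setT f -> regular_map f.
Proof.
move=> rf; split=> [|W g /rf.2]; last by rewrite setTI.
by apply/continuousP => W oW; have := rmap_open rf oW; rewrite setTI.
Qed.

(** * Restriction of versality to subgroups *)

Section RegularRepresentation.
Variables (K : closedFieldType) (gT : finGroupType).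
Local Notation E := (affine_variety K #|gT|).

Definition translation (v : E) (a : gT) : E := fun i => (v : 'I_#|gT| -> K) (enum_rank (a * enum_val i)%g).

Lemma translationM v a b : translation v (a * b)%g = translation (translation v a) b.
Proof. by apply/funext => i; rewrite /translation enum_rankK mulgA. Qed.

Lemma translation1 v : translation v 1%g = v.
Proof. by apply/funext => i; rewrite /translation mul1g enum_valK. Qed.

Lemma translation_is_action : is_action [set: gT]%SET translation.
Proof.
split=> [a v w E|v a b _ _]; last exact: translationM.
by rewrite -[v]translation1 -[w]translation1 -(mulgV a) !translationM E.
Qed.

Definition translation_action : action [set: gT]%SET E := Action translation_is_action.

Lemma translation_faithful : faithful_variety translation_action.
Proof.
split=> a _.
  apply: rmap_regular_map; apply: rmap_affine; first exact: openT.
  by move=> i; apply: affine_coord_regular.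
move=> /(_ (fun i => (i == enum_rank 1%g)%:R)) /(congr1 (fun v : E => v (enum_rank 1%g))) /=.
rewrite /translation eqxx enum_rankK mulg1 (inj_eq enum_rank_inj).
by case: eqP => // _ /eqP; rewrite eq_sym oner_eq0.
Qed.

End RegularRepresentation.

Section Restriction.
Variables (K : closedFieldType) (gT : finGroupType) (H : {group gT}) (Y : variety K).
Variable toY : action H Y.

Lemma subg_is_action : is_action [set: subg_of H]%SET (fun y u => toY y (sgval u)).
Proof.
have [inj M] : is_action H toY by case: toY.
by split=> [u|y u u' _ _]; [exact: inj|rewrite -M ?subgP].
Qed.

(** Makes [H] a group type of its own, as [equivariant_bump] is about actions of a whole group
    type. *)
Definition subg_action : action [set: subg_of H]%SET Y := Action subg_is_action.

Lemma subg_faithful : faithful_variety toY -> faithful_variety subg_action.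
Proof.
move=> [r f]; split=> u _; first by apply: r; apply: subgP.
by move=> h; apply/val_inj/(f _ (subgP u)).
Qed.

End Restriction.

(* A faithful H-variety is mapped equivariantly to the regular representation of the
   whole group, with prescribed value at a point of a free orbit; the latter is then
   mapped to X by versality. *)
Lemma versal_subgroup (K : closedFieldType) (gT : finGroupType) (X : variety K)
    (to : action [set: gT]%SET X) (H : {group gT}) :
  versal to -> versal (raction to (finset.subsetT H)).
Proof.
move=> [[regX faithX] vers]; split.
  split=> a aH; first by apply: regX; rewrite finset.in_setT.
  by apply: faithX; rewrite finset.in_setT.
move=> Y toY fY U oU nU _; have fY' := subg_faithful fY.
(* [U] is invariant under [H] only, so versality for the whole group is applied to its core. *)
have [oC nC] := core_open regX oU nU.
have [|V0 [f [oV0 [v0 V0v0] rf feq]]] := vers _ _ (translation_faithful K gT) _ oC nC.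
  by move=> a x _; apply: core_inv.
have [x0 _] := nU; pose phi := extend x0 (fun v : induced_space V0 => incl (f v)).
have rphi : rmap V0 phi by apply: induced_rmap.
have phiE (v : induced_space V0) : phi (sval v) = incl (f v) by apply: extendE.
have [x Ux] := nU; have nT : [set: Y] !=set0 by have [] := variety_irreducible Y.
have [B [y0 [lam [[oB _ iB] By0 rlam [lam1 lam0] lamS]]]] := equivariant_bump fY' openT nT.
have regY' : acts_regularly (subg_action toY) := fY'.1.
(* The sum of the translates of [v0] with coefficients [lam] is equivariant and takes the value [v0]
   at [y0], so the composite with [phi] is defined somewhere. *)
pose Phi (y : Y) : affine_variety K #|gT| :=
  fun i => \sum_(h : subg_of H) lam (subg_action toY y h^-1%g) * translation v0 (sgval h) i.
have rPhi : rmap B Phi.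
  apply: rmap_affine => // i; apply: reg_sum => // h; apply: regular_mul; last exact: regular_cst.
  by have := to_regular regY' h^-1%g rlam; apply: regular_restrict => // y; apply: iB.
have Phi0 : Phi y0 = v0.
  apply/funext => i; rewrite /Phi (bigD1 1%g) // invg1 to1 lam1 mul1r translation1 big1; first exact: addr0.
  by move=> h h1; rewrite lam0 ?mul0r // invg_eq1.
have PhiM y u : Phi (subg_action toY y u) = translation (Phi y) (sgval u).
  apply/funext => i; rewrite /Phi (reindex_inj (mulIg u)); apply: eq_bigr => h _.
  rewrite invMg toM toK; congr (_ * _).
  by rewrite translationM.
have rc := rmap_comp rPhi rphi; set B2 := B `&` Phi @^-1` V0 in rc.
have hU y : B2 y -> U (phi (Phi y)).
  move=> [_ Vy]; rewrite -[Phi y]/(sval (exist V0 (Phi y) Vy)) phiE.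
  exact: (core_sub (svalP (f _))).
exists B2, (fun v : induced_space B2 =>
    (exist U (phi (Phi (sval v))) (hU _ (svalP v)) : induced_space U)); split=> //.
- exact: rc.1.
- by exists y0; split=> //; rewrite /= Phi0.
- exact: (rmap_induced hU rc).
move=> a v w aH wE; rewrite /incl /= in wE *; case: v w wE => [y [By Vy]] [y' [By' Vy']] /= wE.
pose v1 : induced_space V0 := exist V0 (Phi y) Vy.
pose w1 : induced_space V0 := exist V0 (Phi y') Vy'.
rewrite -[Phi y]/(sval v1) -[Phi y']/(sval w1) !phiE.
apply: (feq a v1 w1); first by rewrite finset.in_setT.
have -> : incl w1 = Phi (subg_action toY y (subg H a)) by rewrite /= subgK // -wE.
by rewrite PhiM subgK.
Qed.

Local Close Scope classical_set_scope.

Theorem corollary3p6 (R : realType) (gT : finGroupType)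
    (X : variety R[i]) (to : action [set: gT] X) (Gp : nat -> {group gT}) :
  complete X -> nonsingular X -> toric X -> faithful_variety to ->
  (forall p, prime p -> p.-Sylow([set: gT]) (Gp p))%g ->
  (versal to <->
   forall p, prime p -> versal (raction to (finset.subsetT (Gp p)))).
Proof.
move=> cX nX tX fX syl; split=> [vG p _|vp]; first exact: versal_subgroup.
split=> // Y toY fY U oU nU _.
have [n [N [V [W [P [al [d [good [ptt [tt L]]]]]]]]]] := lift_model_exists cX nX tX fX.1.
(* The cocycle is fixed here once, so that the coboundaries for all primes concern the same one. *)
have /choice [ga hga] (ab : gT * gT) : exists g : 'I_N -> R[i], inker V g /\ forall z i,
    (P ab.2 i).@[fun k => (P ab.1 k).@[z]] = g i * (P (ab.1 * ab.2)%g i).@[z].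
  by have [g] := lm_comp L ab.1 ab.2; exists g.
pose ga' a b := ga (a, b).
have hga' a b : inker V (ga' a b) /\ forall z i,
    (P b i).@[fun k => (P a k).@[z]] = ga' a b i * (P (a * b)%g i).@[z].
  exact: hga (a, b).
apply: (coboundary_map L fY hga' oU nU).
exact: (coboundary_one L fX.1 fY hga' syl vp).
Qed.
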